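(* Let $\omega_1\in L_2(\Omega)$ and let $\psi_1$ be a weak solution to the problem $$-\Delta\psi_1-\frac{2}{r}\psi_{1,r}=\omega_1\ \text{ in }\Omega,\qquad \psi_1=0\ \text{ on }S.$$ Let $K=K(r)$, $r\ge 0$, be a smooth function with compact support such that $$\lim_{r\to0^+}\frac{K(r)}{r^2}=c_0<\infty,$$ and define $$\chi(r,z)=\int_0^r\psi_{1,\tau}(\tau,z)\,(1+K(\tau))\,d\tau .$$ Then $$\|\psi_1-\psi_1(0)-\chi\|_{L_2(-a,a;H^2_0(0,R))}^2+\|\psi_{1,zr}\|_{L_2(\Omega)}^2+\|\psi_{1,zz}\|_{L_2(\Omega)}^2\le c\,\|\omega_1\|_{L_2(\Omega)}^2,$$ where $\psi_1(0)=\psi_1|_{r=0}$ (a function of $z$) and $c$ is a constant independent of $\psi_1$ and $\omega_1$.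
   Context: Let $a,R>0$. $\Omega=\{x\in\mathbb{R}^3: r<R,\ |z|<a\}$ is a bounded cylinder in cylindrical coordinates $(r,\varphi,z)$, with boundary $S=S_1\cup S_2$, $S_1=\{r=R,\ |z|<a\}$, $S_2=\{r<R,\ z\in\{-a,a\}\}$. All functions are real-valued and axially symmetric, i.e. functions of $(r,z)$ only, so $\Omega$ is identified with $(0,R)\times(-a,a)$ and $dx=r\,dr\,dz$. Subscripts after a comma denote partial derivatives ($\psi_{1,\tau}(\tau,z)$ is the derivative in the radial variable), and $\Delta=\partial_r^2+\frac1r\partial_r+\partial_z^2$. A weak solution is a function $\psi_1\in H^1(\Omega)$ (i.e. $\psi_1,\psi_{1,r},\psi_{1,z}\in L_2$ with respect to $r\,dr\,dz$) with zero trace on $S$ for which the equation holds in the sense of distributions in the open rectangle $(0,R)\times(-a,a)$. $H^2_0(0,R)$ is a weighted Sobolev space with weight exponent $\mu=0$ (not a space of functions with zero traces): $$\|v\|_{H^2_0(0,R)}^2=\sum_{i=0}^2\int_0^R|\partial_r^i v|^2\,r^{2(i-2)}\,r\,dr.$$ $L_2(\Omega)$ is taken with respect to $r\,dr\,dz$, and $L_2(-a,a;X)$ denotes $X$-valued square-integrable functions of $z\in(-a,a)$. *)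

(* Defs.v *)
From HB Require Import structures.
From mathcomp Require Import all_boot all_order all_algebra.
From mathcomp Require Import all_classical all_reals all_analysis.

Set Implicit Arguments.
Unset Strict Implicit.
Unset Printing Implicit Defensive.

Import Order.TTheory GRing.Theory Num.Theory.
Import numFieldNormedType.Exports.

Local Open Scope classical_set_scope.
Local Open Scope ring_scope.

Section Defs.
Context {R : realType}.
Implicit Types (a rad r z : R) (p : R * R)
  (K f g : R -> R) (u w ph psi psir psiz om : R * R -> R).

Local Notation leb := (@lebesgue_measure R).
Local Notation leb2 := (leb \x leb)%E.

(** Points of the plane are pairs [(r, z)]; [rad] is the radius of the cylinder.
    Functions are Borel representatives of their almost-everywhere classes. *)

Definition er : R * R := (1, 0).
Definition ez : R * R := (0, 1).

Definition Omega rad a : set (R * R) := `]0, rad[ `*` `]- a, a[.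

Fixpoint Ck (k : nat) u : Prop :=
  continuous u /\
  (if k is k'.+1 then
     [/\ forall p, derivable u p er, forall p, derivable u p ez,
         Ck k' (fun p => 'D_er u p) & Ck k' (fun p => 'D_ez u p)]
   else True).

Definition smooth2 u : Prop := forall k, Ck k u.

Definition smooth1 f : Prop := forall k x, derivable (f^`(k)%classic) x 1.

Definition test2 (U : set (R * R)) ph : Prop :=
  smooth2 ph /\
  exists C : set (R * R),
    [/\ compact C, C `<=` U & forall p, ~ C p -> ph p = 0].

Definition test1 (I : set R) f : Prop :=
  smooth1 f /\
  exists C : set R, [/\ compact C, C `<=` I & forall x, ~ C x -> f x = 0].

(** Only the values of [K] on [[0, +oo[] matter: smoothness up to the endpoint
    [0] is the existence of a smooth extension to the line. *)
Definition smooth_halfline K : Prop :=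
  exists Kt : R -> R, smooth1 Kt /\ forall r, 0 <= r -> K r = Kt r.

Definition compact_support_halfline K : Prop :=
  exists M : R, forall r, M <= r -> K r = 0.

Definition loc_integrable2 (U : set (R * R)) u : Prop :=
  measurable_fun U u /\
  forall C : set (R * R), compact C -> C `<=` U ->
    leb2.-integrable C (EFin \o u).

(** Distributions are tested against [dr dz], not against the weighted measure
    [r dr dz]. *)
Definition weak_deriv2 (U : set (R * R)) (e : R * R) u w : Prop :=
  [/\ loc_integrable2 U u, loc_integrable2 U w &
      forall ph, test2 U ph ->
        \int[leb2]_(p in U) (u p * 'D_e ph p) =
        - \int[leb2]_(p in U) (w p * ph p)].

Definition weak_deriv1 (I : set R) f g : Prop :=
  [/\ locally_integrable I f, locally_integrable I g &
      forall h : R -> R, test1 I h ->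
        \int[leb]_(x in I) (f x * h^`()%classic x) = - \int[leb]_(x in I) (g x * h x)].

(** Squared [L_2(Omega)] norm for [dx = r dr dz]. *)
Definition L2norm2 rad a u : \bar R :=
  (\int[leb2]_(p in Omega rad a) (u p ^+ 2 * p.1)%R%:E)%E.

Definition in_L2 rad a u : Prop :=
  measurable_fun (Omega rad a) u /\ (L2norm2 rad a u < +oo)%E.

(** [psi] is in [H^1], with weak derivatives [psir] and [psiz]. *)
Definition in_H1 rad a psi psir psiz : Prop :=
  [/\ in_L2 rad a psi, in_L2 rad a psir, in_L2 rad a psiz,
      weak_deriv2 (Omega rad a) er psi psir &
      weak_deriv2 (Omega rad a) ez psi psiz].

(** Squared [L_2(S)] norm: the surface measure is [rad dz] on the lateral
    boundary and [r dr] on the top and bottom. *)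
Definition L2norm2_S rad a u : \bar R :=
  ((\int[leb]_(z in `](- a)%R, a[) (u (rad, z) ^+ 2 * rad)%R%:E)
   + (\int[leb]_(r in `]0%R, rad[) (u (r, a) ^+ 2 * r)%R%:E)
   + (\int[leb]_(r in `]0%R, rad[) (u (r, - a) ^+ 2 * r)%R%:E))%E.

(** The trace on [S] is the [H^1]-continuous extension of the restriction to [S]
    of functions smooth up to the boundary.  The axis [r = 0] is not part
    of [S]. *)
Definition zero_trace rad a psi psir psiz : Prop :=
  exists u : nat -> R * R -> R,
    [/\ forall n, smooth2 (u n),
        L2norm2 rad a (fun p => u n p - psi p) @[n --> \oo] --> 0%E,
        L2norm2 rad a (fun p => 'D_er (u n) p - psir p) @[n --> \oo] --> 0%E,
        L2norm2 rad a (fun p => 'D_ez (u n) p - psiz p) @[n --> \oo] --> 0%E &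
        L2norm2_S rad a (u n) @[n --> \oo] --> 0%E].

(** [- Delta psi - (2 / r) psi_r = om] in the sense of distributions in the open
    rectangle, [Delta = d_r^2 + (1 / r) d_r + d_z^2]. *)
Definition distr_equation rad a om psi psir : Prop :=
  forall ph, test2 (Omega rad a) ph ->
    \int[leb2]_(p in Omega rad a)
      (- (psi p * 'D_er (fun q => 'D_er ph q) p
          + (1 / p.1) * psir p * ph p
          + psi p * 'D_ez (fun q => 'D_ez ph q) p)
       - (2 / p.1) * psir p * ph p)
    = \int[leb2]_(p in Omega rad a) (om p * ph p).

Definition weak_solution rad a om psi psir psiz : Prop :=
  [/\ in_H1 rad a psi psir psiz,
      zero_trace rad a psi psir psiz &
      distr_equation rad a om psi psir].

(** For a.e. [z] the slice [psi (., z)] has a continuous representative on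
    [(0, rad)] whose limit at [0] is [psi0 z]; this determines [psi0] up to a
    null set. *)
Definition axis_trace rad a psi (psi0 : R -> R) : Prop :=
  {ae leb, forall z, z \in `]- a, a[ ->
    exists f : R -> R,
      [/\ {within `]0, rad[, continuous f},
          {ae leb, forall r, r \in `]0, rad[ -> f r = psi (r, z)} &
          f r @[r --> 0^'+] --> psi0 z]}.

Definition chi_integrable rad a K psir : Prop :=
  {ae leb, forall z, z \in `]- a, a[ ->
    leb.-integrable `]0, rad[ (fun t => (psir (t, z) * (1 + K t))%:E)}.

Definition chi K psir p : R :=
  \int[leb]_(t in `]0, p.1[) (psir (t, p.2) * (1 + K t)).

(** Squared norm of [f] in [H^2_0(0, rad)], with [f1] and [f2] the weak
    derivatives of [f]. *)
Definition H20norm2 rad f (f1 f2 : R -> R) : \bar R :=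
  (\sum_(i < 3) \int[leb]_(r in `]0%R, rad[)
     (`|[:: f r; f1 r; f2 r]`_i| ^+ 2 * r ^ (2 * (i%:Z - 2)) * r)%R%:E)%E.

(** [w1] and [w2] are the first and second radial weak derivatives of a.e. slice
    of [w], all jointly measurable. *)
Definition slice_derivs rad a w (w1 w2 : R * R -> R) : Prop :=
  [/\ measurable_fun (Omega rad a) w, measurable_fun (Omega rad a) w1,
      measurable_fun (Omega rad a) w2 &
      {ae leb, forall z, z \in `]- a, a[ ->
        weak_deriv1 `]0, rad[ (fun r => w (r, z)) (fun r => w1 (r, z)) /\
        weak_deriv1 `]0, rad[ (fun r => w1 (r, z)) (fun r => w2 (r, z))}].

Definition L2H20norm2 rad a w (w1 w2 : R * R -> R) : \bar R :=
  (\int[leb]_(z in `](- a)%R, a[)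
     H20norm2 rad (fun r => w (r, z)) (fun r => w1 (r, z)) (fun r => w2 (r, z)))%E.

End Defs.

(* Main.v *)
Require Import Defs.
From HB Require Import structures.
From mathcomp Require Import all_boot all_order all_algebra.
From mathcomp Require Import all_classical all_reals all_analysis.
From mathcomp Require Import measurable_realfun metric_structure.
From mathcomp Require Import ring lra.

Set Implicit Arguments.
Unset Strict Implicit.
Unset Printing Implicit Defensive.

Import Order.TTheory GRing.Theory Num.Theory.
Import numFieldNormedType.Exports.

Local Open Scope classical_set_scope.
Local Open Scope ring_scope.

(** Extend everything by zero and expand in the sines [sin (l_k (z + a))],
    [l_k = (k + 1) pi / (2 a)], which vanish at [z = -a] and [z = a].  The
    coefficients [f_k], [p_k], [o_k] of [psi], [psi_r], [om] satisfy on [(0, rad)]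
      [(r^3 p_k)' = r^3 (l_k^2 f_k - o_k)],  [f_k' = p_k],  [f_k (rad) = 0],
    where the boundary conditions enter only through the trace.  As [r p_k^2] is
    integrable, no constant of integration survives at the axis, and pairing
    with [f_k] gives
      [l_k^4 int r f_k^2 + 2 l_k^2 int r p_k^2 <= int r o_k^2].
    Summed over [k] (Bessel), this makes the series for [psi_zz] and [psi_zr]
    converge in [L_2(Omega)], with norms controlled by that of [om].  Completeness of
    the sines then turns the mode equations into identities on a.e. slice,
      [r^3 psi_r = int_0^r t^3 h],  [psi = psi(0) + int_0^r psi_r],  [h = - om - psi_zz],
    so that [psi_r^2 <= A(z) := int t h^2 dt].  Finally
    [psi - psi(0) - chi = - int_0^r K psi_r] has derivatives [- K psi_r] and
    [- K' psi_r - K (h - 3 psi_r / r)], and [|K| <= C r^2], [|K'| <= C r] bound its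
    weighted norm by a multiple of [A(z)], whose integral is the norm of [h]. *)

(** * Real-valued integrals *)

(** The operator is [d_r^2 + (3 / r) d_r + d_z^2], a Laplacian in five dimensions whose natural
    weight is [r^3], while the norms carry the weight [r]. Each mode equation is therefore used in
    two forms, with [h = l_k^2 f - o] and the index dropped. The form [(r^3 p)' = r^3 h] has no term
    of order zero and bounds [p] at the axis. The form [(r p)' = - 2 p + r h] is paired with [f];
    its additional term [- 2 p f] integrates to [f(0)^2], since [f] vanishes at [rad], and so has
    the good sign. The corners and the axis are out of reach of interior regularity. Expanding in
    [z] alone leaves ordinary differential equations in [r], solved by explicit primitives. The
    obstacle is that the equation may be tested only against functions with compact support in the
    open rectangle, whereas the sines reach [z = - a] and [z = a], and the primitives used in [r] do
    not vanish at [rad]. Both gaps are closed by integrating by parts along the smooth sequence that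
    defines the zero trace. *)

Section L1_functions.
Context d (T : measurableType d) (R : realType) (mu : {measure set T -> \bar R}).
Implicit Types (f g : T -> R) (D : set T).

(** Integrals run over the whole space. A function given on a domain enters multiplied by its
    indicator, so that no set has to be carried through Fubini and integration by parts. *)
Definition L1 f := mu.-integrable setT (EFin \o f).

Lemma L1_measurable f : L1 f -> measurable_fun setT f.
Proof. by move=> /integrableP[/measurable_EFinP]. Qed.

Lemma L1_le f g : measurable_fun setT f -> L1 g ->
  (forall x, `|f x| <= g x) -> L1 f.
Proof.
move=> mf ig fg; apply: le_integrable ig => //; first exact/measurable_EFinP.
by move=> x _ /=; rewrite lee_fin (le_trans (fg x))// ler_norm.
Qed.

Lemma L1D f g : L1 f -> L1 g -> L1 (fun x => f x + g x).
Proof. by move=> If Ig; exact: (integrableD measurableT If Ig). Qed.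

Lemma L1N f : L1 f -> L1 (fun x => - f x).
Proof. by move=> If; exact: (integrableN If). Qed.

Lemma L1B f g : L1 f -> L1 g -> L1 (fun x => f x - g x).
Proof. by move=> If Ig; apply: L1D => //; exact: L1N. Qed.

Lemma L1Zl c f : L1 f -> L1 (fun x => c * f x).
Proof. by move=> If; exact: (integrableZl measurableT c If). Qed.

Lemma L1Zr c f : L1 f -> L1 (fun x => f x * c).
Proof. by move=> If; under eq_fun do rewrite mulrC; exact: L1Zl. Qed.

Lemma L1_cst0 : L1 (fun=> 0).
Proof. exact: integrable0. Qed.

Lemma L1_sum I (s : seq I) (F : I -> T -> R) :
  (forall i, L1 (F i)) -> L1 (fun x => \sum_(i <- s) F i x).
Proof.
move=> IF; elim: s => [|i s IH].
  by under eq_fun do rewrite big_nil; exact: L1_cst0.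
by under eq_fun do rewrite big_cons; exact: L1D.
Qed.

Lemma L1_norm f : L1 f -> L1 (fun x => `|f x|).
Proof. by move=> If; exact: integrable_norm. Qed.

Lemma L1_indic D : measurable D -> (mu D < +oo)%E -> L1 (\1_D : T -> R).
Proof.
move=> mD fD; apply/integrableP; split; first exact/measurable_EFinP.
under eq_integral.
  move=> x _; rewrite gee0_abs; last by rewrite lee_fin indicE.
  over.
by rewrite integral_indic// setIT.
Qed.

Lemma L1_mull_bounded f g (M : R) : measurable_fun setT f -> L1 g ->
  (forall x, `|f x| <= M) -> L1 (fun x => f x * g x).
Proof.
move=> mf Ig fM; apply: (@L1_le _ (fun x => M * `|g x|)).
- by apply: measurable_funM => //; exact: L1_measurable.
- by apply: L1Zl; exact: L1_norm.
- by move=> x; rewrite normrM ler_wpM2r.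
Qed.

Lemma IntD f g : L1 f -> L1 g ->
  \int[mu]_x (f x + g x) = \int[mu]_x f x + \int[mu]_x g x.
Proof. by move=> If Ig; exact: RintegralD. Qed.

Lemma IntB f g : L1 f -> L1 g ->
  \int[mu]_x (f x - g x) = \int[mu]_x f x - \int[mu]_x g x.
Proof. by move=> If Ig; exact: RintegralB. Qed.

Lemma IntZl c f : L1 f -> \int[mu]_x (c * f x) = c * \int[mu]_x f x.
Proof. by move=> If; exact: RintegralZl. Qed.

Lemma IntZr c f : L1 f -> \int[mu]_x (f x * c) = (\int[mu]_x f x) * c.
Proof. by move=> If; exact: RintegralZr. Qed.

Lemma IntN f : L1 f -> \int[mu]_x (- f x) = - \int[mu]_x f x.
Proof.
move=> If; rewrite -mulN1r -IntZl//.
by apply: eq_Rintegral => x _; rewrite mulN1r.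
Qed.

Lemma Int0 : \int[mu]_x (0 : R) = 0.
Proof. by rewrite /Rintegral integral0. Qed.

Lemma Int_sum I (s : seq I) (F : I -> T -> R) :
  (forall i, L1 (F i)) ->
  \int[mu]_x (\sum_(i <- s) F i x) = \sum_(i <- s) \int[mu]_x F i x.
Proof.
move=> IF; elim: s => [|i s IH].
  by rewrite big_nil; under eq_Rintegral do rewrite big_nil; exact: Int0.
rewrite big_cons -IH -IntD//; last exact: L1_sum.
by apply: eq_Rintegral => x _; rewrite big_cons.
Qed.

Lemma eq_Int f g : f =1 g -> \int[mu]_x f x = \int[mu]_x g x.
Proof. by move=> fg; apply: eq_Rintegral => x _. Qed.

Lemma Int_le f g : L1 f -> L1 g -> (forall x, f x <= g x) ->
  \int[mu]_x f x <= \int[mu]_x g x.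
Proof. by move=> If Ig fg; apply: le_Rintegral. Qed.

Lemma Int_ge0 f : (forall x, 0 <= f x) -> 0 <= \int[mu]_x f x.
Proof. by move=> f0; apply: Rintegral_ge0. Qed.

Lemma Int_norm f : L1 f -> `|\int[mu]_x f x| <= \int[mu]_x `|f x|.
Proof. by move=> If; exact: le_normr_Rintegral. Qed.

Lemma Int_norm_le f g : L1 f -> L1 g -> (forall x, `|f x| <= g x) ->
  `|\int[mu]_x f x| <= \int[mu]_x g x.
Proof.
move=> If Ig fg; apply: (le_trans (Int_norm If)); apply: Int_le => //.
exact: L1_norm.
Qed.

Lemma L1_ae f g : measurable_fun setT g -> L1 f ->
  {ae mu, forall x, f x = g x} -> L1 g.
Proof.
move=> mg If fg; apply/integrableP; split; first exact/measurable_EFinP.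
have := If => /integrableP[_]; apply: le_lt_trans.
rewrite le_eqVlt; apply/orP; left; apply/eqP.
apply: ae_eq_integral => //.
- by apply: measurableT_comp => //; exact/measurable_EFinP.
- apply: measurableT_comp => //; apply/measurable_EFinP; exact: L1_measurable.
- by apply: filterS fg => x /= -> _.
Qed.

Lemma Int_ae f g : measurable_fun setT f -> measurable_fun setT g ->
  {ae mu, forall x, f x = g x} -> \int[mu]_x f x = \int[mu]_x g x.
Proof.
move=> mf mg fg; rewrite /Rintegral; congr fine.
apply: ae_eq_integral => //; try exact/measurable_EFinP.
by apply: filterS fg => x /= -> _.
Qed.

(** [min f g] lies below [g] everywhere and equals [f] almost everywhere, which reduces the claim to
    [Int_le]. *)
Lemma Int_ae_le f g : L1 f -> L1 g -> {ae mu, forall x, f x <= g x} ->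
  \int[mu]_x f x <= \int[mu]_x g x.
Proof.
move=> If Ig fg.
have Im : L1 (fun x => Order.min (f x) (g x)).
  apply: (@L1_le _ (fun x => `|f x| + `|g x|)).
  - by apply: measurable_minr; exact: L1_measurable.
  - by apply: L1D; exact: L1_norm.
  - by move=> x; rewrite minElt; case: ifP => _; [rewrite lerDl|rewrite lerDr].
rewrite (@Int_ae f (fun x => Order.min (f x) (g x))).
- by apply: Int_le => // x; rewrite ge_min lexx orbT.
- exact: L1_measurable.
- exact: L1_measurable.
- by apply: filterS fg => x fg; rewrite min_l.
Qed.

Lemma Int_EFin f : L1 f -> (\int[mu]_x (f x)%:E)%E = (\int[mu]_x f x)%:E.
Proof.
by move=> If; rewrite /Rintegral fineK//; apply: integrable_fin_num.
Qed.

Lemma L1_ge0P f : measurable_fun setT f -> (forall x, 0 <= f x) ->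
  (\int[mu]_x (f x)%:E < +oo)%E -> L1 f.
Proof.
move=> mf f0 foo; apply/integrableP; split; first exact/measurable_EFinP.
rewrite (le_lt_trans _ foo)//; apply: ge0_le_integral => //.
- by apply: measurableT_comp => //; exact/measurable_EFinP.
- exact/measurable_EFinP.
- by move=> x _; rewrite /= ger0_norm.
Qed.

Lemma Int_eq0_ae f : L1 f -> (forall x, 0 <= f x) -> \int[mu]_x f x = 0 ->
  {ae mu, forall x, f x = 0}.
Proof.
move=> If f0 I; have I0 : (\int[mu]_x (f x)%:E = 0)%E by rewrite Int_EFin// I.
have I1 : (\int[mu]_x `|(EFin \o f) x| = 0)%E.
  by rewrite -[RHS]I0; apply: eq_integral => x _ /=; rewrite ger0_norm.
have := (ae_eq_integral_abs mu measurableT (measurable_int _ If)).1 I1.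
by apply: filterS => x h; case: (h Logic.I).
Qed.

Lemma Int_cvg (u : nat -> T -> R) f g :
  (forall n, measurable_fun setT (u n)) -> measurable_fun setT f -> L1 g ->
  {ae mu, forall x, u ^~ x @ \oo --> f x} ->
  (forall n x, `|u n x| <= g x) ->
  \int[mu]_x u n x @[n --> \oo] --> \int[mu]_x f x.
Proof.
move=> mu_ mf Ig uf ug.
have [] := @dominated_convergence _ _ _ mu setT measurableT
  (fun n => EFin \o u n) (EFin \o f) (EFin \o g).
- by move=> n; exact/measurable_EFinP.
- exact/measurable_EFinP.
- by apply: filterS uf => x uf _; apply: cvg_comp uf _.
- exact: Ig.
- by apply: nearW => x n _; rewrite lee_fin.
move=> If _; rewrite (Int_EFin If).
by move=> /fine_cvgP[_].
Qed.

(** For [A > 0] the choice [s = x / A] turns the hypothesis into [x <= A B / x]. This is the passage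
    from the weighted arithmetic-geometric mean inequality to Cauchy-Schwarz. *)
Lemma sqr_le_of_AMGM (x A B : R) : 0 <= x -> 0 <= A -> 0 <= B ->
  (forall s, 0 < s -> 2 * x <= s * A + B / s) -> x ^+ 2 <= A * B.
Proof.
move=> x0 A0 B0 H.
have [->|xn0] := eqVneq x 0; first by rewrite expr0n mulr_ge0.
have xp : 0 < x by rewrite lt_def xn0.
have [AE|An0] := eqVneq A 0.
  (* For [A = 0] this [s] gives [2 x <= x B / (B + 1)], impossible for [x > 0]. *)
  have := H ((B + 1) / x); rewrite divr_gt0 ?ltr_wpDl// => /(_ isT).
  have B1 : B + 1 != 0 by rewrite gt_eqF// ltr_wpDl.
  rewrite AE mulr0 add0r invf_div mulrCA -subr_le0 => h.
  have : x * (2 * (B + 1) - B) <= 0.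
    rewrite (_ : _ * _ = (2 * x - x * (B / (B + 1))) * (B + 1)); last by field.
    by rewrite mulr_le0_ge0// addr_ge0.
  by rewrite pmulr_rle0// => h2; lra.
have Ap : 0 < A by rewrite lt_def An0.
have := H (x / A); rewrite divr_gt0// => /(_ isT).
rewrite invf_div divfK// => h.
rewrite expr2 (mulrC A) -(@ler_pM2r _ x^-1) ?invr_gt0// mulfK//.
by rewrite -mulrA; lra.
Qed.

(** A pointwise majorant [A B] of [f^2] lets weights such as [r] be split between the two factors
    without square roots. Integrability comes from [2 |f| <= A + B], the inequality from
    [2 |f| <= s A + B / s] for every [s > 0]. *)
Lemma Int_cauchy_schwarz f A B : measurable_fun setT f -> L1 A -> L1 B ->
  (forall x, 0 <= A x) -> (forall x, 0 <= B x) ->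
  (forall x, f x ^+ 2 <= A x * B x) ->
  L1 f /\ (\int[mu]_x f x) ^+ 2 <= (\int[mu]_x A x) * (\int[mu]_x B x).
Proof.
move=> mf IA IB A0 B0 fAB.
have fs s x : 0 < s -> 2 * `|f x| <= s * A x + B x / s.
  move=> s0; have sx : 0 <= s * A x + B x / s.
    by rewrite addr_ge0 ?mulr_ge0 ?invr_ge0 ?A0 ?B0// ltW.
  rewrite -(@ler_pXn2r _ 2)// ?nnegrE ?mulr_ge0//.
  rewrite exprMn real_normK ?num_real//.
  have s0' : s != 0 by rewrite gt_eqF.
  apply: (@le_trans _ _ (4 * (A x * B x))); first by have := fAB x; lra.
  have -> : 4 * (A x * B x) = (s * A x + B x / s) ^+ 2 - (s * A x - B x / s) ^+ 2.
    by field.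
  by rewrite gerBl sqr_ge0.
have If : L1 f.
  apply: (@L1_le _ (fun x => 1 * A x + B x / 1)) => //.
    by apply: L1D; [exact: L1Zl|exact: L1Zr].
  by move=> x; have := fs 1 x ltr01; have := normr_ge0 (f x); lra.
split => //; rewrite -[leLHS]real_normK ?num_real//.
apply: sqr_le_of_AMGM => //; try exact: Int_ge0.
move=> s s0; apply: (@le_trans _ _ (2 * \int[mu]_x `|f x|)).
  by rewrite ler_pM2l// Int_norm.
rewrite -IntZl; last exact: L1_norm.
rewrite -IntZl// -IntZr// -IntD; [|exact: L1Zl|exact: L1Zr].
apply: Int_le.
- by apply: L1Zl; exact: L1_norm.
- by apply: L1D; [exact: L1Zl|exact: L1Zr].
- by move=> x; exact: fs.
Qed.

Lemma ae_imp (P Q : T -> Prop) : {ae mu, forall x, P x} ->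
  (forall x, P x -> Q x) -> {ae mu, forall x, Q x}.
Proof. by move=> aP PQ; apply: filterS aP. Qed.

Lemma ae_imp2 (P Q S : T -> Prop) : {ae mu, forall x, P x} ->
  {ae mu, forall x, Q x} -> (forall x, P x -> Q x -> S x) ->
  {ae mu, forall x, S x}.
Proof. by move=> aP aQ PQ; apply: filterS2 aP aQ. Qed.

Lemma ae_all (P : nat -> T -> Prop) :
  (forall n, {ae mu, forall x, P n x}) -> {ae mu, forall x, forall n, P n x}.
Proof. by move=> aP; apply/ae_foralln. Qed.

End L1_functions.

(** * Fubini and Tonelli for real-valued integrals *)

Section Fubini.
Context d1 d2 (T1 : measurableType d1) (T2 : measurableType d2) (R : realType).
Variable m1 : {sigma_finite_measure set T1 -> \bar R}.
Variable m2 : {sigma_finite_measure set T2 -> \bar R}.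
Variable F : T1 * T2 -> R.

(** The extended inner integral is finite only for almost every [x], and [fine] sends its infinite
    values to 0. The real and the extended inner integrals agree off a null set, and each property
    is transported along that identity. *)
Lemma L1_fubini1 : L1 (m1 \x m2)%E F ->
  [/\ {ae m1, forall x, L1 m2 (fun y => F (x, y))},
     measurable_fun setT (fun x => \int[m2]_y F (x, y)),
     L1 m1 (fun x => \int[m2]_y F (x, y)) &
     \int[(m1 \x m2)%E]_p F p = \int[m1]_x \int[m2]_y F (x, y)].
Proof.
move=> IF.
have ae1 := ae_integrable1 IF.
have mI : measurable_fun setT (fun x => \int[m2]_y F (x, y)).
  have := measurable_fubini_F IF; rewrite /fubini_F => mF.
  by apply: measurableT_comp mF; exact: fine_measurable.
have eqF : {ae m1, forall x, fubini_F m2 (EFin \o F) x = (\int[m2]_y F (x, y))%:E}.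
  by apply: filterS ae1 => x /Int_EFin <-.
have II : L1 m1 (fun x => \int[m2]_y F (x, y)).
  have /integrableP[mF] := integrable_fubini_F IF.
  move=> Foo; apply/integrableP; split; first exact/measurable_EFinP.
  rewrite (le_lt_trans _ Foo)// le_eqVlt; apply/orP; left; apply/eqP.
  apply: ae_eq_integral => //.
  - by apply: measurableT_comp => //; exact/measurable_EFinP.
  - exact: measurableT_comp.
  - by apply: filterS eqF => x /= -> _.
split => //.
have E : (\int[m1]_x fubini_F m2 (EFin \o F) x =
    \int[m1]_x (\int[m2]_y F (x, y))%:E)%E.
  apply: ae_eq_integral => //.
  - exact: (measurable_fubini_F IF).
  - exact/measurable_EFinP.
  - by apply: filterS eqF => x /= -> _.
have := integral12_prod_meas1 IF.
by move=> h; apply: EFin_inj; rewrite -(Int_EFin IF) -(Int_EFin II) -E h.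
Qed.

Lemma L1_fubini2 : L1 (m1 \x m2)%E F ->
  [/\ {ae m2, forall y, L1 m1 (fun x => F (x, y))},
     measurable_fun setT (fun y => \int[m1]_x F (x, y)),
     L1 m2 (fun y => \int[m1]_x F (x, y)) &
     \int[(m1 \x m2)%E]_p F p = \int[m2]_y \int[m1]_x F (x, y)].
Proof.
move=> IF.
have ae1 := ae_integrable2 IF.
have mI : measurable_fun setT (fun y => \int[m1]_x F (x, y)).
  have := measurable_fubini_G IF; rewrite /fubini_G => mF.
  by apply: measurableT_comp mF; exact: fine_measurable.
have mG := measurable_fubini_G IF.
have eqF : {ae m2, forall y, fubini_G m1 (EFin \o F) y = (\int[m1]_x F (x, y))%:E}.
  by apply: filterS ae1 => x /Int_EFin <-.
have II : L1 m2 (fun y => \int[m1]_x F (x, y)).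
  apply/integrableP; split; first exact/measurable_EFinP.
  have /(integrable21ltyP _ _ (measurable_int _ IF)) Foo := IF.
  rewrite (le_lt_trans _ Foo)//; apply: ge0_le_integral => //.
  - by apply: measurableT_comp => //; exact/measurable_EFinP.
  - apply: (measurable_fun_fubini_tonelli_G (abse \o (EFin \o F))) => //=.
    by apply: measurableT_comp => //; exact: measurable_int IF.
  - move=> y _.
    apply: le_trans (le_abse_integral m1 measurableT _); last first.
      apply/measurable_EFinP; apply: measurableT_comp => //.
      exact: L1_measurable IF.
    rewrite /= /Rintegral.
    by case: (\int[m1]_x (F (x, y))%:E)%E => [r| |]; rewrite /= ?normr0 ?lexx ?leey.
split => //.
have E : (\int[m2]_y fubini_G m1 (EFin \o F) y =
    \int[m2]_y (\int[m1]_x F (x, y))%:E)%E.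
  apply: ae_eq_integral => //.
  - exact/measurable_EFinP.
  - by apply: filterS eqF => x /= -> _.
have := integral21_prod_meas1 IF.
by move=> h; apply: EFin_inj; rewrite -(Int_EFin IF) -(Int_EFin II) -E h.
Qed.

Lemma L1_tonelli1 (G : T1 -> R) : measurable_fun setT F -> L1 m1 G ->
  {ae m1, forall x, L1 m2 (fun y => F (x, y))
     /\ \int[m2]_y `|F (x, y)| <= G x} ->
  L1 (m1 \x m2)%E F.
Proof.
move=> mF IG FG.
apply/(integrable12ltyP m1 m2); first exact/measurable_EFinP.
apply: le_lt_trans (_ : \int[m1]_x `|(G x)%:E| < +oo)%E; last first.
  by case/integrableP : IG.
apply: ae_ge0_le_integral => //.
- by move=> x _; apply: integral_ge0.
- apply: (measurable_fun_fubini_tonelli_F (abse \o (EFin \o F))) => //=.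
  by apply: measurableT_comp => //; exact/measurable_EFinP.
- by apply: measurableT_comp => //; case/integrableP : IG.
- apply: filterS FG => x [Fx FGx] _ /=.
  by rewrite (Int_EFin (L1_norm Fx)) lee_fin (le_trans FGx)// ler_norm.
Qed.

Lemma L1_tonelli2 (G : T2 -> R) : measurable_fun setT F -> L1 m2 G ->
  {ae m2, forall y, L1 m1 (fun x => F (x, y))
     /\ \int[m1]_x `|F (x, y)| <= G y} ->
  L1 (m1 \x m2)%E F.
Proof.
move=> mF IG FG.
apply/(integrable21ltyP m1 m2); first exact/measurable_EFinP.
apply: le_lt_trans (_ : \int[m2]_y `|(G y)%:E| < +oo)%E; last first.
  by case/integrableP : IG.
apply: ae_ge0_le_integral => //.
- by move=> x _; apply: integral_ge0.
- apply: (measurable_fun_fubini_tonelli_G (abse \o (EFin \o F))) => //=.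
  by apply: measurableT_comp => //; exact/measurable_EFinP.
- by apply: measurableT_comp => //; case/integrableP : IG.
- apply: filterS FG => x [Fx FGx] _ /=.
  by rewrite (Int_EFin (L1_norm Fx)) lee_fin (le_trans FGx)// ler_norm.
Qed.

End Fubini.

(** * Completeness of weighted spaces of square integrable functions *)

Section Riesz_Fischer.
Context d (T : measurableType d) (R : realType) (mu : {measure set T -> \bar R}).

(** The steps themselves are at most [q 2^-n] for any [q] with [C <= q^2], so the telescoping series
    converges absolutely. *)
Lemma cvg_of_geometric_steps (u : nat -> R) (C : R) :
  (forall n, (u n.+1 - u n) ^+ 2 <= C * (4^-1) ^+ n) -> cvgn u.
Proof.
move=> uC.
have C0 : 0 <= C.
  by have := uC 0%N; rewrite expr0 mulr1; apply: le_trans; exact: sqr_ge0.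
pose q := Num.sqrt C + 1.
have q0 : 0 <= q by rewrite addr_ge0// sqrtr_ge0.
have qC : C <= q ^+ 2.
  rewrite -[leLHS](sqr_sqrtr C0) ler_pXn2r// ?nnegrE ?sqrtr_ge0//.
  by rewrite lerDl.
have bound n : `|telescope u n| <= q * (2^-1) ^+ n.
  rewrite -(@ler_pXn2r _ 2)// ?nnegrE ?mulr_ge0 ?exprn_ge0//.
  rewrite real_normK ?num_real// exprMn -exprM mulnC exprM.
  apply: (le_trans (uC n)).
  have -> : (2^-1 : R) ^+ 2 = 4^-1 by rewrite exprVn -natrX.
  by apply: ler_wpM2r => //; rewrite exprn_ge0.
have cs : cvgn (series (telescope u)).
  apply: normed_cvg; apply: (@series_le_cvg _ _ (geometric q 2^-1)).
  - by move=> n; exact: normr_ge0.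
  - by move=> n /=; rewrite mulr_ge0// exprn_ge0.
  - by move=> n /=; exact: bound.
  - apply: is_cvg_geometric_series; rewrite ger0_norm//.
    by rewrite invf_lt1// ltr1n.
have -> : u = (fun n => u 0%N + series (telescope u) n).
  by apply/funext => n; exact: eq_sum_telescope.
by apply: is_cvgD => //; exact: is_cvg_cst.
Qed.

(** The sum of all [f n] has a finite integral, hence is finite almost everywhere, and it dominates
    every term. *)
Lemma ae_bounded_of_summable (f : nat -> T -> R) :
  (forall n, L1 mu (f n)) -> (forall n x, 0 <= f n x) ->
  (forall n, \int[mu]_x f n x <= (2^-1) ^+ n) ->
  {ae mu, forall x, exists C, forall n, f n x <= C}.
Proof.
move=> If f0 fle.
pose S x := (\sum_(0 <= n <oo) (f n x)%:E)%E.
have mf n : measurable_fun setT (fun x => (f n x)%:E).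
  by apply/measurable_EFinP; exact: L1_measurable.
have IS : (\int[mu]_x S x < +oo)%E.
  rewrite integral_nneseries//; last by move=> n x _; rewrite lee_fin.
  apply: (@le_lt_trans _ _ (\sum_(0 <= n <oo) ((geometric 1 2^-1) n)%:E)%E).
    apply: lee_nneseries => [n _ _|n _]; first by apply: integral_ge0 => x _; rewrite lee_fin.
    by rewrite Int_EFin// lee_fin /= mul1r.
  rewrite [ltLHS](_ : _ = (limn (series (geometric 1 (2^-1 : R))))%:E).
    by rewrite ltry.
  under eq_fun do rewrite sumEFin.
  rewrite EFin_lim//.
  apply: is_cvg_geometric_series; rewrite ger0_norm//.
  by rewrite invf_lt1// ltr1n.
have mS : measurable_fun setT S.
  by apply: ge0_emeasurable_sum => [n x _ _|n _]; [rewrite lee_fin|exact: mf].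
have /integrable_ae : mu.-integrable setT S.
  apply/integrableP; split => //.
  rewrite (eq_integral S); first exact: IS.
  move=> x _.
  by rewrite gee0_abs// nneseries_ge0// => n _ _; rewrite lee_fin.
move=> /(_ measurableT); apply: filterS => x /(_ Logic.I) Sfin.
exists (fine (S x)) => n.
rewrite -lee_fin fineK//.
have := @nneseries_lim_ge R (fun n => (f n x)%:E) xpredT 0%N n.+1.
move=> /(_ (fun i _ _ => f0 i x)); apply: le_trans.
rewrite big_nat_recr//= leeDr// sume_ge0// => i _.
by rewrite lee_fin.
Qed.

(** The weight may vanish, so convergence is obtained only where [w] is not 0. The clause on common
    zeros of the [u n] makes the limit inherit their support. *)
Lemma Riesz_Fischer (w : T -> R) (u : nat -> T -> R) :
  (forall x, 0 <= w x) -> measurable_fun setT w ->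
  (forall n, measurable_fun setT (u n)) ->
  (forall m n, L1 mu (fun x => (u m x - u n x) ^+ 2 * w x)) ->
  (forall e, 0 < e -> exists N : nat, forall m n, (N <= m)%N -> (N <= n)%N ->
     \int[mu]_x ((u m x - u n x) ^+ 2 * w x) <= e) ->
  exists v : T -> R, [/\ measurable_fun setT v,
    forall x, (forall n, u n x = 0) -> v x = 0,
    forall n, L1 mu (fun x => (v x - u n x) ^+ 2 * w x) &
    forall e, 0 < e -> exists N : nat, forall n, (N <= n)%N ->
     \int[mu]_x ((v x - u n x) ^+ 2 * w x) <= e].
Proof.
move=> w0 mw mu_ Iu cau.
have e0 j : 0 < (8^-1 : R) ^+ j by rewrite exprn_gt0.
have /choice[N HN] : forall j, exists N : nat, forall m n, (N <= m)%N ->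
    (N <= n)%N -> \int[mu]_x ((u m x - u n x) ^+ 2 * w x) <= 8^-1 ^+ j.
  by move=> j; exact: cau.
(* The partial sums make [phi] monotone and at least [N j]; the summand [j] makes it unbounded. *)
pose phi j := (\sum_(i < j.+1) N i + j)%N.
have Nphi j : (N j <= phi j)%N.
  by rewrite /phi big_ord_recr/= -addnA addnCA leq_addr.
have phiS j : (phi j <= phi j.+1)%N.
  by rewrite /phi [X in (_ <= X + _)%N]big_ord_recr/= leq_add// leq_addr.
have jphi j : (j <= phi j)%N by rewrite leq_addl.
(* The factor [4^j] against the rate [8^-j] leaves the summable bound [2^-j]. Boundedness of [f j x]
   in [j], divided by [w x], is then the hypothesis of [cvg_of_geometric_steps]. *)
pose f j x := 4 ^+ j * ((u (phi j.+1) x - u (phi j) x) ^+ 2 * w x).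
have fae : {ae mu, forall x, exists C, forall n, f n x <= C}.
  apply: ae_bounded_of_summable => [n|n x|n].
  - exact: L1Zl.
  - by rewrite mulr_ge0 ?exprn_ge0// mulr_ge0// sqr_ge0.
  - rewrite IntZl//.
    apply: (@le_trans _ _ (4 ^+ n * 8^-1 ^+ n)).
      rewrite ler_wpM2l ?exprn_ge0// HN//.
      by rewrite (leq_trans (Nphi n)).
    by rewrite -exprMn (_ : 4 * 8^-1 = 2^-1 :> R)//; lra.
have cae : {ae mu, forall x, w x != 0 -> cvgn (fun j => u (phi j) x)}.
  apply: filterS fae => x [C fC] wx.
  apply: (@cvg_of_geometric_steps _ (C / w x)) => n.
  have := fC n; rewrite /f.
  have wp : 0 < w x by rewrite lt_def wx w0.
  move=> h; rewrite exprVn ler_pdivlMr ?exprn_gt0// ler_pdivlMr//.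
  by apply: le_trans h; rewrite mulrA [X in _ <= X * _]mulrC.
(* An upper limit is measurable whether or not the sequence converges; where [w] vanishes, its value
   does not enter the integrals. *)
pose v x := fine (limn_esup (fun j => (u (phi j) x)%:E)).
have mv : measurable_fun setT v.
  apply: measurableT_comp; first exact: fine_measurable.
  apply: measurable_fun_limn_esup => n; exact/measurable_EFinP.
have vcvg x l : (fun j => u (phi j) x) @ \oo --> l -> v x = l.
  move=> ul; rewrite /v (cvg_limn_einf_sup (l := l%:E))//.
  by apply: cvg_comp ul _.
(* Fatou along the subsequence: the limit inherits any bound on [u j - u n] that is valid for all
   [j >= n]. *)
have key n (e : R) : (forall j, (n <= j)%N ->
    \int[mu]_x ((u j x - u n x) ^+ 2 * w x) <= e) ->
  L1 mu (fun x => (v x - u n x) ^+ 2 * w x) /\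
  \int[mu]_x ((v x - u n x) ^+ 2 * w x) <= e.
  move=> ne.
  pose g j x := ((u (phi (n + j)%N) x - u n x) ^+ 2 * w x)%:E.
  have g0 j x : setT x -> (0 <= g j x)%E.
    by move=> _; rewrite lee_fin mulr_ge0// sqr_ge0.
  have mg j : measurable_fun setT (g j).
    apply/measurable_EFinP; exact: L1_measurable (Iu _ _).
  have := fatou mu measurableT mg g0.
  have mgv : measurable_fun setT (fun x => (v x - u n x) ^+ 2 * w x).
    by apply: measurable_funM => //; apply: measurable_funX; apply: measurable_funB.
  have -> : (\int[mu]_x limn_einf (g^~ x) =
      \int[mu]_x ((v x - u n x) ^+ 2 * w x)%:E)%E.
    apply: ae_eq_integral => //.
    - rewrite (_ : (fun x => _) = (fun x => - limn_esup (-%E \o g ^~ x))%E).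
        apply: measurableT_comp => //; apply: measurable_fun_limn_esup => k.
        exact: measurableT_comp.
      by apply/funext => x; rewrite limn_esupN oppeK.
    - exact/measurable_EFinP.
    - apply: filterS cae => x /= cx _.
      have [wx|/cx ccx] := eqVneq (w x) 0.
        rewrite /g wx mulr0.
        under eq_fun do rewrite mulr0.
        have c0 : (fun=> 0%:E : \bar R) @ \oo --> (0%:E : \bar R) by exact: cvg_cst.
        by have [-> _] := cvg_limn_einf_sup c0.
      have := ccx; move=> /cvg_ex[l ul].
      rewrite (vcvg _ _ ul).
      suff : g ^~ x @ \oo --> ((l - u n x) ^+ 2 * w x)%:E.
        by move=> /cvg_limn_einf_sup[-> _].
      apply: cvg_comp (_ : (fun j => (u (phi (n + j)%N) x - u n x) ^+ 2 * w x)
         @ \oo --> (l - u n x) ^+ 2 * w x) _ => //.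
      apply: cvgM; last exact: cvg_cst.
      apply: (@cvg_comp _ _ _ (fun j => u (phi (n + j)%N) x - u n x) (fun t => t ^+ 2)
         _ (nbhs (l - u n x))); last exact: exprn_continuous.
      apply: cvgB; last exact: cvg_cst.
      have := ul; rewrite -(cvg_shiftn n) /=.
      by under eq_fun do rewrite addnC.
  have le1 : (limn_einf (fun k => \int[mu]_x g k x) <= e%:E)%E.
    rewrite limn_einf_lim; apply: lime_le; first exact: is_cvg_einfs.
    apply: nearW => k; apply: (@le_trans _ _ (\int[mu]_x g k x)%E).
      by apply: ereal_inf_lbound; exists k => /=.
    rewrite Int_EFin// lee_fin ne//.
    by rewrite (leq_trans _ (jphi _))// leq_addr.
  move=> /le_trans /(_ le1) le2.
  have I1 : L1 mu (fun x => (v x - u n x) ^+ 2 * w x).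
    apply: L1_ge0P => //; last by rewrite (le_lt_trans le2)// ltry.
    by move=> x; rewrite mulr_ge0// sqr_ge0.
  by split => //; rewrite -lee_fin -Int_EFin.
exists v; split => //.
- move=> x ux; apply: vcvg; rewrite (_ : (fun j => _) = fun=> 0); first exact: cvg_cst.
  by apply/funext => j; rewrite ux.
- move=> n; have [M HM] := cau 1 ltr01.
  have [I1 _] := key M 1 (fun j Mj => HM _ _ Mj (leqnn M)).
  apply: (@L1_le _ _ _ _ _ (fun x => 2 * ((v x - u M x) ^+ 2 * w x) + 2 * ((u M x - u n x) ^+ 2 * w x))).
  + by apply: measurable_funM => //; apply: measurable_funX; apply: measurable_funB.
  + by apply: L1D; apply: L1Zl.
  + move=> x; rewrite ger0_norm; last by rewrite mulr_ge0// sqr_ge0.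
    rewrite !mulrA -mulrDl ler_wpM2r//.
    have := sqr_ge0 ((v x - u M x) - (u M x - u n x)); lra.
- move=> e /cau[M HM]; exists M => n Mn.
  by apply: (key n e _).2 => j nj; apply: HM => //; exact: leq_trans nj.
Qed.

End Riesz_Fischer.

(** * Measurability and iterated integrals in the plane *)

Section plane.
Context {R : realType}.

(** The rational boxes contained in [U] are countably many and cover it. As the product
    sigma-algebra is generated by rectangles, this is what makes continuous functions of two
    variables measurable. *)
Lemma open_measurable_plane (U : set (R * R)) : open U -> measurable U.
Proof.
move=> oU.
pose box (t : (rat * rat) * (rat * rat)) : set (R * R) :=
  `](ratr t.1.1 : R), ratr t.1.2[ `*` `](ratr t.2.1 : R), ratr t.2.2[.
have -> : U = \bigcup_(t in [set t | box t `<=` U]) box t.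
  apply/seteqP; split => [[x y] Uxy|p [t tU]]; last exact: tU.
  have /nbhs_ballP[e /= e0 eU] : nbhs (x, y) U by exact: open_nbhs_nbhs.
  have [p1 /andP[]] := @rat_in_itvoo R (x - e) x ltac:(lra).
  rewrite !bnd_simp => p1l p1r.
  have [p2 /andP[]] := @rat_in_itvoo R x (x + e) ltac:(lra).
  rewrite !bnd_simp => p2l p2r.
  have [q1 /andP[]] := @rat_in_itvoo R (y - e) y ltac:(lra).
  rewrite !bnd_simp => q1l q1r.
  have [q2 /andP[]] := @rat_in_itvoo R y (y + e) ltac:(lra).
  rewrite !bnd_simp => q2l q2r.
  exists ((p1, p2), (q1, q2)) => /=; last first.
    by split => /=; rewrite in_itv/=; apply/andP.
  move=> [s t] [/=]; rewrite !in_itv/= => /andP[s1 s2] /andP[t1 t2].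
  apply: eU; split => /=; rewrite /ball /= ltr_distlC; apply/andP; split; lra.
rewrite bigcup_mkcond; apply: countable_bigcupT_measurable => // t.
by case: ifP => _; [apply: measurableX; exact: measurable_itv|exact: measurable0].
Qed.

Lemma closed_measurable_plane (U : set (R * R)) : closed U -> measurable U.
Proof.
move=> cU; rewrite -(setCK U); apply: measurableC; apply: open_measurable_plane.
exact: closed_openC.
Qed.

Lemma continuous_measurable_plane (f : R * R -> R) :
  continuous f -> measurable_fun setT f.
Proof.
move=> /continuousP cf; apply: (measurability _ (RGenOpens.measurableE R)).
move=> _ [_ [a [b ->] <-]]; rewrite setTI; apply: open_measurable_plane.
exact/cf/interval_open.
Qed.

Local Notation leb := (@lebesgue_measure R).
Local Notation leb2 := (leb \x leb)%E.
Implicit Types (F : R * R -> R) (G : R -> R).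

Lemma plane_fubini1 F : L1 leb2 F ->
  [/\ {ae leb, forall x, L1 leb (fun y => F (x, y))},
     measurable_fun setT (fun x => \int[leb]_y F (x, y)),
     L1 leb (fun x => \int[leb]_y F (x, y)) &
     \int[leb2]_p F p = \int[leb]_x \int[leb]_y F (x, y)].
Proof. exact: (@L1_fubini1 _ _ _ _ R leb leb F). Qed.

Lemma plane_fubini2 F : L1 leb2 F ->
  [/\ {ae leb, forall y, L1 leb (fun x => F (x, y))},
     measurable_fun setT (fun y => \int[leb]_x F (x, y)),
     L1 leb (fun y => \int[leb]_x F (x, y)) &
     \int[leb2]_p F p = \int[leb]_y \int[leb]_x F (x, y)].
Proof. exact: (@L1_fubini2 _ _ _ _ R leb leb F). Qed.

Lemma plane_tonelli1 F G : measurable_fun setT F -> L1 leb G ->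
  {ae leb, forall x, L1 leb (fun y => F (x, y))
     /\ \int[leb]_y `|F (x, y)| <= G x} ->
  L1 leb2 F.
Proof. exact: (@L1_tonelli1 _ _ _ _ R leb leb F G). Qed.

Lemma plane_tonelli2 F G : measurable_fun setT F -> L1 leb G ->
  {ae leb, forall y, L1 leb (fun x => F (x, y))
     /\ \int[leb]_x `|F (x, y)| <= G y} ->
  L1 leb2 F.
Proof. exact: (@L1_tonelli2 _ _ _ _ R leb leb F G). Qed.

End plane.

Section measurable_slices.
Context d (T : measurableType d) {R : realType}.
Local Notation leb := (@lebesgue_measure R).
Implicit Types F : T * R -> R.

Lemma measurable_slice F x :
  measurable_fun setT F -> measurable_fun setT (fun y => F (x, y)).
Proof. by move=> mF; exact: measurableT_comp mF (measurable_pair1 x). Qed.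

(** Tonelli makes the integrals of the positive and of the negative part measurable in [x], whatever
    the slices are; [fine] is applied to their difference. *)
Lemma measurable_Int_slice F : measurable_fun setT F ->
  measurable_fun setT (fun x => \int[leb]_y F (x, y)).
Proof.
move=> mF; apply: measurableT_comp; first exact: fine_measurable.
rewrite (_ : (fun x => _) = (fun x => \int[leb]_y ((EFin \o F)^\+ (x, y)) -
    \int[leb]_y ((EFin \o F)^\- (x, y)))%E); last first.
  apply/funext => x; rewrite integralE.
  by congr (_ - _)%E; apply: eq_integral => y _; rewrite ?funeposE ?funenegE.
have mE : measurable_fun setT (EFin \o F) by exact/measurable_EFinP.
apply: emeasurable_funB.
- apply: (@measurable_fun_fubini_tonelli_F _ _ T (measurableTypeR R) R leb) => //.
  exact: measurable_funepos.
- apply: (@measurable_fun_fubini_tonelli_F _ _ T (measurableTypeR R) R leb) => //.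
  exact: measurable_funeneg.
Qed.

End measurable_slices.

(** * Primitives of integrable functions *)

Section primitive.
Context {R : realType}.
Local Notation leb := (@lebesgue_measure R).
Implicit Types (f g h : R -> R).

(** The primitive vanishing at minus infinity. The cut is a factor of the integrand, so that in
    [Prim_fubini] it becomes a function on the plane. *)
Definition Prim g x : R := \int[leb]_t (g t * (t <= x)%R%:R).

Lemma measurable_le_nat d (T : measurableType d) (f g : T -> R) :
  measurable_fun setT f -> measurable_fun setT g ->
  measurable_fun setT (fun x => (f x <= g x)%R%:R : R).
Proof.
move=> mf mg.
rewrite (_ : (fun x => _) = (fun x => if f x <= g x then 1 else 0 : R)).
  by apply: measurable_fun_ifT => //; exact: measurable_fun_ler.
by apply/funext => x; case: ifP.
Qed.

Lemma measurable_lt_nat d (T : measurableType d) (f g : T -> R) :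
  measurable_fun setT f -> measurable_fun setT g ->
  measurable_fun setT (fun x => (f x < g x)%R%:R : R).
Proof.
move=> mf mg.
rewrite (_ : (fun x => _) = (fun x => if f x < g x then 1 else 0 : R)).
  by apply: measurable_fun_ifT => //; exact: measurable_fun_ltr.
by apply/funext => x; case: ifP.
Qed.

Lemma L1_mul_bool g (b : R -> bool) :
  measurable_fun setT (fun x => (b x)%:R : R) -> L1 leb g ->
  L1 leb (fun x => g x * (b x)%:R).
Proof.
move=> mb Ig; apply: (L1_le _ (L1_norm Ig)).
- by apply: measurable_funM => //; exact: L1_measurable Ig.
- by move=> x; rewrite normrM; case: (b x); rewrite /= ?normr1 ?normr0 ?mulr1 ?mulr0.
Qed.

Lemma L1_le_cut g x : L1 leb g -> L1 leb (fun t => g t * (t <= x)%R%:R).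
Proof. by move=> Ig; apply: L1_mul_bool => //; exact: measurable_le_nat. Qed.

Lemma PrimE g x : Prim g x = \int[leb]_(t in `]-oo, x]) g t.
Proof.
rewrite /Prim [RHS]Rintegral_mkcond; apply: eq_Int => t; rewrite patchE.
by rewrite mem_setE in_itv/=; case: (t <= x); rewrite ?mulr1 ?mulr0.
Qed.

Lemma integrable_sub (D : set R) g : measurable D -> L1 leb g ->
  leb.-integrable D (EFin \o g).
Proof. by move=> mD Ig; apply: (@integrableS _ _ _ leb setT D). Qed.

Lemma Prim_le g x : L1 leb g -> `|Prim g x| <= \int[leb]_t `|g t|.
Proof.
move=> Ig; apply: Int_norm_le; [exact: L1_le_cut|exact: L1_norm|move=> t].
by rewrite normrM; case: (t <= x)%R; rewrite /= ?normr1 ?normr0 ?mulr1 ?mulr0.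
Qed.

(** Integration by parts for primitives: [h x * g y] is integrated over [y <= x] and over [x <= y],
    two half-planes that cover the plane and meet only in the diagonal, a null set. Primitives are
    bounded, whence the integrability claims. *)
Lemma Prim_fubini g h : L1 leb g -> L1 leb h ->
  [/\ measurable_fun setT (Prim g), L1 leb (fun x => Prim g x * h x),
      L1 leb (fun x => g x * Prim h x) &
  \int[leb]_x (Prim g x * h x) + \int[leb]_x (g x * Prim h x) =
  (\int[leb]_x g x) * (\int[leb]_x h x)].
Proof.
move=> Ig Ih.
have mg := L1_measurable Ig; have mh := L1_measurable Ih.
have key (u v : R -> R) (b : R -> R -> bool) : L1 leb u -> L1 leb v ->
    measurable_fun setT (fun p : R * R => (b p.1 p.2)%:R : R) ->
    L1 (leb \x leb)%E (fun p => v p.1 * u p.2 * (b p.1 p.2)%:R).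
  move=> Iu Iv mb.
  have mu := L1_measurable Iu; have mv := L1_measurable Iv.
  have m2 : measurable_fun setT (fun p : R * R => v p.1 * u p.2 * (b p.1 p.2)%:R).
    apply: measurable_funM => //; apply: measurable_funM.
      by apply: measurableT_comp.
    by apply: measurableT_comp.
  have m2x x : measurable_fun setT (fun y : R => v x * u y * (b x y)%:R).
    exact: (measurableT_comp m2 (measurable_pair1 x)).
  apply: (@plane_tonelli1 _ _ (fun x => `|v x| * \int[leb]_y `|u y|)) => //.
    by apply: L1Zr; exact: L1_norm.
  apply: nearW => x.
  have le1 y : `|v x * u y * (b x y)%:R| <= `|v x| * `|u y|.
    rewrite -normrM; case: (b x y); rewrite /= ?mulr1 ?mulr0//.
    by rewrite normr0.
  have I1 : L1 leb (fun y => v x * u y * (b x y)%:R).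
    apply: (@L1_le _ _ _ leb _ (fun y => `|v x| * `|u y|)) => //; first exact: m2x.
    by apply: L1Zl; exact: L1_norm.
  split => //; rewrite -IntZl; last exact: L1_norm.
  apply: Int_le => //; first exact: L1_norm.
  by apply: L1Zl; exact: L1_norm.
have mle : measurable_fun setT (fun p : R * R => (p.2 <= p.1)%R%:R : R).
  exact: measurable_le_nat.
have mlt : measurable_fun setT (fun p : R * R => (p.2 < p.1)%R%:R : R).
  exact: measurable_lt_nat.
have mP (u : R -> R) : L1 leb u -> measurable_fun setT (Prim u).
  move=> Iu.
  apply: (measurable_Int_slice (F := fun p : R * R => u p.2 * (p.2 <= p.1)%R%:R)).
  by apply: measurable_funM => //; apply: measurableT_comp => //; exact: L1_measurable Iu.
have IP (u v : R -> R) : L1 leb u -> L1 leb v -> L1 leb (fun x => Prim u x * v x).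
  move=> Iu Iv; apply: (@L1_mull_bounded _ _ _ leb _ _ (\int[leb]_t `|u t|)) => //.
    exact: mP.
  by move=> x; exact: Prim_le.
split.
- exact: mP.
- exact: IP.
- by under eq_fun do rewrite mulrC; exact: IP.
have IF := key g h (fun x y => y <= x) Ig Ih mle.
have [_ _ _ E1] := plane_fubini1 IF.
have [_ _ _ E2] := plane_fubini2 IF.
have -> : \int[leb]_x (Prim g x * h x) =
    \int[(leb \x leb)%E]_p (h p.1 * g p.2 * (p.2 <= p.1)%R%:R).
  rewrite E1; apply: eq_Int => x /=.
  rewrite mulrC -IntZl; last exact: L1_le_cut.
  by apply: eq_Int => y; rewrite mulrA.
rewrite E2 -IntD; first last.
- by under eq_fun do rewrite mulrC; exact: IP.
- by have [] := plane_fubini2 IF.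
have hx y : L1 leb (fun x => h x * (y <= x)%R%:R).
  by apply: L1_mul_bool => //; exact: measurable_le_nat.
rewrite -IntZr//; apply: eq_Int => y /=.
have -> : \int[leb]_x (h x * g y * (y <= x)%R%:R) = g y * \int[leb]_x (h x * (y <= x)%R%:R).
  rewrite -IntZl//; apply: eq_Int => x; ring.
rewrite -mulrDr; congr (_ * _).
rewrite /Prim -IntD//; last exact: L1_le_cut.
apply: Int_ae => //.
- apply: measurable_funD; apply: measurable_funM => //; exact: measurable_le_nat.
- exists [set y]; split => //; first exact: lebesgue_measure_set1.
  move=> x /= H; apply: contrapT => /eqP xy; apply: H.
  by case: (ltgtP x y) xy => //=; rewrite ?mulr0 ?mulr1 ?addr0 ?add0r.
Qed.

Lemma Prim_deriv_ae g : L1 leb g ->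
  {ae leb, forall x, derivable (Prim g) x 1 /\ derive1 (Prim g) x = g x}.
Proof.
move=> Ig; have PE : Prim g = (fun x => \int[leb]_(t in `]-oo, x]) g t).
  by apply/funext => x; exact: PrimE.
rewrite PE; apply: FTC1Ny; first by move=> y; exact: integrable_sub.
by apply: open_integrable_locally => //; exact: openT.
Qed.

Lemma Prim_deriv g x : L1 leb g -> {for x, continuous g} ->
  derivable (Prim g) x 1 /\ derive1 (Prim g) x = g x.
Proof.
move=> Ig cg; have -> : Prim g = (fun x => \int[leb]_(t in `]-oo, x]) g t).
  by apply/funext => y; exact: PrimE.
apply: (@continuous_FTC1 _ _ _ _ (x + 1)) => //; first by rewrite ltrDl.
  exact: integrable_sub.
by rewrite ltNyr.
Qed.

Lemma ae_eq0_of_Prim g : L1 leb g -> (forall x, Prim g x = 0) ->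
  {ae leb, forall x, g x = 0}.
Proof.
move=> Ig P0; apply: (ae_imp (Prim_deriv_ae Ig)) => x [_ <-].
by rewrite (_ : Prim g = cst 0) ?derive1_cst//; apply/funext.
Qed.

Lemma L1_continuous_segment f c d : continuous f ->
  L1 leb (fun x => f x * (c <= x <= d)%R%:R).
Proof.
move=> cf.
have := @continuous_compact_integrable R f `[c, d] (@segment_compact _ c d).
move=> /(_ (continuous_subspaceT cf)); rewrite integrable_mkcond; last first.
  exact: measurable_itv.
rewrite /L1; congr (leb.-integrable _ _); apply/funext => x /=.
by rewrite patchE mem_setE in_itv/=; case: (c <= x <= d); rewrite ?mulr1 ?mulr0.
Qed.

Lemma Prim_of_deriv f c d x : (forall y, derivable f y 1) ->
  continuous (derive1 f) -> c <= x -> x <= d ->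
  Prim (fun t => derive1 f t * (c <= t <= d)%R%:R) x = f x - f c.
Proof.
move=> df cf'; rewrite le_eqVlt => /predU1P[<- _|cx xd].
  rewrite subrr -(@Int0 _ _ _ leb); apply: Int_ae => //.
  - apply: measurable_funM; last exact: measurable_le_nat.
    exact: L1_measurable (L1_continuous_segment _ _ cf').
  - exists [set c]; split => //; first exact: lebesgue_measure_set1.
    move=> y /= H; apply: contrapT => /eqP yc; apply: H.
    move: yc; case: (ltgtP y c) => //= _ _; rewrite ?mulr0 ?mul0r//.
have cf : continuous f by move=> y; apply/differentiable_continuous/derivable1_diffP.
have E := @continuous_FTC2 R (derive1 f) f c x cx (continuous_subspaceT cf').
rewrite /Prim /Rintegral; apply: EFin_inj; rewrite fineK; last first.
  apply: integrable_fin_num => //; apply: L1_le_cut; exact: L1_continuous_segment.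
rewrite EFinB -E//.
- rewrite [RHS]integral_mkcond; apply: eq_integral => t _; rewrite patchE.
  rewrite mem_setE in_itv/=; case: (leP c t); case: (leP t x) => //=.
  + by move=> tx _; rewrite (le_trans tx xd) !mulr1.
  + by rewrite mulr0.
  + by rewrite mulr0 mul0r.
  + by rewrite mulr0.
- split => //.
  + by apply: cvg_at_right_filter; exact: cf.
  + by apply: cvg_at_left_filter; exact: cf.
Qed.

Lemma leb_mull_bounded f g (M : R) : measurable_fun setT f -> L1 leb g ->
  (forall x, `|f x| <= M) -> L1 leb (fun x => f x * g x).
Proof. by move=> mf Ig fM; apply: (@L1_mull_bounded _ _ _ leb _ _ M). Qed.

Lemma leb_L1_ae f g : measurable_fun setT g -> L1 leb f ->
  {ae leb, forall x, f x = g x} -> L1 leb g.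
Proof. by move=> mg If fg; apply: (@L1_ae _ _ _ leb f). Qed.

Lemma leb_L1_le f g : measurable_fun setT f -> L1 leb g ->
  (forall x, `|f x| <= g x) -> L1 leb f.
Proof. by move=> mf Ig fg; apply: (@L1_le _ _ _ leb f g). Qed.

Lemma leb_mulr_bounded f g (M : R) : L1 leb f -> measurable_fun setT g ->
  (forall x, `|g x| <= M) -> L1 leb (fun x => f x * g x).
Proof.
by move=> If mg gM; under eq_fun do rewrite mulrC; exact: leb_mull_bounded gM.
Qed.

(** Truncating [|f|] at [|g|] changes it only on a null set and makes the domination hold
    everywhere. *)
Lemma leb_L1_ae_le (f g : R -> R) : measurable_fun setT f -> L1 leb g ->
  {ae leb, forall x, `|f x| <= g x} -> L1 leb f.
Proof.
move=> mf Ig fg.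
have mn : measurable_fun setT (fun x => `|f x|).
  by apply: measurableT_comp => //; exact: normr_measurable.
have mm : measurable_fun setT (fun x => Order.min `|f x| `|g x|).
  apply: measurable_minr => //; apply: measurableT_comp; first exact: normr_measurable.
  exact: L1_measurable Ig.
have I2 : L1 leb (fun x => Order.min `|f x| `|g x|).
  apply: (leb_L1_le mm (L1_norm Ig)) => r.
  by rewrite ger0_norm ?le_min ?normr_ge0// ge_min lexx orbT.
have In : L1 leb (fun x => `|f x|).
  apply: (leb_L1_ae mn I2); apply: (ae_imp fg) => x fgx.
  by rewrite min_l// (le_trans fgx)// ler_norm.
by apply: (leb_L1_le mf In) => x.
Qed.

End primitive.

(** * Smooth test functions *)

Section smooth_functions.
Context {R : realType}.
Implicit Types (f g : R -> R) (k n : nat).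

(** Differentiates first and recurses on the derivative, whereas the iterated derivative in
    [smooth1] adds its last derivative outside. This form passes through the product and chain rules
    by induction. *)
Fixpoint derivable_upto k f : Prop :=
  (forall x, derivable f x 1) /\
  (if k is k'.+1 then derivable_upto k' (derive1 f) else True).

Lemma smooth1P f : smooth1 f <-> forall k, derivable_upto k f.
Proof.
split=> [sf k|sf k x].
  elim: k f sf => [|k IH] f sf /=; split=> //; try by move=> x; exact: (sf 0%N).
  by apply: IH => k' x; rewrite -derive1Sn; exact: sf.
elim: k f sf => [|k IH] f sf; first by have [/(_ x)] := sf 0%N.
rewrite derive1Sn; apply: IH => k'; by have [_] := sf k'.+1.
Qed.

Lemma derivable_uptoS k f : derivable_upto k.+1 f -> derivable_upto k f.
Proof.
elim: k f => [|k IH] f [df sf]; split => //.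
by apply: IH; exact: sf.
Qed.

Lemma derivable_upto_cst k (c : R) : derivable_upto k (fun=> c).
Proof.
elim: k c => [|k IH] c; split => //; try by move=> x; exact: derivable_cst.
rewrite (_ : derive1 _ = fun=> 0); first exact: IH.
by apply/funext => x; exact: derive1_cst.
Qed.

Lemma derive1_funD f g : (forall x, derivable f x 1) -> (forall x, derivable g x 1) ->
  (forall x, derivable (fun x => f x + g x) x 1) /\
  derive1 (fun x => f x + g x) = (fun x => derive1 f x + derive1 g x).
Proof.
move=> df dg; split; first by move=> x; exact: derivableD.
by apply/funext => x; rewrite derive1E (deriveD (df x) (dg x)) -!derive1E.
Qed.

Lemma derive1_funM f g : (forall x, derivable f x 1) -> (forall x, derivable g x 1) ->
  (forall x, derivable (fun x => f x * g x) x 1) /\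
  derive1 (fun x => f x * g x) = (fun x => derive1 f x * g x + f x * derive1 g x).
Proof.
move=> df dg; split; first by move=> x; exact: derivableM.
apply/funext => x; rewrite derive1E (deriveM (df x) (dg x)) -!derive1E.
by rewrite addrC; congr (_ + _); rewrite /GRing.scale/= mulrC.
Qed.

Lemma derive1_fun_affine f (b c : R) : (forall x, derivable f x 1) ->
  (forall x, derivable (fun x => f (b * x + c)) x 1) /\
  derive1 (fun x => f (b * x + c)) = (fun x => b * derive1 f (b * x + c)).
Proof.
move=> df.
have dl (x : R) : is_derive x 1 (fun x : R => b * x + c) b.
  have d1 : is_derive x 1 (fun x : R => b * x) b.
    have d2 := @is_deriveM _ _ (cst b) id x 1 _ _ (is_derive_cst b x 1) (is_derive_id x 1).
    by apply: (is_derive_eq d2); rewrite /GRing.scale/= mulr1 mulr0 addr0.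
  have d3 := is_deriveD d1 (is_derive_cst c x 1).
  by apply: (is_derive_eq d3); rewrite addr0.
split.
  move=> x; apply: (@ex_derive _ _ _ _ _ _ (b * derive1 f (b * x + c))).
  rewrite mulrC; apply: is_derive1_comp; rewrite derive1E; exact: derivableP.
apply/funext => x; rewrite derive1E; apply: derive_val.
by rewrite mulrC; apply: is_derive1_comp; rewrite derive1E; exact: derivableP.
Qed.

Lemma derive1_fun_expR f : (forall x, derivable f x 1) ->
  (forall x, derivable (fun x => expR (f x)) x 1) /\
  derive1 (fun x => expR (f x)) = (fun x => derive1 f x * expR (f x)).
Proof.
move=> df; split.
  move=> x; apply: (@ex_derive _ _ _ _ _ _ (expR (f x) * derive1 f x)).
  apply: is_derive1_comp; rewrite derive1E; exact: derivableP.
apply/funext => x; rewrite derive1E; apply: derive_val.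
by rewrite mulrC; apply: is_derive1_comp; rewrite derive1E; exact: derivableP.
Qed.

Lemma derivable_uptoD k f g : derivable_upto k f -> derivable_upto k g ->
  derivable_upto k (fun x => f x + g x).
Proof.
elim: k f g => [|k IH] f g [df sf] [dg sg]; have [d e] := derive1_funD df dg.
  by split.
by split => //; rewrite e; exact: IH.
Qed.

Lemma derivable_uptoM k f g : derivable_upto k f -> derivable_upto k g ->
  derivable_upto k (fun x => f x * g x).
Proof.
elim: k f g => [|k IH] f g Hf Hg; have [df sf] := Hf; have [dg sg] := Hg;
  have [d e] := derive1_funM df dg; split => //.
rewrite e; apply: derivable_uptoD; apply: IH => //; exact: derivable_uptoS.
Qed.

Lemma smooth1_derivable f x : smooth1 f -> derivable f x 1.
Proof. by move=> /(_ 0%N); exact. Qed.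

Lemma smooth1_continuous f : smooth1 f -> continuous f.
Proof.
by move=> sf x; apply/differentiable_continuous/derivable1_diffP/smooth1_derivable.
Qed.

Lemma smooth1_derive1 f : smooth1 f -> smooth1 (derive1 f).
Proof. by move=> sf k x; rewrite -derive1Sn; exact: sf. Qed.

Lemma smooth1_of_derive1 f : (forall x, derivable f x 1) -> smooth1 (derive1 f) ->
  smooth1 f.
Proof. by move=> df sf [|k] x; [exact: df|rewrite derive1Sn; exact: sf]. Qed.

Lemma smooth1_cst (c : R) : smooth1 (fun=> c).
Proof. by apply/smooth1P => k; exact: derivable_upto_cst. Qed.

Lemma smooth1_id : smooth1 (fun x : R => x).
Proof.
apply: smooth1_of_derive1; first by move=> x; exact: derivable_id.
have -> : derive1 (fun x : R => x) = (fun=> 1 : R); last exact: smooth1_cst.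
by apply/funext => x; rewrite derive1E; exact: derive_id.
Qed.

Lemma smooth1D f g : smooth1 f -> smooth1 g -> smooth1 (fun x => f x + g x).
Proof.
by move=> /smooth1P sf /smooth1P sg; apply/smooth1P => k; exact: derivable_uptoD.
Qed.

Lemma smooth1M f g : smooth1 f -> smooth1 g -> smooth1 (fun x => f x * g x).
Proof.
by move=> /smooth1P sf /smooth1P sg; apply/smooth1P => k; exact: derivable_uptoM.
Qed.

Lemma smooth1Z c f : smooth1 f -> smooth1 (fun x => c * f x).
Proof. by move=> sf; apply: smooth1M; [exact: smooth1_cst|exact: sf]. Qed.

Lemma smooth1B f g : smooth1 f -> smooth1 g -> smooth1 (fun x => f x - g x).
Proof.
move=> sf sg; apply: smooth1D; first exact: sf.
by under eq_fun do rewrite -mulN1r; exact: smooth1Z.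
Qed.

Lemma smooth1X f n : smooth1 f -> smooth1 (fun x => f x ^+ n).
Proof.
move=> sf; elim: n => [|n IH].
  by under eq_fun do rewrite expr0; exact: smooth1_cst.
by under eq_fun do rewrite exprS; exact: smooth1M.
Qed.

Lemma smooth1_affine f (b c : R) : smooth1 f -> smooth1 (fun x => f (b * x + c)).
Proof.
move=> /smooth1P sf; apply/smooth1P => k.
elim: k f {sf}(sf k) => [|k IH] f [df sf]; have [d e] := derive1_fun_affine b c df.
  by split.
by split => //; rewrite e; apply: derivable_uptoM; [exact: derivable_upto_cst|exact: IH].
Qed.

Lemma smooth1_expR f : smooth1 f -> smooth1 (fun x => expR (f x)).
Proof.
move=> /smooth1P sf; apply/smooth1P => k.
have := sf k; elim: k => [|k IH] Hf; have [df sf'] := Hf;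
  have [d e] := derive1_fun_expR df; split => //.
rewrite e; apply: derivable_uptoM => //.
by apply: IH; exact: derivable_uptoS.
Qed.

(** [n = 0] is the classical flat function [exp (- 1 / x)]. The powers [x^-n] are included because
    the linear span of the family is closed under differentiation. *)
Definition flat n (x : R) : R := if 0 < x then x ^- n * expR (- x^-1) else 0.

Lemma flat_ge0 n x : 0 <= flat n x.
Proof.
by rewrite /flat; case: ifP => // x0; rewrite mulr_ge0 ?expR_ge0// invr_ge0 exprn_ge0// ltW.
Qed.

Lemma flat_gt0 n x : 0 < x -> 0 < flat n x.
Proof. by move=> x0; rewrite /flat x0 mulr_gt0 ?expR_gt0// invr_gt0 exprn_gt0. Qed.

(* [exp t = (exp (t / m)) ^ m >= (t / m) ^ m] with [t = 1 / x] *)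
Lemma flat_le n x : flat n x <= (n.+1)%:R ^+ n.+1 * `|x|.
Proof.
rewrite /flat; case: ifP => [x0|_]; last by rewrite mulr_ge0.
rewrite gtr0_norm// expRN.
have xu : x != 0 by rewrite gt_eqF.
have e1 : (x^-1 / n.+1%:R) ^+ n.+1 <= expR x^-1.
  have -> : expR x^-1 = expR (x^-1 / n.+1%:R) ^+ n.+1.
    by rewrite -expRM_natr divfK.
  have h0 : 0 <= x^-1 / n.+1%:R by rewrite divr_ge0// invr_ge0 ltW.
  rewrite ler_pXn2r// ?nnegrE ?expR_ge0//.
  by apply: le_trans (expR_ge1Dx _); rewrite lerDr.
rewrite ler_pdivrMr ?expR_gt0//.
apply: (@le_trans _ _ (n.+1%:R ^+ n.+1 * x * (x^-1 / n.+1%:R) ^+ n.+1)); last first.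
  by rewrite ler_wpM2l// mulr_ge0 ?exprn_ge0// ltW.
have N0 : n.+1%:R ^+ n.+1 != 0 :> R by rewrite expf_neq0.
rewrite expr_div_n [leRHS](_ : _ = x * x^-1 ^+ n.+1); last by field.
by rewrite exprS mulrA mulfV// mul1r exprVn.
Qed.

Lemma flat_mul n x : flat n x = x * flat n.+1 x.
Proof.
rewrite /flat; case: ifP => [x0|_]; last by rewrite mulr0.
by rewrite exprS invfM mulrA mulrA mulfV ?mul1r// gt_eqF.
Qed.

Lemma is_derive_of_sqr_bound f (x df C : R) :
  (forall h, `|f (x + h) - f x - h * df| <= C * h ^+ 2) -> is_derive x 1 f df.
Proof.
move=> fC.
have C0 : 0 <= C.
  by have := fC 1; rewrite expr1n mulr1; apply: le_trans.
have cv : (fun h => h^-1 *: ((f \o shift x) (h *: 1) - f x)) @ (0 : R)^' --> df.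
  apply/cvgrPdist_le => e e0; near=> h.
  have h0 : h != 0 by near: h; exact: nbhs_dnbhs_neq.
  have he : `|h| <= e / (C + 1).
    by near: h; apply: dnbhs0_le; rewrite divr_gt0// ltr_wpDl.
  have -> : df - h^-1 *: ((f \o shift x) (h *: 1) - f x) =
      - (h^-1 * (f (x + h) - f x - h * df)).
    rewrite /GRing.scale/= mulr1 (addrC h); field; exact: h0.
  rewrite normrN normrM normfV ler_pdivrMl ?normr_gt0//.
  apply: (le_trans (fC h)); rewrite -[X in _ * X]real_normK ?num_real//.
  rewrite expr2 mulrCA ler_wpM2l//.
  apply: (@le_trans _ _ ((C + 1) * `|h|)); first by rewrite ler_wpM2r// lerDl.
  by rewrite mulrC -ler_pdivlMr// ltr_wpDl.
by apply: DeriveDef; [apply/cvg_ex; exists df|apply/cvg_lim].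
Unshelve. all: by end_near.
Qed.

(** At 0, where the two cases of [flat] meet, [flat n h = h * flat n.+1 h] is bounded by a multiple
    of [h^2] thanks to [flat_le]; elsewhere this is the product rule. *)
Lemma is_derive_flat n (x : R) : is_derive x 1 (flat n)
  (flat n.+2 x - n%:R * flat n.+1 x).
Proof.
have [x0|x0|->] := ltgtP x 0.
- apply: (@near_eq_is_derive _ _ _ (fun=> 0)).
    near=> y; rewrite /flat ltNge (_ : y <= 0)//.
    by apply/ltW; near: y; exact: lt_nbhsl.
  apply: (is_derive_eq (is_derive_cst (0 : R) x 1)).
  by rewrite /flat !(ltNge _ x) ltW//= mulr0 subr0.
- have xu : x != 0 by rewrite gt_eqF.
  apply: (@near_eq_is_derive R _ _ (fun y : R => y^-1 ^+ n * expR (- y^-1) : R)).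
    near=> y; rewrite /flat (_ : 0 < y) ?exprVn//.
    by near: y; exact: lt_nbhsr.
  have dV : is_derive x 1 (fun y : R => y^-1) (- x ^- 2).
    apply: is_derive_eq; first exact: is_deriveV.
    by rewrite /GRing.scale/= mulr1.
  have dN : is_derive x 1 (fun y : R => - y^-1) (x ^- 2).
    by apply: is_derive_eq; rewrite opprK.
  have dE := @is_derive1_comp _ expR (fun y : R => - y^-1) x _ _ (is_derive_expR _) dN.
  have dX := is_deriveX n dV; rewrite exprfctE in dX.
  apply: (is_derive_eq (is_deriveM dX dE)).
  rewrite /flat x0 /GRing.scale/=.
  rewrite -!exprVn; case: n {dX} => [|n] /=; rewrite !exprS ?expr0; ring.
- have f0 m : flat m 0 = 0 by rewrite /flat ltxx.
  rewrite !f0 mulr0 subr0.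
  apply: (@is_derive_of_sqr_bound _ _ _ (n.+2%:R ^+ n.+2)) => h.
  rewrite add0r mulr0 subr0 f0 subr0 flat_mul normrM.
  rewrite -[h ^+ 2]real_normK ?num_real// expr2 mulrCA ler_wpM2l//.
  by rewrite ger0_norm ?flat_ge0// flat_le.
Unshelve. all: by end_near.
Qed.

Lemma derivable_upto_flat k n : derivable_upto k (flat n).
Proof.
elim: k n => [|k IH] n; split => //; try by move=> x; have [] := is_derive_flat n x.
have -> : derive1 (flat n) = (fun x => flat n.+2 x + (- n%:R) * flat n.+1 x).
  apply/funext => x; rewrite derive1E; have [_ ->] := is_derive_flat n x.
  by rewrite mulNr.
apply: derivable_uptoD => //; apply: derivable_uptoM => //.
exact: derivable_upto_cst.
Qed.

Lemma smooth1_flat n : smooth1 (flat n).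
Proof. by apply/smooth1P => k; exact: derivable_upto_flat. Qed.

Definition bumpR (c d x : R) : R := flat 0 (x - c) * flat 0 (d - x).

Lemma bump_ge0 c d x : 0 <= bumpR c d x.
Proof. by rewrite mulr_ge0// flat_ge0. Qed.

Lemma bump_gt0 c d x : c < x -> x < d -> 0 < bumpR c d x.
Proof. by move=> cx xd; rewrite mulr_gt0// flat_gt0// subr_gt0. Qed.

Lemma bump_eq0 c d x : ~~ (c < x < d) -> bumpR c d x = 0.
Proof.
rewrite negb_and /bumpR /flat !subr_gt0 => /orP[/negbTE ->|/negbTE ->].
  by rewrite mul0r.
by rewrite mulr0.
Qed.

Lemma smooth1_bump c d : smooth1 (bumpR c d).
Proof.
have E1 : (fun x => flat 0 (x - c)) = (fun x => flat 0 (1 * x + - c)).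
  by apply/funext => x; rewrite mul1r.
have E2 : (fun x => flat 0 (d - x)) = (fun x => flat 0 (-1 * x + d)).
  by apply/funext => x; rewrite mulN1r addrC.
apply: smooth1M; rewrite ?E1 ?E2; apply: smooth1_affine; exact: smooth1_flat.
Qed.

(** Smooth functions that increase to the indicator of [(c, d)] as [n] grows, made from a single
    bump by exponentiation; they do the work of mollified indicators. *)
Definition plateau (n : nat) (c d x : R) : R := 1 - expR (- n%:R * bumpR c d x).

Lemma smooth1_plateau n c d : smooth1 (plateau n c d).
Proof.
apply: smooth1B; first exact: smooth1_cst.
by apply: smooth1_expR; apply: smooth1Z; exact: smooth1_bump.
Qed.

Lemma plateau_le n c d x : 0 <= plateau n c d x <= (c < x < d)%R%:R.
Proof.
have e1 : expR (- n%:R * bumpR c d x) <= 1.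
  by rewrite -[leRHS]expR0 ler_expR mulNr oppr_le0 mulr_ge0// bump_ge0.
apply/andP; split; first by rewrite subr_ge0.
have [_|] := boolP (c < x < d); first by rewrite lerBlDr lerDl expR_ge0.
by move=> /bump_eq0; rewrite /plateau => ->; rewrite mulr0 expR0 subrr.
Qed.

Lemma cvg_plateau c d x : plateau n c d x @[n --> \oo] --> ((c < x < d)%R%:R : R).
Proof.
have [/andP[cx xd]|cxd] := boolP (c < x < d); last first.
  rewrite (_ : (fun n => _) = fun=> 0); first exact: cvg_cst.
  by apply/funext => n; rewrite /plateau bump_eq0// mulr0 expR0 subrr.
have b0 := bump_gt0 cx xd.
rewrite -[X in _ --> X]subr0; apply: cvgB; first exact: cvg_cst.
rewrite (_ : (fun n => _) = (fun n => expR (- bumpR c d x) ^+ n)).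
  apply: cvg_expr; rewrite ger0_norm ?expR_ge0//.
  by rewrite -[ltRHS]expR0 ltr_expR oppr_lt0.
by apply/funext => n; rewrite -expRM_natr mulrC mulrN mulNr.
Qed.

End smooth_functions.

(** * Integration by parts, the fundamental lemma and the lemma of du Bois-Reymond *)

Section test_functions.
Context {R : realType}.
Local Notation leb := (@lebesgue_measure R).
Implicit Types (f g h : R -> R) (c d l u x : R).

Definition C1 f := (forall x, derivable f x 1) /\ continuous (derive1 f).

Lemma C1_continuous f : C1 f -> continuous f.
Proof.
by move=> [df _] x; apply/differentiable_continuous/derivable1_diffP; exact: df.
Qed.

Lemma smooth1_C1 f : smooth1 f -> C1 f.
Proof.
move=> sf; split; first by move=> x; exact: smooth1_derivable.
exact: smooth1_continuous (smooth1_derive1 sf).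
Qed.

Lemma C1M f g : C1 f -> C1 g -> C1 (fun x => f x * g x) /\
  derive1 (fun x => f x * g x) = (fun x => derive1 f x * g x + f x * derive1 g x).
Proof.
move=> cf cg; have [df cf'] := cf; have [dg cg'] := cg.
have [dfg e] := derive1_funM df dg; split; last exact: e.
split; first exact: dfg.
rewrite e => x; apply: cvgD; apply: cvgM.
- exact: cf'.
- exact: (C1_continuous cg).
- exact: (C1_continuous cf).
- exact: cg'.
Qed.

Lemma derive1_eq0_outside f c d x : (forall y, ~~ (c <= y <= d) -> f y = 0) ->
  ~~ (c <= x <= d) -> derive1 f x = 0.
Proof.
move=> f0 xcd.
have near0 : \near x, (fun=> 0) x = f x.
  move: xcd; rewrite negb_and -!ltNge => /orP[xc|dx].
    near=> y; rewrite f0// negb_and -!ltNge (_ : y < c)//.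
    by near: y; exact: lt_nbhsl.
  near=> y; rewrite f0// negb_and -!ltNge (_ : d < y) ?orbT//.
  by near: y; exact: lt_nbhsr.
rewrite derive1E -(near_eq_derive _ near0).
exact: derive_cst.
Unshelve. all: by end_near.
Qed.

Lemma eq_mul_indicator f c d : (forall y, ~~ (c <= y <= d) -> f y = 0) ->
  f = (fun x => f x * (c <= x <= d)%R%:R).
Proof.
move=> f0; apply/funext => x; case: (boolP (c <= x <= d)) => [_|/f0 ->].
  by rewrite mulr1.
by rewrite mul0r.
Qed.

Lemma L1_continuous_support f c d : continuous f ->
  (forall y, ~~ (c <= y <= d) -> f y = 0) -> L1 leb f.
Proof.
by move=> cf /eq_mul_indicator ->; exact: L1_continuous_segment.
Qed.

Lemma continuous_bounded_support f c d : continuous f ->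
  (forall y, ~~ (c <= y <= d) -> f y = 0) -> exists2 M, 0 <= M & forall x, `|f x| <= M.
Proof.
move=> cf f0.
have [cd|cd] := leP c d; last first.
  exists 0 => // x; rewrite f0 ?normr0// negb_and -!ltNge.
  by apply/orP; have [|] := leP c x; [right; exact: lt_le_trans cd _|left].
have cn0 : `[c, d]%classic !=set0 by exists c; rewrite /= in_itv/= lexx.
have [m md Hm] := @compact_EVT_max _ R (fun x => `|f x|) `[c, d]%classic
   cn0 (@segment_compact _ c d)
   (continuous_subspaceT (fun x => cvg_norm (cf x))).
exists `|f m| => // x; have [xcd|/f0 ->] := boolP (c <= x <= d); last by rewrite normr0.
by apply: Hm; rewrite inE /= in_itv.
Qed.

Lemma Prim_C1_support f c d : C1 f -> c <= d ->
  (forall y, ~~ (c <= y <= d) -> f y = 0) ->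
  [/\ L1 leb (derive1 f), forall x, Prim (derive1 f) x = f x & \int[leb]_x derive1 f x = 0].
Proof.
move=> [df cf'] cd f0.
have f'0 y : ~~ (c <= y <= d) -> derive1 f y = 0 by exact: derive1_eq0_outside.
have L := L1_continuous_support cf' f'0.
(* The interval is enlarged by 1 on both sides, so that [f] vanishes at the new end points, which
   the hypothesis does not say of [c] and [d]. *)
have out y : ~~ (c - 1 <= y <= d + 1) -> derive1 f y = 0.
  move=> H; apply: f'0; apply: contra H => /andP[H1 H2].
  by apply/andP; split; lra.
have out' y : ~~ (c - 1 <= y <= d + 1) -> f y = 0.
  move=> H; apply: f0; apply: contra H => /andP[H1 H2].
  by apply/andP; split; lra.
have E := eq_mul_indicator out.
have fc : f (c - 1) = 0 by apply: f0; rewrite negb_and -ltNge; apply/orP; left; lra.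
have fd : f (d + 1) = 0 by apply: f0; rewrite negb_and -!ltNge; apply/orP; right; lra.
have P1 x : c - 1 <= x -> x <= d + 1 -> Prim (derive1 f) x = f x.
  move=> x1 x2; rewrite (congr1 (Prim ^~ x) E).
  by rewrite (Prim_of_deriv df cf' x1 x2) fc subr0.
have PT : \int[leb]_x derive1 f x = Prim (derive1 f) (d + 1).
  apply: eq_Int => t; have [t1|t1] := leP t (d + 1); first by rewrite mulr1.
  by rewrite mulr0; apply: out; rewrite negb_and -!ltNge t1 orbT.
have dd : c - 1 <= d + 1 by lra.
split => //; last by rewrite PT P1.
move=> x; have [x1|x1] := leP (c - 1) x; last first.
  rewrite out' ?negb_and -?ltNge ?x1// -[RHS](@Int0 _ _ _ leb); apply: eq_Int => t.
  have [t1|t1] := leP t x; last by rewrite mulr0.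
  by rewrite mulr1 out// negb_and -ltNge (le_lt_trans t1).
have [x2|x2] := leP x (d + 1); first exact: P1.
rewrite out' ?negb_and -?ltNge ?x2 ?orbT// -fd -(P1 (d + 1))// /Prim; apply: eq_Int => t.
have [t1|t1] := leP t (d + 1); first by rewrite (le_trans t1)// ltW.
by rewrite mulr0 out ?mul0r// negb_and -!ltNge t1 orbT.
Qed.

Lemma parts_C1_support g f c d : L1 leb g -> C1 f -> c <= d ->
  (forall y, ~~ (c <= y <= d) -> f y = 0) ->
  \int[leb]_x (Prim g x * derive1 f x) = - \int[leb]_x (g x * f x).
Proof.
move=> Ig Cf cd f0; have [L P0 T0] := Prim_C1_support Cf cd f0.
have [_ _ _] := Prim_fubini Ig L.
rewrite T0 mulr0 => /eqP; rewrite addr_eq0 => /eqP ->; congr (- _).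
by apply: eq_Int => x; rewrite P0.
Qed.

Lemma test1_support l u f : l < u -> test1 `]l, u[ f ->
  exists c d, [/\ l < c, c <= d, d < u & forall x, ~~ (c <= x <= d) -> f x = 0].
Proof.
move=> lu [sf [C [cC CI f0]]].
have [C0|/set0P Cn0] := eqVneq C set0.
  exists ((l + u) / 2), ((l + u) / 2); split; try lra.
  by move=> x _; apply: f0; rewrite C0.
have cid : {within C, continuous (fun x : R => x)}.
  by apply: continuous_subspaceT => x; exact: cvg_id.
have [c cC' Hc] := compact_EVT_min Cn0 cC cid.
have [d dC' Hd] := compact_EVT_max Cn0 cC cid.
rewrite inE in cC'; rewrite inE in dC'.
have := CI _ cC'; rewrite /= in_itv/= => /andP[lc cu].
have := CI _ dC'; rewrite /= in_itv/= => /andP[ld du].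
exists c, d; split => //; first by apply: Hc; rewrite inE.
move=> x xcd; apply: f0 => Cx; move/negP: xcd; apply.
by rewrite Hc ?Hd// inE.
Qed.

Lemma test1_of_support l u f c d : l < c -> d < u -> smooth1 f ->
  (forall x, ~~ (c <= x <= d) -> f x = 0) -> test1 `]l, u[ f.
Proof.
move=> lc du sf f0; split => //; exists `[c, d]%classic; split.
- exact: segment_compact.
- move=> x /=; rewrite !in_itv/= => /andP[cx xd].
  by rewrite (lt_le_trans lc)//= (le_lt_trans xd).
- move=> x /= H; apply: f0; apply/negP; move: H; by rewrite in_itv.
Qed.

Lemma test1_plateau n l u c d : l < c -> d < u -> test1 `]l, u[ (plateau n c d).
Proof.
move=> lc du; apply: (test1_of_support lc du); first exact: smooth1_plateau.
move=> x xcd; rewrite /plateau bump_eq0 ?mulr0 ?expR0 ?subrr//.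
by apply: contra xcd => /andP[/ltW -> /ltW ->].
Qed.

(** In the limit the plateaus test [f] against indicators of intervals. All primitives of the cut
    function then vanish, differentiation gives [f = 0] almost everywhere on [(c, d)], and countably
    many such intervals exhaust [(l, u)]. *)
Lemma fundamental_lemma l u f : measurable_fun setT f ->
  (forall c d, l < c -> d < u -> L1 leb (fun x => f x * (c <= x <= d)%R%:R)) ->
  (forall h, test1 `]l, u[ h -> \int[leb]_x (f x * h x) = 0) ->
  {ae leb, forall x, l < x < u -> f x = 0}.
Proof.
move=> mf If If0.
have mlt c d : measurable_fun setT (fun x : R => (c < x < d)%R%:R : R).
  rewrite (_ : (fun x => _) = fun x => (c < x)%R%:R * (x < d)%R%:R).
    by apply: measurable_funM; exact: measurable_lt_nat.
  by apply/funext => x; case: (c < x); case: (x < d); rewrite ?mulr1 ?mul1r ?mulr0.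
have le1 c d x : (c < x < d)%R%:R <= (c <= x <= d)%R%:R :> R.
  have [/andP[/ltW -> /ltW ->]//|_] := boolP (c < x < d).
  by case: (c <= x <= d).
have step1 c d : l < c -> d < u -> \int[leb]_x (f x * (c < x < d)%R%:R) = 0.
  move=> lc du.
  have : \int[leb]_x (f x * plateau n c d x) @[n --> \oo] -->
      \int[leb]_x (f x * (c < x < d)%R%:R).
    apply: (Int_cvg _ _ (L1_norm (If _ _ lc du))).
    - move=> n; apply: measurable_funM => //; apply: continuous_measurable_fun.
      by apply: smooth1_continuous; exact: smooth1_plateau.
    - by apply: measurable_funM => //; exact: mlt.
    - apply: nearW => x; apply: cvgM; [exact: cvg_cst|exact: cvg_plateau].
    - move=> n x; rewrite !normrM ler_wpM2l//.
      have /andP[p0 p1] := plateau_le n c d x.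
      by rewrite !ger0_norm//; exact: le_trans p1 (le1 _ _ _).
  have -> : (fun n => \int[leb]_x (f x * plateau n c d x)) = fun=> 0.
    by apply/funext => n; apply: If0; exact: test1_plateau.
  move=> h; have h0 : (fun _ : nat => 0 : R) @ \oo --> (0 : R) by exact: cvg_cst.
  exact: (cvg_unique (@Rhausdorff R) h h0).
have step2 c d : l < c -> d < u -> {ae leb, forall x, f x * (c < x < d)%R%:R = 0}.
  move=> lc du.
  have IL : L1 leb (fun x => f x * (c < x < d)%R%:R).
    apply: (L1_le _ (L1_norm (If _ _ lc du))); first by apply: measurable_funM => //; exact: mlt.
    by move=> x; rewrite !normrM ler_wpM2l// !ger0_norm.
  apply: (ae_eq0_of_Prim IL) => x.
  (* Up to the point [x], the primitive at [x] of the cut function is the integral over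
     [(c, min x d)], again an instance of [step1]. *)
  rewrite -(step1 c (Order.min x d))//; last by rewrite gt_min du orbT.
  apply: Int_ae.
  - apply: measurable_funM; last exact: measurable_le_nat.
    by apply: measurable_funM => //; exact: mlt.
  - by apply: measurable_funM => //; exact: mlt.
  - exists [set x]; split => //; first exact: lebesgue_measure_set1.
    move=> y /= H; apply: contrapT => /eqP yx; apply: H.
    rewrite lt_min -mulrA; congr (_ * _).
    move: yx; case: (ltgtP y x) => //= _ _; rewrite ?mulr1 ?mulr0 ?andbF//.
have : {ae leb, forall x, forall n : nat,
    f x * (l + n.+1%:R^-1 < x < u - n.+1%:R^-1)%R%:R = 0}.
  apply: ae_all => n; apply: step2; first by rewrite ltrDl invr_gt0.
  by rewrite ltrBlDr ltrDl invr_gt0.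
move=> H; apply: (ae_imp H) => x Hx /andP[lx xu].
have [n1 Hn1] := ltr_add_invr lx.
have [n2 Hn2] := ltr_add_invr xu.
have := Hx (maxn n1 n2).
have inv k m : (k <= m)%N -> m.+1%:R^-1 <= k.+1%:R^-1 :> R.
  by move=> km; rewrite lef_pV2 ?posrE// ler_nat.
have := inv _ _ (leq_maxl n1 n2); have := inv _ _ (leq_maxr n1 n2) => i2 i1.
rewrite (_ : (_ < x < _) = true) ?mulr1//; apply/andP; split.
  by apply: le_lt_trans Hn1; rewrite lerD2l.
by rewrite ltrBrDr; apply: le_lt_trans Hn2; rewrite lerD2l.
Qed.

(** [f - Prim g] annihilates derivatives of test functions, that is, test functions of integral 0.
    Subtracting a multiple of a fixed bump [b0] reduces any [b] to that case, and [C] is the average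
    of [f - Prim g] against [b0]. *)
Lemma du_Bois_Reymond l u f g : l < u -> L1 leb f -> L1 leb g ->
  (forall h, test1 `]l, u[ h ->
     \int[leb]_x (f x * derive1 h x) = - \int[leb]_x (g x * h x)) ->
  exists C, {ae leb, forall x, l < x < u -> f x = C + Prim g x}.
Proof.
move=> lu If Ig fg.
have mf := L1_measurable If.
pose c0 := (3 * l + u) / 4; pose d0 := (l + 3 * u) / 4.
have lc0 : l < c0 by rewrite /c0; lra.
have cd0 : c0 < d0 by rewrite /c0 /d0; lra.
have du0 : d0 < u by rewrite /d0; lra.
pose b0 := bumpR c0 d0.
have sb0 : smooth1 b0 by exact: smooth1_bump.
have b00 x : ~~ (c0 <= x <= d0) -> b0 x = 0.
  move=> H; apply: bump_eq0; apply: contra H => /andP[/ltW -> /ltW ->] //.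
have Lb0 : L1 leb b0 := L1_continuous_support (smooth1_continuous sb0) b00.
have k0 : \int[leb]_x b0 x != 0.
  apply/negP => /eqP k0; have := Int_eq0_ae Lb0 (bump_ge0 _ _) k0.
  move=> [A [mA A0 sA]].
  have : (leb `]c0, d0[%classic <= leb A)%E.
    apply: le_measure; rewrite ?inE//.
    move=> x /=; rewrite in_itv/= => /andP[cx xd]; apply: sA => /= b0x.
    by have := bump_gt0 cx xd; rewrite -/(b0 x) b0x ltxx.
  by rewrite A0 lebesgue_measure_itv/= lte_fin cd0 -EFinD lee_fin; lra.
pose k0v := \int[leb]_x b0 x.
have [mPg _ _ _] := Prim_fubini Ig Ig.
have bPg x : `|Prim g x| <= \int[leb]_t `|g t| by exact: Prim_le.
pose D x := f x - Prim g x.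
have mD : measurable_fun setT D by exact: measurable_funB.
have LD h c d : continuous h -> (forall y, ~~ (c <= y <= d) -> h y = 0) ->
    [/\ L1 leb (fun x => f x * h x), L1 leb (fun x => Prim g x * h x) &
     L1 leb (fun x => D x * h x)].
  move=> ch h0; have [M M0 hM] := continuous_bounded_support ch h0.
  have Lf : L1 leb (fun x => f x * h x).
    apply: (leb_mulr_bounded _ _ hM) => //.
    exact: continuous_measurable_fun.
  have LP : L1 leb (fun x => Prim g x * h x).
    by apply: (leb_mull_bounded _ _ bPg) => //; exact: (L1_continuous_support ch h0).
  split => //; under eq_fun do rewrite mulrBl; exact: L1B.
pose C := (\int[leb]_x (D x * b0 x)) / k0v.
exists C.
have key : {ae leb, forall x, l < x < u -> D x - C = 0}.
  apply: fundamental_lemma.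
  - exact: measurable_funB.
  - move=> c d lc du.
    have L1i : L1 leb (fun x : R => 1 * (c <= x <= d)%R%:R).
      by apply: (@L1_continuous_segment _ (fun=> 1)) => x; exact: cvg_cst.
    have mi : measurable_fun setT (fun x : R => (c <= x <= d)%R%:R : R).
      by have := L1_measurable L1i; under eq_fun do rewrite mul1r.
    rewrite (_ : (fun x => _) = (fun x => f x * (c <= x <= d)%R%:R -
        (Prim g x + C) * (1 * (c <= x <= d)%R%:R))); last first.
      by apply/funext => x; rewrite /D; ring.
    apply: L1B; first exact: L1_mul_bool.
    apply: (leb_mull_bounded _ L1i (M := \int[leb]_t `|g t| + `|C|)).
      exact: measurable_funD.
    by move=> x; rewrite (le_trans (ler_normD _ _))// lerD2r.
  - move=> b tb.
    have [cb [db [lcb cdb dbu b_0]]] := test1_support lu tb.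
    have [sb _] := tb.
    have Lb := L1_continuous_support (smooth1_continuous sb) b_0.
    pose kb := \int[leb]_x b x.
    (* [h] has integral 0, so its primitive vanishes on both sides of the support and is itself a
       test function. *)
    pose h x := b x - kb / k0v * b0 x.
    pose c1 := Order.min c0 cb; pose d1 := Order.max d0 db.
    have cd1 : c1 <= d1 by rewrite /c1 /d1 ge_min le_max (ltW cd0).
    have lc1 : l < c1 by rewrite /c1 lt_min lc0 lcb.
    have du1 : d1 < u by rewrite /d1 gt_max du0 dbu.
    have h0 x : ~~ (c1 <= x <= d1) -> h x = 0.
      move=> H; rewrite /h b_0 ?b00 ?mulr0 ?subr0//; apply: contra H;
        by rewrite /c1 /d1 ge_min le_max => /andP[-> ->]; rewrite ?orbT.
    have sh : smooth1 h by apply: (smooth1B sb); apply: smooth1Z.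
    have ch := smooth1_continuous sh.
    have Lh := L1_continuous_support ch h0.
    have Ih : \int[leb]_x h x = 0.
      rewrite IntB//; last exact: L1Zl.
      by rewrite IntZl// -/k0v divfK// subrr.
    have dH x : derivable (Prim h) x 1 /\ derive1 (Prim h) x = h x.
      by apply: Prim_deriv => //; exact: ch.
    have H' : derive1 (Prim h) = h by apply/funext => x; have [] := dH x.
    have tH : test1 `]l, u[ (Prim h).
      apply: (test1_of_support lc1 du1).
        by apply: smooth1_of_derive1; [move=> x; have [] := dH x|rewrite H'].
      move=> x; rewrite negb_and -!ltNge => /orP[xc|dx].
        rewrite /Prim -[RHS](@Int0 _ _ _ leb); apply: eq_Int => t.
        have [tx|] := leP t x; last by rewrite mulr0.
        by rewrite mulr1 h0// negb_and -ltNge (le_lt_trans tx).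
      rewrite /Prim -[RHS]Ih; apply: eq_Int => t.
      have [|tx] := leP t x; first by rewrite mulr1.
      by rewrite mulr0 h0// negb_and -!ltNge (lt_trans dx) ?orbT.
    have := fg _ tH; rewrite H' => E1.
    have [_ _ _] := Prim_fubini Ig Lh; rewrite Ih mulr0 => E2.
    have [Lfh LPh _] := LD h c1 d1 ch h0.
    have E3 : \int[leb]_x (D x * h x) = 0.
      rewrite (_ : \int[leb]_x (D x * h x) = \int[leb]_x (f x * h x) - \int[leb]_x (Prim g x * h x)).
        by rewrite E1; lra.
      by rewrite -IntB//; apply: eq_Int => x; rewrite mulrBl.
    have [_ _ LDb] := LD b cb db (smooth1_continuous sb) b_0.
    have [_ _ LDb0] := LD b0 c0 d0 (smooth1_continuous sb0) b00.
    have E4 : \int[leb]_x (D x * b x) = kb * C.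
      have : \int[leb]_x (D x * h x) = \int[leb]_x (D x * b x) - kb * C.
        have -> : kb * C = (\int[leb]_x (D x * b0 x)) * (kb / k0v) by rewrite /C; ring.
        rewrite -IntZr// -IntB//; last exact: L1Zr.
        by apply: eq_Int => x; rewrite /h; ring.
      by rewrite E3 => /esym/eqP; rewrite subr_eq0 => /eqP.
    transitivity (\int[leb]_x (D x * b x) - C * kb); last by rewrite E4; ring.
    rewrite -IntZl// -IntB//; last exact: L1Zl.
    by apply: eq_Int => x; ring.
apply: (ae_imp key) => x Hx /Hx /eqP; rewrite subr_eq0 /D => /eqP <-; ring.
Qed.

End test_functions.

(** * Test functions of two variables, their slices and their supports *)

Section plane_test_functions.
Context {R : realType}.
Implicit Types (u v ph : R * R -> R) (f g : R -> R) (rad a : R).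

Lemma shift_er (h : R) r z : h *: er + (r, z) = (h *: 1 + r, z).
Proof.
apply: injective_projections => //.
by rewrite (_ : _.2 = h * 0 + z)// mulr0 add0r.
Qed.

Lemma shift_ez (h : R) r z : h *: ez + (r, z) = (r, h *: 1 + z).
Proof.
apply: injective_projections => //.
by rewrite (_ : _.1 = h * 0 + r)// mulr0 add0r.
Qed.

Lemma derivable_er u r z :
  derivable u (r, z) er <-> derivable (fun x => u (x, z)) r 1.
Proof.
rewrite /derivable; set F := (X in cvg (X @ _) <-> _).
set G := (X in _ <-> cvg (X @ _)); suff -> : F = G by [].
by apply/funext => h; rewrite /F /G /= shift_er [_ *: 1]mulr1.
Qed.

Lemma derivable_ez u r z :
  derivable u (r, z) ez <-> derivable (fun y => u (r, y)) z 1.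
Proof.
rewrite /derivable; set F := (X in cvg (X @ _) <-> _).
set G := (X in _ <-> cvg (X @ _)); suff -> : F = G by [].
by apply/funext => h; rewrite /F /G /= shift_ez [_ *: 1]mulr1.
Qed.

Lemma D_erE u r z : 'D_er u (r, z) = derive1 (fun x => u (x, z)) r.
Proof.
rewrite /derive1 /derive; set F := (X in lim (X @ _) = _).
set G := (X in _ = lim (X @ _)); suff -> : F = G by [].
by apply/funext => h; rewrite /F /G /= shift_er [_ *: 1]mulr1.
Qed.

Lemma D_ezE u r z : 'D_ez u (r, z) = derive1 (fun y => u (r, y)) z.
Proof.
rewrite /derive1 /derive; set F := (X in lim (X @ _) = _).
set G := (X in _ = lim (X @ _)); suff -> : F = G by [].
by apply/funext => h; rewrite /F /G /= shift_ez [_ *: 1]mulr1.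
Qed.

Lemma derive1_Zl (c : R) f x : derivable f x 1 ->
  derivable (fun y => c * f y) x 1 /\ derive1 (fun y => c * f y) x = c * derive1 f x.
Proof.
move=> df; rewrite !derive1E; split; first exact: (@derivableZ _ _ _ f c).
exact: (@deriveZ _ _ _ f c).
Qed.

Lemma derive1_Zr (c : R) f x : derivable f x 1 ->
  derivable (fun y => f y * c) x 1 /\ derive1 (fun y => f y * c) x = derive1 f x * c.
Proof. by move=> df; under eq_fun do rewrite mulrC; rewrite mulrC; exact: derive1_Zl. Qed.

Lemma D_er_tensor f g p : derivable f p.1 1 ->
  derivable (fun p => f p.1 * g p.2) p er /\
  'D_er (fun p => f p.1 * g p.2) p = derive1 f p.1 * g p.2.
Proof.
case: p => r z /= df; have [d e] := derive1_Zr (g z) df.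
by split; [exact/derivable_er|rewrite D_erE].
Qed.

Lemma D_ez_tensor f g p : derivable g p.2 1 ->
  derivable (fun p => f p.1 * g p.2) p ez /\
  'D_ez (fun p => f p.1 * g p.2) p = f p.1 * derive1 g p.2.
Proof.
case: p => r z /= df; have [d e] := derive1_Zl (f r) df.
by split; [exact/derivable_ez|rewrite D_ezE].
Qed.

Lemma continuous_tensor f g : continuous f -> continuous g ->
  continuous (fun p : R * R => f p.1 * g p.2).
Proof.
move=> cf cg p; apply: cvgM.
- by apply: (@cvg_comp _ _ _ fst f _ (nbhs p.1)); [exact: cvg_fst|exact: cf].
- by apply: (@cvg_comp _ _ _ snd g _ (nbhs p.2)); [exact: cvg_snd|exact: cg].
Qed.

Lemma smooth2_tensor f g : smooth1 f -> smooth1 g ->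
  smooth2 (fun p => f p.1 * g p.2).
Proof.
move=> sf sg k; elim: k f g sf sg => [|k IH] f g sf sg /=;
  have cfg := continuous_tensor (smooth1_continuous sf) (smooth1_continuous sg).
  by split; [exact: cfg|].
split; first exact: cfg.
have df r := smooth1_derivable (x := r) sf.
have dg r := smooth1_derivable (x := r) sg.
split.
- by move=> p; have [] := D_er_tensor g (df p.1).
- by move=> p; have [] := D_ez_tensor f (dg p.2).
- rewrite (_ : (fun p => _) = (fun p => derive1 f p.1 * g p.2)).
    exact: (IH _ _ (smooth1_derive1 sf) sg).
  by apply/funext => p; have [_ ->] := D_er_tensor g (df p.1).
- rewrite (_ : (fun p => _) = (fun p => f p.1 * derive1 g p.2)).
    exact: (IH _ _ sf (smooth1_derive1 sg)).
  by apply/funext => p; have [_ ->] := D_ez_tensor f (dg p.2).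
Qed.

Lemma test2_tensor (I J : set R) f g : test1 I f -> test1 J g ->
  test2 (I `*` J) (fun p => f p.1 * g p.2).
Proof.
move=> [sf [C [cC CI f0]]] [sg [E [cE EJ g0]]].
split; first exact: smooth2_tensor.
exists (C `*` E); split; first exact: compact_setX.
- by move=> p [/= /CI ? /EJ].
- move=> p /= H; have [Cp|/f0 ->] := pselect (C p.1); last by rewrite mul0r.
  have [Ep|/g0 ->] := pselect (E p.2); last by rewrite mulr0.
  by exfalso; apply: H.
Qed.

Lemma smooth2_continuous u : smooth2 u -> continuous u.
Proof. by move=> /(_ 0%N)[]. Qed.

Lemma smooth2_D_er u : smooth2 u -> smooth2 (fun p => 'D_er u p).
Proof. by move=> su k; case: (su k.+1) => _ [_ _ H _]; exact: H. Qed.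

Lemma smooth2_D_ez u : smooth2 u -> smooth2 (fun p => 'D_ez u p).
Proof. by move=> su k; case: (su k.+1) => _ [_ _ _ H]; exact: H. Qed.

Lemma continuous_slice1 u z : continuous u -> continuous (fun r => u (r, z)).
Proof.
move=> cu r; apply: (@continuous2_cvg R R R R (nbhs r) _ id (fun=> z) (fun x y => u (x, y))).
- rewrite (_ : (fun p : R * R => u (p.1, p.2)) = u); first exact: cu.
  by apply/funext => -[].
- exact: cvg_id.
- exact: cvg_cst.
Qed.

Lemma continuous_slice2 u r : continuous u -> continuous (fun z => u (r, z)).
Proof.
move=> cu z; apply: (@continuous2_cvg R R R R (nbhs z) _ (fun=> r) id (fun x y => u (x, y))).
- rewrite (_ : (fun p : R * R => u (p.1, p.2)) = u); first exact: cu.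
  by apply/funext => -[].
- exact: cvg_cst.
- exact: cvg_id.
Qed.

Lemma smooth2_C1_slice1 u z : smooth2 u -> C1 (fun r => u (r, z)).
Proof.
move=> su; split.
  by move=> r; apply/derivable_er; have [_ []] := su 1%N.
rewrite (_ : derive1 _ = fun r => 'D_er u (r, z)).
  by apply: (@continuous_slice1 (fun p => 'D_er u p)); exact: smooth2_continuous (smooth2_D_er su).
by apply/funext => r; rewrite D_erE.
Qed.

Lemma smooth2_C1_slice2 u r : smooth2 u -> C1 (fun z => u (r, z)).
Proof.
move=> su; split.
  by move=> z; apply/derivable_ez; have [_ []] := su 1%N.
rewrite (_ : derive1 _ = fun z => 'D_ez u (r, z)).
  by apply: (@continuous_slice2 (fun p => 'D_ez u p)); exact: smooth2_continuous (smooth2_D_ez su).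
by apply/funext => z; rewrite D_ezE.
Qed.

Lemma near_eq0_compl (C : set (R * R)) u p : compact C ->
  (forall q, ~ C q -> u q = 0) -> ~ C p -> \near p, (fun=> 0) p = u p.
Proof.
move=> cC u0 nCp.
have : nbhs p (~` C).
  apply: open_nbhs_nbhs; split => //; apply: closed_openC.
  by apply: compact_closed => //; exact: norm_hausdorff.
by apply: filterS => q /u0 ->.
Qed.

Lemma test2_D_er (U : set (R * R)) ph : test2 U ph -> test2 U (fun p => 'D_er ph p).
Proof.
move=> [sp [C [cC CU p0]]]; split; first exact: smooth2_D_er.
exists C; split => // p nCp; rewrite -(near_eq_derive _ (near_eq0_compl cC p0 nCp)).
exact: derive_cst.
Qed.

Lemma test2_D_ez (U : set (R * R)) ph : test2 U ph -> test2 U (fun p => 'D_ez ph p).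
Proof.
move=> [sp [C [cC CU p0]]]; split; first exact: smooth2_D_ez.
exists C; split => // p nCp; rewrite -(near_eq_derive _ (near_eq0_compl cC p0 nCp)).
exact: derive_cst.
Qed.

Lemma compact_box (l1 u1 l2 u2 : R) (C : set (R * R)) : l1 < u1 -> l2 < u2 ->
  compact C -> C `<=` `]l1, u1[ `*` `]l2, u2[ ->
  exists c d c' d', [/\ l1 < c <= d, d < u1, l2 < c' <= d', d' < u2 &
    forall p, C p -> (c <= p.1 <= d) /\ (c' <= p.2 <= d')].
Proof.
move=> lu1 lu2 cC CI.
have [C0|/set0P Cn0] := eqVneq C set0.
  exists ((l1 + u1) / 2), ((l1 + u1) / 2), ((l2 + u2) / 2), ((l2 + u2) / 2).
  by rewrite C0; split => //; try (apply/andP; split); lra.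
have c1 : {within C, continuous (fun p : R * R => p.1)}.
  by apply: continuous_subspaceT => x; exact: cvg_fst.
have c2 : {within C, continuous (fun p : R * R => p.2)}.
  by apply: continuous_subspaceT => x; exact: cvg_snd.
have [c cC' Hc] := compact_EVT_min Cn0 cC c1.
have [d dC' Hd] := compact_EVT_max Cn0 cC c1.
have [c' cC2 Hc2] := compact_EVT_min Cn0 cC c2.
have [d' dC2 Hd2] := compact_EVT_max Cn0 cC c2.
exists c.1, d.1, c'.2, d'.2.
have inC p : p \in C -> (l1 < p.1 < u1) /\ (l2 < p.2 < u2).
  by rewrite inE => /CI[/=]; rewrite !in_itv.
have [/andP[h1 h1'] _] := inC _ cC'; have [/andP[h2 h2'] _] := inC _ dC'.
have [_ /andP[h3 h3']] := inC _ cC2; have [_ /andP[h4 h4']] := inC _ dC2.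
split => //; rewrite ?h1 ?h3 ?Hc ?Hc2//.
by move=> p Cp; rewrite Hc ?Hd ?Hc2 ?Hd2// inE.
Qed.

Lemma test2_box rad a ph : 0 < rad -> 0 < a -> test2 (Omega rad a) ph ->
  exists c d c' d', [/\ 0 < c <= d, d < rad, - a < c' <= d', d' < a &
    forall p, ~~ ((c <= p.1 <= d) && (c' <= p.2 <= d')) -> ph p = 0].
Proof.
move=> rad0 a0 [sp [C [cC CU p0]]].
have aa : - a < a by lra.
have [c [d [c' [d' [h1 h2 h3 h4 h5]]]]] := compact_box rad0 aa cC CU.
exists c, d, c', d'; split => // p H; apply: p0 => /h5[e1 e2].
by move: H; rewrite e1 e2.
Qed.

Lemma test2_bounded (U : set (R * R)) ph : test2 U ph ->
  exists2 M, 0 <= M & forall p, `|ph p| <= M.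
Proof.
move=> [sp [C [cC CU p0]]].
have [C0|/set0P Cn0] := eqVneq C set0.
  by exists 0 => // p; rewrite p0 ?normr0// C0.
have c1 : {within C, continuous (fun p : R * R => `|ph p|)}.
  by apply: continuous_subspaceT => x; apply: cvg_norm; exact: smooth2_continuous.
have [m mC Hm] := compact_EVT_max Cn0 cC c1.
exists `|ph m| => // p; have [Cp|/p0 ->] := pselect (C p); last by rewrite normr0.
by apply: Hm; rewrite inE.
Qed.

Lemma test2_measurable (U : set (R * R)) ph : test2 U ph -> measurable_fun setT ph.
Proof. by move=> [sp _]; apply: continuous_measurable_plane; exact: smooth2_continuous. Qed.

(* The weight [r] is bounded below on the support of a test function. *)
Lemma test2_le_weight rad a ph : 0 < rad -> 0 < a -> test2 (Omega rad a) ph ->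
  exists2 M, 0 <= M & forall p, `|ph p| <= M * Order.max p.1 0.
Proof.
move=> rad0 a0 tp; have [M M0 HM] := test2_bounded tp.
have [c [d [c' [d' [/andP[c0 cd] _ _ _ p0]]]]] := test2_box rad0 a0 tp.
exists (M / c); first by rewrite divr_ge0// ltW.
move=> p; have [/andP[/andP[cp _] _]|/p0 ->] :=
    boolP ((c <= p.1 <= d) && (c' <= p.2 <= d')); last first.
  by rewrite normr0 !mulr_ge0 ?invr_ge0 ?(ltW c0)// le_max lexx orbT.
rewrite max_l ?(le_trans (ltW c0))// mulrAC ler_pdivlMr//.
by rewrite ler_pM// ltW.
Qed.

End plane_test_functions.

Lemma ae_neq {R : realType} (c : R) : {ae @lebesgue_measure R, forall x, x != c}.
Proof.
exists [set c]; split => //; first exact: lebesgue_measure_set1.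
by move=> x /= /negP; rewrite negbK => /eqP.
Qed.

(** * Trigonometric series *)

Section sines.
Context {R : realType}.
Local Notation leb := (@lebesgue_measure R).
Context (a : R) (a0 : 0 < a).
Implicit Types (f g : R -> R) (k n : nat) (z : R).

Definition itvJ z : R := (- a < z < a)%R%:R.

Lemma itvJ_in z : - a < z < a -> itvJ z = 1.
Proof. by rewrite /itvJ => ->. Qed.

Lemma itvJ_out z : ~~ (- a < z < a) -> itvJ z = 0.
Proof. by rewrite /itvJ => /negbTE ->. Qed.

Lemma itvJ_idem z : itvJ z * itvJ z = itvJ z.
Proof. by rewrite /itvJ; case: (_ < _ < _); rewrite ?mulr1 ?mulr0. Qed.

Lemma measurable_itvJ : measurable_fun setT itvJ.
Proof.
rewrite (_ : itvJ = fun z => (- a < z)%R%:R * (z < a)%R%:R).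
  by apply: measurable_funM; exact: measurable_lt_nat.
by apply/funext => z; rewrite /itvJ; case: (- a < z); case: (z < a); rewrite ?mulr1 ?mulr0.
Qed.

Lemma ae_itvJ_seg f : measurable_fun setT f ->
  {ae leb, forall z, f z * (- a <= z <= a)%R%:R = f z * itvJ z}.
Proof.
move=> mf; apply: (ae_imp2 (ae_neq (- a)) (ae_neq a)) => z z1 z2.
congr (_ * _); rewrite /itvJ; move: z1 z2.
by case: (ltgtP z (- a)) => //=; case: (ltgtP z a).
Qed.

Lemma L1_itvJ f : continuous f -> L1 leb (fun z => f z * itvJ z).
Proof.
move=> cf; apply: (L1_ae _ (L1_continuous_segment (- a) a cf)).
  by apply: measurable_funM; [exact: continuous_measurable_fun|exact: measurable_itvJ].
by apply: ae_itvJ_seg; exact: continuous_measurable_fun.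
Qed.

Lemma Prim_deriv_itvJ f x : C1 f -> - a <= x <= a ->
  Prim (fun z => derive1 f z * itvJ z) x = f x - f (- a).
Proof.
move=> [df cf'] /andP[ax xa]; rewrite -(Prim_of_deriv df cf' ax xa).
have mf' := continuous_measurable_fun cf'.
apply: Int_ae.
- apply: measurable_funM; last exact: measurable_le_nat.
  by apply: measurable_funM => //; exact: measurable_itvJ.
- apply: measurable_funM; last exact: measurable_le_nat.
  exact: L1_measurable (L1_continuous_segment _ _ cf').
- by apply: (ae_imp (ae_itvJ_seg mf')) => z ->.
Qed.

Lemma Int_deriv_itvJ f : C1 f ->
  \int[leb]_z (derive1 f z * itvJ z) = f a - f (- a).
Proof.
move=> Cf; rewrite -(Prim_deriv_itvJ Cf); last by rewrite lexx andbT ge0_cp ?ltW.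
apply: eq_Int => z; rewrite /itvJ; have [/andP[_ /ltW ->]|_] := boolP (- a < z < a).
  by rewrite !mulr1.
by rewrite !mulr0 mul0r.
Qed.

Definition lam k : R := k.+1%:R * (pi / (2 * a)).
Definition sinl k z : R := sin (lam k * (z + a)).
(** The constant mode is absent. The cosines occur as [z]-derivatives of the sines, and for them
    orthogonality is used but not completeness. *)
Definition cosl k z : R := cos (lam k * (z + a)).
Definition sn k z : R := sinl k z * itvJ z.
Definition cs k z : R := cosl k z * itvJ z.

Lemma lam_gt0 k : 0 < lam k.
Proof. by rewrite mulr_gt0// divr_gt0 ?pi_gt0// mulr_gt0. Qed.

Lemma lam_ge k : lam 0 <= lam k.
Proof.
rewrite /lam ler_wpM2r ?ler_nat//.
by rewrite divr_ge0 ?pi_ge0// mulr_ge0// ltW.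
Qed.

Let is_derive_arg k z : is_derive z 1 (fun z => lam k * (z + a)) (lam k).
Proof.
have [d e] := derive1_fun_affine (lam k) (lam k * a) (@derivable_id R R ^~ 1).
have -> : (fun z => lam k * (z + a)) = (fun z => id (lam k * z + lam k * a)).
  by apply/funext => y; rewrite mulrDr.
apply: DeriveDef; first exact: d.
by rewrite -derive1E e derive1_id mulr1.
Qed.

Lemma C1_sinl k : C1 (sinl k) /\ derive1 (sinl k) = (fun z => lam k * cosl k z).
Proof.
have d z : is_derive z 1 (sinl k) (lam k * cosl k z).
  have := @is_derive1_comp _ sin (fun z => lam k * (z + a)) z _ _ (is_derive_sin _) (is_derive_arg k z).
  by rewrite mulrC.
have e : derive1 (sinl k) = (fun z => lam k * cosl k z).
  by apply/funext => z; rewrite derive1E; exact: (@derive_val _ _ _ _ _ _ _ (d z)).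
split; last exact: e.
split; first by move=> z; exact: (@ex_derive _ _ _ _ _ _ _ (d z)).
rewrite e => z; apply: cvgM; first exact: cvg_cst.
apply: (@cvg_comp _ _ _ (fun z => lam k * (z + a)) cos _ (nbhs (lam k * (z + a)))).
  apply: cvgM; first exact: cvg_cst.
  by apply: cvgD; [exact: cvg_id|exact: cvg_cst].
exact: continuous_cos.
Qed.

Lemma C1_cosl k : C1 (cosl k) /\ derive1 (cosl k) = (fun z => - lam k * sinl k z).
Proof.
have d z : is_derive z 1 (cosl k) (- lam k * sinl k z).
  have := @is_derive1_comp _ cos (fun z => lam k * (z + a)) z _ _ (is_derive_cos _) (is_derive_arg k z).
  by rewrite mulrC mulrN mulNr.
have e : derive1 (cosl k) = (fun z => - lam k * sinl k z).
  by apply/funext => z; rewrite derive1E; exact: (@derive_val _ _ _ _ _ _ _ (d z)).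
split; last exact: e.
split; first by move=> z; exact: (@ex_derive _ _ _ _ _ _ _ (d z)).
rewrite e => z; apply: cvgM; first exact: cvg_cst.
exact: (C1_continuous (C1_sinl k).1).
Qed.

Lemma sinl_Na k : sinl k (- a) = 0.
Proof. by rewrite /sinl addNr mulr0 sin0. Qed.

Lemma sinl_a k : sinl k a = 0.
Proof.
rewrite /sinl (_ : lam k * (a + a) = k.+1%:R * pi); last first.
  by rewrite /lam; field; rewrite gt_eqF.
elim: k.+1 => [|n IH]; first by rewrite mul0r sin0.
by rewrite -natr1 mulrDl mul1r sinDpi IH oppr0.
Qed.

Lemma sn_le1 k z : `|sn k z| <= 1.
Proof.
rewrite normrM /itvJ; case: (_ < _ < _); rewrite ?normr1 ?normr0 ?mulr1 ?mulr0//.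
exact: sin_max.
Qed.

Lemma cs_le1 k z : `|cs k z| <= 1.
Proof.
rewrite normrM /itvJ; case: (_ < _ < _); rewrite ?normr1 ?normr0 ?mulr1 ?mulr0//.
exact: cos_max.
Qed.

Lemma L1_sn k : L1 leb (sn k).
Proof. by apply: L1_itvJ; exact: (C1_continuous (C1_sinl k).1). Qed.

Lemma L1_cs k : L1 leb (cs k).
Proof. by apply: L1_itvJ; exact: (C1_continuous (C1_cosl k).1). Qed.

Lemma sn_out k z : ~~ (- a < z < a) -> sn k z = 0.
Proof. by move=> /itvJ_out; rewrite /sn => ->; rewrite mulr0. Qed.

Lemma cs_out k z : ~~ (- a < z < a) -> cs k z = 0.
Proof. by move=> /itvJ_out; rewrite /cs => ->; rewrite mulr0. Qed.

(** No constant of integration appears because [sinl k] vanishes at [- a]. *)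
Lemma Prim_cs k x : - a <= x <= a -> Prim (fun z => lam k * cs k z) x = sinl k x.
Proof.
move=> xa; have [Cs e] := C1_sinl k.
rewrite -[RHS]subr0 -(sinl_Na k) -(Prim_deriv_itvJ Cs xa) e.
by apply: eq_Int => z; rewrite /cs mulrA.
Qed.

Lemma Int_cs k : \int[leb]_z (lam k * cs k z) = 0.
Proof.
have [Cs e] := C1_sinl k.
rewrite -[RHS](subrr (sinl k a)) {2}(sinl_a k) -(sinl_Na k) -(Int_deriv_itvJ Cs) e.
by apply: eq_Int => z; rewrite /cs mulrA.
Qed.

Lemma lam_inj j k : j != k -> lam j ^+ 2 != lam k ^+ 2.
Proof.
move=> jk; rewrite eqrXn2 ?ltW ?lam_gt0//.
rewrite /lam; apply: contra jk => /eqP /mulIf H.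
have : j.+1%:R = k.+1%:R :> R.
  by apply: H; rewrite mulf_neq0 ?gt_eqF ?pi_gt0// invr_gt0 mulr_gt0.
by move=> /eqP; rewrite eqr_nat eqSS.
Qed.

Let C1Z (c : R) f : C1 f -> C1 (fun z => c * f z) /\
   derive1 (fun z => c * f z) = (fun z => c * derive1 f z).
Proof.
move=> [df cf]; have e : derive1 (fun z => c * f z) = (fun z => c * derive1 f z).
  by apply/funext => x; have [] := derive1_Zl c (df x).
split; last exact: e.
split; first by move=> x; have [] := derive1_Zl c (df x).
by rewrite e => x; apply: cvgM; [exact: cvg_cst|exact: cf].
Qed.

Let C1B f g : C1 f -> C1 g -> C1 (fun z => f z - g z) /\
   derive1 (fun z => f z - g z) = (fun z => derive1 f z - derive1 g z).
Proof.
move=> [df cf] [dg cg].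
have e : derive1 (fun z => f z - g z) = (fun z => derive1 f z - derive1 g z).
  by apply/funext => x; rewrite derive1E (deriveB (df x) (dg x)) -!derive1E.
split; last exact: e.
split; first by move=> x; exact: derivableB.
by rewrite e => x; apply: cvgB; [exact: cf|exact: cg].
Qed.

(* Wronskian [f' g - f g'], whose derivative is [(m - l) f g] when [f'' = - l f] and [g'' = - m g] *)
Let wronskian f g f' g' (l m : R) : C1 f -> C1 g -> C1 f' -> C1 g' ->
  derive1 f = f' -> derive1 g = g' ->
  derive1 f' = (fun z => - l * f z) -> derive1 g' = (fun z => - m * g z) ->
  \int[leb]_z ((m - l) * (f z * g z * itvJ z)) =
  (f' a * g a - f a * g' a) - (f' (- a) * g (- a) - f (- a) * g' (- a)).
Proof.
move=> cf cg cf' cg' e1 e2 e3 e4.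
have [h1 E1] := C1M cf' cg; have [h2 E2] := C1M cf cg'.
have [h3 E3] := C1B h1 h2.
rewrite -(Int_deriv_itvJ h3); apply: eq_Int => z.
by rewrite E3 E1 E2 e1 e2 e3 e4; ring.
Qed.

(** The sum of the two integrals is [2 a] since [cos^2 + sin^2 = 1]; their difference is 0 since
    [(sin cos)' = lam (cos^2 - sin^2)] and the sine vanishes at both ends. *)
Lemma sn_cs_diag k : \int[leb]_z (sn k z * sn k z) = a /\ \int[leb]_z (cs k z * cs k z) = a.
Proof.
have [Cs es] := C1_sinl k; have [Cc ec] := C1_cosl k.
have cs' := C1_continuous Cs; have cc := C1_continuous Cc.
have Is : L1 leb (fun z => (sinl k z * sinl k z) * itvJ z).
  by apply: L1_itvJ => z; apply: cvgM; exact: cs'.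
have Ic : L1 leb (fun z => (cosl k z * cosl k z) * itvJ z).
  by apply: L1_itvJ => z; apply: cvgM; exact: cc.
have Es : \int[leb]_z (sn k z * sn k z) = \int[leb]_z ((sinl k z * sinl k z) * itvJ z).
  by apply: eq_Int => z; rewrite /sn mulrACA itvJ_idem.
have Ec : \int[leb]_z (cs k z * cs k z) = \int[leb]_z ((cosl k z * cosl k z) * itvJ z).
  by apply: eq_Int => z; rewrite /cs mulrACA itvJ_idem.
have sum : \int[leb]_z (sn k z * sn k z) + \int[leb]_z (cs k z * cs k z) = 2 * a.
  have Cid : C1 (@id R).
    split; first by move=> x; exact: derivable_id.
    by rewrite (_ : derive1 _ = fun=> 1 : R);
       [move=> x; exact: cvg_cst|apply/funext => x; exact: derive1_id].
  rewrite Es Ec -IntD//.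
  transitivity (\int[leb]_z (derive1 (@id R) z * itvJ z)); last first.
    by rewrite (Int_deriv_itvJ Cid) /=; ring.
  apply: eq_Int => z; rewrite derive1_id -mulrDl; congr (_ * _).
  by rewrite -!expr2 addrC cos2Dsin2.
have dif : lam k * (\int[leb]_z (cs k z * cs k z) - \int[leb]_z (sn k z * sn k z)) = 0.
  have [h e] := C1M Cs Cc.
  rewrite Es Ec -IntB// -IntZl; last exact: L1B.
  transitivity (\int[leb]_z (derive1 (fun z => sinl k z * cosl k z) z * itvJ z)).
    by apply: eq_Int => z; rewrite e es ec; ring.
  by rewrite (Int_deriv_itvJ h) sinl_a sinl_Na !mul0r subrr.
move: dif => /eqP; rewrite mulf_eq0 gt_eqF ?lam_gt0//= subr_eq0 => /eqP E.
by rewrite E in sum *; split; lra.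
Qed.

Lemma sn_orth j k : \int[leb]_z (sn j z * sn k z) = (j == k)%:R * a.
Proof.
have [<-|jk] := eqVneq j k; first by rewrite mul1r (sn_cs_diag j).1.
rewrite mul0r.
have [Csj esj] := C1_sinl j; have [Ccj ecj] := C1_cosl j.
have [Csk esk] := C1_sinl k; have [Cck eck] := C1_cosl k.
have [C1j e1j] := C1Z (lam j) Ccj; have [C1k e1k] := C1Z (lam k) Cck.
have : \int[leb]_z ((lam k ^+ 2 - lam j ^+ 2) * (sinl j z * sinl k z * itvJ z)) = 0.
  rewrite (wronskian Csj Csk C1j C1k esj esk); first last.
  - by rewrite e1k eck; apply/funext => z; ring.
  - by rewrite e1j ecj; apply/funext => z; ring.
  - by rewrite !sinl_a !sinl_Na; ring.
rewrite IntZl; last first.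
  by apply: L1_itvJ => z; apply: cvgM; [exact: (C1_continuous Csj)|exact: (C1_continuous Csk)].
move=> /eqP; rewrite mulf_eq0 subr_eq0 eq_sym (negbTE (lam_inj jk))/= => /eqP <-.
by apply: eq_Int => z; rewrite /sn mulrACA itvJ_idem.
Qed.

Lemma cs_orth j k : \int[leb]_z (cs j z * cs k z) = (j == k)%:R * a.
Proof.
have [<-|jk] := eqVneq j k; first by rewrite mul1r (sn_cs_diag j).2.
rewrite mul0r.
have [Csj esj] := C1_sinl j; have [Ccj ecj] := C1_cosl j.
have [Csk esk] := C1_sinl k; have [Cck eck] := C1_cosl k.
have [C1j e1j] := C1Z (- lam j) Csj; have [C1k e1k] := C1Z (- lam k) Csk.
have : \int[leb]_z ((lam k ^+ 2 - lam j ^+ 2) * (cosl j z * cosl k z * itvJ z)) = 0.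
  rewrite (wronskian Ccj Cck C1j C1k ecj eck); first last.
  - by rewrite e1k esk; apply/funext => z; ring.
  - by rewrite e1j esj; apply/funext => z; ring.
  - by rewrite !sinl_a !sinl_Na; ring.
rewrite IntZl; last first.
  by apply: L1_itvJ => z; apply: cvgM; [exact: (C1_continuous Ccj)|exact: (C1_continuous Cck)].
move=> /eqP; rewrite mulf_eq0 subr_eq0 eq_sym (negbTE (lam_inj jk))/= => /eqP <-.
by apply: eq_Int => z; rewrite /cs mulrACA itvJ_idem.
Qed.

End sines.

(** * Completeness of the sines and Bessel's inequality *)

Section completeness.
Context {R : realType} (a : R) (a0 : 0 < a).
Local Notation leb := (@lebesgue_measure R).
Implicit Types (f g : R -> R) (k n : nat) (z : R).

Lemma bernoulli_ge (t : R) m : 0 <= t -> 1 + m%:R * t <= (1 + t) ^+ m.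
Proof.
move=> t0; elim: m => [|m IH]; first by rewrite mul0r addr0 expr0.
rewrite exprS -natr1.
apply: (@le_trans _ _ ((1 + t) * (1 + m%:R * t))); last by rewrite ler_wpM2l// addr_ge0.
rewrite -subr_ge0 (_ : _ - _ = m%:R * t ^+ 2); last by ring.
by rewrite mulr_ge0// sqr_ge0.
Qed.

Lemma bernoulli_le (t : R) m : 0 <= t <= 1 -> 1 - m%:R * t <= (1 - t) ^+ m.
Proof.
move=> /andP[t0 t1]; elim: m => [|m IH]; first by rewrite mul0r subr0 expr0.
rewrite exprS -natr1.
apply: (@le_trans _ _ ((1 - t) * (1 - m%:R * t))); last by rewrite ler_wpM2l// subr_ge0.
rewrite -subr_ge0 (_ : _ - _ = m%:R * t ^+ 2); last by ring.
by rewrite mulr_ge0// sqr_ge0.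
Qed.

Definition step_poly n (x : R) : R := (1 - x ^+ n) ^+ (2 ^ n).

Lemma step_poly_01 n x : 0 <= x <= 1 -> 0 <= step_poly n x <= 1.
Proof.
move=> /andP[x0 x1]; have xn1 : x ^+ n <= 1 by rewrite exprn_ile1.
rewrite /step_poly exprn_ge0 ?subr_ge0//= exprn_ile1 ?subr_ge0//.
by rewrite lerBlDr lerDl exprn_ge0.
Qed.

(* [(1 - x^n)^(2^n)], from the elementary proof of the Weierstrass theorem. *)
Lemma cvg_step_poly x : 0 <= x <= 1 -> x != 2^-1 ->
  step_poly n x @[n --> \oo] --> ((x < 2^-1)%R%:R : R).
Proof.
move=> x01; have /andP[x0 x1] := x01.
have natpow n : (2 ^ n)%:R = 2 ^+ n :> R by rewrite natrX.
case: (ltgtP x 2^-1) => // [xlt|xgt] _.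
- have c1 : (fun n => 1 - (2 * x) ^+ n) @ \oo --> (1 : R).
    rewrite -[X in _ --> X]subr0; apply: cvgB; first exact: cvg_cst.
    by apply: cvg_expr; rewrite ger0_norm ?mulr_ge0//; lra.
  apply: (squeeze_cvgr _ c1 (@cvg_cst _ (1 : R) _ \oo _)).
  apply: nearW => n; have /andP[_ ->] := step_poly_01 n x01; rewrite andbT.
  rewrite /step_poly; apply: le_trans (bernoulli_le _ _).
    by rewrite natpow -exprMn.
  by rewrite exprn_ge0// exprn_ile1.
- have c1 : (fun n => ((2 * x)^-1) ^+ n) @ \oo --> (0 : R).
    have x2 : 1 < 2 * x by lra.
    have x3 : 0 < 2 * x by lra.
    apply: cvg_expr; rewrite ger0_norm ?invr_ge0 ?(ltW x3)//.
    by rewrite invf_lt1.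
  apply: (squeeze_cvgr _ (@cvg_cst _ (0 : R) _ \oo _) c1).
  apply: nearW => n; have /andP[-> _] := step_poly_01 n x01; rewrite /=.
  have xp : 0 < x by apply: lt_trans xgt; rewrite invr_gt0.
  have x2 : 0 < (2 * x) ^+ n by rewrite exprn_gt0// mulr_gt0.
  rewrite exprVn -[leRHS]mul1r ler_pdivlMr//.
  (* The additional factor is at least [(2 x)^n] by Bernoulli, and the product is
     [(1 - (x^n)^2)^(2^n) <= 1]. *)
  apply: (@le_trans _ _ (step_poly n x * (1 + x ^+ n) ^+ (2 ^ n))).
    apply: ler_wpM2l; first by have /andP[] := step_poly_01 n x01.
    apply: le_trans (bernoulli_ge _ _); last by rewrite exprn_ge0.
    by rewrite natpow -exprMn lerDr.
  rewrite /step_poly -exprMn -subr_sqr expr1n exprn_ile1//.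
    by rewrite subr_ge0 expr2 mulr_ile1// ?exprn_ge0// exprn_ile1.
  by rewrite lerBlDr lerDl sqr_ge0.
Qed.

Let th z := pi / (2 * a) * (z + a).

Let sinlE k z : sinl a k z = sin (k.+1%:R * th z).
Proof. by rewrite /sinl /lam -mulrA. Qed.

Let sinl_cos k z : sinl a k z * cos (th z) =
  2^-1 * sinl a k.+1 z + 2^-1 * sin (k%:R * th z).
Proof.
rewrite !sinlE -!natr1 !mulrDl !mul1r.
set t := th z; set s := k%:R * t.
rewrite (sinD (s + t) t) (_ : sin s = sin (s + t - t)); last by congr sin; ring.
by rewrite (sinB (s + t) t); field.
Qed.

(** The bounded multipliers [phi] for which [g phi] is orthogonal to every sine. By the product
    formula [sinl_cos] they are stable under multiplication by [cos (th z)]; as soon as 1 is one of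
    them, so is every polynomial in that cosine. *)
Let orth g (phi : R -> R) := [/\ measurable_fun setT phi, (exists M, forall z, `|phi z| <= M)
  & forall k, \int[leb]_z (g z * sn a k z * phi z) = 0].

Let mcos : measurable_fun setT (fun z => cos (th z)).
Proof.
apply: continuous_measurable_fun => z.
apply: (@cvg_comp _ _ _ th cos _ (nbhs (th z))); last exact: continuous_cos.
apply: cvgM; first exact: cvg_cst.
by apply: cvgD; [exact: cvg_id|exact: cvg_cst].
Qed.

Let L1gs g k : L1 leb g -> L1 leb (fun z => g z * sn a k z).
Proof.
move=> Ig; apply: (leb_mulr_bounded Ig _ (sn_le1 a k)).
exact: L1_measurable (L1_sn a k).
Qed.

Let orth_L1 g phi k : L1 leb g -> orth g phi ->
  L1 leb (fun z => g z * sn a k z * phi z).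
Proof.
move=> Ig [mphi [M pM] _]; exact: (leb_mulr_bounded (L1gs k Ig) mphi pM).
Qed.

Let orthZ g phi c : L1 leb g -> orth g phi -> orth g (fun z => c * phi z).
Proof.
move=> Ig op; have [mphi [M pM] h] := op; split.
- exact: measurable_funM.
- by exists (`|c| * M) => z; rewrite normrM ler_wpM2l.
- move=> k; transitivity (c * \int[leb]_z (g z * sn a k z * phi z)).
    by rewrite -IntZl ?orth_L1//; apply: eq_Int => z; ring.
  by rewrite h mulr0.
Qed.

Let orthD g phi psi : L1 leb g -> orth g phi -> orth g psi ->
  orth g (fun z => phi z + psi z).
Proof.
move=> Ig op oq; have [mp [M pM] hp] := op; have [mq [N qN] hq] := oq; split.
- exact: measurable_funD.
- by exists (M + N) => z; rewrite (le_trans (ler_normD _ _))// lerD.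
- move=> k; transitivity (\int[leb]_z (g z * sn a k z * phi z) + \int[leb]_z (g z * sn a k z * psi z)).
    by rewrite -IntD ?orth_L1//; apply: eq_Int => z; ring.
  by rewrite hp hq addr0.
Qed.

Let orth_cos g phi : L1 leb g -> orth g phi -> orth g (fun z => phi z * cos (th z)).
Proof.
move=> Ig op; have [mp [M pM] hp] := op; split.
- exact: measurable_funM.
- exists M => z; rewrite normrM -[leRHS]mulr1 ler_pM//.
  exact: cos_max.
- move=> k.
  transitivity (2^-1 * \int[leb]_z (g z * sn a k.+1 z * phi z) +
      2^-1 * \int[leb]_z (g z * (sin (k%:R * th z) * itvJ a z) * phi z)).
    have I2 : L1 leb (fun z => g z * (sin (k%:R * th z) * itvJ a z) * phi z).
      case: k => [|k].
        under eq_fun do rewrite mul0r sin0 mul0r mulr0 mul0r; exact: L1_cst0.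
      have := orth_L1 k Ig op; rewrite /sn; by under eq_fun do rewrite sinlE.
    rewrite -!IntZl ?orth_L1// -IntD; [|by apply: L1Zl; exact: orth_L1|exact: L1Zl].
    apply: eq_Int => z; rewrite /sn.
    have := sinl_cos k z; set s := sinl a k z; set c := cos _ => E.
    have -> : g z * (s * itvJ a z) * (phi z * c) = g z * phi z * itvJ a z * (s * c) by ring.
    by rewrite E; ring.
  rewrite hp mulr0 add0r; case: k => [|k].
    rewrite (@eq_Int _ _ _ leb _ (fun=> 0)) ?Int0 ?mulr0// => z.
    by rewrite mul0r sin0; ring.
  rewrite (@eq_Int _ _ _ leb _ (fun z => g z * sn a k z * phi z)) ?hp ?mulr0// => z.
  by rewrite /sn sinlE.
Qed.

(** An affine image of [cos (th z)] that stays in [[0, 1]] for [|y| <= 1] and crosses [1 / 2], the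
    threshold of [step_poly], exactly where [cos (th z) = y]. *)
Let xx (y z : R) := (2 + cos (th z) - y) / 4.

Let orth_xx g phi y n : L1 leb g -> orth g phi ->
  orth g (fun z => phi z * xx y z ^+ n).
Proof.
move=> Ig op; elim: n => [|n IH].
  by under eq_fun do rewrite expr0 mulr1.
have -> : (fun z => phi z * xx y z ^+ n.+1) = (fun z =>
    ((2 - y) / 4) * (phi z * xx y z ^+ n) + 4^-1 * (phi z * xx y z ^+ n * cos (th z))).
  by apply/funext => z; rewrite exprS {1}/xx; field.
by apply: orthD => //; apply: orthZ => //; exact: orth_cos.
Qed.

Let orth_step g phi y n m : L1 leb g -> orth g phi ->
  orth g (fun z => phi z * (1 - xx y z ^+ n) ^+ m).
Proof.
move=> Ig op; elim: m => [|m IH].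
  by under eq_fun do rewrite expr0 mulr1.
have -> : (fun z => phi z * (1 - xx y z ^+ n) ^+ m.+1) = (fun z =>
   phi z * (1 - xx y z ^+ n) ^+ m + (-1) * ((phi z * (1 - xx y z ^+ n) ^+ m) * xx y z ^+ n)).
  by apply/funext => z; rewrite exprS; ring.
by apply: orthD => //; apply: orthZ => //; exact: orth_xx.
Qed.

Let th_range z : - a < z < a -> 0 < th z < pi.
Proof.
move=> /andP[z1 z2]; have pa : 0 < pi / (2 * a) by rewrite divr_gt0 ?pi_gt0// mulr_gt0.
apply/andP; split; first by rewrite mulr_gt0//; lra.
rewrite /th mulrAC ltr_pdivrMr ?mulr_gt0// ltr_pM2l ?pi_gt0//; lra.
Qed.

(** [step_poly n] of [xx (cos (th y)) z] is a polynomial in [cos (th z)] and tends to the indicator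
    of [y < z], the cosine being decreasing on [[0, pi]]. Thus [g] times the first sine has integral
    0 over all half-lines and vanishes almost everywhere; the first sine is positive inside the
    interval. *)
Lemma sines_complete g : L1 leb g -> (forall z, ~~ (- a < z < a) -> g z = 0) ->
  (forall k, \int[leb]_z (g z * sn a k z) = 0) -> {ae leb, forall z, g z = 0}.
Proof.
move=> Ig g0 gk.
have o1 : orth g (fun=> 1).
  split; [exact: measurable_cst|by exists 1 => z; rewrite normr1|move=> k].
  by rewrite -[RHS](gk k); apply: eq_Int => z; rewrite mulr1.
pose G z := g z * sn a 0 z.
have IG : L1 leb G by exact: L1gs.
have mG := L1_measurable IG.
have step (y : R) : - a < y < a -> \int[leb]_z (G z * (y < z)%R%:R) = 0.
  move=> ya; have /andP[y0 ypi] := th_range ya.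
  have x01 z : 0 <= xx (cos (th y)) z <= 1.
    have := cos_max (th z); have := cos_max (th y); rewrite !ler_norml.
    move=> /andP[h1 h2] /andP[h3 h4]; apply/andP; split; rewrite /xx; lra.
  have mstep n : measurable_fun setT (fun z => step_poly n (xx (cos (th y)) z)).
    have [+ _ _] := orth_step (cos (th y)) n (2 ^ n) Ig o1.
    by under eq_fun do rewrite mul1r.
  have mlt : measurable_fun setT (fun z : R => (y < z)%R%:R : R).
    exact: measurable_lt_nat.
  have : \int[leb]_z (G z * step_poly n (xx (cos (th y)) z)) @[n --> \oo] -->
      \int[leb]_z (G z * (y < z)%R%:R).
    apply: (Int_cvg _ _ (L1_norm IG)).
    - by move=> n; apply: measurable_funM => //; exact: mstep.
    - exact: measurable_funM.
    - apply: (ae_imp (ae_neq y)) => z zy.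
      have [za|za] := boolP (- a < z < a); last first.
        rewrite /G g0// !mul0r (_ : (fun n => _) = fun=> 0); first exact: cvg_cst.
        by apply/funext => n; rewrite !mul0r.
      apply: cvgM; first exact: cvg_cst.
      have /andP[z0 zpi] := th_range za.
      have thm : (th y < th z) = (y < z).
        rewrite /th ltr_pM2l ?ltrD2r// divr_gt0 ?pi_gt0// mulr_gt0//.
      have cm : (cos (th z) < cos (th y)) = (y < z).
        by rewrite ltr_cos ?thm// in_itv/= ltW//= ltW.
      have cm' : (cos (th y) < cos (th z)) = (z < y).
        rewrite ltr_cos ?in_itv/= ?(ltW z0) ?(ltW y0) ?ltW//.
        by rewrite /th ltr_pM2l ?ltrD2r// divr_gt0 ?pi_gt0// mulr_gt0//.
      rewrite (_ : (y < z) = (xx (cos (th y)) z < 2^-1)).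
        apply: cvg_step_poly => //.
        apply/negP => /eqP E; have {}E : cos (th z) = cos (th y) by rewrite /xx in E; lra.
        by move: cm cm' zy; rewrite E ltxx; case: ltgtP.
      by rewrite -cm /xx; apply/idP/idP => h; lra.
    - move=> n z; rewrite normrM -[leRHS]mulr1 ler_wpM2l//.
      by have /andP[h1 h2] := step_poly_01 n (x01 z); rewrite ger0_norm.
  have -> : (fun n => \int[leb]_z (G z * step_poly n (xx (cos (th y)) z))) = fun=> 0.
    apply/funext => n; have [_ _ h] := orth_step (cos (th y)) n (2 ^ n) Ig o1.
    by rewrite -[RHS](h 0%N); apply: eq_Int => z; rewrite /G /step_poly; ring.
  move=> h; have h0 : (fun _ : nat => 0 : R) @ \oo --> (0 : R) by exact: cvg_cst.
  exact: (cvg_unique (@Rhausdorff R) h h0).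
have PG x : Prim G x = 0.
  have [xl|xl] := leP x (- a).
    rewrite /Prim -[RHS](@Int0 _ _ _ leb); apply: eq_Int => t.
    have [tx|] := leP t x; last by rewrite mulr0.
    by rewrite /G g0 ?mul0r// negb_and -!leNgt (le_trans tx).
  have [xr|xr] := leP a x.
    rewrite /Prim -[RHS](gk 0%N); apply: eq_Int => t.
    have [|tx] := leP t x; first by rewrite mulr1.
    by rewrite -/(G t) /G g0 ?mul0r// negb_and -!leNgt (le_trans xr (ltW tx)) orbT.
  have := step x; rewrite xl xr => /(_ isT) E.
  have := gk 0%N; rewrite (_ : \int[leb]_z _ = Prim G x + \int[leb]_z (G z * (x < z)%R%:R)).
    by rewrite E addr0.
  rewrite /Prim -IntD; first last.
  - by apply: L1_mul_bool => //; exact: measurable_lt_nat.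
  - exact: L1_le_cut.
  by apply: eq_Int => z; rewrite -/(G z); case: (leP z x) => _; rewrite /=; ring.
apply: (ae_imp (ae_eq0_of_Prim IG PG)) => z.
have [za|/g0 //] := boolP (- a < z < a).
move=> /eqP; rewrite mulf_eq0 => /orP[/eqP //|].
rewrite /sn itvJ_in// mulr1 sinlE mul1r gt_eqF//.
by apply: sin_gt0_pi; exact: th_range.
Qed.

(** Not normalised: the squared norm of [sn a k] is [a], which explains the factor [a] in
    [Bessel]. *)
Definition coef g k := \int[leb]_z (g z * sn a k z).

Lemma orthogonal_sum_sqr (e : nat -> R -> R) (al : nat -> R) N :
  (forall i j, L1 leb (fun z => e i z * e j z)) ->
  (forall i j, \int[leb]_z (e i z * e j z) = (i == j)%:R * a) ->
  L1 leb (fun z => (\sum_(i < N) al i * e i z) ^+ 2) /\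
  \int[leb]_z (\sum_(i < N) al i * e i z) ^+ 2 = a * \sum_(i < N) al i ^+ 2.
Proof.
move=> Ie oe.
have E z : (\sum_(i < N) al i * e i z) ^+ 2 =
    \sum_(i < N) \sum_(j < N) (al i * al j) * (e i z * e j z).
  rewrite expr2 mulr_suml; apply: eq_bigr => i _; rewrite mulr_sumr.
  by apply: eq_bigr => j _; rewrite mulrACA.
have L i : L1 leb (fun z => \sum_(j < N) (al i * al j) * (e i z * e j z)).
  by apply: L1_sum => j; exact: L1Zl.
split; first by under eq_fun do rewrite E; exact: L1_sum.
rewrite (eq_Int leb E) Int_sum// mulr_sumr; apply: eq_bigr => i _.
rewrite Int_sum; last by move=> j; exact: L1Zl.
rewrite (bigD1 i)//= big1 ?addr0; last first.
  move=> j ji; rewrite IntZl// oe eq_sym val_eqE (negbTE ji) mul0r mulr0//.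
by rewrite IntZl// oe eqxx mul1r expr2 mulrC.
Qed.

Lemma L1_sn2 i j : L1 leb (fun z => sn a i z * sn a j z).
Proof.
by apply: (leb_mulr_bounded (L1_sn a i) _ (sn_le1 a j)); exact: L1_measurable (L1_sn a j).
Qed.

Lemma Bessel g N : L1 leb g -> L1 leb (fun z => g z ^+ 2) ->
  \sum_(k < N) coef g k ^+ 2 <= a * \int[leb]_z (g z ^+ 2).
Proof.
move=> Ig Ig2.
pose S z := \sum_(k < N) (coef g k / a) * sn a k z.
have [IS2 ES2] := orthogonal_sum_sqr (fun k => coef g k / a) N L1_sn2 (sn_orth a0).
have E z : g z * S z = \sum_(k < N) (coef g k / a) * (g z * sn a k z).
  by rewrite /S mulr_sumr; apply: eq_bigr => k _; rewrite mulrCA.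
have IgS : L1 leb (fun z => g z * S z).
  by under eq_fun do rewrite E; apply: L1_sum => k; apply: L1Zl; exact: L1gs.
have EgS : \int[leb]_z (g z * S z) = a^-1 * \sum_(k < N) coef g k ^+ 2.
  rewrite (eq_Int leb E) Int_sum; last by move=> k; apply: L1Zl; exact: L1gs.
  rewrite mulr_sumr; apply: eq_bigr => k _; rewrite IntZl; last exact: L1gs.
  by rewrite -/(coef g k); ring.
have aN : a != 0 by rewrite gt_eqF.
have : 0 <= \int[leb]_z ((g z ^+ 2 - 2 * (g z * S z)) + S z ^+ 2).
  apply: Int_ge0 => z; rewrite (_ : _ + _ = (g z - S z) ^+ 2) ?sqr_ge0//; ring.
have I1 : L1 leb (fun z => g z ^+ 2 - 2 * (g z * S z)) by apply: L1B => //; exact: L1Zl.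
rewrite (IntD I1 IS2) IntB//; last exact: L1Zl.
rewrite IntZl// EgS ES2.
have -> : \sum_(i < N) (coef g i / a) ^+ 2 = a ^- 2 * \sum_(k < N) coef g k ^+ 2.
  by rewrite mulr_sumr; apply: eq_bigr => k _; rewrite expr_div_n mulrC.
set B := \sum_(k < N) _.
have -> : a * (a ^- 2 * B) = a^-1 * B by field.
move=> h; rewrite -ler_pdivrMl//; lra.
Qed.

End completeness.

(** * The weighted space and traces *)

Section weighted_L2.
Context {R : realType} (rad a : R) (rad0 : 0 < rad) (a0 : 0 < a).
Local Notation leb := (@lebesgue_measure R).
Local Notation leb2 := (leb \x leb)%E.
Implicit Types (u v w : R * R -> R) (f g h : R -> R) (p : R * R) (r z : R).

Definition inO p := (0 < p.1 < rad) && (- a < p.2 < a).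

Lemma inOE p : Omega rad a p <-> inO p.
Proof.
rewrite /Omega /inO /=; split=> [[/=]|/andP[h1 h2]]; rewrite !in_itv//=.
by move=> -> ->.
Qed.

Lemma mem_Omega p : (p \in Omega rad a) = inO p.
Proof. by apply/idP/idP => [|h]; rewrite ?inE; [move/inOE|exact/inOE]. Qed.

Definition supp u := forall p, ~~ inO p -> u p = 0.

(** Vanishing outside the rectangle makes [u^2 r] nonnegative on the whole plane, so the weight can
    be written [p.1] without absolute value. *)
Definition L2w u := [/\ measurable_fun setT u, supp u &
  L1 leb2 (fun p => u p ^+ 2 * p.1)].

Definition N2 u : R := \int[leb2]_p (u p ^+ 2 * p.1).

Lemma supp_wge0 u p : supp u -> 0 <= u p ^+ 2 * p.1.
Proof.
move=> su; have [/andP[/andP[p0 _] _]|/su ->] := boolP (inO p).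
  by rewrite mulr_ge0 ?sqr_ge0// ltW.
by rewrite expr0n mul0r.
Qed.

Lemma N2_ge0 u : supp u -> 0 <= N2 u.
Proof. by move=> su; apply: Int_ge0 => p; exact: supp_wge0. Qed.

Lemma measurable_p1 : measurable_fun setT (fun p : R * R => p.1).
Proof. exact: measurable_fst. Qed.

Lemma measurable_Omega : measurable (Omega rad a).
Proof. by apply: measurableX; exact: measurable_itv. Qed.

Lemma measurable_inO : measurable_fun setT (fun p => (inO p)%:R : R).
Proof.
rewrite (_ : (fun p => _) = \1_(Omega rad a)); first exact: measurable_indic measurable_Omega.
by apply/funext => p; rewrite indicE mem_Omega.
Qed.

Lemma L1_inO : L1 leb2 (fun p => (inO p)%:R : R).
Proof.
rewrite (_ : (fun p => _) = \1_(Omega rad a)).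
  apply: (@L1_indic _ _ _ leb2); first exact: measurable_Omega.
  have := @product_measure1E _ _ _ _ R leb leb `]0, rad[%classic `]- a, a[%classic.
  move=> /(_ (measurable_itv _) (measurable_itv _)) E.
  have l1 : leb `]0, rad[%classic = rad%:E.
    by rewrite lebesgue_measure_itv/= lte_fin rad0 -EFinB subr0.
  have l2 : leb `]- a, a[%classic = (a - - a)%:E.
    by rewrite lebesgue_measure_itv/= lte_fin gtrN.
  apply: (@le_lt_trans _ _ (rad%:E * (a - - a)%:E)%E); last by rewrite -EFinM ltry.
  rewrite le_eqVlt; apply/orP; left; apply/eqP; rewrite [LHS]E.
  by congr (_ * _)%E; [exact: l1|exact: l2].
by apply/funext => p; rewrite indicE mem_Omega.
Qed.

Lemma L1_mul_inO u (M : R) : measurable_fun setT u ->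
  (forall p, inO p -> `|u p| <= M) -> L1 leb2 (fun p => u p * (inO p)%:R).
Proof.
move=> mu uM; apply: (@L1_le _ _ _ leb2 _ (fun p => `|M| * (inO p)%:R)).
- by apply: measurable_funM => //; exact: measurable_inO.
- by apply: L1Zl; exact: L1_inO.
- move=> p; rewrite normrM; have [/uM h|_] := boolP (inO p); last by rewrite normr0 !mulr0.
  by rewrite normr1 !mulr1 (le_trans h)// ler_norm.
Qed.

Lemma L1_weight : L1 leb2 (fun p => p.1 * (inO p)%:R).
Proof.
apply: (@L1_mul_inO _ rad); first exact: measurable_p1.
by move=> p /andP[/andP[h1 h2] _]; rewrite gtr0_norm// ltW.
Qed.

Definition Wt : R := \int[leb2]_p (p.1 * (inO p)%:R).

(** Cauchy-Schwarz with the splitting [u^2 r] and [v^2 / r <= M^2 r]. The bound [|v| <= M r] is what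
    converts the weighted norm into control of integrals against [dr dz]; test functions satisfy it
    because they vanish near the axis. *)
Lemma pairing u v (M : R) : L2w u -> measurable_fun setT v ->
  (forall p, inO p -> `|v p| <= M * p.1) ->
  L1 leb2 (fun p => u p * v p) /\
  (\int[leb2]_p (u p * v p)) ^+ 2 <= N2 u * (M ^+ 2 * Wt).
Proof.
move=> [mu su Iu] mv vM.
rewrite /Wt -IntZl; last exact: L1_weight.
apply: Int_cauchy_schwarz => //.
- exact: measurable_funM.
- by apply: L1Zl; exact: L1_weight.
- by move=> p; exact: supp_wge0.
- move=> p; rewrite mulr_ge0 ?sqr_ge0//.
  by rewrite /inO; case: (boolP (0 < p.1 < rad)) => [/andP[/ltW ? _]|_]; rewrite ?mulr0// mulr_ge0.
- move=> p; have [pO|/su ->] := boolP (inO p); last first.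
    by rewrite mul0r !expr0n !mul0r.
  have := vM p pO; move: pO => /andP[/andP[p0 _] _] h.
  rewrite exprMn mulr1 -mulrA ler_wpM2l ?sqr_ge0//.
  rewrite (_ : p.1 * _ = (M * p.1) ^+ 2); last by ring.
  by rewrite -real_normK ?num_real// ler_pXn2r// nnegrE (le_trans _ h).
Qed.

Lemma pairing_cvg (u : nat -> R * R -> R) v (M : R) : (forall n, L2w (u n)) ->
  N2 (u n) @[n --> \oo] --> 0 -> measurable_fun setT v ->
  (forall p, inO p -> `|v p| <= M * p.1) ->
  \int[leb2]_p (u n p * v p) @[n --> \oo] --> 0.
Proof.
move=> Lu Nu mv vM.
have c : N2 (u n) * (M ^+ 2 * Wt) @[n --> \oo] --> (0 : R).
  rewrite -[X in _ --> X](mul0r (M ^+ 2 * Wt)).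
  by apply: cvgM => //; exact: cvg_cst.
apply/cvgrPdist_lt => e e0.
have e2 : 0 < e ^+ 2 by rewrite exprn_gt0.
move/cvgrPdist_lt : c => /(_ _ e2); apply: filterS => n.
rewrite !sub0r !normrN => h.
have [_ h2] := pairing (Lu n) mv vM.
rewrite -(@ltr_pXn2r _ 2) ?nnegrE//; last exact: ltW.
rewrite real_normK ?num_real//; apply: (le_lt_trans h2).
by rewrite (le_lt_trans _ h)// ler_norm.
Qed.

Lemma L2wZ c u : L2w u -> L2w (fun p => c * u p).
Proof.
move=> [mu su Iu]; split.
- exact: measurable_funM.
- by move=> p /su ->; rewrite mulr0.
- by under eq_fun do rewrite exprMn -mulrA; exact: L1Zl.
Qed.

(** The factors 2 replace the triangle inequality and avoid square roots; they are the origin of the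
    factors 2 and 6 in the final bounds. *)
Lemma N2_add_le u v : L2w u -> L2w v ->
  L2w (fun p => u p + v p) /\ N2 (fun p => u p + v p) <= 2 * N2 u + 2 * N2 v.
Proof.
move=> [mu su Iu] [mv sv Iv].
have suv : supp (fun p => u p + v p) by move=> p pO; rewrite su ?sv ?addr0.
have le p : (u p + v p) ^+ 2 * p.1 <= 2 * (u p ^+ 2 * p.1) + 2 * (v p ^+ 2 * p.1).
  have [/andP[/andP[/ltW p0 _] _]|pO] := boolP (inO p); last first.
    by rewrite su ?sv// addr0 expr0n !mul0r !mulr0 addr0.
  rewrite !mulrA -mulrDl ler_wpM2r//.
  have := sqr_ge0 (u p - v p); lra.
have I2 : L1 leb2 (fun p => 2 * (u p ^+ 2 * p.1) + 2 * (v p ^+ 2 * p.1)).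
  by apply: L1D; exact: L1Zl.
have I1 : L1 leb2 (fun p => (u p + v p) ^+ 2 * p.1).
  apply: (@L1_le _ _ _ leb2 _ _ _ I2).
    apply: measurable_funM; last exact: measurable_p1.
    by apply: measurable_funX; exact: measurable_funD.
  by move=> p; rewrite ger0_norm// (supp_wge0 p suv).
split; first by split => //; exact: measurable_funD.
rewrite /N2 -!IntZl// -IntD; [exact: Int_le|exact: L1Zl|exact: L1Zl].
Qed.

Lemma L2wD u v : L2w u -> L2w v -> L2w (fun p => u p + v p).
Proof. by move=> Lu Lv; have [] := N2_add_le Lu Lv. Qed.

Lemma L2wN u : L2w u -> L2w (fun p => - u p).
Proof. by move=> Lu; under eq_fun do rewrite -mulN1r; exact: L2wZ. Qed.

Lemma L2wB u v : L2w u -> L2w v -> L2w (fun p => u p - v p).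
Proof. by move=> Lu Lv; apply: L2wD => //; exact: L2wN. Qed.

Lemma L2w_sum (I : Type) (s : seq I) (F : I -> R * R -> R) :
  (forall i, L2w (F i)) -> L2w (fun p => \sum_(i <- s) F i p).
Proof.
move=> LF; elim: s => [|i s IH].
  under eq_fun do rewrite big_nil; split => //.
  by under eq_fun do rewrite expr0n mul0r; exact: L1_cst0.
by under eq_fun do rewrite big_cons; exact: L2wD.
Qed.

(** Fubini gives [u^2 r] integrable on a slice; for [r > 0] the factor [r] is divided out, and
    [|u| <= u^2 + 1] on the bounded interval gives integrability of [u]. *)
Lemma ae_slice_L2 u : L2w u ->
  {ae leb, forall r, L1 leb (fun z => u (r, z)) /\ L1 leb (fun z => u (r, z) ^+ 2)}.
Proof.
move=> [mu su Iu]; have [ae1 _ _ _] := plane_fubini1 Iu.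
apply: (ae_imp ae1) => r /= Ir.
have mr : measurable_fun setT (fun z => u (r, z)) by exact: measurable_slice.
have [r0|r0] := leP r 0.
  have E z : u (r, z) = 0 by apply: su; rewrite /inO/= ltNge r0.
  by split; rewrite (_ : (fun z => _) = fun=> 0); try exact: L1_cst0;
    apply/funext => z; rewrite E ?expr0n.
have I2 : L1 leb (fun z => u (r, z) ^+ 2).
  have := L1Zr r^-1 Ir; congr (L1 _ _).
  by apply/funext => z; rewrite mulfK// gt_eqF.
split => //.
apply: (@L1_le _ _ _ leb _ (fun z => u (r, z) ^+ 2 + 1 * itvJ a z)) => //.
  by apply: L1D => //; apply: L1_itvJ => z; exact: cvg_cst.
move=> z; rewrite /itvJ mul1r.
have [za|za] := boolP (- a < z < a); last first.
  by rewrite su ?normr0 ?expr0n ?addr0// /inO/= (negbTE za) andbF.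
rewrite -[u _ ^+ 2]real_normK ?num_real// (_ : true%:R = 1)//.
have := sqr_ge0 (`|u (r, z)| - 2^-1); rewrite sqrrB; have := normr_ge0 (u (r, z)); lra.
Qed.

(** For [g = sn a k] this is the [k]-th mode of [u] as a function of [r]. *)
Definition zint u g r := \int[leb]_z (u (r, z) * g z).

Lemma measurable_zint u g : measurable_fun setT u -> measurable_fun setT g ->
  measurable_fun setT (zint u g).
Proof.
move=> mu mg; apply: (measurable_Int_slice (F := fun p : R * R => u p * g p.2)).
by apply: measurable_funM => //; exact: measurableT_comp.
Qed.

Lemma zint_out u g r : supp u -> ~~ (0 < r < rad) -> zint u g r = 0.
Proof.
move=> su rO; rewrite /zint (@eq_Int _ _ _ leb _ (fun=> 0)) ?Int0// => z.
by rewrite su ?mul0r// /inO/= (negbTE rO).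
Qed.

Lemma slice_sqr_w u : L2w u ->
  L1 leb (fun r => (\int[leb]_z u (r, z) ^+ 2) * r) /\
  \int[leb]_r ((\int[leb]_z u (r, z) ^+ 2) * r) = N2 u.
Proof.
move=> Lu; have [mu su Iu] := Lu; have [_ _ I1 E1] := plane_fubini1 Iu.
have E : {ae leb, forall r, \int[leb]_z (u (r, z) ^+ 2 * r) = (\int[leb]_z u (r, z) ^+ 2) * r}.
  by apply: (ae_imp (ae_slice_L2 Lu)) => r [_ I2]; rewrite IntZr.
have m1 : measurable_fun setT (fun r => (\int[leb]_z u (r, z) ^+ 2) * r).
  apply: measurable_funM => //.
  by apply: (measurable_Int_slice (F := fun p => u p ^+ 2)); exact: measurable_funX.
split; first exact: (leb_L1_ae m1 I1 E).
rewrite /N2 E1; apply: Int_ae => //; first exact: L1_measurable I1.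
by apply: (ae_imp E) => r ->.
Qed.

Lemma zint_sqr_w u g (B : R) : L2w u -> measurable_fun setT g ->
  (forall z, `|g z| <= B) -> L1 leb (fun r => zint u g r ^+ 2 * r).
Proof.
move=> Lu mg gB; have [mu su Iu] := Lu; have [I1 _] := slice_sqr_w Lu.
have IJ : L1 leb (fun z => B ^+ 2 * (1 * itvJ a z)).
  by apply: L1Zl; apply: L1_itvJ => z; exact: cvg_cst.
pose C := \int[leb]_z (B ^+ 2 * (1 * itvJ a z)).
have mz : measurable_fun setT (fun r => zint u g r ^+ 2 * r).
  by apply: measurable_funM => //; apply: measurable_funX; exact: measurable_zint.
have le1 : {ae leb, forall r, zint u g r ^+ 2 * `|r| <= ((\int[leb]_z u (r, z) ^+ 2) * r) * C}.
  apply: (ae_imp (ae_slice_L2 Lu)) => r [Ir I2].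
  have [r0|r0] := boolP (0 < r < rad); last first.
    rewrite zint_out// expr0n mul0r.
    rewrite (@eq_Int _ _ _ leb _ (fun=> 0)) ?Int0 ?mul0r// => z.
    by rewrite su ?expr0n// /inO/= (negbTE r0).
  move: r0 => /andP[r0 _]; rewrite gtr0_norm// [leRHS]mulrAC; apply: ler_wpM2r; first exact: ltW.
  apply: (Int_cauchy_schwarz _ I2 IJ _ _ _).2.
  - by apply: measurable_funM => //; exact: measurable_slice.
  - by move=> z; exact: sqr_ge0.
  - by move=> z; rewrite mulr_ge0 ?sqr_ge0// mul1r /itvJ.
  - move=> z; have [za|za] := boolP (- a < z < a); last first.
      rewrite su ?mul0r ?expr0n ?mul0r//=; last by rewrite /inO/= (negbTE za) andbF.
    rewrite exprMn ler_wpM2l ?sqr_ge0// itvJ_in// !mulr1.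
    by rewrite -[leLHS]real_normK ?num_real// ler_pXn2r// nnegrE (le_trans _ (gB z)).
have I3 : L1 leb (fun r => `|((\int[leb]_z u (r, z) ^+ 2) * r) * C|).
  by apply: L1_norm; exact: L1Zr.
(* The bound [le1] holds almost everywhere only; the minimum satisfies it everywhere without leaving
   the class. *)
pose m r := Order.min (zint u g r ^+ 2 * `|r|) `|((\int[leb]_z u (r, z) ^+ 2) * r) * C|.
have mm : measurable_fun setT m.
  apply: measurable_minr; last exact: L1_measurable I3.
  apply: measurable_funM; first by apply: measurable_funX; exact: measurable_zint.
  exact: normr_measurable.
have Im : L1 leb m.
  apply: (@L1_le _ _ _ leb _ _ mm I3) => r; rewrite ger0_norm ?ge_min ?lexx ?orbT//.
  by rewrite le_min normr_ge0 mulr_ge0 ?sqr_ge0.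
apply: (leb_L1_ae mz Im); apply: (ae_imp le1) => r h.
rewrite /m min_l; last by rewrite (le_trans h)// ler_norm.
have [r0|r0] := boolP (0 < r < rad); last by rewrite zint_out// expr0n !mul0r.
by move: r0 => /andP[r0 _]; rewrite gtr0_norm.
Qed.

Lemma L1_w_of_sqr f : measurable_fun setT f -> (forall r, ~~ (0 < r < rad) -> f r = 0) ->
  L1 leb (fun r => f r ^+ 2 * r) -> L1 leb (fun r => f r * r).
Proof.
move=> mf f0 If.
have IJ : L1 leb (fun x : R => `|x| * (0 <= x <= rad)%R%:R).
  by apply: L1_continuous_segment => x; apply: cvg_norm; exact: cvg_id.
apply: (@L1_le _ _ _ leb _ (fun r => f r ^+ 2 * r + `|r| * (0 <= r <= rad)%R%:R)).
- exact: measurable_funM.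
- exact: L1D.
- move=> r; have [/andP[r0 rr]|r0] := boolP (0 < r < rad); last first.
    by rewrite f0// expr0n !mul0r normr0 add0r mulr_ge0.
  rewrite (ltW r0) (ltW rr) /= normrM (gtr0_norm r0) mulr1.
  rewrite (_ : _ + r = (f r ^+ 2 + 1) * r); last by ring.
  apply: ler_wpM2r; first exact: ltW.
  rewrite -[f r ^+ 2]real_normK ?num_real//.
  have := sqr_ge0 (`|f r| - 2^-1); rewrite sqrrB; have := normr_ge0 (f r); lra.
Qed.

Lemma zint_fubini u g h (M B : R) : L2w u ->
  measurable_fun setT g -> (forall z, `|g z| <= B) ->
  measurable_fun setT h -> (forall r, 0 < r < rad -> `|h r| <= M * r) ->
  [/\ L1 leb2 (fun p => u p * (h p.1 * g p.2)), L1 leb (fun r => zint u g r * h r) &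
  \int[leb2]_p (u p * (h p.1 * g p.2)) = \int[leb]_r (zint u g r * h r)].
Proof.
move=> Lu mg gB mh hM; have [mu su Iu] := Lu.
have m2 : measurable_fun setT (fun p : R * R => h p.1 * g p.2).
  by apply: measurable_funM; apply: measurableT_comp => //; exact: measurable_p1.
have bnd p : inO p -> `|h p.1 * g p.2| <= M * B * p.1.
  move=> /andP[p1 _]; rewrite normrM mulrAC ler_pM//; exact: hM.
have [I1 _] := pairing Lu m2 bnd.
have [_ _ I2 E2] := plane_fubini1 I1.
have mz : measurable_fun setT (fun r => zint u g r * h r).
  by apply: measurable_funM => //; exact: measurable_zint.
have E : {ae leb, forall r, \int[leb]_z (u (r, z) * (h r * g z)) = zint u g r * h r}.
  apply: (ae_imp (ae_slice_L2 Lu)) => r [Ir _].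
  rewrite /zint -IntZr; first by apply: eq_Int => z; ring.
  exact: (leb_mulr_bounded Ir mg gB).
split => //; first exact: (leb_L1_ae mz I2 E).
by rewrite E2; apply: Int_ae => //; exact: L1_measurable I2.
Qed.

Definition rint u h z := \int[leb]_r (u (r, z) * h r).

Lemma rint_fubini u g h (M B : R) : L2w u ->
  measurable_fun setT g -> (forall z, `|g z| <= B) ->
  measurable_fun setT h -> (forall r, 0 < r < rad -> `|h r| <= M * r) ->
  [/\ L1 leb (rint u h), (forall z, ~~ (- a < z < a) -> rint u h z = 0) &
  \int[leb2]_p (u p * (h p.1 * g p.2)) = \int[leb]_z (rint u h z * g z)].
Proof.
move=> Lu mg gB mh hM; have [mu su Iu] := Lu.
have o z : ~~ (- a < z < a) -> rint u h z = 0.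
  move=> za; rewrite /rint (@eq_Int _ _ _ leb _ (fun=> 0)) ?Int0// => r.
  by rewrite su ?mul0r// /inO/= (negbTE za) andbF.
have [I0 _ _] := zint_fubini Lu (@measurable_cst _ _ _ _ setT (1 : R)) (fun z => lexx `|1|) mh hM.
have [ae1 m1 I1 _] := plane_fubini2 I0.
have E z : \int[leb]_r (u (r, z) * (h r * 1)) = rint u h z.
  by apply: eq_Int => r; rewrite mulr1.
have [I2 _ _] := zint_fubini Lu mg gB mh hM.
have [_ m3 I3 E3] := plane_fubini2 I2.
have Ir : L1 leb (rint u h) by move: I1; rewrite (funext E).
split => //; rewrite E3; apply: Int_ae => //.
  by apply: measurable_funM => //; exact: L1_measurable Ir.
apply: (ae_imp ae1) => z /= Iz.
rewrite /rint -IntZr; first by apply: eq_Int => r; ring.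
by move: Iz; under eq_fun do rewrite mulr1.
Qed.

End weighted_L2.

(** * Integration by parts up to the boundary *)

Section traces.
Context {R : realType} (rad a : R) (rad0 : 0 < rad) (a0 : 0 < a).
Local Notation leb := (@lebesgue_measure R).
Local Notation leb2 := (leb \x leb)%E.
Local Notation inO := (inO rad a).
Local Notation supp := (supp rad a).
Local Notation L2w := (L2w rad a).
Implicit Types (u v w psi psir psiz : R * R -> R) (f g h m : R -> R) (p : R * R) (r z : R).

Lemma Int_deriv_oo c d f : c <= d -> C1 f ->
  L1 leb (fun x => derive1 f x * (c < x < d)%R%:R) /\
  \int[leb]_x (derive1 f x * (c < x < d)%R%:R) = f d - f c.
Proof.
move=> cd [df cf']; have mf' := continuous_measurable_fun cf'.
have I1 := L1_continuous_segment c d cf'.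
have ml : measurable_fun setT (fun x : R => (c < x < d)%R%:R : R).
  rewrite (_ : (fun x => _) = fun x => (c < x)%R%:R * (x < d)%R%:R).
    by apply: measurable_funM; exact: measurable_lt_nat.
  by apply/funext => x; case: (c < x); case: (x < d); rewrite ?mulr1 ?mul1r ?mulr0.
have mfl : measurable_fun setT (fun x => derive1 f x * (c < x < d)%R%:R).
  exact: measurable_funM.
have E : {ae leb, forall x, derive1 f x * (c <= x <= d)%R%:R =
    derive1 f x * (c < x < d)%R%:R}.
  apply: (ae_imp2 (ae_neq c) (ae_neq d)) => x x1 x2; congr (_ * _%:R).
  by rewrite !le_eqVlt (negbTE x2) eq_sym (negbTE x1).
split; first exact: (leb_L1_ae mfl I1 E).
rewrite -(Prim_of_deriv df cf' cd (lexx d)) /Prim.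
transitivity (\int[leb]_x (derive1 f x * (c <= x <= d)%R%:R)).
  by apply/esym; apply: Int_ae => //; exact: L1_measurable I1.
apply: eq_Int => x; have [/andP[_ ->]|_] := boolP (c <= x <= d); first by rewrite !mulr1.
by rewrite !mulr0 mul0r.
Qed.

Lemma L2norm2E u v : L2w v -> (forall p, inO p -> u p = v p) ->
  L2norm2 rad a u = (N2 v)%:E.
Proof.
move=> [mv sv Iv] uv; rewrite /L2norm2 /N2 -(Int_EFin Iv) [LHS]integral_mkcond.
apply: eq_integral => p _; rewrite patchE mem_Omega.
by have [/uv ->//|/sv ->] := boolP (inO p); rewrite expr0n mul0r.
Qed.

Lemma L2w_of_in_L2 u : in_L2 rad a u -> L2w (fun p => u p * (inO p)%:R).
Proof.
move=> [mu uoo].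
have E : (fun p => u p * (inO p)%:R) = u \_ (Omega rad a).
  apply/funext => p; rewrite patchE mem_Omega.
  by case: (inO p); rewrite ?mulr1 ?mulr0.
have m1 : measurable_fun setT (fun p => u p * (inO p)%:R).
  rewrite E; apply/(measurable_restrictT _ _).1 => //.
  exact: measurable_Omega.
have s1 : supp (fun p => u p * (inO p)%:R).
  by move=> p /negbTE ->; rewrite mulr0.
split => //.
apply: (@L1_ge0P _ _ _ leb2).
- by apply: measurable_funM; [exact: measurable_funX|exact: measurable_p1].
- by move=> p; exact: (supp_wge0 p s1).
- rewrite /L2norm2 integral_mkcond in uoo; apply: le_lt_trans uoo.
  rewrite le_eqVlt; apply/orP; left; apply/eqP; apply: eq_integral => p _.
  rewrite patchE mem_Omega; have [_|_] := boolP (inO p); first by rewrite mulr1.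
  by rewrite mulr0 expr0n mul0r.
Qed.

Lemma L2w_continuous u : continuous u -> L2w (fun p => u p * (inO p)%:R).
Proof.
move=> cu.
have [M uM] : exists M, forall p, inO p -> `|u p| <= M.
  have K := compact_setX (@segment_compact R 0 rad) (@segment_compact R (- a) a).
  have Kn0 : (`[0, rad]%classic `*` `[- a, a]%classic) !=set0.
    exists (0, a); split; rewrite /= in_itv/= lexx ?andbT; first exact: ltW.
    by rewrite ge0_cp// ltW.
  have c1 : {within `[0, rad]%classic `*` `[- a, a]%classic, continuous (fun p : R * R => `|u p|)}.
    by apply: continuous_subspaceT => x; apply: cvg_norm; exact: cu.
  have [q _ Hq] := compact_EVT_max Kn0 K c1.
  exists `|u q| => p /andP[/andP[/ltW h1 /ltW h2] /andP[/ltW h3 /ltW h4]].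
  by apply: Hq; rewrite inE; split; rewrite /= in_itv/= ?h1 ?h3.
have mu := continuous_measurable_plane cu.
split.
- by apply: measurable_funM => //; exact: measurable_inO.
- by move=> p /negbTE ->; rewrite mulr0.
- rewrite (_ : (fun p => _) = (fun p => (u p ^+ 2 * p.1) * (inO p)%:R)); last first.
    by apply/funext => p; case: (inO p); rewrite ?mulr1 ?mulr0 ?expr0n ?mul0r.
  apply: (@L1_mul_inO _ _ _ rad0 a0 _ (M ^+ 2 * rad)).
    by apply: measurable_funM; [exact: measurable_funX|exact: measurable_p1].
  move=> p pO; have h := uM _ pO; move: pO => /andP[/andP[/ltW h1 /ltW h2] _].
  rewrite normrM (ger0_norm h1) ler_pM// ger0_norm ?sqr_ge0//.
  by rewrite -[leLHS]real_normK ?num_real// ler_pXn2r// nnegrE (le_trans _ h).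
Qed.

(** [zero_trace] with real integrals over the whole plane and the three parts of the boundary
    separated. [N2] is a real number even for a non-integrable function, so membership in [L2w] is
    recorded next to each convergence. *)
Definition trace0 psi psir psiz := exists u : nat -> R * R -> R,
  [/\ forall n, smooth2 (u n),
   (forall n, L2w (fun p => u n p * (inO p)%:R - psi p)) /\
      N2 (fun p => u n p * (inO p)%:R - psi p) @[n --> \oo] --> 0,
   (forall n, L2w (fun p => 'D_er (u n) p * (inO p)%:R - psir p)) /\
      N2 (fun p => 'D_er (u n) p * (inO p)%:R - psir p) @[n --> \oo] --> 0,
   (forall n, L2w (fun p => 'D_ez (u n) p * (inO p)%:R - psiz p)) /\
      N2 (fun p => 'D_ez (u n) p * (inO p)%:R - psiz p) @[n --> \oo] --> 0 &
   [/\ \int[leb]_z (u n (rad, z) ^+ 2 * itvJ a z) @[n --> \oo] --> 0,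
      \int[leb]_r (u n (r, a) ^+ 2 * r * (0 < r < rad)%R%:R) @[n --> \oo] --> 0 &
      \int[leb]_r (u n (r, - a) ^+ 2 * r * (0 < r < rad)%R%:R) @[n --> \oo] --> 0] ].

(** The boundary term at [rad] disappears through the trace and not through [m]: for the smooth
    approximations it is [Bn n], which the norm on the lateral boundary sends to 0. The term at the
    axis is removed by [m 0 = 0], the axis not being part of the boundary. *)
Lemma trace_radial psi psir psiz m g (M B : R) :
  L2w psi -> L2w psir -> trace0 psi psir psiz ->
  C1 m -> m 0 = 0 -> (forall r, 0 < r < rad -> `|m r| <= M * r) ->
  (forall r, 0 < r < rad -> `|derive1 m r| <= M * r) ->
  measurable_fun setT g -> (forall z, `|g z| <= B) ->
  \int[leb2]_p (psi p * (derive1 m p.1 * g p.2)) =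
  - \int[leb2]_p (psir p * (m p.1 * g p.2)).
Proof.
move=> Lp Lr [u [su [Lu Nu] [Lur Nur] _ [S1 _ _]]] Cm m0 mM m'M mg gB.
have mm := continuous_measurable_fun (C1_continuous Cm).
have mm' : measurable_fun setT (derive1 m) by apply: continuous_measurable_fun; exact: Cm.2.
have mt h : measurable_fun setT h -> measurable_fun setT (fun p : R * R => h p.1 * g p.2).
  move=> mh; apply: measurable_funM; apply: measurableT_comp => //; exact: measurable_p1.
have bt h : (forall r, 0 < r < rad -> `|h r| <= M * r) ->
   forall p, inO p -> `|h p.1 * g p.2| <= M * B * p.1.
  by move=> hM p /andP[p1 _]; rewrite normrM mulrAC ler_pM//; exact: hM.
have Lpc v h : L2w v -> measurable_fun setT h ->
    (forall r, 0 < r < rad -> `|h r| <= M * r) -> L1 leb2 (fun p => v p * (h p.1 * g p.2)).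
  by move=> Lv mh hM; exact: (pairing rad0 a0 Lv (mt h mh) (bt h hM)).1.
have c1 := pairing_cvg rad0 a0 Lu Nu (mt _ mm') (bt _ m'M).
have c2 := pairing_cvg rad0 a0 Lur Nur (mt _ mm) (bt _ mM).
have LU n := L2w_continuous (smooth2_continuous (su n)).
have LUr n := L2w_continuous (smooth2_continuous (smooth2_D_er (su n))).
pose T := \int[leb2]_p (psi p * (derive1 m p.1 * g p.2)) +
          \int[leb2]_p (psir p * (m p.1 * g p.2)).
pose Bn n := \int[leb]_z (u n (rad, z) * (m rad * (g z * itvJ a z))).
(* The fundamental theorem of calculus on each slice; the first two integrals on the right are the
   approximation errors, which tend to 0. *)
have E n : Bn n = \int[leb2]_p ((u n p * (inO p)%:R - psi p) * (derive1 m p.1 * g p.2)) +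
   \int[leb2]_p (('D_er (u n) p * (inO p)%:R - psir p) * (m p.1 * g p.2)) + T.
  have P1 := Lpc _ _ (Lu n) mm' m'M; have P2 := Lpc _ _ (Lur n) mm mM.
  have P3 := Lpc _ _ Lp mm' m'M; have P4 := Lpc _ _ Lr mm mM.
  rewrite /T addrACA -(IntD P1 P3) -(IntD P2 P4) -(IntD (L1D P1 P3) (L1D P2 P4)).
  transitivity (\int[leb2]_p (u n p * (inO p)%:R * (derive1 m p.1 * g p.2) +
      'D_er (u n) p * (inO p)%:R * (m p.1 * g p.2))); last first.
    by apply: eq_Int => p; set b : R := (inO p)%:R; ring.
  have [_ _ _ ->] := plane_fubini2 (L1D (Lpc _ _ (LU n) mm' m'M) (Lpc _ _ (LUr n) mm mM)).
  apply: eq_Int => z /=.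
  have Cu := smooth2_C1_slice1 z (su n).
  have [Cum eum] := C1M Cu Cm.
  have [J1 J2] := Int_deriv_oo (ltW rad0) Cum.
  have -> : u n (rad, z) * (m rad * (g z * itvJ a z)) = (g z * itvJ a z) *
      \int[leb]_r (derive1 (fun r => u n (r, z) * m r) r * (0 < r < rad)%R%:R).
    by rewrite J2 m0 mulr0 subr0; ring.
  rewrite -IntZl//; apply: eq_Int => r.
  rewrite eum -D_erE /inO /itvJ /=.
  by case: (0 < r < rad); case: (- a < z < a); rewrite /= ?mulr0 ?mul0r ?mulr1 ?addr0//; ring.
have IJ : L1 leb (fun z => (m rad * B) ^+ 2 * (1 * itvJ a z)).
  by apply: L1Zl; apply: L1_itvJ => z; exact: cvg_cst.
have Bsq n : Bn n ^+ 2 <= \int[leb]_z (u n (rad, z) ^+ 2 * itvJ a z) *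
    \int[leb]_z ((m rad * B) ^+ 2 * (1 * itvJ a z)).
  have cu : continuous (fun z => u n (rad, z)).
    exact: continuous_slice2 (smooth2_continuous (su n)).
  apply: (Int_cauchy_schwarz _ _ IJ _ _ _).2.
  - apply: measurable_funM; first exact: continuous_measurable_fun.
    by apply: measurable_funM => //; apply: measurable_funM => //; exact: measurable_itvJ.
  - apply: L1_itvJ => z; exact: (cvgM (cu z) (cu z)).
  - by move=> z; rewrite mulr_ge0 ?sqr_ge0// /itvJ.
  - by move=> z; rewrite mulr_ge0 ?sqr_ge0// mul1r /itvJ.
  - move=> z; rewrite /itvJ; case: (- a < z < a); rewrite ?mulr0 ?expr0n// !mulr1.
    rewrite !exprMn ler_wpM2l ?sqr_ge0// ler_wpM2l ?sqr_ge0//.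
    by rewrite -[leLHS]real_normK ?num_real// ler_pXn2r// nnegrE (le_trans _ (gB z)).
have cB : Bn n @[n --> \oo] --> 0.
  have c : \int[leb]_z (u n (rad, z) ^+ 2 * itvJ a z) *
    \int[leb]_z ((m rad * B) ^+ 2 * (1 * itvJ a z)) @[n --> \oo] --> (0 : R).
    rewrite -[X in _ --> X](mul0r (\int[leb]_z ((m rad * B) ^+ 2 * (1 * itvJ a z)))).
    by apply: cvgM => //; exact: cvg_cst.
  apply/cvgrPdist_lt => e e0; have e2 : 0 < e ^+ 2 by rewrite exprn_gt0.
  move/cvgrPdist_lt : c => /(_ _ e2); apply: filterS => n.
  rewrite !sub0r !normrN => h.
  rewrite -(@ltr_pXn2r _ 2) ?nnegrE//; last exact: ltW.
  rewrite real_normK ?num_real//; apply: (le_lt_trans (Bsq n)).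
  by rewrite (le_lt_trans _ h)// ler_norm.
have cT : Bn n @[n --> \oo] --> 0 + 0 + T.
  rewrite (funext E); apply: cvgD; last exact: cvg_cst.
  exact: cvgD.
have := cvg_unique (@Rhausdorff R) cB cT; rewrite addr0 add0r /T => e.
by apply/eqP; rewrite -addr_eq0 -e.
Qed.

Lemma trace_axial psi psir psiz h c (M : R) :
  L2w psi -> L2w psiz -> trace0 psi psir psiz ->
  measurable_fun setT h -> (forall r, 0 < r < rad -> `|h r| <= M * r) -> C1 c ->
  \int[leb2]_p (psi p * (h p.1 * (derive1 c p.2 * itvJ a p.2))) =
  - \int[leb2]_p (psiz p * (h p.1 * (c p.2 * itvJ a p.2))).
Proof.
move=> Lp Lz [u [su [Lu Nu] _ [Luz Nuz] [_ S2 S3]]] mh hM Cc.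
have bJ f : continuous f -> exists B, forall z, `|f z * itvJ a z| <= B.
  move=> cf; have n0 : `[- a, a]%classic !=set0.
    by exists a; rewrite /= in_itv/= lexx andbT ge0_cp// ltW.
  have [q _ Hq] := compact_EVT_max n0 (@segment_compact R (- a) a)
     (continuous_subspaceT (fun x => cvg_norm (cf x))).
  exists `|f q| => z; rewrite /itvJ; have [/andP[/ltW z1 /ltW z2]|_] := boolP (- a < z < a).
    by rewrite mulr1; apply: Hq; rewrite inE /= in_itv/= z1.
  by rewrite mulr0 normr0.
have [B0 hB0] := bJ _ (C1_continuous Cc); have [B1 hB1] := bJ _ Cc.2.
have mJ f : continuous f -> measurable_fun setT (fun z => f z * itvJ a z).
  move=> cf; apply: measurable_funM; last exact: measurable_itvJ.
  exact: continuous_measurable_fun.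
have mc := mJ _ (C1_continuous Cc); have mc' := mJ _ Cc.2.
have mt g : measurable_fun setT g -> measurable_fun setT (fun p : R * R => h p.1 * g p.2).
  move=> mg; apply: measurable_funM; apply: measurableT_comp => //; exact: measurable_p1.
have bt g B : (forall z, `|g z| <= B) ->
   forall p, inO p -> `|h p.1 * g p.2| <= M * B * p.1.
  by move=> gB p /andP[p1 _]; rewrite normrM mulrAC ler_pM//; exact: hM.
have Lpc v g B : L2w v -> measurable_fun setT g -> (forall z, `|g z| <= B) ->
    L1 leb2 (fun p => v p * (h p.1 * g p.2)).
  by move=> Lv mg gB; exact: (pairing rad0 a0 Lv (mt g mg) (bt g B gB)).1.
have c1 := pairing_cvg rad0 a0 Lu Nu (mt _ mc') (bt _ _ hB1).
have c2 := pairing_cvg rad0 a0 Luz Nuz (mt _ mc) (bt _ _ hB0).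
have LU n := L2w_continuous (smooth2_continuous (su n)).
have LUz n := L2w_continuous (smooth2_continuous (smooth2_D_ez (su n))).
pose T := \int[leb2]_p (psi p * (h p.1 * (derive1 c p.2 * itvJ a p.2))) +
          \int[leb2]_p (psiz p * (h p.1 * (c p.2 * itvJ a p.2))).
pose Bn e n := \int[leb]_r (u n (r, e) * (c e * (h r * (0 < r < rad)%R%:R))).
have mI : measurable_fun setT (fun r : R => (0 < r < rad)%R%:R : R).
  rewrite (_ : (fun x => _) = fun x => (0 < x)%R%:R * (x < rad)%R%:R).
    by apply: measurable_funM; exact: measurable_lt_nat.
  by apply/funext => x; case: (0 < x); case: (x < rad); rewrite ?mulr1 ?mul1r ?mulr0.
have II : L1 leb (fun r => (M ^+ 2 * r) * (0 < r < rad)%R%:R).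
  have cI : continuous (fun r : R => M ^+ 2 * r) by move=> r; apply: cvgM; [exact: cvg_cst|exact: cvg_id].
  have I1 := L1_continuous_segment 0 rad cI.
  apply: (leb_L1_le _ I1); first by apply: measurable_funM => //; exact: continuous_measurable_fun.
  move=> r; have [/andP[r0 rr]|_] := boolP (0 < r < rad).
    by rewrite (ltW r0) (ltW rr) !mulr1 ger0_norm// mulr_ge0 ?sqr_ge0// ltW.
  rewrite mulr0 normr0; have [/andP[r0 _]|_] := boolP (0 <= r <= rad); last by rewrite mulr0.
  by rewrite mulr1 mulr_ge0 ?sqr_ge0.
have hsq r : (h r * (0 < r < rad)%R%:R) ^+ 2 <= M ^+ 2 * r * r * (0 < r < rad)%R%:R.
  have [rr|_] := boolP (0 < r < rad); last by rewrite !mulr0 expr0n.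
  rewrite !mulr1 -mulrA -expr2 -exprMn -[leLHS]real_normK ?num_real//.
  by rewrite ler_pXn2r ?nnegrE// ?(le_trans _ (hM _ rr))//; exact: hM.
have bsq e n : L1 leb (fun r => u n (r, e) * (c e * (h r * (0 < r < rad)%R%:R))) /\
    Bn e n ^+ 2 <= \int[leb]_r (u n (r, e) ^+ 2 * r * (0 < r < rad)%R%:R) *
    (c e ^+ 2 * \int[leb]_r ((M ^+ 2 * r) * (0 < r < rad)%R%:R)).
  have cu : continuous (fun r => u n (r, e)).
    exact: continuous_slice1 (smooth2_continuous (su n)).
  have cu2 : continuous (fun r => u n (r, e) ^+ 2 * r).
    move=> r; apply: cvgM; last exact: cvg_id.
    exact: (cvgM (cu r) (cu r)).
  rewrite -IntZl//; apply: Int_cauchy_schwarz.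
  - apply: measurable_funM; first exact: continuous_measurable_fun.
    by apply: measurable_funM => //; exact: measurable_funM.
  - have I1 := L1_continuous_segment 0 rad cu2.
    apply: (leb_L1_le _ I1); first by apply: measurable_funM => //; exact: continuous_measurable_fun.
    move=> r; have [/andP[r0 rr]|_] := boolP (0 < r < rad).
      by rewrite (ltW r0) (ltW rr) !mulr1 ger0_norm// mulr_ge0 ?sqr_ge0// ltW.
    rewrite mulr0 normr0; have [/andP[r0 _]|_] := boolP (0 <= r <= rad); last by rewrite mulr0.
    by rewrite mulr1 mulr_ge0 ?sqr_ge0.
  - exact: L1Zl.
  - move=> r; have [/andP[r0 _]|_] := boolP (0 < r < rad); last by rewrite mulr0.
    by rewrite mulr1 mulr_ge0 ?sqr_ge0// ltW.
  - move=> r; rewrite mulr_ge0 ?sqr_ge0//.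
    have [/andP[r0 _]|_] := boolP (0 < r < rad); last by rewrite mulr0.
    by rewrite mulr1 mulr_ge0 ?sqr_ge0// ltW.
  - move=> r; have := hsq r; have [rr|_] := boolP (0 < r < rad); last by rewrite !mulr0 expr0n.
    rewrite !mulr1 => hs.
    rewrite !exprMn (_ : _ * (c e ^+ 2 * _) = u n (r, e) ^+ 2 * (c e ^+ 2 * (M ^+ 2 * r * r))); last by ring.
    by rewrite ler_wpM2l ?sqr_ge0// ler_wpM2l ?sqr_ge0.
have E n : Bn a n - Bn (- a) n =
   \int[leb2]_p ((u n p * (inO p)%:R - psi p) * (h p.1 * (derive1 c p.2 * itvJ a p.2))) +
   \int[leb2]_p (('D_ez (u n) p * (inO p)%:R - psiz p) * (h p.1 * (c p.2 * itvJ a p.2))) + T.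
  have P1 := Lpc _ _ _ (Lu n) mc' hB1; have P2 := Lpc _ _ _ (Luz n) mc hB0.
  have P3 := Lpc _ _ _ Lp mc' hB1; have P4 := Lpc _ _ _ Lz mc hB0.
  rewrite /T addrACA -(IntD P1 P3) -(IntD P2 P4) -(IntD (L1D P1 P3) (L1D P2 P4)).
  transitivity (\int[leb2]_p (u n p * (inO p)%:R * (h p.1 * (derive1 c p.2 * itvJ a p.2)) +
      'D_ez (u n) p * (inO p)%:R * (h p.1 * (c p.2 * itvJ a p.2)))); last first.
    by apply: eq_Int => p; set b : R := (inO p)%:R; ring.
  have I1 := Lpc _ _ _ (LU n) mc' hB1; have I2 := Lpc _ _ _ (LUz n) mc hB0.
  have [_ _ _ ->] := plane_fubini1 (L1D I1 I2).
  rewrite /Bn -IntB; [|exact: (bsq a n).1|exact: (bsq (- a) n).1].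
  apply: eq_Int => r /=.
  have Cu := smooth2_C1_slice2 r (su n).
  have [Cum eum] := C1M Cu Cc.
  have aa : - a <= a by rewrite ge0_cp// ltW.
  have [J1 J2] := Int_deriv_oo aa Cum.
  have -> : u n (r, a) * (c a * (h r * (0 < r < rad)%R%:R)) -
      u n (r, - a) * (c (- a) * (h r * (0 < r < rad)%R%:R)) = (h r * (0 < r < rad)%R%:R) *
      \int[leb]_z (derive1 (fun z => u n (r, z) * c z) z * (- a < z < a)%R%:R).
    by rewrite J2; ring.
  rewrite -IntZl//; apply: eq_Int => z.
  rewrite eum -D_ezE /inO /itvJ /=.
  by case: (0 < r < rad); case: (- a < z < a); rewrite /= ?mulr0 ?mul0r ?mulr1 ?addr0//; ring.
have cB e : \int[leb]_r (u n (r, e) ^+ 2 * r * (0 < r < rad)%R%:R) @[n --> \oo] --> 0 ->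
    Bn e n @[n --> \oo] --> 0.
  move=> S.
  have cc : \int[leb]_r (u n (r, e) ^+ 2 * r * (0 < r < rad)%R%:R) *
    (c e ^+ 2 * \int[leb]_r ((M ^+ 2 * r) * (0 < r < rad)%R%:R)) @[n --> \oo] --> (0 : R).
    rewrite -[X in _ --> X](mul0r (c e ^+ 2 * \int[leb]_r ((M ^+ 2 * r) * (0 < r < rad)%R%:R))).
    by apply: cvgM => //; exact: cvg_cst.
  apply/cvgrPdist_lt => eps e0; have e2 : 0 < eps ^+ 2 by rewrite exprn_gt0.
  move/cvgrPdist_lt : cc => /(_ _ e2); apply: filterS => n.
  rewrite !sub0r !normrN => hh.
  rewrite -(@ltr_pXn2r _ 2) ?nnegrE//; last exact: ltW.
  rewrite real_normK ?num_real//; apply: (le_lt_trans (bsq e n).2).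
  by rewrite (le_lt_trans _ hh)// ler_norm.
have cBB : Bn a n - Bn (- a) n @[n --> \oo] --> (0 - 0 : R).
  by apply: cvgB; apply: cB.
have cT : Bn a n - Bn (- a) n @[n --> \oo] --> 0 + 0 + T.
  rewrite (funext E); apply: cvgD; last exact: cvg_cst.
  exact: cvgD.
have := cvg_unique (@Rhausdorff R) cBB cT; rewrite subr0 addr0 add0r /T => e.
by apply/eqP; rewrite -addr_eq0 -e.
Qed.

End traces.

(** * The modes *)

Section radial_ode.
Context {R : realType} (rad : R) (rad0 : 0 < rad).
Local Notation leb := (@lebesgue_measure R).
Implicit Types (f g h p q om : R -> R) (r t c d : R).

Definition L2r f := [/\ measurable_fun setT f, forall r, ~~ (0 < r < rad) -> f r = 0 &
  L1 leb (fun r => f r ^+ 2 * r)].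

Lemma derive1_idE : derive1 (@id R) = fun=> 1.
Proof. by apply/funext => x; exact: derive1_id. Qed.

Lemma C1_id : C1 (@id R).
Proof.
split; first by move=> x; exact: derivable_id.
by rewrite derive1_idE => x; exact: cvg_cst.
Qed.

Lemma Int_itv r : 0 <= r -> \int[leb]_t (1 * (0 <= t <= r)%R%:R) = r.
Proof.
move=> r0; rewrite -[RHS]subr0 -(Prim_of_deriv C1_id.1 C1_id.2 r0 (lexx r)) /Prim.
apply: eq_Int => t; rewrite derive1_idE.
by have [/andP[_ ->]|_] := boolP (0 <= t <= r); rewrite !(mulr1, mulr0, mul0r).
Qed.

Lemma L2r_wge0 f r : L2r f -> 0 <= f r ^+ 2 * r.
Proof.
move=> [_ f0 _]; have [/andP[r0 _]|/f0 ->] := boolP (0 < r < rad).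
  by rewrite mulr_ge0 ?sqr_ge0// ltW.
by rewrite expr0n mul0r.
Qed.

Lemma L2rZ c f : L2r f -> L2r (fun r => c * f r).
Proof.
move=> [mf f0 If]; split.
- exact: measurable_funM.
- by move=> r /f0 ->; rewrite mulr0.
- by under eq_fun do rewrite exprMn -mulrA; exact: L1Zl.
Qed.

Lemma L2rD f g : L2r f -> L2r g -> L2r (fun r => f r + g r).
Proof.
move=> Lf Lg; have [mf f0 If] := Lf; have [mg g0 Ig] := Lg; split.
- exact: measurable_funD.
- by move=> r rO; rewrite f0// g0// addr0.
- apply: (leb_L1_le _ (L1D (L1Zl 2 If) (L1Zl 2 Ig))).
    apply: measurable_funM => //; apply: measurable_funX; exact: measurable_funD.
  move=> r; have [/andP[r0 _]|rO] := boolP (0 < r < rad); last first.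
    by rewrite f0// g0// addr0 expr0n !mul0r normr0 !mulr0 addr0.
  rewrite ger0_norm; last by rewrite mulr_ge0 ?sqr_ge0// ltW.
  rewrite !mulrA -mulrDl; apply: ler_wpM2r; first exact: ltW.
  have := sqr_ge0 (f r - g r); lra.
Qed.

Lemma L2r_L1 f : L2r f -> L1 leb (fun r => f r * r).
Proof. by move=> [mf f0 If]; exact: (L1_w_of_sqr mf f0 If). Qed.

Lemma L2r_mul f g (M : R) : L2r f -> measurable_fun setT g ->
  (forall r, 0 < r < rad -> `|g r| <= M * r) -> L1 leb (fun r => f r * g r).
Proof.
move=> Lf mg gM; have [mf f0 _] := Lf.
apply: (leb_L1_le _ (L1Zl M (L1_norm (L2r_L1 Lf)))); first exact: measurable_funM.
move=> r; have [rr|/f0 ->] := boolP (0 < r < rad); last by rewrite !mul0r normr0 mulr0.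
rewrite !normrM mulrCA ler_wpM2l//; have /andP[r0 _] := rr.
by rewrite (gtr0_norm r0) gM.
Qed.

Lemma L2r_mul2 f g : L2r f -> L2r g -> L1 leb (fun r => r * f r * g r).
Proof.
move=> Lf Lg; have [mf f0 If] := Lf; have [mg g0 Ig] := Lg.
apply: (leb_L1_le _ (L1D If Ig)).
  by apply: measurable_funM => //; exact: measurable_funM.
move=> r; have [/andP[r0 _]|rO] := boolP (0 < r < rad); last first.
  by rewrite f0// g0// expr0n !(mul0r, mulr0) normr0 addr0.
rewrite -mulrA normrM (gtr0_norm r0) mulrC -mulrDl; apply: ler_wpM2r; first exact: ltW.
rewrite normrM -[f r ^+ 2]real_normK ?num_real// -[g r ^+ 2]real_normK ?num_real//.
have := sqr_ge0 (`|f r| - `|g r|); rewrite sqrrB.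
have := mulr_ge0 (normr_ge0 (f r)) (normr_ge0 (g r)).
have := sqr_ge0 (`|f r|); have := sqr_ge0 (`|g r|); lra.
Qed.

Lemma Prim_out_le f x : (forall r, ~~ (0 < r < rad) -> f r = 0) -> x <= 0 -> Prim f x = 0.
Proof.
move=> f0 x0; rewrite /Prim (@eq_Int _ _ _ leb _ (fun=> 0)) ?Int0// => t.
have [tx|] := leP t x; last by rewrite mulr0.
by rewrite f0 ?mul0r// negb_and -leNgt (le_trans tx).
Qed.

Lemma L2r_pow_L1 h n : L2r h -> L1 leb (fun r => r ^+ n.+1 * h r).
Proof.
move=> Lh; under eq_fun do rewrite mulrC; apply: (L2r_mul (M := rad ^+ n) Lh).
  exact: measurable_funX.
move=> r /andP[r0 rr]; rewrite ger0_norm ?exprn_ge0 ?(ltW r0)// exprSr.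
by apply: ler_wpM2r; [exact: ltW|apply: lerXn2r; rewrite ?nnegrE; exact: ltW].
Qed.

(* Cauchy-Schwarz: [int_0^r t^(n+1) |h| <= (int t h^2)^(1/2) (int_0^r t^(2n+1))^(1/2)]. *)
Lemma Prim_pow_sqr_le h n r : L2r h -> 0 < r < rad ->
  Prim (fun t => t ^+ n.+1 * h t) r ^+ 2 <= (\int[leb]_t (h t ^+ 2 * t)) * r ^+ n.+1 ^+ 2.
Proof.
move=> Lh /andP[r0 rr]; have [mh h0 Ih] := Lh.
have cB : continuous (fun t : R => t ^+ n.*2.+1) by exact: exprn_continuous.
have IB := L1_continuous_segment 0 r cB.
have IB' : L1 leb (fun t => (r ^+ n.*2.+1) * (1 * (0 <= t <= r)%R%:R)).
  by apply: L1Zl; apply: L1_continuous_segment => x; exact: cvg_cst.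
have EB : \int[leb]_t (r ^+ n.*2.+1 * (1 * (0 <= t <= r)%R%:R)) = r ^+ n.+1 ^+ 2.
  have I1 : L1 leb (fun t => 1 * (0 <= t <= r)%R%:R : R).
    by apply: L1_continuous_segment => x; exact: cvg_cst.
  by rewrite IntZl// Int_itv ?(ltW r0)// -exprSr -doubleS -muln2 exprM.
apply: (@le_trans _ _ (\int[leb]_t (h t ^+ 2 * t) *
   \int[leb]_t (t ^+ n.*2.+1 * (0 <= t <= r)%R%:R))).
  apply: (Int_cauchy_schwarz _ Ih IB _ _ _).2.
  - apply: measurable_funM; last exact: measurable_le_nat.
    by apply: measurable_funM => //; exact: measurable_funX.
  - by move=> t; exact: L2r_wge0.
  - move=> t; have [/andP[t0 _]|_] := boolP (0 <= t <= r); last by rewrite mulr0.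
    by rewrite mulr1 exprn_ge0.
  - move=> t; have [/andP[t0 _]|/h0 ->] := boolP (0 < t < rad); last first.
      by rewrite mulr0 mul0r expr0n !mul0r.
    rewrite (ltW t0)/=; case: (t <= r); rewrite /= ?mulr0 ?expr0n// !mulr1.
    rewrite exprMn (_ : t ^+ n.+1 ^+ 2 = t * t ^+ n.*2.+1).
      by rewrite mulrC mulrA.
    by rewrite -exprM muln2 -exprS doubleS.
apply: ler_wpM2l; first by apply: Int_ge0 => t; exact: L2r_wge0.
rewrite -EB; apply: Int_le => // t.
have [/andP[t0 tr]|_] := boolP (0 <= t <= r); last by rewrite !mulr0.
by rewrite !mulr1 ler_pXn2r ?nnegrE// (le_trans t0).
Qed.

(** A property that holds almost everywhere is met in every interval of positive length; this
    provides points arbitrarily close to the axis. *)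
Lemma ae_subinterval (P : R -> Prop) c d : 0 <= c -> c < d -> d <= rad ->
  {ae leb, forall r, 0 < r < rad -> P r} -> exists2 r, c < r < d & P r.
Proof.
move=> c0 cd dr aP; apply: contrapT => H.
have I1 : L1 leb (fun x : R => 1 * (c < x < d)%R%:R).
  by have [+ _] := Int_deriv_oo (ltW cd) C1_id; rewrite derive1_idE.
have : \int[leb]_x (1 * (c < x < d)%R%:R) = 0 :> R.
  rewrite -[RHS](@Int0 _ _ _ leb); apply: Int_ae => //.
    exact: L1_measurable I1.
  apply: (ae_imp aP) => x Px; have [/andP[cx xd]|_] := boolP (c < x < d); last by rewrite mulr0.
  exfalso; apply: H; exists x; rewrite ?cx//; apply: Px.
  by rewrite (le_lt_trans c0 cx) (lt_le_trans xd dr).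
have [_] := Int_deriv_oo (ltW cd) C1_id; rewrite derive1_idE => ->.
by move/eqP; rewrite subr_eq0 gt_eqF.
Qed.

Lemma Prim_ae_bound f (B : R) r : L1 leb f ->
  (forall t, ~~ (0 < t < rad) -> f t = 0) -> 0 <= B ->
  {ae leb, forall t, 0 < t < rad -> `|f t| <= B} -> 0 < r -> `|Prim f r| <= B * r.
Proof.
move=> If f0 B0 fB r0.
have I1 : L1 leb (fun t => 1 * (0 <= t <= r)%R%:R : R).
  by apply: L1_continuous_segment => x; exact: cvg_cst.
have -> : B * r = \int[leb]_t (B * (1 * (0 <= t <= r)%R%:R)).
  by rewrite IntZl// Int_itv// ltW.
apply: (le_trans (Int_norm (L1_le_cut r If))).
apply: Int_ae_le; first by apply: L1_norm; exact: L1_le_cut.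
  exact: L1Zl.
apply: (ae_imp fB) => t ft.
have [tr|/f0 ->] := boolP (0 < t < rad); last by rewrite mul0r normr0 mulr_ge0// mul1r.
have /andP[t0 _] := tr; rewrite (ltW t0)/=.
by case: (t <= r); rewrite /= ?mulr0 ?normr0// !mulr1; exact: ft.
Qed.

(** The support stays away from 0. The square absorbs both the weight [r] and one factor [1 / r]. *)
Lemma test1_le_sqr ee : test1 `]0, rad[ ee -> exists2 M, 0 <= M & forall r, 0 < r < rad -> `|ee r| <= M * r ^+ 2.
Proof.
move=> te; have [c [d [c0 cd dr e0]]] := test1_support rad0 te.
have [se _] := te.
have [M M0 eM] := continuous_bounded_support (smooth1_continuous se) e0.
exists (M / c ^+ 2); first by rewrite divr_ge0// sqr_ge0.
move=> r /andP[r0 _]; have [/andP[cr _]|/e0 ->] := boolP (c <= r <= d); last first.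
  by rewrite normr0 mulr_ge0 ?sqr_ge0// divr_ge0// sqr_ge0.
rewrite mulrAC ler_pdivlMr ?exprn_gt0// ler_pM ?sqr_ge0//.
by rewrite ler_pXn2r ?nnegrE// ltW.
Qed.

Section equation.
Context p h (Lp : L2r p) (Lh : L2r h).
(** The weak form of [p' + (3 / r) p = h], tested against [dr]. *)
Hypothesis eq_p : forall ee, test1 `]0, rad[ ee ->
  \int[leb]_r (p r * derive1 ee r) =
  \int[leb]_r (3 * (p r * (r^-1 * ee r))) - \int[leb]_r (h r * ee r).

Let H := \int[leb]_t (h t ^+ 2 * t).

Let H0 : 0 <= H.
Proof. by apply: Int_ge0 => t; exact: L2r_wge0. Qed.

Let test_pow n ee : test1 `]0, rad[ ee -> test1 `]0, rad[ (fun r => r ^+ n * ee r) /\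
  derive1 (fun r => r ^+ n.+1 * ee r) =
   (fun r => n.+1%:R * r ^+ n * ee r + r ^+ n.+1 * derive1 ee r).
Proof.
move=> te; have [se [C [cC CI e0]]] := te; split.
  split; first by apply: smooth1M; [apply: smooth1X; exact: smooth1_id|exact: se].
  by exists C; split => // x /e0 ->; rewrite mulr0.
have dX (x : R) : is_derive x 1 (fun r : R => r ^+ n.+1) (n.+1%:R * x ^+ n).
  have := @is_deriveX _ _ id n.+1 x 1 _ (is_derive_id x 1).
  by rewrite exprfctE /GRing.scale/= mulr1.
have [_ ->] := derive1_funM (fun x => @ex_derive _ _ _ _ _ _ _ (dX x))
  (fun x => smooth1_derivable (x := x) se).
apply/funext => x; rewrite derive1E; by rewrite (@derive_val _ _ _ _ _ _ _ (dX x)).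
Qed.

Let test_L1 f ee n : L2r f -> test1 `]0, rad[ ee -> L1 leb (fun r => f r * (r ^+ n * ee r)).
Proof.
move=> Lf te; have [[se _] _] := test_pow n te; have [M M0 eM] := test1_le_sqr te.
apply: (L2r_mul (M := M * rad * rad ^+ n) Lf).
  exact: continuous_measurable_fun (smooth1_continuous se).
move=> r rr; have /andP[r0 r1] := rr; rewrite normrM mulrC.
rewrite (_ : _ * r = (M * (rad * r)) * rad ^+ n); last by ring.
rewrite ler_pM//.
  apply: (le_trans (eM _ rr)); rewrite ler_wpM2l// expr2.
  by apply: ler_wpM2r; exact: ltW.
by rewrite ger0_norm ?exprn_ge0 ?(ltW r0)//; apply: lerXn2r; rewrite ?nnegrE; exact: ltW.
Qed.

Let smooth_deriv_L1 f ee n : L2r f -> test1 `]0, rad[ ee ->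
  L1 leb (fun r => f r * (r ^+ n * derive1 ee r)).
Proof.
move=> Lf te; apply: test_L1 => //.
have [c [d [c0 cd dr e0]]] := test1_support rad0 te; have [se _] := te.
apply: (test1_of_support c0 dr); first exact: smooth1_derive1.
by move=> x; exact: derive1_eq0_outside.
Qed.

(** Testing with [r^(n+1) ee] gives the weak form of [(r^(n+1) p)' = (n - 2) r^n p + r^(n+1) h]. For
    [n = 2] the term of order zero cancels; [n = 0] yields the weight [r] of the energy estimate. *)
Lemma weak_radial n ee : test1 `]0, rad[ ee ->
  \int[leb]_r ((r ^+ n.+1 * p r) * derive1 ee r) =
  - \int[leb]_r (((n%:R - 2) * (r ^+ n * p r) + r ^+ n.+1 * h r) * ee r).
Proof.
move=> te; have [te' e'] := test_pow n te; have [te1 _] := test_pow n.+1 te.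
have := eq_p te1; rewrite e' => E.
have I1 := test_L1 n Lp te; have I2 := smooth_deriv_L1 n.+1 Lp te.
have I3 := test_L1 n.+1 Lh te.
have E1 : \int[leb]_r (p r * (n.+1%:R * r ^+ n * ee r + r ^+ n.+1 * derive1 ee r)) =
   n.+1%:R * \int[leb]_r (p r * (r ^+ n * ee r)) +
   \int[leb]_r (p r * (r ^+ n.+1 * derive1 ee r)).
  by rewrite -IntZl// -IntD//; [apply: eq_Int => r; ring|exact: L1Zl].
have E2 : \int[leb]_r (3 * (p r * (r^-1 * (r ^+ n.+1 * ee r)))) =
   3 * \int[leb]_r (p r * (r ^+ n * ee r)).
  rewrite -IntZl//; apply: eq_Int => r.
  have [r0|r0] := boolP (0 < r < rad); last first.
    by have [_ p0 _] := Lp; rewrite p0// !mul0r.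
  by rewrite exprS (mulrA r^-1) (mulrA r^-1) mulVf ?mul1r// gt_eqF//; case/andP: r0.
rewrite E1 E2 in E.
transitivity (\int[leb]_r (p r * (r ^+ n.+1 * derive1 ee r))).
  by apply: eq_Int => r; ring.
transitivity ((2 - n%:R) * \int[leb]_r (p r * (r ^+ n * ee r)) - \int[leb]_r (h r * (r ^+ n.+1 * ee r))).
  rewrite -natr1 in E; lra.
rewrite -IntZl// -IntB//; last exact: L1Zl.
rewrite -IntN; last first.
  rewrite (_ : (fun r => _) = (fun r => (n%:R - 2) * (p r * (r ^+ n * ee r)) +
      h r * (r ^+ n.+1 * ee r))); last by apply/funext => r; ring.
  by apply: L1D => //; exact: L1Zl.
by apply: eq_Int => r; ring.
Qed.

Lemma cube_p_eq : {ae leb, forall r, 0 < r < rad ->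
  r ^+ 3 * p r = Prim (fun t => t ^+ 3 * h t) r}.
Proof.
have [mp p0 Ip] := Lp; have [mh h0 Ih] := Lh.
have [C HC] : exists C, {ae leb, forall r, 0 < r < rad ->
    r ^+ 3 * p r = C + Prim (fun t => t ^+ 3 * h t) r}.
  apply: du_Bois_Reymond => //; [exact: L2r_pow_L1|exact: L2r_pow_L1|].
  move=> ee te; rewrite (weak_radial 2 te); congr (- _).
  by apply: eq_Int => r; rewrite subrr mul0r add0r.
suff C0 : C = 0 by apply: (ae_imp HC) => r Hr rr; rewrite Hr// C0 add0r.
pose A := \int[leb]_r (p r ^+ 2 * r).
have A0 : 0 <= A by apply: Int_ge0 => t; exact: L2r_wge0.
(* If [C <> 0] then [r p^2] grows like [r^-5] at the axis. *)
have key e : 0 < e < rad -> C ^+ 2 <= e * (2 * (rad ^+ 3 * A) + 2 * (H * rad ^+ 5)).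
  move=> /andP[e0 er].
  have I1 : L1 leb (fun r => 1 * (0 <= r <= e)%R%:R : R).
    by apply: L1_continuous_segment => x; exact: cvg_cst.
  have E1 := Int_itv (ltW e0).
  have : \int[leb]_r (C ^+ 2 * (1 * (0 <= r <= e)%R%:R)) <=
     \int[leb]_r ((2 * (e ^+ 2 * rad ^+ 3)) * (p r ^+ 2 * r) +
         (2 * (H * rad ^+ 4 * e ^+ 2)) * (1 * (0 <= r <= e)%R%:R)).
    apply: Int_ae_le; first exact: L1Zl.
      by apply: L1D; exact: L1Zl.
    apply: (ae_imp2 HC (ae_neq 0)) => r Hr rn0.
    have [/andP[r0 re]|_] := boolP (0 <= r <= e); last first.
      by rewrite !mulr0 addr0 mulr_ge0 ?L2r_wge0// !mulr_ge0 ?sqr_ge0 ?exprn_ge0// ltW.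
    have rr : 0 < r < rad by rewrite lt_def rn0 r0/= (le_lt_trans re).
    have /andP[rp rlt] := rr.
    have E : C = r ^+ 3 * p r - Prim (fun t => t ^+ 3 * h t) r by rewrite Hr//; ring.
    have P2 := Prim_pow_sqr_le 2 Lh rr; rewrite -/H in P2.
    rewrite !mulr1 E.
    apply: (@le_trans _ _ (2 * (r ^+ 3 * p r) ^+ 2 + 2 * Prim (fun t => t ^+ 3 * h t) r ^+ 2)).
      have := sqr_ge0 (r ^+ 3 * p r + Prim (fun t => t ^+ 3 * h t) r); lra.
    apply: lerD.
      rewrite -mulrA ler_pM2l// (_ : _ ^+ 2 = (r ^+ 2 * r ^+ 3) * (p r ^+ 2 * r)); last by ring.
      apply: ler_wpM2r; first exact: L2r_wge0.
      by apply: ler_pM; rewrite ?exprn_ge0// ler_pXn2r ?nnegrE// ltW.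
    rewrite ler_pM2l//; apply: (le_trans P2); rewrite -mulrA; apply: ler_wpM2l => //.
    rewrite (_ : r ^+ 3 ^+ 2 = r ^+ 4 * r ^+ 2); last by ring.
    by apply: ler_pM; rewrite ?exprn_ge0// ler_pXn2r ?nnegrE// ltW.
  rewrite IntD; [|exact: L1Zl|exact: L1Zl].
  rewrite (IntZl _ I1) (IntZl _ I1) (IntZl _ Ip) E1 -/A => h1.
  have h2 : e * C ^+ 2 <= e * (e * (2 * (rad ^+ 3 * A) + 2 * (H * rad ^+ 4 * e))).
    by rewrite mulrC; apply: (le_trans h1); rewrite le_eqVlt; apply/orP; left; apply/eqP; ring.
  rewrite ler_pM2l// in h2; apply: (le_trans h2); rewrite ler_pM2l// lerD2l ler_pM2l//.
  rewrite -mulrA; apply: ler_wpM2l => //; rewrite [rad ^+ 5]exprSr.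
  by apply: ler_wpM2l; [apply: exprn_ge0; exact: ltW|exact: ltW].
set K := 2 * (rad ^+ 3 * A) + 2 * (H * rad ^+ 5) in key.
have K0 : 0 <= K by rewrite addr_ge0// !mulr_ge0 ?exprn_ge0 ?(ltW rad0).
apply/eqP; rewrite -sqrf_eq0; apply/negPn/negP => C2.
have C2p : 0 < C ^+ 2 by rewrite lt_def C2 sqr_ge0.
(* With this [e] the bound [key] would give [C^2 <= e K <= C^2 / 2]; the entry [rad / 2] keeps [e]
   below [rad]. *)
pose e := Order.min (rad / 2) (C ^+ 2 / (2 * (K + 1))).
have K1 : 0 < 2 * (K + 1) by lra.
have e0 : 0 < e by rewrite lt_min !divr_gt0.
have er : e < rad by rewrite gt_min; apply/orP; left; have := rad0; lra.
have := key e; rewrite e0 er => /(_ isT) h1.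
have : e * (2 * (K + 1)) <= C ^+ 2 by rewrite -ler_pdivlMr// ge_min lexx orbT.
have : e * K <= e * (K + 1) by rewrite ler_pM2l//; lra.
lra.
Qed.

(** [Prim_pow_sqr_le] with the exponent 3 produces [r^6], which cancels against the square of
    [r^3 p]. So [p] is bounded up to the axis, and therefore integrable. *)
Lemma p_sqr_le : {ae leb, forall r, 0 < r < rad -> p r ^+ 2 <= H}.
Proof.
apply: (ae_imp cube_p_eq) => r Hr rr; have /andP[r0 _] := rr.
have := Prim_pow_sqr_le 2 Lh rr; rewrite -Hr// -/H exprMn mulrC ler_pM2r//.
by rewrite !exprn_gt0.
Qed.

Lemma p_L1 : L1 leb p.
Proof.
have [mp p0 Ip] := Lp.
have I1 : L1 leb (fun r => (H + 1) * (1 * (0 <= r <= rad)%R%:R)).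
  by apply: L1Zl; apply: L1_continuous_segment => x; exact: cvg_cst.
apply: (leb_L1_ae_le mp I1); apply: (ae_imp p_sqr_le) => r Hr.
have [rr|/p0 ->] := boolP (0 < r < rad); last by rewrite normr0 mulr_ge0 ?mul1r// addr_ge0.
have /andP[/ltW -> /ltW ->] := rr; rewrite !mulr1.
have := Hr rr; rewrite -[p r ^+ 2]real_normK ?num_real//.
have := sqr_ge0 (`|p r| - 2^-1); rewrite sqrrB; lra.
Qed.

(** The form of the equation that is paired with [f]. It comes after [p_L1] because its right-hand
    side contains [- 2 p] without any power of [r]. *)
Lemma r_p_eq : {ae leb, forall r, r * p r = Prim (fun t => - 2 * p t + t * h t) r \/ ~~ (0 < r < rad)}.
Proof.
have [mp p0 Ip] := Lp; have [mh h0 Ih] := Lh.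
have Ip1 := p_L1; have Irh : L1 leb (fun t => t ^+ 1 * h t) by exact: L2r_pow_L1.
have Irp : L1 leb (fun t => t ^+ 1 * p t) by exact: L2r_pow_L1.
have Ig : L1 leb (fun t => - 2 * p t + t * h t).
  by apply: L1D; [exact: L1Zl|exact: Irh].
have [C HC] : exists C, {ae leb, forall r, 0 < r < rad ->
    r * p r = C + Prim (fun t => - 2 * p t + t * h t) r}.
  apply: du_Bois_Reymond => //.
  move=> ee te; have := weak_radial 0 te; under eq_Int do rewrite expr1; move=> ->.
  by congr (- _); apply: eq_Int => r; ring.
suff C0 : C = 0.
  apply: (ae_imp HC) => r Hr; have [rr|] := boolP (0 < r < rad); last by right.
  by left; rewrite Hr// C0 add0r.
have HH : 0 <= H + 1 by rewrite addr_ge0.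
(* Every other term of the identity is [O(r)] as [r -> 0]. *)
have key e : 0 < e < rad -> `|C| <= e * (4 * (H + 1)).
  move=> /andP[e0 er].
  have [r /andP[r0 re] [P1 P2]] : exists2 r, 0 < r < e &
      r * p r = C + Prim (fun t => - 2 * p t + t * h t) r /\ p r ^+ 2 <= H.
    apply: ae_subinterval => //; first exact: ltW.
    by apply: (ae_imp2 HC p_sqr_le) => x h1 h2 xx; split; [exact: h1|exact: h2].
  have rr : 0 < r < rad by rewrite r0 (lt_trans re).
  have sq_le (x : R) : x ^+ 2 <= H -> `|x| <= H + 1.
    rewrite -[x ^+ 2]real_normK ?num_real//.
    have := sqr_ge0 (`|x| - 2^-1); rewrite sqrrB; lra.
  have b1 : `|r * p r| <= e * (H + 1).
    by rewrite normrM (gtr0_norm r0) ler_pM ?sq_le// ltW.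
  have b2 : `|Prim p r| <= e * (H + 1).
    have ab : {ae leb, forall t, 0 < t < rad -> `|p t| <= H + 1}.
      by apply: (ae_imp p_sqr_le) => t ht tt; exact: sq_le (ht tt).
    apply: (le_trans (Prim_ae_bound Ip1 p0 HH ab r0)).
    by rewrite mulrC; apply: ler_wpM2r => //; exact: ltW.
  have b3 : `|Prim (fun t => t ^+ 1 * h t) r| <= e * (H + 1).
    have := Prim_pow_sqr_le 0 Lh rr; rewrite -/H !expr1 => P3.
    have : (Prim (fun t => t ^+ 1 * h t) r / r) ^+ 2 <= H.
      by rewrite expr_div_n ler_pdivrMr ?exprn_gt0.
    move=> /sq_le; rewrite normrM normfV (gtr0_norm r0) ler_pdivrMr// => P4.
    by apply: (le_trans P4); rewrite mulrC ler_wpM2r// ltW.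
  have EP : Prim (fun t => - 2 * p t + t * h t) r = - 2 * Prim p r + Prim (fun t => t ^+ 1 * h t) r.
    rewrite /Prim -IntZl; last exact: L1_le_cut.
    rewrite -IntD; [|by apply: L1Zl; exact: L1_le_cut|exact: L1_le_cut].
    by apply: eq_Int => t; ring.
  have -> : C = r * p r + 2 * Prim p r - Prim (fun t => t ^+ 1 * h t) r.
    by rewrite P1 EP; ring.
  apply: (le_trans (ler_normB _ _)).
  have := ler_normD (r * p r) (2 * Prim p r); rewrite (normrM 2) ger0_norm//; lra.
apply/eqP; rewrite -normr_eq0; apply/negPn/negP => Cn.
have Cp : 0 < `|C| by rewrite normr_gt0 -normr_eq0.
pose K := 4 * (H + 1).
have K1 : 0 < 2 * (K + 1) by rewrite /K; have := HH; lra.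
pose e := Order.min (rad / 2) (`|C| / (2 * (K + 1))).
have e0 : 0 < e by rewrite lt_min !divr_gt0.
have er : e < rad by rewrite gt_min; apply/orP; left; have := rad0; lra.
have := key e; rewrite e0 er => /(_ isT) h1.
have : e * (2 * (K + 1)) <= `|C| by rewrite -ler_pdivlMr// ge_min lexx orbT.
have : e * K <= e * (K + 1) by rewrite ler_pM2l//; lra.
rewrite -/K in h1; lra.
Qed.

End equation.
End radial_ode.

Section inv.
Context {R : realType}.
(** The continuous functions [x / (x^2 + 1 / (n + 1))] converge everywhere, also at 0, where the
    limit 0 agrees with the convention for the inverse. *)
Lemma measurable_inv : measurable_fun setT (fun x : R => x^-1).
Proof.
apply: (@measurable_fun_cvg _ (measurableTypeR R) R _ (fun n (x : R) => x / (x ^+ 2 + n.+1%:R^-1))).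
  move=> n; apply: continuous_measurable_fun => x; apply: cvgM; first exact: cvg_id.
  have p : 0 < x ^+ 2 + n.+1%:R^-1 by rewrite ltr_wpDl ?sqr_ge0.
  apply: cvgV; first by rewrite gt_eqF.
  by apply: cvgD; [exact: exprn_continuous|exact: cvg_cst].
move=> x _; have [->|x0] := eqVneq x 0.
  by rewrite invr0; under eq_cvg do rewrite mul0r; exact: cvg_cst.
rewrite [X in _ --> X](_ : _ = x / (x ^+ 2 + 0)); last by rewrite addr0 expr2 invfM mulVKf.
apply: cvgM; first exact: cvg_cst.
apply: cvgV; first by rewrite addr0 expf_neq0.
by apply: cvgD; [exact: cvg_cst|exact: cvg_harmonic].
Qed.
End inv.

(** In the application [x], [y], [z] and [t] are the integrals of [r p^2], [r f^2], [r om^2] and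
    [r om f]; [s] is that of [p * Prim p], [m] that of [r h], and [P], the integral of [p], is the
    opposite of the value of [f] at the axis. The term [P^2] is dropped thanks to its sign. *)
Lemma energy_algebra (R : realDomainType) (l P x y z s t m : R) :
  2 * s = P ^+ 2 -> x + (- 2 * s + (l ^+ 2 * y - t + P * m)) = (- 2 * P + m) * P ->
  2 * l ^+ 2 * t <= l ^+ 4 * y + z -> l ^+ 4 * y + 2 * l ^+ 2 * x <= z.
Proof.
move=> hs hE ht; have hx : x = t - l ^+ 2 * y - P ^+ 2.
  by rewrite -hs; move: hE; rewrite mulrDl -mulrA -expr2 -hs; lra.
have hP : 0 <= l ^+ 2 * P ^+ 2 by rewrite mulr_ge0 ?sqr_ge0.
rewrite hx (_ : l ^+ 4 * y + _ = 2 * l ^+ 2 * t - l ^+ 4 * y - 2 * (l ^+ 2 * P ^+ 2)); last by ring.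
lra.
Qed.

(** * Energy estimate for a single mode *)

Section mode_energy.
Context {R : realType} (rad : R) (rad0 : 0 < rad).
Local Notation leb := (@lebesgue_measure R).
Context (f p om : R -> R) (l : R) (l0 : 0 < l).
Hypotheses (Lf : L2r rad f) (Lp : L2r rad p) (Lo : L2r rad om).
(** The weak form of [f' = p] together with [f (rad) = 0]: the condition at [rad] is encoded because
    [Prim b] is in general not zero there. *)
Hypothesis f_p : forall b, test1 `]0, rad[ b ->
  \int[leb]_r (f r * b r) = - \int[leb]_r (p r * Prim b r).

Let h r := l ^+ 2 * f r - om r.

Hypothesis eq_p : forall v, test1 `]0, rad[ v ->
  \int[leb]_r (p r * derive1 v r) =
  \int[leb]_r (3 * (p r * (r^-1 * v r))) - \int[leb]_r (h r * v r).

Let Lh : L2r rad h.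
Proof.
apply: L2rD; first exact: L2rZ.
by under eq_fun do rewrite -mulN1r; exact: L2rZ.
Qed.

Lemma mode_cube_eq : {ae leb, forall r, 0 < r < rad ->
  r ^+ 3 * p r = Prim (fun t => t ^+ 3 * h t) r}.
Proof. exact: (cube_p_eq rad0 Lp Lh eq_p). Qed.

Lemma mode_p_L1 : L1 leb p.
Proof. exact: (p_L1 rad0 Lp Lh eq_p). Qed.

(** [f_p] is available for all [b], not only for derivatives, so the comparison with [Prim p] by
    [Prim_fubini] determines the constant as well. *)
Lemma mode_primitive : {ae leb, forall r, 0 < r < rad ->
  f r = Prim p r - \int[leb]_t p t}.
Proof.
have Ip := mode_p_L1; set P := \int[leb]_t p t.
have [mf f0 _] := Lf; have [mP _ _ _] := Prim_fubini Ip Ip.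
have key : {ae leb, forall r, 0 < r < rad -> f r - Prim p r + P = 0}.
  apply: fundamental_lemma.
  - by apply: measurable_funD => //; exact: measurable_funB.
  - move=> c d c0 dr.
    have L1i : L1 leb (fun x : R => 1 * (c <= x <= d)%R%:R).
      by apply: (@L1_continuous_segment _ (fun=> 1)) => x; exact: cvg_cst.
    have mi : measurable_fun setT (fun x : R => (c <= x <= d)%R%:R : R).
      by have := L1_measurable L1i; under eq_fun do rewrite mul1r.
    rewrite (_ : (fun x => _) = (fun x => f x * (c <= x <= d)%R%:R -
        (Prim p x - P) * (1 * (c <= x <= d)%R%:R))); last first.
      by apply/funext => x; ring.
    apply: L1B.
      apply: (L2r_mul (M := c^-1) Lf mi) => r /andP[r0 _].
      have [/andP[cr _]|_] := boolP (c <= r <= d); last by rewrite normr0 mulr_ge0// ?invr_ge0 ltW.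
      by rewrite normr1 mulrC ler_pdivlMr// mul1r.
    apply: (leb_mull_bounded (M := \int[leb]_t `|p t| + `|P|) _ L1i).
      exact: measurable_funB.
    by move=> x; rewrite (le_trans (ler_normB _ _))// lerD2r; exact: Prim_le.
  - move=> b tb; have [c [d [c0 cd dr b0]]] := test1_support rad0 tb.
    have [sb _] := tb; have cb := smooth1_continuous sb.
    have Ib := L1_continuous_support cb b0.
    have [M M0 bM] := continuous_bounded_support cb b0.
    have [_ I1 I2 E] := Prim_fubini Ip Ib.
    have If : L1 leb (fun r => f r * b r).
      have [M' _ bM'] := test1_le_sqr rad0 tb.
      apply: (L2r_mul (M := M' * rad) Lf); first exact: continuous_measurable_fun.
      move=> r rr; apply: (le_trans (bM' _ rr)); have /andP[r0 r1] := rr.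
      rewrite -(mulrA M'); apply: ler_wpM2l; last by rewrite expr2 ler_wpM2r// ltW.
      have := bM' _ rr; move=> /(le_trans (normr_ge0 _)).
      by rewrite pmulr_lge0// exprn_gt0.
    rewrite (@eq_Int _ _ _ leb _ (fun r => (f r * b r - Prim p r * b r) + P * b r)); last first.
      by move=> r; ring.
    rewrite IntD; [|exact: L1B|exact: L1Zl].
    by rewrite IntB// IntZl// f_p//; move: E; rewrite -/P; lra.
by apply: (ae_imp key) => r Hr rr; have := Hr rr; lra.
Qed.

(** By [r_p_eq], the integral of [r p^2] is that of [Prim q * p] with [q = - 2 p + r h]. Integrating
    by parts and inserting [f = Prim p - P] leaves the integrals of [r h f] and of [p * Prim p], the
    latter being [P^2 / 2]. The product [r om f] is absorbed by completing a square. *)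
Lemma mode_energy : l ^+ 4 * \int[leb]_r (f r ^+ 2 * r) +
  2 * l ^+ 2 * \int[leb]_r (p r ^+ 2 * r) <= \int[leb]_r (om r ^+ 2 * r).
Proof.
have [mf f0 If] := Lf; have [mp p0 Ip2] := Lp; have [mo o0 Io] := Lo; have [mh h0 _] := Lh.
have Ip := mode_p_L1; pose P := \int[leb]_t p t.
have Irh : L1 leb (fun r => r ^+ 1 * h r) by apply: (L2r_pow_L1 rad0 0 Lh).
pose q r := - 2 * p r + r * h r.
have Iq : L1 leb q by apply: L1D; [exact: L1Zl|exact: Irh].
have [_ E1a E1b E1] := Prim_fubini Iq Ip.
have [mP E2a E2b E2] := Prim_fubini Ip Ip.
have Irhf := L2r_mul2 Lh Lf.
have IrhP : L1 leb (fun r => r ^+ 1 * h r * Prim p r).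
  apply: (leb_mulr_bounded Irh mP) => x; exact: Prim_le.
have S1 : \int[leb]_r (Prim q r * p r) = \int[leb]_r (p r ^+ 2 * r).
  apply: Int_ae; [exact: L1_measurable E1a|exact: L1_measurable Ip2|].
  apply: (ae_imp (r_p_eq rad0 Lp Lh eq_p)) => r [<-|/p0 ->]; first by ring.
  by rewrite mulr0 expr0n mul0r.
have S2 : 2 * \int[leb]_r (p r * Prim p r) = P ^+ 2.
  rewrite expr2 -E2 (@eq_Int _ _ _ leb (fun x => Prim p x * p x) (fun x => p x * Prim p x)).
    by ring.
  by move=> x; ring.
have S3 : \int[leb]_r (r ^+ 1 * h r * Prim p r) =
    \int[leb]_r (r * h r * f r) + P * \int[leb]_r (r ^+ 1 * h r).
  rewrite -IntZl// -IntD//; last exact: L1Zl.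
  apply: Int_ae.
  - exact: L1_measurable IrhP.
  - by apply: L1_measurable (L1D Irhf (L1Zl P Irh)).
  - apply: (ae_imp mode_primitive) => r Hr.
    have [/Hr ->|/h0 ->] := boolP (0 < r < rad); last by rewrite !(mulr0, mul0r) addr0.
    by rewrite -/P; ring.
have S4 : \int[leb]_r (q r * Prim p r) =
    - 2 * \int[leb]_r (p r * Prim p r) + \int[leb]_r (r ^+ 1 * h r * Prim p r).
  rewrite -IntZl// -IntD//; last exact: L1Zl.
  by apply: eq_Int => r; rewrite /q; ring.
have S5 : \int[leb]_r q r = - 2 * P + \int[leb]_r (r ^+ 1 * h r).
  by rewrite -IntZl// -IntD//; exact: L1Zl.
have Irof := L2r_mul2 Lo Lf.
have S6 : \int[leb]_r (r * h r * f r) =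
    l ^+ 2 * \int[leb]_r (f r ^+ 2 * r) - \int[leb]_r (r * om r * f r).
  rewrite -IntZl// -IntB//; last exact: L1Zl.
  by apply: eq_Int => r; rewrite /h; ring.
have S7 : 2 * l ^+ 2 * \int[leb]_r (r * om r * f r) <=
    l ^+ 4 * \int[leb]_r (f r ^+ 2 * r) + \int[leb]_r (om r ^+ 2 * r).
  rewrite -!IntZl// -IntD//; last exact: L1Zl.
  apply: Int_le; [exact: L1Zl|by apply: L1D => //; exact: L1Zl|move=> r].
  have [/andP[/ltW r0 _]|rO] := boolP (0 < r < rad); last first.
    by rewrite f0// o0// expr0n !(mulr0, mul0r) addr0.
  rewrite -subr_ge0 (_ : _ - _ = (l ^+ 2 * f r - om r) ^+ 2 * r); last by ring.
  by rewrite mulr_ge0// sqr_ge0.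
apply: (energy_algebra (m := \int[leb]_r (r ^+ 1 * h r)) S2 _ S7).
by rewrite -S6 -S1 -S5 -/P -E1 S4 S3.
Qed.

End mode_energy.

(** * The equations satisfied by the sine coefficients *)

Section modes.
Context {R : realType} (rad a : R) (rad0 : 0 < rad) (a0 : 0 < a).
Local Notation leb := (@lebesgue_measure R).
Local Notation leb2 := (leb \x leb)%E.
Context (om psi psir psiz : R * R -> R).
Hypotheses (Lo : L2w rad a om) (Lp : L2w rad a psi) (Lr : L2w rad a psir)
  (Lz : L2w rad a psiz) (tr0 : trace0 rad a psi psir psiz).
Hypothesis weak_z : forall ph, test2 (Omega rad a) ph ->
  \int[leb2]_q (psi q * 'D_ez ph q) = - \int[leb2]_q (psiz q * ph q).
(** The terms [(1 / r) psi_r] and [(2 / r) psi_r] are merged into the coefficient 3. *)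
Hypothesis weak_eq : forall ph, test2 (Omega rad a) ph ->
  \int[leb2]_q (psi q * 'D_er (fun s => 'D_er ph s) q) +
  \int[leb2]_q (3 * (psir q * (q.1^-1 * ph q))) +
  \int[leb2]_q (psi q * 'D_ez (fun s => 'D_ez ph s) q) = - \int[leb2]_q (om q * ph q).

Let msn k : measurable_fun setT (sn a k) := L1_measurable (L1_sn a k).

Lemma L2r_zint u (g : R -> R) (B : R) : L2w rad a u -> measurable_fun setT g ->
  (forall z, `|g z| <= B) -> L2r rad (zint u g).
Proof.
move=> Lu mg gB; have [mu su _] := Lu; split.
- exact: (measurable_zint mu mg).
- by move=> r rO; exact: (zint_out g su rO).
- exact: (zint_sqr_w Lu mg gB).
Qed.

Lemma L2r_mode u k : L2w rad a u -> L2r rad (zint u (sn a k)).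
Proof. by move=> Lu; exact: (L2r_zint Lu (msn k) (sn_le1 a k)). Qed.

Let test_le v : test1 `]0, rad[ v -> exists2 M, 0 <= M &
  forall r, 0 < r < rad -> [/\ `|v r| <= M * r, `|r^-1 * v r| <= M * r,
     `|derive1 v r| <= M * r & `|derive1 (derive1 v) r| <= M * r].
Proof.
move=> tv; have [c [d [c0 cd dr v0]]] := test1_support rad0 tv; have [sv _] := tv.
have sv' := smooth1_derive1 sv; have sv'' := smooth1_derive1 sv'.
have v'0 x := @derive1_eq0_outside _ v c d x v0.
have v''0 x := @derive1_eq0_outside _ (derive1 v) c d x v'0.
have t1 := test1_of_support c0 dr sv' v'0.
have t2 := test1_of_support c0 dr sv'' v''0.
have [M0 h0 H0] := test1_le_sqr rad0 tv.
have [M1 h1 H1] := test1_le_sqr rad0 t1.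
have [M2 h2 H2] := test1_le_sqr rad0 t2.
have r0' := ltW rad0.
pose M := M0 * rad + M0 + M1 * rad + M2 * rad.
have e0 := mulr_ge0 h0 r0'; have e1 := mulr_ge0 h1 r0'; have e2 := mulr_ge0 h2 r0'.
exists M; first by rewrite !addr_ge0.
move=> r rr; have /andP[r0 rlt] := rr.
have bd (K x : R) : `|x| <= K * r ^+ 2 -> 0 <= K -> K * rad <= M -> `|x| <= M * r.
  move=> hx K0 KM; apply: (le_trans hx); apply: (@le_trans _ _ (K * rad * r)).
    by rewrite -mulrA expr2; apply: ler_wpM2l => //; apply: ler_wpM2r; exact: ltW.
  by apply: ler_wpM2r => //; exact: ltW.
split.
- by apply: (bd M0) => //; [exact: H0|rewrite /M; lra].
- rewrite normrM normfV (gtr0_norm r0) ler_pdivrMl//.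
  apply: (le_trans (H0 _ rr)).
  rewrite (_ : r * (M * r) = M * r ^+ 2); last by ring.
  by apply: ler_wpM2r; [exact: sqr_ge0|rewrite /M; lra].
- by apply: (bd M1) => //; [exact: H1|rewrite /M; lra].
- by apply: (bd M2) => //; [exact: H2|rewrite /M; lra].
Qed.

(** [trace_radial] with [m = Prim b], which vanishes near the axis but is only constant near [rad];
    the identity thus carries the boundary value of the mode at [rad]. *)
Lemma mode_trace k b : test1 `]0, rad[ b ->
  \int[leb]_r (zint psi (sn a k) r * b r) =
  - \int[leb]_r (zint psir (sn a k) r * Prim b r).
Proof.
move=> tb; have [c [d [c0 cd dr b0]]] := test1_support rad0 tb; have [sb _] := tb.
have cb := smooth1_continuous sb.
have Ib := L1_continuous_support cb b0.
have [M M0 bM] := test_le tb.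
have dP x : derivable (Prim b) x 1 /\ derive1 (Prim b) x = b x.
  by apply: Prim_deriv => //; exact: cb.
have eP : derive1 (Prim b) = b by apply/funext => x; have [] := dP x.
have CP : C1 (Prim b) by split; [move=> x; have [] := dP x|rewrite eP].
have Psmall r : r < c -> Prim b r = 0.
  move=> rc; rewrite /Prim (@eq_Int _ _ _ leb _ (fun=> 0)) ?Int0// => t.
  have [tr|] := leP t r; last by rewrite mulr0.
  by rewrite b0 ?mul0r// negb_and -ltNge (le_lt_trans tr).
pose K := \int[leb]_t `|b t|.
have K0 : 0 <= K by exact: Int_ge0.
have PM r : 0 < r < rad -> `|Prim b r| <= (K / c + M) * r.
  move=> /andP[r0 _]; have [rc|cr] := ltP r c.
    by rewrite Psmall// normr0 mulr_ge0 ?(ltW r0)// addr_ge0// divr_ge0// ltW.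
  apply: (le_trans (Prim_le r Ib)); rewrite -/K mulrDl mulrAC.
  apply: (@le_trans _ _ (K * r / c)); last by rewrite lerDl mulr_ge0// ltW.
  by rewrite ler_pdivlMr//; apply: ler_wpM2l.
have b'M r : 0 < r < rad -> `|derive1 (Prim b) r| <= (K / c + M) * r.
  move=> rr; rewrite eP; have [h _ _ _] := bM _ rr; apply: (le_trans h).
  by have /andP[/ltW r0 _] := rr; rewrite ler_wpM2r// lerDr divr_ge0// ltW.
have := trace_radial rad0 a0 Lp Lr tr0 CP (Psmall 0 c0) PM b'M (msn k) (sn_le1 a k).
have mb := continuous_measurable_fun cb.
have mP := continuous_measurable_fun (C1_continuous CP).
rewrite eP in b'M *.
have [_ _ ->] := zint_fubini rad0 a0 Lp (msn k) (sn_le1 a k) mb b'M.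
by have [_ _ ->] := zint_fubini rad0 a0 Lr (msn k) (sn_le1 a k) mP PM.
Qed.

(** A sine is not a test function in [z]. For fixed [v] the function [Mz], the integral of [psiz v]
    over [r], therefore gets an integrable weak derivative [N] from the equation. It is paired with
    [lam cos], whose primitive is the sine, and [trace_axial] moves the remaining derivative off
    [psiz]. *)
Lemma mode_equation k v : test1 `]0, rad[ v ->
  \int[leb]_r (zint psir (sn a k) r * derive1 v r) =
  \int[leb]_r (3 * (zint psir (sn a k) r * (r^-1 * v r))) -
  \int[leb]_r ((lam a k ^+ 2 * zint psi (sn a k) r - zint om (sn a k) r) * v r).
Proof.
move=> tv; have [c [d [c0 cd dr v0]]] := test1_support rad0 tv; have [sv _] := tv.
have sv' := smooth1_derive1 sv; have sv'' := smooth1_derive1 sv'.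
have mv := continuous_measurable_fun (smooth1_continuous sv).
have mv' := continuous_measurable_fun (smooth1_continuous sv').
have mv'' := continuous_measurable_fun (smooth1_continuous sv'').
have mrv : measurable_fun setT (fun r : R => r^-1 * v r).
  by apply: measurable_funM => //; exact: measurable_inv.
have v'0 x := @derive1_eq0_outside _ v c d x v0.
have [M M0 vM] := test_le tv.
have b0 r : 0 < r < rad -> `|v r| <= M * r by move=> /vM[].
have b1 r : 0 < r < rad -> `|r^-1 * v r| <= M * r by move=> /vM[].
have b2 r : 0 < r < rad -> `|derive1 v r| <= M * r by move=> /vM[].
have b3 r : 0 < r < rad -> `|derive1 (derive1 v) r| <= M * r by move=> /vM[].
have step_r : \int[leb]_r (zint psi (sn a k) r * derive1 (derive1 v) r) =
   - \int[leb]_r (zint psir (sn a k) r * derive1 v r).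
  have v'00 : derive1 v 0 = 0 by apply: v'0; rewrite negb_and -ltNge c0.
  have := trace_radial rad0 a0 Lp Lr tr0 (smooth1_C1 sv') v'00 b2 b3 (msn k) (sn_le1 a k).
  have [_ _ ->] := zint_fubini rad0 a0 Lp (msn k) (sn_le1 a k) mv'' b3.
  by have [_ _ ->] := zint_fubini rad0 a0 Lr (msn k) (sn_le1 a k) mv' b2.
have aa : - a < a by rewrite gtrN.
pose Mz := rint psiz v.
(* [N] is [psi_zz] as given by the equation, integrated against [v] in [r]. *)
pose N z := - (rint om v z + 3 * rint psir (fun r => r^-1 * v r) z +
   rint psi (derive1 (derive1 v)) z).
have one (z : R) : `|(1 : R)| <= 1 by rewrite normr1.
have m1 : measurable_fun setT (fun _ : R => 1 : R) by exact: measurable_cst.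
have [IM M0' _] := rint_fubini rad0 a0 Lz m1 one mv b0.
have [Io _ _] := rint_fubini rad0 a0 Lo m1 one mv b0.
have [Ir _ _] := rint_fubini rad0 a0 Lr m1 one mrv b1.
have [Ip _ _] := rint_fubini rad0 a0 Lp m1 one mv'' b3.
have IN : L1 leb N.
  by apply: L1N; apply: L1D => //; apply: L1D => //; exact: L1Zl.
have Ng (g : R -> R) (B : R) : measurable_fun setT g -> (forall z, `|g z| <= B) ->
    \int[leb]_z (N z * g z) = - (\int[leb2]_q (om q * (v q.1 * g q.2)) +
      3 * \int[leb2]_q (psir q * ((q.1^-1 * v q.1) * g q.2)) +
      \int[leb2]_q (psi q * (derive1 (derive1 v) q.1 * g q.2))).
  move=> mg gB.
  have [_ _ ->] := rint_fubini rad0 a0 Lo mg gB mv b0.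
  have [_ _ E] := rint_fubini rad0 a0 Lr mg gB mrv b1; rewrite E.
  have [_ _ ->] := rint_fubini rad0 a0 Lp mg gB mv'' b3.
  have J u : L1 leb u -> L1 leb (fun z => u z * g z) by move=> Iu; exact: leb_mulr_bounded gB.
  rewrite -IntZl; last exact: J.
  rewrite -IntD; [|exact: J|by apply: L1Zl; exact: J].
  rewrite -IntD; [|by apply: L1D; [exact: J|apply: L1Zl; exact: J]|exact: J].
  rewrite -IntN; last by apply: L1D; [apply: L1D; [exact: J|apply: L1Zl; exact: J]|exact: J].
  by apply: eq_Int => z; rewrite /N; ring.
have [C HC] : exists C, {ae leb, forall z, - a < z < a -> Mz z = C + Prim N z}.
  apply: du_Bois_Reymond => // th tth.
  have [c' [d' [c0' cd' dr' th0]]] := test1_support aa tth; have [sth _] := tth.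
  have sth' := smooth1_derive1 sth.
  have th'0 x := @derive1_eq0_outside _ th c' d' x th0.
  have tth' := test1_of_support c0' dr' sth' th'0.
  have [B _ hB] := continuous_bounded_support (smooth1_continuous sth) th0.
  have [B' _ hB'] := continuous_bounded_support (smooth1_continuous sth') th'0.
  have mth := continuous_measurable_fun (smooth1_continuous sth).
  have mth' := continuous_measurable_fun (smooth1_continuous sth').
  have [_ _ E1] := rint_fubini rad0 a0 Lz mth' hB' mv b0.
  rewrite -/Mz in E1; rewrite -E1 (Ng _ _ mth hB).
  have dv x := smooth1_derivable (x := x) sv.
  have dv' x := smooth1_derivable (x := x) sv'.
  have dth x := smooth1_derivable (x := x) sth.
  have dth' x := smooth1_derivable (x := x) sth'.
  have [Ir' _ _] := zint_fubini rad0 a0 Lr mth hB mrv b1.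
  have W1 : \int[leb2]_q (psi q * (v q.1 * derive1 (derive1 th) q.2)) =
      - \int[leb2]_q (psiz q * (v q.1 * derive1 th q.2)).
    apply: etrans (weak_z (test2_tensor tv tth')); apply: eq_Int => q; congr (_ * _).
    by have [_ ->] := D_ez_tensor v (dth' q.2).
  have W2 : \int[leb2]_q (psi q * (derive1 (derive1 v) q.1 * th q.2)) +
      3 * \int[leb2]_q (psir q * ((q.1^-1 * v q.1) * th q.2)) +
      \int[leb2]_q (psi q * (v q.1 * derive1 (derive1 th) q.2)) =
      - \int[leb2]_q (om q * (v q.1 * th q.2)).
    apply: etrans (weak_eq (test2_tensor tv tth)); congr (_ + _ + _).
    - apply: eq_Int => q; congr (_ * _); rewrite (_ : (fun s => _) = (fun s => derive1 v s.1 * th s.2)).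
        by have [_ ->] := D_er_tensor th (dv' q.1).
      by apply/funext => s; have [_ ->] := D_er_tensor th (dv s.1).
    - by rewrite -IntZl//; apply: eq_Int => q; congr (_ * (_ * _)); exact/esym/mulrA.
    - apply: eq_Int => q; congr (_ * _); rewrite (_ : (fun s => _) = (fun s => v s.1 * derive1 th s.2)).
        by have [_ ->] := D_ez_tensor v (dth' q.2).
      by apply/funext => s; have [_ ->] := D_ez_tensor v (dth s.2).
  rewrite opprK -[LHS]opprK -W1 -[X in X + _ + _]opprK -W2; ring.
have Ilc : L1 leb (fun z => lam a k * cs a k z) by apply: L1Zl; exact: L1_cs.
(* The constant [C] drops out because the cosine has integral 0; the boundary terms drop out because
   the sine vanishes at both ends. *)
have S1 : \int[leb]_z (Mz z * (lam a k * cs a k z)) = - \int[leb]_z (N z * sn a k z).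
  have [mPN I1 I2 E] := Prim_fubini IN Ilc; rewrite Int_cs// mulr0 in E.
  have -> : \int[leb]_z (N z * sn a k z) = \int[leb]_z (N z * Prim (fun z => lam a k * cs a k z) z).
    apply: eq_Int => z; have [/andP[z1 z2]|zO] := boolP (- a < z < a).
      by rewrite Prim_cs// ?(ltW z1) ?(ltW z2)// /sn itvJ_in ?z1// mulr1.
    have [_ o1 _] := rint_fubini rad0 a0 Lo m1 one mv b0.
    have [_ o2 _] := rint_fubini rad0 a0 Lr m1 one mrv b1.
    have [_ o3 _] := rint_fubini rad0 a0 Lp m1 one mv'' b3.
    by rewrite /N o1// o2// o3// mulr0 !addr0 oppr0 !mul0r.
  have E3 : \int[leb]_z (Mz z * (lam a k * cs a k z)) =
      \int[leb]_z (C * (lam a k * cs a k z)) + \int[leb]_z (Prim N z * (lam a k * cs a k z)).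
    rewrite -IntD//; last exact: L1Zl.
    apply: Int_ae.
    - apply: measurable_funM; first exact: L1_measurable IM.
      exact: L1_measurable Ilc.
    - exact: L1_measurable (L1D (L1Zl C Ilc) I1).
    - apply: (ae_imp HC) => z Hz; have [/Hz ->|zO] := boolP (- a < z < a); first by ring.
      by rewrite cs_out// !mulr0 addr0.
  rewrite E3 IntZl// Int_cs// mulr0 add0r; apply/eqP; rewrite -addr_eq0; apply/eqP; exact: E.
have [Cc ec] := C1_cosl a k.
have Clc : C1 (fun z => lam a k * cosl a k z) /\
    derive1 (fun z => lam a k * cosl a k z) = (fun z => - (lam a k ^+ 2) * sinl a k z).
  have e : derive1 (fun z => lam a k * cosl a k z) = (fun z => - (lam a k ^+ 2) * sinl a k z).
    by apply/funext => x; have [_ ->] := derive1_Zl (lam a k) (Cc.1 x); rewrite ec; ring.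
  split; last exact: e.
  split; first by move=> x; have [] := derive1_Zl (lam a k) (Cc.1 x).
  by rewrite e => x; apply: cvgM; [exact: cvg_cst|exact: (C1_continuous (C1_sinl a k).1)].
(* The second evaluation of the same integral, where the vanishing of the trace at the top and the
   bottom enters. *)
have S2 : \int[leb]_z (Mz z * (lam a k * cs a k z)) =
    lam a k ^+ 2 * \int[leb]_r (zint psi (sn a k) r * v r).
  have := trace_axial rad0 a0 Lp Lz tr0 mv b0 Clc.1; rewrite Clc.2.
  have mlc : measurable_fun setT (fun z => lam a k * cs a k z) by exact: L1_measurable Ilc.
  have blc z : `|lam a k * cs a k z| <= `|lam a k|.
    by rewrite normrM -[leRHS]mulr1 ler_wpM2l// cs_le1.
  have [_ _ E] := rint_fubini rad0 a0 Lz mlc blc mv b0; rewrite -/Mz in E; rewrite -E.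
  have [If _ <-] := zint_fubini rad0 a0 Lp (msn k) (sn_le1 a k) mv b0.
  rewrite -IntZl// => E'.
  rewrite (@eq_Int _ _ _ leb2 _ (fun q => psiz q * (v q.1 * (lam a k * cosl a k q.2 * itvJ a q.2)))); last first.
    by move=> q; rewrite /cs; ring.
  apply: oppr_inj; rewrite -E' -IntN; last exact: L1Zl.
  by apply: eq_Int => q; rewrite /sn; ring.
move: S1; rewrite S2 (Ng _ _ (msn k) (sn_le1 a k)) opprK.
have [Jo _ ->] := zint_fubini rad0 a0 Lo (msn k) (sn_le1 a k) mv b0.
have [Jo1 Jo2 _] := zint_fubini rad0 a0 Lo (msn k) (sn_le1 a k) mv b0.
have [_ Jr ->] := zint_fubini rad0 a0 Lr (msn k) (sn_le1 a k) mrv b1.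
have [_ Jp _] := zint_fubini rad0 a0 Lp (msn k) (sn_le1 a k) mv b0.
have [_ _ ->] := zint_fubini rad0 a0 Lp (msn k) (sn_le1 a k) mv'' b3.
rewrite step_r IntZl// (@eq_Int _ _ _ leb (fun r => (_ - _) * _) (fun r => lam a k ^+ 2 * (zint psi (sn a k) r * v r) - zint om (sn a k) r * v r)); last by move=> r; ring.
rewrite IntB//; last exact: L1Zl.
rewrite IntZl// => ->; ring.
Qed.

End modes.

(** * Second derivatives *)

Section tensor.
Context {R : realType}.
Local Notation leb := (@lebesgue_measure R).
Local Notation leb2 := (leb \x leb)%E.

Lemma measurable_tensor (F G : R -> R) : measurable_fun setT F -> measurable_fun setT G ->
  measurable_fun setT (fun p : R * R => F p.1 * G p.2).
Proof. by move=> mF mG; apply: measurable_funM; exact: measurableT_comp. Qed.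

Lemma L1_tensor (F G : R -> R) : L1 leb F -> L1 leb G ->
  L1 leb2 (fun p => F p.1 * G p.2) /\
  \int[leb2]_p (F p.1 * G p.2) = (\int[leb]_r F r) * (\int[leb]_z G z).
Proof.
move=> IF IG.
have I2 : L1 leb2 (fun p => F p.1 * G p.2).
  apply: (@plane_tonelli1 _ _ (fun r => `|F r| * \int[leb]_z `|G z|)).
  - apply: measurable_tensor; [exact: L1_measurable IF|exact: L1_measurable IG].
  - by apply: L1Zr; exact: L1_norm.
  - apply: aeW => r /=; split; first exact: L1Zl.
    rewrite (@eq_Int _ _ _ leb _ (fun z => `|F r| * `|G z|)); last by move=> z; rewrite normrM.
    by rewrite IntZl//; exact: L1_norm.
split => //; have [_ _ _ ->] := plane_fubini1 I2.
rewrite -IntZr//; apply: eq_Int => r /=; exact: IntZl.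
Qed.

End tensor.

(** * Orthogonal series in the weighted space *)

Section series.
Context {R : realType} (rad a : R) (rad0 : 0 < rad) (a0 : 0 < a).
Local Notation leb := (@lebesgue_measure R).
Local Notation leb2 := (leb \x leb)%E.

Lemma measurable_indic_seg (x y : R) :
  measurable_fun setT (fun r : R => (x <= r <= y)%R%:R : R).
Proof.
have L1i : L1 leb (fun r => 1 * (x <= r <= y)%R%:R).
  by apply: (@L1_continuous_segment _ (fun=> 1)) => z; exact: cvg_cst.
by have := L1_measurable L1i; under eq_fun do rewrite mul1r.
Qed.

Lemma L2w_tensor (c g : R -> R) : L2r rad c -> L1 leb g -> (forall z, `|g z| <= 1) ->
  (forall z, ~~ (- a < z < a) -> g z = 0) -> L2w rad a (fun p => c p.1 * g p.2).
Proof.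
move=> [mc c0 Ic] Ig g1 g0.
have mg := L1_measurable Ig.
split; first exact: measurable_tensor.
  by move=> p; rewrite /inO negb_and => /orP[/c0 ->|/g0 ->]; rewrite ?mul0r ?mulr0.
have Ig2 : L1 leb (fun z => g z * g z) by exact: (leb_mulr_bounded Ig mg g1).
have [I2 _] := L1_tensor Ic Ig2.
rewrite (_ : (fun p => _) = (fun p => c p.1 ^+ 2 * p.1 * (g p.2 * g p.2)))//.
by apply/funext => p; ring.
Qed.

Context (e : nat -> R -> R).
Hypotheses (Ie : forall k, L1 leb (e k)) (e1 : forall k (z : R), `|e k z| <= 1)
  (e0 : forall k (z : R), ~~ (- a < z < a) -> e k z = 0)
  (oe : forall i j, \int[leb]_z (e i z * e j z) = (i == j)%:R * a).

Let me_ k : measurable_fun setT (e k) := L1_measurable (Ie k).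

Let Iee i j : L1 leb (fun z => e i z * e j z) := leb_mulr_bounded (Ie i) (me_ j) (e1 j).

Lemma N2_partial (c : nat -> R -> R) N : (forall k, L2r rad (c k)) ->
  L2w rad a (fun p => \sum_(k < N) c k p.1 * e k p.2) /\
  N2 (fun p => \sum_(k < N) c k p.1 * e k p.2) =
  a * \sum_(k < N) \int[leb]_r (c k r ^+ 2 * r).
Proof.
move=> Lc.
have Ls : L2w rad a (fun p => \sum_(k < N) c k p.1 * e k p.2).
  by apply: L2w_sum => k; exact: (L2w_tensor (Lc k) (Ie k) (e1 k) (e0 k)).
split => //; have [_ _ I2] := Ls.
rewrite /N2; have [_ _ _ ->] := plane_fubini1 I2.
rewrite -Int_sum; last by move=> k; have [] := Lc k.
rewrite -IntZl; last by apply: L1_sum => k; have [] := Lc k.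
apply: eq_Int => r /=.
have [Is Es] := orthogonal_sum_sqr (fun k => c k r) N Iee oe.
by rewrite IntZr// Es -mulrA mulr_suml.
Qed.

(** The norm of [s m - s n] is [a] times a difference of bounded monotone partial sums, so
    [Riesz_Fischer] applies. The series is then used in two ways: tested term by term against
    functions of size [M r], and through its coefficients [a * c k]. Sines and cosines are both
    instances of [e]. *)
Lemma orthogonal_series (c : nat -> R -> R) (B : R) : (forall k, L2r rad (c k)) ->
  (forall N, \sum_(k < N) \int[leb]_r (c k r ^+ 2 * r) <= B) ->
  exists v, [/\ L2w rad a v, N2 v <= 2 * a * B,
    forall (w : R * R -> R) (M : R), measurable_fun setT w -> (forall p, inO rad a p -> `|w p| <= M * p.1) ->
      \sum_(k < n) \int[leb2]_p (c k p.1 * e k p.2 * w p) @[n --> \oo] --> \int[leb2]_p (v p * w p) &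
    forall k, {ae leb, forall r, 0 < r < rad -> zint v (e k) r = a * c k r}].
Proof.
move=> Lc HB.
pose s n p := \sum_(k < n) c k p.1 * e k p.2.
pose T n := \sum_(k < n) \int[leb]_r (c k r ^+ 2 * r).
(* The indicator makes the weight nonnegative on the whole plane, as [Riesz_Fischer] demands. *)
pose w p : R := p.1 * (inO rad a p)%:R.
have sO n p : ~~ inO rad a p -> s n p = 0.
  rewrite /inO negb_and => pO; apply: big1 => k _; have [_ c0 _] := Lc k.
  by case/orP: pO => [/c0 ->|/e0 ->]; rewrite ?mul0r ?mulr0.
have Ls n : L2w rad a (s n) by have [] := N2_partial n Lc.
have wE (u : R * R -> R) : (forall p, ~~ inO rad a p -> u p = 0) ->
    (fun p => u p ^+ 2 * w p) = (fun p => u p ^+ 2 * p.1).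
  move=> u0; apply/funext => p; rewrite /w; have [_|/u0 ->] := boolP (inO rad a p).
    by rewrite mulr1.
  by rewrite expr0n !mul0r.
have w0 p : 0 <= w p.
  rewrite /w; case: (boolP (inO rad a p)) => [/andP[/andP[p0 _] _]|_]; last by rewrite mulr0.
  by rewrite mulr1 ltW.
have mw : measurable_fun setT w.
  by apply: measurable_funM; [exact: measurable_p1|exact: measurable_inO].
have Lss m n : L2w rad a (fun p => s m p - s n p) by exact: L2wB.
have Nss m n : (n <= m)%N -> N2 (fun p => s m p - s n p) = a * (T m - T n).
  (* Killing the first [n] coefficients turns [s m - s n] into a partial sum of length [m], to which
     [N2_partial] applies. *)
  move=> nm; pose c' k r := (n <= k)%N%:R * c k r.
  have Lc' k : L2r rad (c' k) by exact: L2rZ.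
  have sumE (F : nat -> R) : \sum_(k < m) (n <= k)%N%:R * F k = \sum_(k < m) F k - \sum_(k < n) F k.
    rewrite (big_ord_widen m F nm) [X in _ - X]big_mkcond/= -sumrB.
    by apply: eq_bigr => k _; case: ltnP => _; rewrite ?mul0r ?mul1r ?subrr ?subr0.
  have -> : (fun p => s m p - s n p) = (fun p => \sum_(k < m) c' k p.1 * e k p.2).
    apply/funext => p; rewrite /s -(sumE (fun k => c k p.1 * e k p.2)).
    by apply: eq_bigr => k _; rewrite mulrA.
  have [_ ->] := N2_partial m Lc'; congr (_ * _).
  rewrite /T -(sumE (fun k => \int[leb]_r (c k r ^+ 2 * r))).
  apply: eq_bigr => k _; rewrite -IntZl; last by have [] := Lc k.
  apply: eq_Int => r; rewrite /c'; case: (n <= k)%N; rewrite ?mul1r// !mul0r expr0n mul0r//.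
have Tmono : nondecreasing_seq T.
  apply/nondecreasing_seqP => n; rewrite /T big_ord_recr/= lerDl.
  by apply: Int_ge0 => r; exact: (L2r_wge0 _ (Lc n)).
have Tcvg : cvgn T.
  apply: nondecreasing_is_cvgn => //; exists B => _ [n _ <-]; exact: HB.
have cau eps : 0 < eps -> exists N : nat, forall m n, (N <= m)%N -> (N <= n)%N ->
    N2 (fun p => s m p - s n p) <= eps.
  move=> eps0; have ea : 0 < eps / a by rewrite divr_gt0.
  have /cvgrPdist_lt/(_ _ ea)[N _ HN] := Tcvg.
  have Tl n : T n <= limn T by exact: nondecreasing_cvgn_le.
  have main m n : (N <= n)%N -> (n <= m)%N -> N2 (fun p => s m p - s n p) <= eps.
    move=> Nn nm; rewrite Nss// -ler_pdivlMl// mulrC; apply/ltW.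
    apply: (@le_lt_trans _ _ (limn T - T n)); first by rewrite lerD2r.
    by rewrite (le_lt_trans (ler_norm _))//; exact: HN.
  exists N => m n Nm Nn; have [nm|/ltnW mn] := leqP n m; first exact: main.
  rewrite (_ : N2 _ = N2 (fun p => s n p - s m p)); first exact: main.
  by apply: eq_Int => p; rewrite -sqrrN opprB.
have [v [mv v0 Iv Nv]] : exists v : R * R -> R, [/\ measurable_fun setT v,
    forall p, (forall n, s n p = 0) -> v p = 0,
    forall n, L1 leb2 (fun p => (v p - s n p) ^+ 2 * w p) &
    forall eps, 0 < eps -> exists N : nat, forall n, (N <= n)%N ->
     \int[leb2]_p ((v p - s n p) ^+ 2 * w p) <= eps].
  apply: (@Riesz_Fischer _ _ _ leb2 w s w0 mw).
  - by move=> n; have [] := Ls n.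
  - move=> m n; rewrite (wE (fun p => s m p - s n p)); first by have [] := Lss m n.
    by move=> p pO; rewrite !sO// subr0.
  - move=> eps /cau[N HN]; exists N => m n Nm Nn.
    rewrite (wE (fun p => s m p - s n p)); first exact: HN.
    by move=> p pO; rewrite !sO// subr0.
have vO p : ~~ inO rad a p -> v p = 0 by move=> pO; apply: v0 => n; exact: sO.
have vsO n p : ~~ inO rad a p -> v p - s n p = 0 by move=> pO; rewrite vO// sO// subr0.
have Lvs n : L2w rad a (fun p => v p - s n p).
  split; [|exact: vsO|by have := Iv n; rewrite (wE (fun p => v p - s n p))//; exact: vsO].
  by apply: measurable_funB => //; have [] := Ls n.
have Nvs eps : 0 < eps -> exists N : nat, forall n, (N <= n)%N -> N2 (fun p => v p - s n p) <= eps.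
  move=> /Nv[N HN]; exists N => n Nn; have := HN _ Nn.
  by rewrite (wE (fun p => v p - s n p))//; exact: vsO.
have vE n : v = (fun p => (v p - s n p) + s n p) by apply/funext => p; rewrite subrK.
have Lv : L2w rad a v by rewrite (vE 0%N); exact: L2wD.
have lim_w (x : R * R -> R) (M : R) : measurable_fun setT x ->
    (forall p, inO rad a p -> `|x p| <= M * p.1) ->
    \sum_(k < n) \int[leb2]_p (c k p.1 * e k p.2 * x p) @[n --> \oo] --> \int[leb2]_p (v p * x p).
  move=> mx xM.
  have Nc : N2 (fun p => v p - s n p) @[n --> \oo] --> 0.
    apply/cvgrPdist_le => eps /Nvs[N HN]; exists N => // n /= /HN h.
    by rewrite sub0r normrN ger0_norm//; apply: (@N2_ge0 _ rad a); have [] := Lvs n.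
  have := pairing_cvg rad0 a0 Lvs Nc mx xM.
  have [Ivx _] := pairing rad0 a0 Lv mx xM.
  have E n : \int[leb2]_p ((v p - s n p) * x p) =
     \int[leb2]_p (v p * x p) - \sum_(k < n) \int[leb2]_p (c k p.1 * e k p.2 * x p).
    have It k : L1 leb2 (fun p => c k p.1 * e k p.2 * x p).
      by have [] := pairing rad0 a0 (L2w_tensor (Lc k) (Ie k) (e1 k) (e0 k)) mx xM.
    rewrite -Int_sum// -IntB//; last exact: L1_sum.
    by apply: eq_Int => p; rewrite mulrBl mulr_suml.
  under eq_fun do rewrite E; move=> h.
  have h2 := cvgB (cvg_cst (\int[leb2]_p (v p * x p))) h; rewrite subr0 in h2.
  rewrite (_ : (fun n => \sum_(k < n) _) = (fun n => \int[leb2]_p (v p * x p) -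
    (\int[leb2]_p (v p * x p) - \sum_(k < n) \int[leb2]_p (c k p.1 * e k p.2 * x p)))).
    exact: h2.
  by apply/funext => n; rewrite opprB addrC subrK.
exists v; split => //.
(* [v = (v - s N) + s N] in [N2_add_le]: the first part costs [2 (eps / 2)], the second gives
   [2 a B]. *)
- apply/ler_addgt0Pr => eps eps0; have e2 : 0 < eps / 2 by rewrite divr_gt0.
  have [N /(_ _ (leqnn N)) hN] := Nvs _ e2.
  have [_] := N2_add_le (Lvs N) (Ls N); rewrite -(vE N) => h; apply: (le_trans h).
  have [_ ->] := N2_partial N Lc; have := HB N; rewrite -(ler_pM2l a0); lra.
- move=> k; have [mz z0 _] := L2r_zint Lv (me_ k) (e1 k); have [mc c0 _] := Lc k.
  suff : {ae leb, forall r, 0 < r < rad -> zint v (e k) r - a * c k r = 0}.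
    by move=> h; apply: (ae_imp h) => r Hr rr; apply/eqP; rewrite -subr_eq0 Hr.
  have Lzc : L2r rad (fun r => zint v (e k) r - a * c k r).
    under eq_fun do rewrite -mulN1r; apply: L2rD; first exact: (L2r_zint Lv (me_ k) (e1 k)).
    by apply: L2rZ; exact: L2rZ.
  apply: fundamental_lemma.
  + by have [] := Lzc.
  + move=> x y x0 yr; apply: (L2r_mul (M := x^-1) Lzc); first exact: measurable_indic_seg.
    move=> r /andP[r0 _]; have [/andP[xr _]|_] := boolP (x <= r <= y); last first.
      by rewrite normr0 mulr_ge0// ?invr_ge0 ltW.
    by rewrite normr1 mulrC ler_pdivlMr// mul1r.
  + move=> b tb; have [M _ bM] := test1_le_sqr rad0 tb; have [sb _] := tb.
    have mb := continuous_measurable_fun (smooth1_continuous sb).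
    have bM' r : 0 < r < rad -> `|b r| <= M * rad * r.
      move=> rr; apply: (le_trans (bM _ rr)); have /andP[r0 r1] := rr.
      have M0 : 0 <= M by have := le_trans (normr_ge0 _) (bM _ rr); rewrite pmulr_lge0// exprn_gt0.
      by rewrite -mulrA expr2 ler_wpM2l// ler_wpM2r// ltW.
    have Icb j : L1 leb (fun r => c j r * b r) by exact: (L2r_mul (Lc j) mb bM').
    have [_ Izb E] := zint_fubini rad0 a0 Lv (me_ k) (e1 k) mb bM'.
    have [] : \int[leb]_r (zint v (e k) r * b r) = a * \int[leb]_r (c k r * b r).
      rewrite -E.
      have mbe : measurable_fun setT (fun p : R * R => b p.1 * e k p.2) by exact: measurable_tensor.
      have beM p : inO rad a p -> `|b p.1 * e k p.2| <= M * rad * p.1.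
        move=> /andP[pr _]; rewrite normrM -[leRHS]mulr1.
        by apply: ler_pM => //; exact: bM'.
      have h := lim_w _ _ mbe beM; apply/esym; apply: (cvg_unique _ _ h) => //.
      apply: cvg_near_cst; near=> n.
      have kn : (k < n)%N by near: n; exact: nbhs_infty_gt.
      rewrite (bigD1 (Ordinal kn))//= big1 => [|j jk].
        rewrite addr0 (@eq_Int _ _ _ leb2 _ (fun p => (c k p.1 * b p.1) * (e k p.2 * e k p.2))); last first.
          by move=> p; ring.
        by have [_ ->] := L1_tensor (Icb k) (Iee k k); rewrite oe eqxx mul1r mulrC.
      rewrite (@eq_Int _ _ _ leb2 _ (fun p => (c j p.1 * b p.1) * (e j p.2 * e k p.2))); last first.
        by move=> p; ring.
      have [_ ->] := L1_tensor (Icb j) (Iee j k); rewrite oe.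
      by rewrite (_ : (_ == _) = false) ?mul0r ?mulr0//; apply: negbTE.
    move=> E2; rewrite (@eq_Int _ _ _ leb _ (fun r => zint v (e k) r * b r - a * (c k r * b r))); last first.
      by move=> r; ring.
    by rewrite IntB ?IntZl ?E2 ?subrr//; exact: L1Zl.
Unshelve. all: end_near.
Qed.

End series.

(** * From modes to functions of two variables *)

Section regularity.
Context {R : realType} (rad a : R) (rad0 : 0 < rad) (a0 : 0 < a).
Local Notation leb := (@lebesgue_measure R).
Local Notation leb2 := (leb \x leb)%E.

Lemma plane_null (u : R * R -> R) : L1 leb2 u ->
  {ae leb, forall r, {ae leb, forall z, u (r, z) = 0}} ->
  {ae leb2, forall p, u p = 0} /\ {ae leb, forall z, {ae leb, forall r, u (r, z) = 0}}.
Proof.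
move=> Iu u0; have In := L1_norm Iu.
have n0 (p : R * R) : 0 <= `|u p| by exact: normr_ge0.
have [_ m1 _ E1] := plane_fubini1 In.
have I0 : \int[leb2]_p `|u p| = 0.
  rewrite E1 -(@Int0 _ _ R leb); apply: Int_ae => //.
  apply: (ae_imp u0) => r h /=.
  rewrite -(@Int0 _ _ R leb); apply: Int_ae => //.
    exact: (measurable_slice r (L1_measurable In)).
  by apply: (ae_imp h) => z -> ; rewrite normr0.
split; first by apply: (ae_imp (Int_eq0_ae In n0 I0)) => p /normr0_eq0.
have [a2 _ I2 E2] := plane_fubini2 In.
have := Int_eq0_ae I2 (fun z => Int_ge0 leb (fun r => n0 (r, z))).
rewrite -E2 I0 => /(_ erefl) h.
apply: (ae_imp2 a2 h) => z Iz Ez.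
by apply: (ae_imp (Int_eq0_ae Iz (fun r => n0 (r, z)) Ez)) => r /normr0_eq0.
Qed.

Lemma complete_plane (u : R * R -> R) : L1 leb2 u -> supp rad a u ->
  (forall k, {ae leb, forall r, zint u (sn a k) r = 0}) ->
  {ae leb2, forall p, u p = 0} /\ {ae leb, forall z, {ae leb, forall r, u (r, z) = 0}}.
Proof.
move=> Iu su u0; apply: plane_null => //; have [a1 _ _ _] := plane_fubini1 Iu.
apply: (ae_imp2 a1 (ae_all u0)) => r Ir Er; apply: (sines_complete a0) => //.
by move=> z zO; apply: su; rewrite /inO negb_and zO orbT.
Qed.

(** On a compact subset [r] is at least some [c > 0], so [|u| <= u^2 + 1 <= u^2 r / c + 1]. *)
Lemma loc_integrable2_L2w u : L2w rad a u -> loc_integrable2 (Omega rad a) u.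
Proof.
move=> [mu su Iu]; split; first exact: measurable_funTS.
move=> C cC CO.
have mC : measurable C.
  by apply: closed_measurable_plane; apply: compact_closed => //; exact: order_hausdorff.
have aa : - a < a by rewrite gtrN.
have [c [d [c' [d' [/andP[c0 cd] dr _ _ HC]]]]] := compact_box rad0 aa cC CO.
have I1 : L1 leb2 (fun p => c^-1 * (u p ^+ 2 * p.1) + 1 * (inO rad a p)%:R).
  apply: L1D; first exact: L1Zl.
  by apply: L1Zl; exact: L1_inO.
have I2 : L1 leb2 (fun p => u p * \1_C p).
  apply: (@L1_le _ _ _ leb2 _ _ _ I1).
    by apply: measurable_funM => //; exact: measurable_indic.
  move=> p; rewrite indicE; have [pC|_] := boolP (p \in C); last first.
    rewrite mulr0 normr0 mul1r addr_ge0//; apply: mulr_ge0; first by rewrite invr_ge0 ltW.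
    exact: (supp_wge0 _ su).
  have Cp : C p by rewrite inE in pC.
  rewrite mulr1 (inOE _ _ _).1 ?mulr1; last exact: CO.
  have [/andP[cp _] _] := HC _ Cp.
  apply: (@le_trans _ _ (u p ^+ 2 + 1)).
    by rewrite -[u p ^+ 2]real_normK ?num_real//; nra.
  by rewrite lerD2r ler_pdivlMl// mulrC ler_wpM2l ?sqr_ge0.
apply: (@eq_integrable _ _ _ leb2 C mC (fun p => (u p * \1_C p)%:E)).
  by move=> p pC /=; rewrite indicE pC mulr1.
by apply: integrableS I2.
Qed.

Lemma Int_Omega (u th : R * R -> R) : L2w rad a u ->
  \int[leb2]_(q in Omega rad a) (u q * th q) = \int[leb2]_q (u q * th q).
Proof.
move=> [_ u0 _]; rewrite /Rintegral [in LHS]integral_mkcond; congr fine; apply: eq_integral => q _.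
by rewrite patchE mem_Omega; case: (boolP (inO rad a q)) => // /u0 ->; rewrite mul0r.
Qed.

(** [S] may be nonzero at the ends; the boundary terms vanish because [ph] has compact support in
    the open rectangle. The indicator stays attached to [S] since the sines are extended by zero. *)
Lemma tensor_parts_z (c S : R -> R) ph : L2r rad c -> C1 S -> test2 (Omega rad a) ph ->
  \int[leb2]_p (c p.1 * (S p.2 * itvJ a p.2) * 'D_ez ph p) =
  - \int[leb2]_p (c p.1 * (derive1 S p.2 * itvJ a p.2) * ph p).
Proof.
move=> Lc CS tp; have [_ CS'] := CS; have cS := C1_continuous CS.
have tz := test2_D_ez tp; have [sp _] := tp.
have [x [y [x' [y' [_ _ /andP[ax' xy'] y'a p0]]]]] := test2_box rad0 a0 tp.
have LcJ : L2w rad a (fun p => c p.1 * itvJ a p.2).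
  apply: L2w_tensor => //; [|by move=> z; rewrite /itvJ; case: (_ < _ < _); rewrite ?normr1 ?normr0|exact: itvJ_out].
  rewrite (_ : itvJ a = fun z => 1 * itvJ a z); last by apply/funext => z; rewrite mul1r.
  by apply: (@L1_itvJ _ a (fun=> 1)) => z; exact: cvg_cst.
have key (T : R -> R) th : continuous T -> test2 (Omega rad a) th ->
   [/\ L1 leb2 (fun p => c p.1 * (T p.2 * itvJ a p.2) * th p) &
   \int[leb2]_p (c p.1 * (T p.2 * itvJ a p.2) * th p) =
   \int[leb]_r (c r * \int[leb]_z (T z * th (r, z)))].
  move=> cT tth; have [sth _] := tth.
  have mth := test2_measurable tth.
  have [M M0 Mth] := test2_le_weight rad0 a0 tth.
  have [q [t [q' [t' [_ _ /andP[aq' qt'] t'a th0]]]]] := test2_box rad0 a0 tth.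
  have [B B0 TB] : exists2 B, 0 <= B & forall z, `|T z * itvJ a z| <= B.
    have n0 : `[- a, a]%classic !=set0 by exists a; rewrite /= in_itv/= lexx andbT ge0_cp// ltW.
    have [m _ mB] := compact_EVT_max n0 (@segment_compact R (- a) a)
      (continuous_subspaceT (fun z => cvg_norm (cT z))).
    exists `|T m| => // z; rewrite /itvJ; have [/andP[/ltW z1 /ltW z2]|_] := boolP (- a < z < a).
      by rewrite mulr1; apply: mB; rewrite inE /= in_itv/= z1.
    by rewrite mulr0 normr0.
  have mT : measurable_fun setT (fun p : R * R => (T p.2 * itvJ a p.2) * th p).
    apply: measurable_funM => //; apply: (measurableT_comp (f := fun z => T z * itvJ a z)) => //.
    by apply: measurable_funM; [exact: continuous_measurable_fun|exact: measurable_itvJ].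
  have wM p : inO rad a p -> `|(T p.2 * itvJ a p.2) * th p| <= (B * M) * p.1.
    move=> /andP[/andP[p1 _] _]; rewrite normrM -mulrA; apply: ler_pM => //.
    by have := Mth p; rewrite max_l// ltW.
  have E (p : R * R) : c p.1 * itvJ a p.2 * (T p.2 * itvJ a p.2 * th p) = c p.1 * (T p.2 * itvJ a p.2) * th p.
    by rewrite -{3}(itvJ_idem a); ring.
  have Ip : L1 leb2 (fun p => c p.1 * (T p.2 * itvJ a p.2) * th p).
    rewrite (_ : (fun p => _) = (fun p => c p.1 * itvJ a p.2 * (T p.2 * itvJ a p.2 * th p))).
      by have [] := pairing rad0 a0 LcJ mT wM.
    by apply/funext => p; rewrite E.
  split => //; have [_ _ _ ->] := plane_fubini1 Ip; apply: eq_Int => r /=.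
  have Ith : L1 leb (fun z => T z * th (r, z)).
    apply: (@L1_continuous_support _ _ q' t').
      by move=> z; apply: cvgM; [exact: cT|exact: (continuous_slice2 (smooth2_continuous sth))].
    by move=> z zO; rewrite th0 ?mulr0// negb_and zO orbT.
  rewrite -IntZl//; apply: eq_Int => z; have [zJ|zO] := boolP (- a < z < a).
    by rewrite itvJ_in// mulr1 mulrA.
  rewrite itvJ_out// th0 ?mulr0// negb_and orbC negb_and -!ltNge.
  move: zO; rewrite negb_and -!leNgt => /orP[h|h]; first by rewrite (le_lt_trans h aq').
  by rewrite (lt_le_trans t'a h) orbT.
have [_ ->] := key _ _ cS tz; have [_ ->] := key _ _ CS' tp.
have [mc _ _] := Lc.
rewrite (@eq_Int _ _ _ leb _ (fun r => - (c r * \int[leb]_z (derive1 S z * ph (r, z))))); last first.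
  move=> r; rewrite -mulrN; congr (_ * _); apply/eqP; rewrite -addr_eq0; apply/eqP.
  have Cp := smooth2_C1_slice2 r sp.
  have [CSp e] := C1M CS Cp.
  have v0 z : ~~ (x' <= z <= y') -> ph (r, z) = 0 by move=> zO; rewrite p0// negb_and zO orbT.
  have S0 z : ~~ (x' <= z <= y') -> S z * ph (r, z) = 0 by move=> /v0 ->; rewrite mulr0.
  have v'0 z : ~~ (x' <= z <= y') -> derive1 (fun z => ph (r, z)) z = 0 by exact: derive1_eq0_outside.
  have [_ _ <-] := Prim_C1_support CSp xy' S0.
  rewrite e -IntD.
  - by apply: eq_Int => z; rewrite D_ezE addrC.
  - apply: (@L1_continuous_support _ _ x' y'); last by move=> z /v'0; rewrite D_ezE => ->; rewrite mulr0.
    move=> z; apply: cvgM; first exact: cS.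
    exact: (continuous_slice2 (smooth2_continuous tz.1)).
  - apply: (@L1_continuous_support _ _ x' y'); last by move=> z /v0 ->; rewrite mulr0.
    by move=> z; apply: cvgM; [exact: CS'|exact: (C1_continuous Cp)].
rewrite IntN//; have [Ip _] := key _ _ CS' tp.
have [_ _ I1 _] := plane_fubini1 Ip.
apply: (leb_L1_ae _ I1).
  apply: measurable_funM => //; apply: (@measurable_Int_slice _ _ _ (fun p => derive1 S p.2 * ph p)).
  apply: measurable_funM; last exact: test2_measurable tp.
  by apply: (measurableT_comp (f := derive1 S)) => //; exact: continuous_measurable_fun.
apply: aeW => r /=; rewrite -IntZl; last first.
  apply: (@L1_continuous_support _ _ x' y'); last by move=> z zO; rewrite p0 ?mulr0// negb_and zO orbT.
  by move=> z; apply: cvgM; [exact: CS'|exact: (continuous_slice2 (smooth2_continuous sp))].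
apply: eq_Int => z; have [zJ|zO] := boolP (- a < z < a).
  by rewrite itvJ_in// mulr1 mulrA.
rewrite itvJ_out// p0 ?mulr0// negb_and orbC negb_and -!ltNge.
move: zO; rewrite negb_and -!leNgt => /orP[h|h]; first by rewrite (le_lt_trans h ax').
by rewrite (lt_le_trans y'a h) orbT.
Qed.

(** On the support of [ph], [f] is a primitive of [p] up to the constant [P], and a constant
    integrates to 0 against ['D_er ph]. *)
Lemma tensor_parts_r (f p g : R -> R) (P : R) ph : L2r rad f -> L2r rad p -> L1 leb p ->
  {ae leb, forall r, 0 < r < rad -> f r = Prim p r - P} ->
  L1 leb g -> (forall z, `|g z| <= 1) -> (forall z, ~~ (- a < z < a) -> g z = 0) ->
  test2 (Omega rad a) ph ->
  \int[leb2]_q (f q.1 * g q.2 * 'D_er ph q) = - \int[leb2]_q (p q.1 * g q.2 * ph q).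
Proof.
move=> Lf Lp Ip fp Ig g1 g0 tp; have [sp _] := tp; have tr := test2_D_er tp.
have [x [y [x' [y' [/andP[x0 xy] yr _ _ p0]]]]] := test2_box rad0 a0 tp.
have key c th : L2r rad c -> test2 (Omega rad a) th ->
   L1 leb2 (fun q => c q.1 * g q.2 * th q).
  move=> Lc tth; have [M M0 Mth] := test2_le_weight rad0 a0 tth.
  have [] // := pairing rad0 a0 (L2w_tensor Lc Ig g1 g0) (test2_measurable tth) (M := M).
  by move=> q /andP[/andP[q1 _] _]; have := Mth q; rewrite max_l// ltW.
have Ipp := key _ _ Lp tp.
have [_ _ _ ->] := plane_fubini2 (key _ _ Lf tr); have [_ _ Iz ->] := plane_fubini2 Ipp.
rewrite -IntN//; apply: eq_Int => z /=.
have Cp := smooth2_C1_slice1 z sp; have [_ cp'] := Cp.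
have v0 r : ~~ (x <= r <= y) -> ph (r, z) = 0 by move=> rO; rewrite p0// negb_and rO.
have [I0 _ T0] := Prim_C1_support Cp xy v0.
have Eparts := parts_C1_support Ip Cp xy v0.
have [_ IP _ _] := Prim_fubini Ip I0.
have [M _ hM] := continuous_bounded_support (C1_continuous Cp) v0.
have Iph : L1 leb (fun r => p r * ph (r, z)).
  by apply: (leb_mulr_bounded Ip _ hM); exact: continuous_measurable_fun (C1_continuous Cp).
have mf : measurable_fun setT f by have [] := Lf.
have md := continuous_measurable_fun cp'.
rewrite (@eq_Int _ _ _ leb (fun r => p r * g z * ph (r, z)) (fun r => g z * (p r * ph (r, z)))); last by move=> r; ring.
rewrite IntZl// -mulrN -Eparts.
have IQ : L1 leb (fun r => Prim p r * derive1 (fun r => ph (r, z)) r - P * derive1 (fun r => ph (r, z)) r).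
  by apply: L1B => //; exact: L1Zl.
transitivity (g z * \int[leb]_r (Prim p r * derive1 (fun r => ph (r, z)) r - P * derive1 (fun r => ph (r, z)) r)); last first.
  by rewrite IntB ?IntZl ?T0 ?mulr0 ?subr0//; exact: L1Zl.
rewrite -IntZl//; apply: Int_ae.
- rewrite (_ : (fun r => _) = (fun r => f r * g z * derive1 (fun r => ph (r, z)) r)); last first.
    by apply/funext => r; rewrite D_erE.
  by apply: measurable_funM => //; exact: measurable_funM.
- by apply: L1_measurable (L1Zl (g z) IQ).
- apply: (ae_imp fp) => r Hr; rewrite D_erE; have [/Hr ->|rO] := boolP (0 < r < rad); first by ring.
  rewrite (derive1_eq0_outside v0) ?mulr0 ?subr0 ?mulr0//.
  move: rO; rewrite !negb_and -!leNgt -!ltNge => /orP[h|h]; first by rewrite (le_lt_trans h x0).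
  by rewrite (lt_le_trans yr h) orbT.
Qed.
End regularity.

(** * The weak derivatives [psi_zz] and [psi_zr] *)

Section second_derivatives.
Context {R : realType} (rad a : R) (rad0 : 0 < rad) (a0 : 0 < a).
Local Notation leb := (@lebesgue_measure R).
Local Notation leb2 := (leb \x leb)%E.
Context (om psi psir psiz : R * R -> R).
Hypotheses (Lo : L2w rad a om) (Lp : L2w rad a psi) (Lr : L2w rad a psir)
  (Lz : L2w rad a psiz) (tr0 : trace0 rad a psi psir psiz).
Hypothesis weak_z : forall ph, test2 (Omega rad a) ph ->
  \int[leb2]_q (psi q * 'D_ez ph q) = - \int[leb2]_q (psiz q * ph q).
Hypothesis weak_eq : forall ph, test2 (Omega rad a) ph ->
  \int[leb2]_q (psi q * 'D_er (fun s => 'D_er ph s) q) +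
  \int[leb2]_q (3 * (psir q * (q.1^-1 * ph q))) +
  \int[leb2]_q (psi q * 'D_ez (fun s => 'D_ez ph s) q) = - \int[leb2]_q (om q * ph q).

Let f k := zint psi (sn a k).
Let p k := zint psir (sn a k).
Let o k := zint om (sn a k).

Let Lf k : L2r rad (f k). Proof. exact: L2r_mode. Qed.
Let Lpk k : L2r rad (p k). Proof. exact: L2r_mode. Qed.
Let Lok k : L2r rad (o k). Proof. exact: L2r_mode. Qed.

Let eq_k k v : test1 `]0, rad[ v -> \int[leb]_r (p k r * derive1 v r) =
  \int[leb]_r (3 * (p k r * (r^-1 * v r))) -
  \int[leb]_r ((lam a k ^+ 2 * f k r - o k r) * v r).
Proof. exact: (mode_equation rad0 a0 Lo Lp Lr Lz tr0 weak_z weak_eq). Qed.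

Let tr_k k b : test1 `]0, rad[ b ->
  \int[leb]_r (f k r * b r) = - \int[leb]_r (p k r * Prim b r).
Proof. exact: (mode_trace rad0 a0 Lp Lr tr0). Qed.

Let l0 k : 0 < lam a k. Proof. exact: lam_gt0. Qed.

Lemma mode_radial_cube k : {ae leb, forall r, 0 < r < rad ->
  r ^+ 3 * p k r = Prim (fun t => t ^+ 3 * (lam a k ^+ 2 * f k t - o k t)) r}.
Proof. exact: (mode_cube_eq rad0 (Lf k) (Lpk k) (Lok k) (@eq_k k)). Qed.

Lemma mode_radial_L1 k : L1 leb (p k).
Proof. exact: (mode_p_L1 rad0 (Lf k) (Lpk k) (Lok k) (@eq_k k)). Qed.

Lemma mode_radial_primitive k : {ae leb, forall r, 0 < r < rad ->
  f k r = Prim (p k) r - \int[leb]_t p k t}.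
Proof. exact: (mode_primitive rad0 (Lf k) (Lpk k) (Lok k) (@tr_k k) (@eq_k k)). Qed.

Let energy_k k : lam a k ^+ 4 * \int[leb]_r (f k r ^+ 2 * r) +
  2 * lam a k ^+ 2 * \int[leb]_r (p k r ^+ 2 * r) <= \int[leb]_r (o k r ^+ 2 * r).
Proof. exact: (mode_energy rad0 (Lf k) (Lpk k) (Lok k) (@tr_k k) (@eq_k k)). Qed.

(** Bessel's inequality on almost every slice, integrated against [r dr]. *)
Lemma Bessel_sum N : \sum_(k < N) \int[leb]_r (o k r ^+ 2 * r) <= a * N2 om.
Proof.
have [I1 E1] := slice_sqr_w Lo; rewrite -E1 -IntZl// -Int_sum; last by move=> k; have [] := Lok k.
apply: Int_ae_le; [by apply: L1_sum => k; have [] := Lok k|exact: L1Zl|].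
apply: (ae_imp (ae_slice_L2 Lo)) => r [Ir Ir2].
have [/andP[r0 _]|rO] := boolP (0 < r < rad); last first.
  rewrite big1; last by move=> k _; have [_ -> //] := Lok k; rewrite expr0n mul0r.
  rewrite (@eq_Int _ _ _ leb _ (fun=> 0)) ?Int0 ?mul0r ?mulr0// => z.
  by have [_ -> //] := Lo; [rewrite expr0n|rewrite /inO negb_and rO].
rewrite -mulr_suml mulrA; apply: ler_wpM2r; first exact: ltW.
exact: (@Bessel R a a0 (fun z => om (r, z)) N Ir Ir2).
Qed.

Let nn (c : R -> R) : L2r rad c -> 0 <= \int[leb]_r (c r ^+ 2 * r).
Proof. by move=> Lc; apply: Int_ge0 => r; exact: (L2r_wge0 _ Lc). Qed.

Let scaled_sum (l : nat -> R) (C : R) (c : nat -> R -> R) N : (forall k, L2r rad (c k)) ->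
  (forall k, l k ^+ 2 * \int[leb]_r (c k r ^+ 2 * r) <= C * \int[leb]_r (o k r ^+ 2 * r)) -> 0 <= C ->
  \sum_(k < N) \int[leb]_r ((l k * c k r) ^+ 2 * r) <= C * (a * N2 om).
Proof.
move=> Lc h C0; apply: (@le_trans _ _ (C * \sum_(k < N) \int[leb]_r (o k r ^+ 2 * r))); last first.
  by rewrite ler_wpM2l// Bessel_sum.
rewrite mulr_sumr; apply: ler_sum => k _; apply: le_trans (h k).
rewrite -IntZl; last by have [] := Lc k.
by rewrite (@eq_Int _ _ _ leb _ (fun r => l k ^+ 2 * (c k r ^+ 2 * r)))// => r; rewrite exprMn mulrA.
Qed.

(** A series with the same modes as [psi] is built first, and completeness identifies it with [psi].
    Afterwards [psi] can be tested term by term. *)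
Lemma psi_series (w : R * R -> R) (M : R) : measurable_fun setT w ->
  (forall q, inO rad a q -> `|w q| <= M * q.1) ->
  \sum_(k < n) \int[leb2]_q (a^-1 * f k q.1 * sn a k q.2 * w q) @[n --> \oo] --> \int[leb2]_q (psi q * w q).
Proof.
move=> mw wM.
(* The energy estimate bounds [lam^4] times the norm of each mode, and [lam a 0] is the smallest
   frequency. *)
have HB N : \sum_(k < N) \int[leb]_r ((a^-1 * f k r) ^+ 2 * r) <= (a^-1 ^+ 2 / lam a 0 ^+ 4) * (a * N2 om).
  apply: (@scaled_sum (fun=> a^-1)) => [k|k|]; first exact: Lf.
    rewrite -[leRHS]mulrA; apply: ler_wpM2l; first exact: sqr_ge0.
    rewrite ler_pdivlMl ?exprn_gt0//; apply: le_trans (energy_k k).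
    rewrite -[leLHS]addr0; apply: lerD; last first.
      by apply: mulr_ge0; [rewrite mulr_ge0 ?sqr_ge0|exact: (nn (Lpk k))].
    apply: ler_wpM2r; first exact: nn.
    by apply: lerXn2r; rewrite ?nnegrE; [exact: ltW|exact: ltW|exact: lam_ge].
  by rewrite divr_ge0 ?sqr_ge0// exprn_ge0// ltW.
have [v [Lv _ Hv cv]] := orthogonal_series rad0 a0 (L1_sn a) (sn_le1 a) (@sn_out _ a) (sn_orth a0)
  (fun k => L2rZ a^-1 (Lf k)) HB.
suff vp : {ae leb2, forall q, (v q - psi q) * q.1 = 0}.
  have := Hv w M mw wM.
  rewrite (_ : \int[leb2]_q (v q * w q) = \int[leb2]_q (psi q * w q))//.
  have [mv v0 _] := Lv; have [mp p0 _] := Lp.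
  apply: Int_ae; [exact: measurable_funM|exact: measurable_funM|].
  apply: (ae_imp vp) => q; have [/andP[/andP[q0 _] _]|qO] := boolP (inO rad a q); last first.
    by rewrite v0// p0// !mul0r.
  by move/eqP; rewrite mulf_eq0 (gt_eqF q0) orbF subr_eq0 => /eqP ->.
have Lvp := L2wB Lv Lp.
(* The factor [r] makes the difference integrable with respect to [dr dz], as [complete_plane]
   requires. *)
have Iu : L1 leb2 (fun q => (v q - psi q) * q.1).
  have [] // := pairing rad0 a0 Lvp (measurable_p1 (R := R)) (M := 1).
  by move=> q /andP[/andP[q0 _] _]; rewrite mul1r gtr0_norm.
have su : supp rad a (fun q => (v q - psi q) * q.1).
  by move=> q qO; have [_ -> //] := Lvp; rewrite mul0r.
have [] // := complete_plane a0 Iu su.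
move=> k; apply: (ae_imp2 (ae_imp2 (ae_slice_L2 Lv) (ae_slice_L2 Lp) (fun r h1 h2 => conj h1 h2)) (cv k)).
move=> r [[I1 _] [I2 _]] Hk.
have msn := L1_measurable (L1_sn a k).
have J1 : L1 leb (fun z => v (r, z) * sn a k z) by exact: leb_mulr_bounded (sn_le1 a k).
have J2 : L1 leb (fun z => psi (r, z) * sn a k z) by exact: leb_mulr_bounded (sn_le1 a k).
rewrite /zint/= (@eq_Int _ _ _ leb _ (fun z => r * (v (r, z) * sn a k z - psi (r, z) * sn a k z))); last first.
  by move=> z; ring.
rewrite IntZl; last exact: L1B.
rewrite IntB// -/(zint v _ r) -/(zint psi _ r) -/(f k r).
have [rI|rO] := boolP (0 < r < rad); last first.
  by have [_ -> // _] := L2r_mode k Lv; have [_ -> // _] := Lf k; rewrite subrr mulr0.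
by rewrite Hk// mulrA divff ?gt_eqF// mul1r subrr mulr0.
Qed.

Let weight_bound ph : test2 (Omega rad a) ph -> exists M, forall q, inO rad a q -> `|ph q| <= M * q.1.
Proof.
move=> tp; have [M M0 h] := test2_le_weight rad0 a0 tp; exists M => q /andP[/andP[q0 _] _].
by have := h q; rewrite max_l// ltW.
Qed.

Let series_unique (F G : nat -> R) (x y : R) : (forall k, F k = G k) ->
  \sum_(k < n) F k @[n --> \oo] --> x -> \sum_(k < n) G k @[n --> \oo] --> y -> x = y.
Proof.
move=> /funext -> h1 h2; exact: cvg_unique h1 h2.
Qed.

(** Both derivatives are moved from [psi] to the test function; each term of the sine series is
    integrated by parts twice, and both series are summed again by their convergence against test
    functions. With coefficients normalised by [1 / a], the constant is [2 a * a^-2 * a = 2]. *)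
Lemma ex_weak_deriv_zz : exists g, [/\ L2w rad a g, N2 g <= 2 * N2 om,
  forall k, {ae leb, forall r, zint g (sn a k) r = - lam a k ^+ 2 * f k r} &
  weak_deriv2 (Omega rad a) ez psiz g].
Proof.
pose c k r := (- a^-1 * lam a k ^+ 2) * f k r.
have HB N : \sum_(k < N) \int[leb]_r (c k r ^+ 2 * r) <= a^-1 ^+ 2 * (a * N2 om).
  apply: (@scaled_sum (fun k => - a^-1 * lam a k ^+ 2)) => [k|k|]; [exact: Lf| |exact: sqr_ge0].
  rewrite exprMn sqrrN -exprM -[leLHS]mulrA; apply: ler_wpM2l; first exact: sqr_ge0.
  apply: le_trans (energy_k k).
  by rewrite lerDl; apply: mulr_ge0; [rewrite mulr_ge0 ?sqr_ge0|exact: (nn (Lpk k))].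
have Lc k : L2r rad (c k) by exact: L2rZ.
have [g [Lg Ng Hg cg]] := orthogonal_series rad0 a0 (L1_sn a) (sn_le1 a) (@sn_out _ a) (sn_orth a0) Lc HB.
exists g; split => //.
- apply: (le_trans Ng); rewrite mulrA mulrA (_ : 2 * a * _ * a = 2)//.
  by field; rewrite gt_eqF.
- move=> k; apply: (ae_imp (cg k)) => r h; have [/h ->|rO] := boolP (0 < r < rad).
    by rewrite /c; field; rewrite gt_eqF.
  by have [_ -> // _] := L2r_mode k Lg; have [_ -> // _] := Lf k; rewrite mulr0.
- split; [exact: loc_integrable2_L2w|exact: loc_integrable2_L2w|move=> ph tp].
have tz := test2_D_ez tp; have tzz := test2_D_ez tz.
rewrite !Int_Omega//.
have := weak_z tz => /(congr1 (fun x => - x)); rewrite opprK => <-; congr (- _).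
have [M1 h1] := weight_bound tzz; have [M2 h2] := weight_bound tp.
apply: (series_unique (G := fun k => \int[leb2]_q (c k q.1 * sn a k q.2 * ph q)) _
  (psi_series (test2_measurable tzz) h1) (Hg _ _ (test2_measurable tp) h2)).
move=> k.
have [Cs es] := C1_sinl a k; have [Cc ec] := C1_cosl a k.
have E1 := tensor_parts_z rad0 a0 (L2rZ a^-1 (Lf k)) Cs tz.
have E2 := tensor_parts_z rad0 a0 (L2rZ (a^-1 * lam a k) (Lf k)) Cc tp.
rewrite {}es in E1; rewrite {}ec in E2.
apply: etrans E1 _; rewrite (@eq_Int _ _ _ leb2 _ (fun q => a^-1 * lam a k * f k q.1 * (cosl a k q.2 * itvJ a q.2) * 'D_ez ph q)); last first.
  by move=> q; ring.
rewrite E2 opprK; apply: eq_Int => q; rewrite /c /sn; ring.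
Qed.

(** Differentiating the sines in [z] gives a cosine series with coefficients [lam p / a]. It is
    bounded by the term [2 lam^2] of the energy estimate, of which half is given away. *)
Lemma ex_weak_deriv_zr : exists g, [/\ L2w rad a g, N2 g <= 2 * N2 om &
  weak_deriv2 (Omega rad a) er psiz g].
Proof.
pose c k r := (a^-1 * lam a k) * p k r.
have HB N : \sum_(k < N) \int[leb]_r (c k r ^+ 2 * r) <= a^-1 ^+ 2 * (a * N2 om).
  apply: (@scaled_sum (fun k => a^-1 * lam a k)) => [k|k|]; [exact: Lpk| |exact: sqr_ge0].
  rewrite exprMn -[leLHS]mulrA; apply: ler_wpM2l; first exact: sqr_ge0.
  apply: le_trans (energy_k k).
  rewrite -[leLHS]add0r; apply: lerD; first by apply: mulr_ge0; [rewrite exprn_ge0// ltW|exact: (nn (Lf k))].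
  by apply: ler_wpM2r; [exact: (nn (Lpk k))|rewrite ler_peMl ?sqr_ge0// ler1n].
have Lc k : L2r rad (c k) by exact: L2rZ.
have [g [Lg Ng Hg cg]] := orthogonal_series rad0 a0 (L1_cs a) (cs_le1 a) (@cs_out _ a) (cs_orth a0) Lc HB.
exists g; split => //.
- apply: (le_trans Ng); rewrite mulrA mulrA (_ : 2 * a * _ * a = 2)//.
  by field; rewrite gt_eqF.
- split; [exact: loc_integrable2_L2w|exact: loc_integrable2_L2w|move=> ph tp].
have tr := test2_D_er tp; have trz := test2_D_ez tr.
rewrite !Int_Omega//.
have := weak_z tr => /(congr1 (fun x => - x)); rewrite opprK => <-; congr (- _).
have [M1 h1] := weight_bound trz; have [M2 h2] := weight_bound tp.
apply: (series_unique (G := fun k => \int[leb2]_q (c k q.1 * cs a k q.2 * ph q)) _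
  (psi_series (test2_measurable trz) h1) (Hg _ _ (test2_measurable tp) h2)).
move=> k.
have [Cs es] := C1_sinl a k.
have E1 := tensor_parts_z rad0 a0 (L2rZ a^-1 (Lf k)) Cs tr.
have E2 := tensor_parts_r rad0 a0 (L2rZ (a^-1 * lam a k) (Lf k)) (Lc k) (L1Zl _ (mode_radial_L1 k)) _
  (L1_cs a k) (cs_le1 a k) (@cs_out _ a k) tp.
rewrite {}es in E1.
apply: etrans E1 _; rewrite (@eq_Int _ _ _ leb2 _ (fun q => a^-1 * lam a k * f k q.1 * cs a k q.2 * 'D_er ph q)); last first.
  by move=> q; rewrite /cs; ring.
rewrite (E2 (a^-1 * lam a k * \int[leb]_t p k t)) ?opprK//.
apply: (ae_imp (mode_radial_primitive k)) => r Hr rr; rewrite Hr// mulrBr; congr (_ - _).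
by rewrite /Prim -IntZl; [apply: eq_Int => t; rewrite /c mulrA|exact: L1_le_cut (mode_radial_L1 k)].
Qed.

End second_derivatives.

(** * Slices *)

Section primitives.
Context {R : realType} (rad a : R) (rad0 : 0 < rad) (a0 : 0 < a).
Local Notation leb := (@lebesgue_measure R).
Local Notation leb2 := (leb \x leb)%E.

(** The upper limit [m] is the identity for a running primitive and the constant [rad] for the full
    integral. *)
Lemma measurable_Prim_plane (u : R * R -> R) (m : R -> R) :
  measurable_fun setT u -> measurable_fun setT m ->
  measurable_fun setT (fun q : R * R => Prim (fun t => u (t, q.2)) (m q.1)).
Proof.
move=> mu mm.
apply: (@measurable_Int_slice _ (R * R)%type R (fun x : (R * R) * R => u (x.2, x.1.2) * (x.2 <= m x.1.1)%R%:R)).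
have m2 : measurable_fun setT (fun x : (R * R) * R => x.2) by exact: measurable_snd.
have m12 : measurable_fun setT (fun x : (R * R) * R => x.1.2).
  exact: (measurableT_comp (f := fun q : R * R => q.2) measurable_snd measurable_fst).
have m11 : measurable_fun setT (fun x : (R * R) * R => x.1.1).
  exact: (measurableT_comp (f := fun q : R * R => q.1) measurable_fst measurable_fst).
apply: measurable_funM.
  exact: (measurableT_comp mu (measurable_fun_pair m2 m12)).
by apply: measurable_le_nat => //; exact: (measurableT_comp mm m11).
Qed.

Lemma Prim_plane (u : R * R -> R) (m : R -> R) : L1 leb2 u -> measurable_fun setT m ->
  L1 leb2 (fun q => Prim (fun t => u (t, q.2)) (m q.1) * (inO rad a q)%:R).
Proof.
move=> Iu mm; have In := L1_norm Iu.
have [a2 _ _ _] := plane_fubini2 Iu; have [_ _ I2 _] := plane_fubini2 In.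
have II : L1 leb (fun r : R => (0 < r < rad)%R%:R : R).
  rewrite (_ : (fun r => _) = (fun r => (1 * (0 <= r <= rad)%R%:R) * (0 < r < rad)%R%:R)).
    apply: L1_mul_bool; last by apply: (@L1_continuous_segment _ (fun=> 1)) => x; exact: cvg_cst.
    rewrite (_ : (fun x => _) = (fun x : R => (0 < x)%R%:R * (x < rad)%R%:R)).
      by apply: measurable_funM; exact: measurable_lt_nat.
    by apply/funext => x; case: (0 < x); rewrite ?mul0r ?mul1r.
  apply/funext => r; have [/andP[/ltW -> /ltW ->]|_] := boolP (0 < r < rad); rewrite ?mulr1 ?mulr0//.
have mP := measurable_Prim_plane (L1_measurable Iu) mm.
apply: (@plane_tonelli2 _ _ (fun z => (\int[leb]_t `|u (t, z)|) * \int[leb]_r (0 < r < rad)%R%:R)).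
- by apply: measurable_funM => //; exact: measurable_inO.
- exact: L1Zr.
- apply: (ae_imp a2) => z Iz /=.
  have mPz : measurable_fun setT (fun r => Prim (fun t => u (t, z)) (m r)).
    have [mQ _ _ _] := Prim_fubini Iz Iz; exact: (measurableT_comp mQ mm).
  have PI : L1 leb (fun r => Prim (fun t => u (t, z)) (m r) * (0 < r < rad)%R%:R).
    by apply: (leb_mull_bounded mPz II) => r; exact: Prim_le.
  have E r : Prim (fun t => u (t, z)) (m r) * (inO rad a (r, z))%:R =
      (- a < z < a)%R%:R * (Prim (fun t => u (t, z)) (m r) * (0 < r < rad)%R%:R).
    by rewrite /inO /=; case: (0 < r < rad); case: (- a < z < a); rewrite ?mulr1 ?mulr0 ?mul1r ?mul0r.
  have IE : L1 leb (fun r => Prim (fun t => u (t, z)) (m r) * (inO rad a (r, z))%:R).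
    by under eq_fun do rewrite E; exact: L1Zl.
  split => //; rewrite -IntZl//; apply: Int_le; [exact: L1_norm|exact: L1Zl|move=> r].
  rewrite E !normrM [X in _ * (_ * X) <= _]ger0_norm ?ler0n// mulrA; apply: ler_wpM2r; first exact: ler0n.
  apply: (@le_trans _ _ (1 * `|Prim (fun t => u (t, z)) (m r)|)).
    by apply: ler_wpM2r => //; rewrite ger0_norm ?ler0n// lern1; case: (_ < _ < _).
  by rewrite mul1r; exact: Prim_le.
Qed.

(** Fubini on the part [t <= x]: taking a mode in [z] commutes with the primitive in [r], so a slice
    identity can be checked mode by mode. *)
Lemma zint_Prim (u : R * R -> R) (g : R -> R) (B x : R) : L1 leb2 u -> measurable_fun setT g ->
  (forall z, `|g z| <= B) ->
  [/\ L1 leb (zint u g), {ae leb, forall z, L1 leb (fun t => u (t, z))},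
    L1 leb (fun z => Prim (fun t => u (t, z)) x * g z) &
    \int[leb]_z (Prim (fun t => u (t, z)) x * g z) = Prim (zint u g) x].
Proof.
move=> Iu mg gB.
have mg2 : measurable_fun setT (fun q : R * R => g q.2) by exact: measurableT_comp.
have Iug : L1 leb2 (fun q => u q * g q.2).
  rewrite (_ : (fun q => _) = (fun q => g q.2 * u q)); last by apply/funext => q; rewrite mulrC.
  by apply: (@L1_mull_bounded _ _ _ leb2 _ _ B).
have mle : measurable_fun setT (fun q : R * R => (q.1 <= x)%R%:R : R).
  by apply: measurable_le_nat => //; exact: measurable_fst.
have Iugx : L1 leb2 (fun q => u q * g q.2 * (q.1 <= x)%R%:R).
  rewrite (_ : (fun q => _) = (fun q => (q.1 <= x)%R%:R * (u q * g q.2))); last by apply/funext => q; rewrite mulrC.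
  apply: (@L1_mull_bounded _ _ _ leb2 _ _ 1 mle Iug) => q.
  by case: (q.1 <= x); rewrite ?normr1 ?normr0.
have [a2 _ _ _] := plane_fubini2 Iu; have [_ _ Iz _] := plane_fubini1 Iug.
have [_ _ I1 E1] := plane_fubini1 Iugx; have [_ m2 I2 E2] := plane_fubini2 Iugx.
have mP : measurable_fun setT (fun z => Prim (fun t => u (t, z)) x * g z).
  apply: measurable_funM => //.
  apply: (measurable_Int_slice (F := fun y : R * R => u (y.2, y.1) * (y.2 <= x)%R%:R)).
  have mS : measurable_fun setT (fun y : R * R => (y.2, y.1)).
    by apply: measurable_fun_pair; [exact: measurable_snd|exact: measurable_fst].
  apply: measurable_funM; first exact: (measurableT_comp (L1_measurable Iu) mS).
  by apply: measurable_le_nat => //; exact: measurable_snd.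
have aE : {ae leb, forall z, \int[leb]_r (u (r, z) * g z * (r <= x)%R%:R) = Prim (fun t => u (t, z)) x * g z}.
  apply: (ae_imp a2) => z Iuz; rewrite /Prim -IntZr; last exact: L1_le_cut.
  by apply: eq_Int => r; rewrite mulrAC.
split => //; first exact: (leb_L1_ae mP I2 aE).
transitivity (\int[leb]_z \int[leb]_r (u (r, z) * g z * (r <= x)%R%:R)).
  by apply: Int_ae => //; apply: (ae_imp aE).
rewrite -E2 E1; have [a1 _ _ _] := plane_fubini1 Iug.
apply: Int_ae; [exact: L1_measurable I1|by apply: L1_measurable; exact: L1_le_cut|].
by apply: (ae_imp a1) => r Ir; rewrite /= IntZr.
Qed.

End primitives.

(** * Identities on almost every slice *)

Section slices.
Context {R : realType} (rad a : R) (rad0 : 0 < rad) (a0 : 0 < a).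
Local Notation leb := (@lebesgue_measure R).
Local Notation leb2 := (leb \x leb)%E.

Lemma slice_L2r u : L2w rad a u ->
  {ae leb, forall z, L2r rad (fun r => u (r, z))} /\
  L1 leb (fun z => \int[leb]_r (u (r, z) ^+ 2 * r)) /\
  \int[leb]_z (\int[leb]_r (u (r, z) ^+ 2 * r)) = N2 u.
Proof.
move=> [mu su Iu]; have [a2 _ I2 E2] := plane_fubini2 Iu; split; last by split => //; rewrite E2.
apply: (ae_imp a2) => z Iz; split => //.
  have mE : measurable_fun setT (fun r : R => (r, z)) by exact: measurable_fun_pair.
  exact: (measurableT_comp mu mE).
by move=> r rO; apply: su; rewrite /inO negb_and rO.
Qed.

(** The powers of [r] cancel as in [p_sqr_le], and [|p| <= A + 1] follows from [p^2 <= A]. The last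
    bound is linear in [A], which depends on the slice and is integrable in [z]; this is what
    [psir_L1] needs. *)
Lemma cube_eq_bound (p h : R -> R) : L2r rad h -> measurable_fun setT p ->
  (forall r, ~~ (0 < r < rad) -> p r = 0) ->
  {ae leb, forall r, 0 < r < rad -> r ^+ 3 * p r = Prim (fun t => t ^+ 3 * h t) r} ->
  [/\ {ae leb, forall r, 0 < r < rad -> p r ^+ 2 <= \int[leb]_t (h t ^+ 2 * t)}, L1 leb p &
  \int[leb]_r `|p r| <= (\int[leb]_t (h t ^+ 2 * t) + 1) * rad].
Proof.
move=> Lh mp p0 cube; set A := \int[leb]_t _.
have A0 : 0 <= A by apply: Int_ge0 => r; exact: L2r_wge0 Lh.
have pA : {ae leb, forall r, 0 < r < rad -> p r ^+ 2 <= A}.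
  apply: (ae_imp cube) => r Hr rr; have := Prim_pow_sqr_le 2 Lh rr.
  rewrite -Hr// exprMn -/A mulrC ler_pM2r//; have /andP[r0 _] := rr.
  by rewrite !exprn_gt0.
have aB : {ae leb, forall r, `|p r| <= (A + 1) * (1 * (0 <= r <= rad)%R%:R)}.
  apply: (ae_imp pA) => r Hr; have [rr|/p0 ->] := boolP (0 < r < rad); last first.
    by rewrite normr0 mulr_ge0 ?addr_ge0// mul1r ler0n.
  have /andP[/ltW -> /ltW ->] := rr; rewrite !mulr1.
  have := Hr rr; rewrite -real_normK ?num_real//; have := normr_ge0 (p r); nra.
have IB : L1 leb (fun r => (A + 1) * (1 * (0 <= r <= rad)%R%:R)).
  by apply: L1Zl; apply: (@L1_continuous_segment _ (fun=> 1)) => x; exact: cvg_cst.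
have Ip : L1 leb p := leb_L1_ae_le mp IB aB.
split => //; apply: le_trans (Int_ae_le (L1_norm Ip) IB aB) _.
rewrite IntZl; last by apply: (@L1_continuous_segment _ (fun=> 1)) => x; exact: cvg_cst.
rewrite ler_wpM2l ?addr_ge0//.
by rewrite (Int_itv (ltW rad0)).
Qed.

Context (om psi psir psiz g : R * R -> R).
Hypotheses (Lo : L2w rad a om) (Lp : L2w rad a psi) (Lr : L2w rad a psir)
  (Lz : L2w rad a psiz) (tr0 : trace0 rad a psi psir psiz).
Hypothesis weak_z : forall ph, test2 (Omega rad a) ph ->
  \int[leb2]_q (psi q * 'D_ez ph q) = - \int[leb2]_q (psiz q * ph q).
Hypothesis weak_eq : forall ph, test2 (Omega rad a) ph ->
  \int[leb2]_q (psi q * 'D_er (fun s => 'D_er ph s) q) +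
  \int[leb2]_q (3 * (psir q * (q.1^-1 * ph q))) +
  \int[leb2]_q (psi q * 'D_ez (fun s => 'D_ez ph s) q) = - \int[leb2]_q (om q * ph q).
Hypotheses (Lg : L2w rad a g)
  (cg : forall k, {ae leb, forall r, zint g (sn a k) r = - lam a k ^+ 2 * zint psi (sn a k) r}).

Let h q := - (om q + g q).

Let Lh : L2w rad a h. Proof. by apply: L2wN; exact: L2wD. Qed.

Let msn k : measurable_fun setT (sn a k) := L1_measurable (L1_sn a k).

Let pair_pow u n : L2w rad a u -> L1 leb2 (fun q => q.1 ^+ n.+1 * u q).
Proof.
move=> Lu; have [] := pairing rad0 a0 Lu (v := fun q => q.1 ^+ n.+1) (M := rad ^+ n).
- by apply: measurable_funX; exact: measurable_p1.
- move=> q /andP[/andP[q0 q1] _]; rewrite ger0_norm ?exprn_ge0 ?(ltW q0)// exprSr.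
  by rewrite ler_wpM2r ?(ltW q0)// lerXn2r ?nnegrE ?(ltW q0) ?(ltW rad0) ?(ltW q1).
by move=> I _; rewrite (_ : (fun q => _) = (fun q => u q * q.1 ^+ n.+1))//; apply/funext => q; rewrite mulrC.
Qed.

Lemma zint_h k : {ae leb, forall r,
  zint h (sn a k) r = lam a k ^+ 2 * zint psi (sn a k) r - zint om (sn a k) r}.
Proof.
apply: (ae_imp2 (ae_imp2 (ae_slice_L2 Lo) (ae_slice_L2 Lg) (fun r h1 h2 => conj h1 h2)) (cg k)).
move=> r [[I1 _] [I2 _]] Hk.
have J1 : L1 leb (fun z => om (r, z) * sn a k z) by exact: leb_mulr_bounded (sn_le1 a k).
have J2 : L1 leb (fun z => g (r, z) * sn a k z) by exact: leb_mulr_bounded (sn_le1 a k).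
rewrite {1}/zint (@eq_Int _ _ _ leb _ (fun z => - (om (r, z) * sn a k z + g (r, z) * sn a k z))); last first.
  by move=> z; rewrite /h; ring.
rewrite IntN; last exact: L1D.
by rewrite IntD// -/(zint om _ r) -/(zint g _ r) Hk; ring.
Qed.

(** With the factor [r^3] both sides are integrable over the plane; their modes agree by
    [mode_radial_cube] and [zint_Prim], and completeness identifies them. *)
Lemma slice_cube : {ae leb, forall z, - a < z < a -> {ae leb, forall r, 0 < r < rad ->
  r ^+ 3 * psir (r, z) = Prim (fun t => t ^+ 3 * h (t, z)) r}}.
Proof.
have Ih := pair_pow 2 Lh; have Ir := pair_pow 2 Lr.
have IQ := Prim_plane rad a Ih (measurable_id (D := setT)).
pose u q := q.1 ^+ 3 * psir q - Prim (fun t => t ^+ 3 * h (t, q.2)) q.1 * (inO rad a q)%:R.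
have Iu : L1 leb2 u by exact: L1B.
have su : supp rad a u.
  by move=> q qO; rewrite /u; have [_ -> //] := Lr; rewrite (negbTE qO) !mulr0 subrr.
have [k|_ H] := complete_plane a0 Iu su.
  apply: (ae_imp2 (mode_radial_cube rad0 a0 Lo Lp Lr Lz tr0 weak_z weak_eq k) (ae_slice_L2 Lr)) => r Hc [I1 _].
  have [rr|rO] := boolP (0 < r < rad); last exact: (zint_out _ su rO).
  have [I2 _ I3 E3] := zint_Prim r Ih (msn k) (sn_le1 a k).
  have J0 : L1 leb (fun z => psir (r, z) * sn a k z) by exact: leb_mulr_bounded (sn_le1 a k).
  have J1 := L1Zl (r ^+ 3) J0.
  rewrite /zint (@eq_Int _ _ _ leb _ (fun z => r ^+ 3 * (psir (r, z) * sn a k z) -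
      Prim (fun t => t ^+ 3 * h (t, z)) r * sn a k z)); last first.
    move=> z; rewrite /u /= /inO /= rr /=; have [_|zO] := boolP (- a < z < a).
      by rewrite mulr1 mulrBl mulrA.
    by rewrite sn_out// !mulr0 subrr.
  rewrite IntB// E3 IntZl// -/(zint psir _ r) Hc//; apply/eqP; rewrite subr_eq0; apply/eqP.
  have Lhk : L2r rad (fun t => lam a k ^+ 2 * zint psi (sn a k) t - zint om (sn a k) t).
    apply: L2rD; first by apply: L2rZ; exact: L2r_mode.
    by under eq_fun do rewrite -mulN1r; apply: L2rZ; exact: L2r_mode.
  apply: Int_ae.
  - by apply: L1_measurable; apply: L1_le_cut; exact: (L2r_pow_L1 rad0 2 Lhk).
  - by apply: L1_measurable; apply: L1_le_cut; exact: I2.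
  - apply: (ae_imp2 (zint_h k) (ae_slice_L2 Lh)) => t <- [It _]; congr (_ * _).
    rewrite /zint -IntZl; last exact: leb_mulr_bounded (sn_le1 a k).
    by apply: eq_Int => z /=; rewrite mulrA.
apply: (ae_imp H) => z Hz zJ; apply: (ae_imp Hz) => r + rr.
by rewrite /u /inO /= rr zJ mulr1 => /eqP; rewrite subr_eq0 => /eqP.
Qed.

(** The a priori bound controls [psir] only with the weight [r]. Integrability without it, gained
    from [slice_cube], is what gives a meaning to the primitive of [psir] from the axis. *)
Lemma psir_L1 : L1 leb2 psir.
Proof.
have [mr r0 _] := Lr; have [aL [IA _]] := slice_L2r Lh; have [aLr _] := slice_L2r Lr.
have IJ : L1 leb (fun z => 1 * itvJ a z) by apply: (@L1_itvJ _ a (fun=> 1)) => z; exact: cvg_cst.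
apply: (@plane_tonelli2 _ _ (fun z => (\int[leb]_t (h (t, z) ^+ 2 * t) + 1 * itvJ a z) * rad) mr).
  by apply: L1Zr; exact: L1D.
apply: (ae_imp2 (ae_imp2 aL aLr (fun z h1 h2 => conj h1 h2)) slice_cube) => z [Lhz Lrz] Hz.
have [zJ|zO] := boolP (- a < z < a).
  have [mz z0 _] := Lrz; have [_ I1 I2] := cube_eq_bound Lhz mz z0 (Hz zJ).
  by split => //; rewrite itvJ_in// mulr1.
have E r : psir (r, z) = 0 by apply: r0; rewrite /inO negb_and zO orbT.
have E' : (fun r => psir (r, z)) = fun=> 0 by apply/funext.
rewrite E'; split; first exact: L1_cst0.
rewrite (@eq_Int _ _ _ leb _ (fun=> 0)); last by move=> r /=; rewrite ?E normr0.
rewrite Int0 mulr_ge0 ?(ltW rad0)// addr_ge0//; last by rewrite itvJ_out// mulr0.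
by apply: Int_ge0 => t; exact: (L2r_wge0 _ Lhz).
Qed.

Lemma slice_primitive : {ae leb, forall z, - a < z < a -> {ae leb, forall r, 0 < r < rad ->
  psi (r, z) = Prim (fun t => psir (t, z)) r - \int[leb]_t psir (t, z)}}.
Proof.
have Ir := psir_L1; have [mr r0 _] := Lr.
have Erad z : \int[leb]_t psir (t, z) = Prim (fun t => psir (t, z)) rad.
  apply: eq_Int => t; have [|tr] := leP t rad; first by rewrite mulr1.
  by rewrite mulr0 r0// /inO /= (ltNge t) (ltW tr) andbF.
have I1 := Prim_plane rad a Ir (measurable_id (D := setT)).
have I2 := Prim_plane rad a Ir (measurable_cst rad).
(* The full integral is written as the primitive at [rad], so that both terms are instances of
   [Prim_plane] and [zint_Prim]. *)
pose v q := (Prim (fun t => psir (t, q.2)) q.1 - Prim (fun t => psir (t, q.2)) rad) * (inO rad a q)%:R.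
have Iv : L1 leb2 v.
  rewrite /v (_ : (fun q => _) = (fun q => Prim (fun t => psir (t, q.2)) q.1 * (inO rad a q)%:R -
     Prim (fun t => psir (t, q.2)) rad * (inO rad a q)%:R)); first exact: L1B.
  by apply/funext => q; rewrite mulrBl.
(* The factor [r] is there because [psi] is known to be square integrable only with the weight
   [r]. *)
pose u q := q.1 ^+ 1 * psi q - (q.1 * (inO rad a q)%:R) * v q.
have Iu : L1 leb2 u.
  apply: L1B; first exact: pair_pow.
  apply: (@L1_mull_bounded _ _ _ leb2 _ _ rad) => //.
    by apply: measurable_funM; [exact: measurable_p1|exact: measurable_inO].
  move=> q; case: (boolP (inO rad a q)) => [/andP[/andP[q0 q1] _]|_]; rewrite ?mulr0 ?normr0 ?mulr1 ?(ltW rad0)//.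
  by rewrite gtr0_norm// ltW.
have su : supp rad a u.
  by move=> q qO; rewrite /u; have [_ -> //] := Lp; rewrite (negbTE qO) !(mulr0, mul0r) subrr.
have [k|_ H] := complete_plane a0 Iu su.
  apply: (ae_imp2 (mode_radial_primitive rad0 a0 Lo Lp Lr Lz tr0 weak_z weak_eq k) (ae_slice_L2 Lp)) => r Hc [Ip _].
  have [rr|rO] := boolP (0 < r < rad); last exact: (zint_out _ su rO).
  have [K1 _ I3 E3] := zint_Prim r Ir (msn k) (sn_le1 a k).
  have [_ _ I4 E4] := zint_Prim rad Ir (msn k) (sn_le1 a k).
  have J0 : L1 leb (fun z => psi (r, z) * sn a k z) by exact: leb_mulr_bounded (sn_le1 a k).
  rewrite /zint (@eq_Int _ _ _ leb _ (fun z => r * ((psi (r, z) * sn a k z) -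
      (Prim (fun t => psir (t, z)) r * sn a k z - Prim (fun t => psir (t, z)) rad * sn a k z)))); last first.
    move=> z; rewrite /u /v /= /inO /= rr /=; have [_|zO] := boolP (- a < z < a).
      by rewrite !mulr1; ring.
    by rewrite sn_out// !(mulr0, subrr).
  have I34 := L1B I3 I4.
  rewrite IntZl; last exact: L1B.
  rewrite IntB// IntB// E3 E4 -/(zint psi _ r) Hc//.
  rewrite (_ : Prim _ rad = \int[leb]_t zint psir (sn a k) t) ?subrr ?mulr0//.
  apply: eq_Int => t; have [|tr] := leP t rad; first by rewrite mulr1.
  by rewrite mulr0 (zint_out _ r0)// negb_and -!leNgt (ltW tr) orbT.
apply: (ae_imp H) => z Hz zJ; apply: (ae_imp Hz) => r + rr.
rewrite Erad /u /v /inO /= rr zJ /= !mulr1 -mulrBr => /eqP; rewrite mulf_eq0 subr_eq0.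
by have /andP[/gt_eqF -> _] := rr => /eqP.
Qed.

End slices.

(** * The corrected function *)

Section cutoff_bounds.
Context {R : realType}.

Lemma cvg_near_eq (T : Type) (F : set_system T) {FF : Filter F} (f g : T -> R) (l : R) :
  (\forall x \near F, f x = g x) -> g x @[x --> F] --> l -> f x @[x --> F] --> l.
Proof.
move=> fg; apply: cvg_trans; apply: near_eq_cvg.
by apply: filterS fg => x.
Qed.

(** A finite limit of [K / r^2] forces the smooth extension and its derivative to vanish at 0. [C]
    is the maximum of [|Kt''|] on [[0, rad]], and the mean value theorem applied twice gives both
    bounds. *)
Lemma halfline_quadratic (K : R -> R) (c0 rad : R) : 0 < rad -> smooth_halfline K ->
  K r / r ^+ 2 @[r --> 0^'+] --> c0 ->
  exists Kt C, [/\ smooth1 Kt, 0 <= C, forall r, 0 <= r -> K r = Kt r &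
    forall r, 0 < r < rad -> `|Kt r| <= C * r ^+ 2 /\ `|derive1 Kt r| <= C * r].
Proof.
move=> rad0 [Kt [sK KE]] Klim.
have dK x := smooth1_derivable (x := x) sK; have cK := smooth1_continuous sK.
have sK' := smooth1_derive1 sK; have dK' x := smooth1_derivable (x := x) sK'.
have sK'' := smooth1_derive1 sK'; have cK' := smooth1_continuous sK'.
have pos : \forall r \near (0 : R)^'+, 0 < r by exact: nbhs_right_gt.
have rr n : r ^+ n.+1 @[r --> (0 : R)^'+] --> (0 : R).
  apply: cvg_at_right_filter; rewrite -[X in _ --> X](expr0n R n.+1).
  exact: exprn_continuous.
have L1' : Kt r / r @[r --> (0 : R)^'+] --> (0 : R).
  have h : K r / r ^+ 2 * r ^+ 1 @[r --> (0 : R)^'+] --> c0 * 0.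
    by apply: cvgM; [exact: Klim|exact: rr].
  rewrite mulr0 in h; refine (cvg_near_eq _ h); near=> r; have r0 : 0 < r by near: r.
  by rewrite KE ?ltW// expr1 expr2; field; rewrite gt_eqF.
have L2' : Kt r @[r --> (0 : R)^'+] --> (0 : R).
  have h : K r / r ^+ 2 * r ^+ 2 @[r --> (0 : R)^'+] --> c0 * 0.
    by apply: cvgM; [exact: Klim|exact: rr].
  rewrite mulr0 in h; refine (cvg_near_eq _ h); near=> r; have r0 : 0 < r by near: r.
  by rewrite KE ?ltW//; field; rewrite gt_eqF.
have K0 : Kt 0 = 0 by exact: cvg_unique (cvg_at_right_filter (cK 0)) L2'.
have K'0 : derive1 Kt 0 = 0.
  (* [K] controls only the right-hand difference quotient; it determines the derivative because [Kt]
     is differentiable at 0. *)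
  have h1 : (fun h => h^-1 *: (Kt (h + 0) - Kt 0)) @ (0 : R)^'+ --> derive1 Kt 0.
    have h0 : (fun h => h^-1 *: (Kt (h + 0) - Kt 0)) @ (0 : R)^' --> derive1 Kt 0.
      by have := dK 0; rewrite /derivable derive1E /derive => h; move: h; under eq_fun do rewrite -[_ *: 1]/(_ * 1) mulr1.
    apply: cvg_trans h0 => P; rewrite /= !nbhs_filterE /= /fmap /=.
    apply: (@filterS _ (nbhs (0 : R))) => y Hy y0; apply: Hy; by rewrite gt_eqF.
  apply: (cvg_unique _ h1) => //; refine (cvg_near_eq _ L1').
  by near=> h; rewrite addr0 K0 subr0 mulrC.
have cK'' : continuous (derive1 (derive1 Kt)) by exact: smooth1_continuous.
have n0 : `[0, rad]%classic !=set0 by exists 0; rewrite /= in_itv/= lexx ltW.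
have [m _ Hm] := compact_EVT_max n0 (@segment_compact R 0 rad)
  (continuous_subspaceT (fun x => cvg_norm (cK'' x))).
pose M := `|derive1 (derive1 Kt) m|.
have mvt (f : R -> R) (B r : R) : (forall x, derivable f x 1) -> f 0 = 0 -> 0 < r ->
   (forall x, 0 < x < r -> `|derive1 f x| <= B) -> `|f r| <= B * r.
  move=> df f0 r0 fB.
  have cf : {within `[0, r], continuous f}.
    by apply: continuous_subspaceT => x; apply/differentiable_continuous/derivable1_diffP.
  have [c cr] := MVT r0 (fun x _ => DeriveDef (df x) (esym (derive1E f x))) cf.
  rewrite f0 !subr0 => ->; rewrite normrM (gtr0_norm r0) ler_wpM2r ?(ltW r0)//.
  by apply: fB; move: cr; rewrite in_itv.
have B1 r : 0 < r < rad -> `|derive1 Kt r| <= M * r.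
  move=> /andP[r0 r1]; apply: (mvt _ _ _ dK' K'0 r0) => x /andP[x0 xr].
  by apply: Hm; rewrite inE /= in_itv/= ltW//= ltW// (lt_trans xr).
have M0 : 0 <= M by exact: normr_ge0.
exists Kt, M; split => // r rI; split; last exact: B1.
have /andP[r0 r1] := rI.
rewrite expr2 mulrA; apply: (mvt _ _ _ dK K0 r0) => x /andP[x0 xr].
apply: (le_trans (B1 x _)); first by rewrite x0 (lt_trans xr).
by apply: ler_wpM2l => //; exact: ltW.
Unshelve. all: end_near.
Qed.

End cutoff_bounds.

(** * Primitives and weak derivatives on an interval *)

Section interval.
Context {R : realType} (rad : R) (rad0 : 0 < rad).
Local Notation leb := (@lebesgue_measure R).

Lemma Int_seg (x y : R) : x <= y -> \int[leb]_t (1 * (x <= t <= y)%R%:R) = y - x.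
Proof.
move=> xy; rewrite -[RHS](Prim_of_deriv C1_id.1 C1_id.2 xy (lexx y)) /Prim.
apply: eq_Int => t; rewrite derive1_idE; have [_|yt] := leP t y; first by rewrite mulr1.
by rewrite andbF !mulr0.
Qed.

Lemma L1_seg (x y : R) : L1 leb (fun t : R => 1 * (x <= t <= y)%R%:R).
Proof. by apply: (@L1_continuous_segment _ (fun=> 1)) => z; exact: cvg_cst. Qed.

Lemma Prim_lipschitz (g : R -> R) (S x y : R) : L1 leb g ->
  {ae leb, forall t, `|g t| <= S} -> x <= y -> `|Prim g y - Prim g x| <= S * (y - x).
Proof.
move=> Ig gS xy; rewrite /Prim -IntB; [|exact: L1_le_cut|exact: L1_le_cut].
have Id : L1 leb (fun t => g t * (t <= y)%R%:R - g t * (t <= x)%R%:R).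
  by apply: L1B; exact: L1_le_cut.
apply: (le_trans (Int_norm Id)); rewrite -(Int_seg xy) -IntZl; last exact: L1_seg.
apply: Int_ae_le; [exact: L1_norm|by apply: L1Zl; exact: L1_seg|].
apply: (ae_imp gS) => t gt; have S0 : 0 <= S := le_trans (normr_ge0 _) gt.
have [tx|xt] := leP t x.
  by rewrite (le_trans tx xy) subrr normr0 mulr_ge0// mul1r.
by have [ty|yt] := leP t y; rewrite ?mulr1 mulr0 subr0 ?normr0 ?(ltW xt) ?mulr1//= mulr_ge0// mul1r.
Qed.

Lemma Prim_lipschitz_continuous (g : R -> R) (S : R) : L1 leb g ->
  {ae leb, forall t, `|g t| <= S} -> continuous (Prim g).
Proof.
move=> Ig gS x; apply/cvgrPdist_le => e e0.
have lip y : `|Prim g x - Prim g y| <= `|S| * `|x - y|.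
  have [xy|/ltW yx] := leP x y.
    rewrite distrC (distrC x) (ger0_norm (x := y - x)) ?subr_ge0//.
    apply: (le_trans (Prim_lipschitz Ig gS xy)); apply: ler_wpM2r; [by rewrite subr_ge0|exact: ler_norm].
  rewrite (ger0_norm (x := x - y)) ?subr_ge0//.
  apply: (le_trans (Prim_lipschitz Ig gS yx)); apply: ler_wpM2r; [by rewrite subr_ge0|exact: ler_norm].
have d0 : 0 < e / (`|S| + 1) by rewrite divr_gt0// ltr_wpDl.
have /cvgrPdist_le/(_ _ d0) nx : y @[y --> x] --> x by exact: cvg_id.
near=> y; apply: (le_trans (lip y)).
have : `|x - y| <= e / (`|S| + 1) by near: y; exact: nx.
rewrite ler_pdivlMr ?ltr_wpDl// => h; rewrite mulrC; apply: le_trans h.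
by rewrite ler_wpM2l// lerDl.
Unshelve. all: end_near.
Qed.

Lemma Int_oo_Prim (g : R -> R) (r : R) : measurable_fun setT g ->
  (forall t, t <= 0 -> g t = 0) -> \int[leb]_(t in `]0, r[) g t = Prim g r.
Proof.
move=> mg g0; rewrite Rintegral_mkcond /Prim.
have mc : measurable_fun setT (fun t : R => g t * (t <= r)%R%:R).
  by apply: measurable_funM => //; exact: measurable_le_nat.
apply: Int_ae => //.
  by apply/(measurable_restrictT _ _).1; [exact: measurable_itv|exact: measurable_funTS].
apply: (ae_imp (ae_neq r)) => t tr; rewrite patchE mem_setE in_itv/=.
have [t0|t0] := ltP 0 t; last by rewrite g0// mul0r.
by rewrite le_eqVlt (negbTE tr) /=; case: ltP; rewrite ?mulr1 ?mulr0.
Qed.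

Lemma locally_integrable_oo (f v : R -> R) : L1 leb v ->
  (forall r, 0 < r < rad -> f r = v r) -> locally_integrable `]0, rad[ f.
Proof.
move=> Iv fv; apply: open_integrable_locally; first exact: interval_open.
apply: (@eq_integrable _ _ _ leb `]0, rad[ (measurable_itv _) (EFin \o v)).
  by move=> r; rewrite inE /= in_itv/= => rr; rewrite fv.
by apply: integrableS Iv.
Qed.

Lemma weak_deriv1_L1 (f g u v : R -> R) : L1 leb u -> L1 leb v ->
  (forall r, 0 < r < rad -> f r = u r) -> (forall r, 0 < r < rad -> g r = v r) ->
  (forall b, test1 `]0, rad[ b -> \int[leb]_r (u r * derive1 b r) = - \int[leb]_r (v r * b r)) ->
  weak_deriv1 `]0, rad[ f g.
Proof.
move=> Iu Iv fu gv H; split; [exact: locally_integrable_oo fu|exact: locally_integrable_oo gv|].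
move=> b tb; have [c [d [c0 cd dr b0]]] := test1_support rad0 tb.
have bO r : ~~ (0 < r < rad) -> ~~ (c <= r <= d).
  apply: contra => /andP[cr rd]; by rewrite (lt_le_trans c0 cr) (le_lt_trans rd dr).
rewrite [LHS]Rintegral_mkcond [in RHS]Rintegral_mkcond.
transitivity (\int[leb]_r (u r * derive1 b r)).
  apply: eq_Int => r; rewrite patchE mem_setE in_itv/=.
  have [/fu ->//|/bO rO] := boolP (0 < r < rad).
  by rewrite (derive1_eq0_outside b0 rO) mulr0.
rewrite (H _ tb); congr (- _); apply: eq_Int => r; rewrite patchE mem_setE in_itv/=.
by have [/gv ->//|/bO/b0 ->] := boolP (0 < r < rad); rewrite mulr0.
Qed.

Lemma Int_oo_le (F G B : R -> R) : (forall r, 0 < r < rad -> F r = G r) ->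
  measurable_fun setT G -> (forall r, 0 <= G r) -> (forall r, ~~ (0 < r < rad) -> G r = 0) ->
  L1 leb B -> {ae leb, forall r, G r <= B r} ->
  (\int[leb]_(r in `]0%R, rad[) (F r)%:E <= (\int[leb]_r B r)%:E)%E.
Proof.
move=> FG mG G0 GO IB GB.
have IG : L1 leb G by apply: (leb_L1_ae_le mG IB); apply: (ae_imp GB) => r; rewrite ger0_norm.
rewrite [leLHS](_ : _ = (\int[leb]_r (G r)%:E)%E).
  by rewrite Int_EFin// lee_fin; exact: Int_ae_le.
rewrite [LHS]integral_mkcond; apply: eq_integral => r _; rewrite patchE mem_setE in_itv/=.
by have [/FG ->//|/GO ->] := boolP (0 < r < rad).
Qed.

Lemma continuous_inv_mul (v : R -> R) (c : R) : 0 < c -> continuous v ->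
  (forall x, x < c -> v x = 0) -> continuous (fun x : R => x^-1 * v x).
Proof.
move=> c0 cv v0 x; have [xc|cx] := ltP x c.
  suff : y^-1 * v y @[y --> x] --> x^-1 * v x by [].
  rewrite v0// mulr0; refine (cvg_near_eq _ (cvg_cst 0)); near=> y.
  by rewrite v0 ?mulr0//; near: y; exact: lt_nbhsl.
have x0 : x != 0 by rewrite gt_eqF// (lt_le_trans c0).
by apply: cvgM; [exact: inv_continuous|exact: cv].
Unshelve. all: end_near.
Qed.

(** [v] vanishes for [x < c], so the singularity of the inverse is never met. Three applications
    produce [r^-3 K b], the function against which [slice_weak2] integrates by parts. *)
Lemma C1_inv_mul (v : R -> R) (c : R) : 0 < c -> C1 v -> (forall x, x < c -> v x = 0) ->
  C1 (fun x : R => x^-1 * v x) /\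
  derive1 (fun x : R => x^-1 * v x) = (fun x => x^-1 * (derive1 v x - x^-1 * v x)).
Proof.
move=> c0 [dv cv'] v0; have cv := C1_continuous (conj dv cv').
have v'0 (x : R) : x < c -> derive1 v x = 0.
  move=> xc; have near0 : \near x, (fun=> 0) x = v x.
    by near=> y; rewrite v0//; near: y; exact: lt_nbhsl.
  by rewrite derive1E -(near_eq_derive _ near0); exact: derive_cst.
have D (x : R) : is_derive x 1 (fun x : R => x^-1 * v x) (x^-1 * (derive1 v x - x^-1 * v x)).
  have [xc|cx] := ltP x c.
    rewrite v0// v'0// !mulr0 subrr mulr0.
    have near0 : \near x, (fun=> 0) x = (fun x => x^-1 * v x) x.
      by near=> y; rewrite v0 ?mulr0//; near: y; exact: lt_nbhsl.
    by apply: (near_eq_is_derive near0); exact: is_derive_cst.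
  have x0 : x != 0 by rewrite gt_eqF// (lt_le_trans c0).
  have d1 : derivable (fun y : R => y^-1) x 1 by apply: (@derivableV _ _ id).
  split; first exact: (derivableM d1 (dv x)).
  rewrite (deriveM d1 (dv x)) (@deriveV _ _ id x 1 x0)// derive_id derive1E.
  by rewrite -![_ *: _]/(_ * _) /=; field.
have e : derive1 (fun x : R => x^-1 * v x) = (fun x => x^-1 * (derive1 v x - x^-1 * v x)).
  by apply/funext => x; rewrite derive1E; case: (D x).
split; last exact: e.
split; first by move=> x; case: (D x).
rewrite e; apply: (continuous_inv_mul c0).
  by move=> x; apply: cvgB; [exact: cv'|exact: (continuous_inv_mul c0 cv v0)].
by move=> x xc; rewrite v0// v'0// mulr0 subrr.
Unshelve. all: end_near.
Qed.

End interval.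

(** * The corrected function on one slice *)

Section slice.
Context {R : realType} (rad : R) (rad0 : 0 < rad).
Local Notation leb := (@lebesgue_measure R).

Lemma L1_mul_supp (m u : R -> R) (M : R) : measurable_fun setT m -> L1 leb u ->
  (forall r, ~~ (0 < r < rad) -> u r = 0) -> (forall r, 0 < r < rad -> `|m r| <= M) ->
  L1 leb (fun r => m r * u r).
Proof.
move=> mm Iu u0 mM; apply: (leb_L1_le _ (L1Zl M (L1_norm Iu))).
  by apply: measurable_funM => //; exact: L1_measurable Iu.
move=> r; rewrite normrM; have [/mM h|/u0 ->] := boolP (0 < r < rad); last by rewrite normr0 !mulr0.
by apply: ler_wpM2r.
Qed.

Context (Kt : R -> R) (C : R) (sK : smooth1 Kt) (C0 : 0 <= C).
Hypothesis KB : forall r, 0 < r < rad -> `|Kt r| <= C * r ^+ 2 /\ `|derive1 Kt r| <= C * r.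
Context (f p h : R -> R).
Hypotheses (mf : measurable_fun setT f) (Lh : L2r rad h) (mp : measurable_fun setT p)
  (p0 : forall r, ~~ (0 < r < rad) -> p r = 0)
  (cube : {ae leb, forall r, 0 < r < rad -> r ^+ 3 * p r = Prim (fun t => t ^+ 3 * h t) r})
  (prim : {ae leb, forall r, 0 < r < rad -> f r = Prim p r - \int[leb]_t p t}).

Let A := \int[leb]_t (h t ^+ 2 * t).
Let S := Num.sqrt A.

Let A0 : 0 <= A. Proof. by apply: Int_ge0 => r; exact: L2r_wge0 Lh. Qed.
Let S2 : S ^+ 2 = A. Proof. exact: sqr_sqrtr. Qed.
Let S0 : 0 <= S. Proof. exact: sqrtr_ge0. Qed.
Let Ip : L1 leb p. Proof. by have [] := cube_eq_bound rad0 Lh mp p0 cube. Qed.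

Let pS : {ae leb, forall r, `|p r| <= S}.
Proof.
have [pA _ _] := cube_eq_bound rad0 Lh mp p0 cube; apply: (ae_imp pA) => r Hr.
have [rr|/p0 ->] := boolP (0 < r < rad); last by rewrite normr0.
by rewrite -(@ler_pXn2r _ 2) ?nnegrE// S2 real_normK ?num_real// Hr.
Qed.

Lemma slice_primitive_continuous : continuous (fun r => Prim p r - \int[leb]_t p t).
Proof.
by move=> x; apply: cvgB; [exact: (Prim_lipschitz_continuous Ip pS)|exact: cvg_cst].
Qed.

Let mK : measurable_fun setT Kt := continuous_measurable_fun (smooth1_continuous sK).
Let mK' : measurable_fun setT (derive1 Kt) :=
  continuous_measurable_fun (smooth1_continuous (smooth1_derive1 sK)).

Let K_le r : 0 < r < rad -> `|Kt r| <= C * rad ^+ 2.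
Proof.
move=> rr; have [h1 _] := KB rr; apply: (le_trans h1); have /andP[/ltW r0 /ltW r1] := rr.
by apply: ler_wpM2l => //; apply: lerXn2r; rewrite ?nnegrE// ltW.
Qed.

Let k r := Kt r * p r.
Let Ik : L1 leb k. Proof. exact: (L1_mul_supp mK Ip p0 K_le). Qed.

Lemma slice_weight_L1 : L1 leb (fun t => p t * (1 + Kt t)).
Proof.
rewrite (_ : (fun t => _) = (fun t => p t + k t)); first exact: L1D.
by apply/funext => t; rewrite /k; ring.
Qed.

Let Ihk : L1 leb (fun r => h r * Kt r).
Proof.
apply: (L2r_mul (M := C * rad) Lh mK) => r rr; have [h1 _] := KB rr; apply: (le_trans h1).
by have /andP[/ltW r0 /ltW r1] := rr; rewrite -mulrA expr2; apply: ler_wpM2l => //; apply: ler_wpM2r.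
Qed.

Definition slice_w1 r := - (Kt r * p r).
(** [h - 3 p / r] stands for [p'], which the equation supplies. *)
Definition slice_w2 r := - (derive1 Kt r * p r) - Kt r * (h r - 3 * (r^-1 * p r)).

Lemma slice_w1_L1 : L1 leb slice_w1. Proof. exact: L1N. Qed.

Lemma slice_w2_L1 : L1 leb slice_w2.
Proof.
have I1 : L1 leb (fun r => derive1 Kt r * p r).
  apply: (L1_mul_supp (M := C * rad) mK' Ip p0) => r rr; have [_ h1] := KB rr.
  by apply: (le_trans h1); have /andP[_ /ltW r1] := rr; apply: ler_wpM2l.
have mKi : measurable_fun setT (fun r : R => Kt r * r^-1).
  by apply: measurable_funM => //; exact: measurable_inv.
have I2 : L1 leb (fun r => (Kt r * r^-1) * p r).
  apply: (L1_mul_supp (M := C * rad) mKi Ip p0) => r rr; have [h1 _] := KB rr.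
  have /andP[r0 /ltW r1] := rr; rewrite normrM normfV (gtr0_norm r0) ler_pdivrMr//.
  by apply: (le_trans h1); rewrite -mulrA expr2; apply: ler_wpM2l => //; apply: ler_wpM2r => //; exact: ltW.
rewrite (_ : slice_w2 = (fun r => - (derive1 Kt r * p r) - h r * Kt r + 3 * ((Kt r * r^-1) * p r))); last first.
  by apply/funext => r; rewrite /slice_w2; ring.
by apply: L1D; [apply: L1B => //; exact: L1N|exact: L1Zl].
Qed.

Context (w : R -> R).
(** The opposite of the integral of [p] is the value of [f] at the axis, so this is [f - f(0) - chi]
    on the slice. *)
Hypothesis wE : forall r, 0 < r < rad ->
  w r = f r + \int[leb]_t p t - Prim (fun t => p t * (1 + Kt t)) r.

Let ind (r : R) : R := (0 < r < rad)%R%:R.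

Let mind : measurable_fun setT ind.
Proof.
rewrite (_ : ind = (fun x : R => (0 < x)%R%:R * (x < rad)%R%:R)).
  by apply: measurable_funM; exact: measurable_lt_nat.
by apply/funext => x; rewrite /ind; case: (0 < x); rewrite ?mul0r ?mul1r.
Qed.

Let vw r := (f r + \int[leb]_t p t - Prim (fun t => p t * (1 + Kt t)) r) * ind r.

Let vwE r : 0 < r < rad -> w r = vw r.
Proof. by move=> rr; rewrite wE// /vw /ind rr mulr1. Qed.

Let vw0 r : ~~ (0 < r < rad) -> vw r = 0.
Proof. by move=> rr; rewrite /vw /ind (negbTE rr) mulr0. Qed.

Let mvw : measurable_fun setT vw.
Proof.
have [mP _ _ _] := Prim_fubini slice_weight_L1 Ip.
apply: measurable_funM => //; apply: measurable_funB => //; exact: measurable_funD.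
Qed.

Let vw_ae : {ae leb, forall r, 0 < r < rad -> vw r = - Prim k r}.
Proof.
apply: (ae_imp prim) => r Hr rr; rewrite /vw /ind rr mulr1 Hr//.
rewrite subrK /Prim -IntB; [|exact: L1_le_cut|by apply: L1_le_cut; exact: slice_weight_L1].
rewrite -IntN; last exact: L1_le_cut.
by apply: eq_Int => t; rewrite /k; ring.
Qed.

(** [|K| <= C r^2] and [|p| <= S] integrate to third order at the axis, so that the most singular
    weight leaves [w^2 r^-4 r = O(r^3)]. *)
Let Prim_k_le r : 0 < r < rad -> `|Prim k r| <= C * S * r ^+ 3.
Proof.
move=> /andP[r0 rr]; have Ikr : L1 leb (fun t => k t * (t <= r)%R%:R) by exact: L1_le_cut.
have IB : L1 leb (fun t : R => (C * S * r ^+ 2) * (1 * (0 <= t <= r)%R%:R)).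
  by apply: L1Zl; exact: L1_seg.
apply: (le_trans (Int_norm Ikr)); rewrite exprSr mulrA -[X in _ * X](Int_itv (ltW r0)) -IntZl; last exact: L1_seg.
apply: Int_ae_le => //; first exact: L1_norm.
apply: (ae_imp pS) => t pt.
have [tI|/p0 pt0] := boolP (0 < t < rad); last first.
  by rewrite /k pt0 mulr0 mul0r normr0 !mulr_ge0 ?exprn_ge0// ltW.
have [tr|] := leP t r; last first.
  by rewrite mulr0 normr0 => _; rewrite !mulr_ge0 ?exprn_ge0// ltW.
have /andP[t0 _] := tI; rewrite (ltW t0) /= !mulr1 /k normrM mulrAC; apply: ler_pM => //.
have [h1 _] := KB tI; apply: (le_trans h1); apply: ler_wpM2l => //.
by apply: lerXn2r; rewrite ?nnegrE// ltW.
Qed.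

Let Ivw : L1 leb vw.
Proof.
apply: (leb_L1_ae_le (g := fun r => (C * S * rad ^+ 3) * (1 * (0 <= r <= rad)%R%:R)) mvw).
  by apply: L1Zl; exact: L1_seg.
apply: (ae_imp vw_ae) => r Hr; have rad0' := ltW rad0.
have [rr|/vw0 ->] := boolP (0 < r < rad); last by rewrite normr0 !mulr_ge0 ?exprn_ge0.
rewrite Hr// normrN; apply: (le_trans (Prim_k_le rr)); have /andP[/ltW r0 /ltW r1] := rr.
by rewrite r0 r1 !mulr1; apply: ler_wpM2l; [exact: mulr_ge0|apply: lerXn2r; rewrite ?nnegrE].
Qed.

Lemma slice_weak1 : weak_deriv1 `]0, rad[ w slice_w1.
Proof.
apply: (weak_deriv1_L1 rad0 Ivw slice_w1_L1) => // b tb.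
have [c [d [c0 cd dr b0]]] := test1_support rad0 tb; have [sb _] := tb.
have Cb := smooth1_C1 sb; have [Ib _ _] := Prim_C1_support Cb cd b0.
have E := parts_C1_support Ik Cb cd b0.
have [_ IP _ _] := Prim_fubini Ik Ib.
have mb' : measurable_fun setT (derive1 b).
  exact: continuous_measurable_fun (smooth1_continuous (smooth1_derive1 sb)).
have mb : measurable_fun setT b := continuous_measurable_fun (smooth1_continuous sb).
rewrite (_ : \int[leb]_r (slice_w1 r * b r) = - \int[leb]_r (k r * b r)); last first.
  have [M _ hM] := continuous_bounded_support (smooth1_continuous sb) b0.
  rewrite -IntN; last exact: (leb_mulr_bounded Ik mb hM).
  by apply: eq_Int => r; rewrite /slice_w1 mulNr.
rewrite opprK -[RHS]opprK -E -IntN//; apply: Int_ae; first exact: measurable_funM.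
  exact: L1_measurable (L1N IP).
apply: (ae_imp vw_ae) => r Hr; have [/Hr ->|rO] := boolP (0 < r < rad); first by rewrite mulNr.
have rcd : ~~ (c <= r <= d).
  by apply: contra rO => /andP[cr rd]; rewrite (lt_le_trans c0 cr) (le_lt_trans rd dr).
by rewrite (derive1_eq0_outside b0 rcd) !mulr0 oppr0.
Qed.

(** [p] has no derivative at hand, but [r^3 p] is a primitive of [r^3 h]. Integrating it by parts
    against [F = r^-3 K b], which is of class [C1] since [b] vanishes near the axis, yields the
    derivative of [K p]. *)
Lemma slice_weak2 : weak_deriv1 `]0, rad[ slice_w1 slice_w2.
Proof.
apply: (weak_deriv1_L1 rad0 slice_w1_L1 slice_w2_L1) => // b tb.
have [c [d [c0 cd dr b0]]] := test1_support rad0 tb; have [sb _] := tb.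
have Cb := smooth1_C1 sb; have CK := smooth1_C1 sK.
have cb := smooth1_continuous sb; have cb' := smooth1_continuous (smooth1_derive1 sb).
have mb := continuous_measurable_fun cb; have mb' := continuous_measurable_fun cb'.
pose ee x := Kt x * b x; have [Ce ee'] := C1M CK Cb.
have e0 x : ~~ (c <= x <= d) -> ee x = 0 by move=> /b0; rewrite /ee => ->; rewrite mulr0.
have lt0 (v : R -> R) : (forall x, ~~ (c <= x <= d) -> v x = 0) -> forall x, x < c -> v x = 0.
  by move=> v0 x xc; rewrite v0// negb_and -ltNge xc.
have [CG1 G1'] := C1_inv_mul c0 Ce (lt0 _ e0).
have z1 x : ~~ (c <= x <= d) -> x^-1 * ee x = 0 by move=> /e0 ->; rewrite mulr0.
have [CG2 G2'] := C1_inv_mul c0 CG1 (lt0 _ z1).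
have z2 x : ~~ (c <= x <= d) -> x^-1 * (x^-1 * ee x) = 0 by move=> /z1 ->; rewrite mulr0.
have [CF F'] := C1_inv_mul c0 CG2 (lt0 _ z2).
have z3 x : ~~ (c <= x <= d) -> x^-1 * (x^-1 * (x^-1 * ee x)) = 0 by move=> /z2 ->; rewrite mulr0.
have Iq : L1 leb (fun t => t ^+ 3 * h t) := L2r_pow_L1 rad0 2 Lh.
have E := parts_C1_support Iq CF cd z3.
have [IF' _ _] := Prim_C1_support CF cd z3.
have [_ IPF _ _] := Prim_fubini Iq IF'.
have [M _ hM] := continuous_bounded_support cb b0.
have b'0 x : ~~ (c <= x <= d) -> derive1 b x = 0 by exact: derive1_eq0_outside.
have [M' _ hM'] := continuous_bounded_support cb' b'0.
have I1 : L1 leb (fun r => slice_w1 r * derive1 b r) := leb_mulr_bounded slice_w1_L1 mb' hM'.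
have I2 : L1 leb (fun r => slice_w2 r * b r) := leb_mulr_bounded slice_w2_L1 mb hM.
have I3 : L1 leb (fun r => h r * Kt r * b r) := leb_mulr_bounded Ihk mb hM.
have I12 := L1D I1 I2.
(* [X] equals [r^3 p F'] almost everywhere; the term [h K b] is split off because it is what the
   integration by parts returns. *)
pose X r := - (slice_w1 r * derive1 b r + slice_w2 r * b r) - h r * Kt r * b r.
have IX : L1 leb X by apply: L1B => //; exact: L1N.
have EX : \int[leb]_r X r = - \int[leb]_r (h r * Kt r * b r).
  transitivity (\int[leb]_x (Prim (fun t => t ^+ 3 * h t) x *
      derive1 (fun x => x^-1 * (x^-1 * (x^-1 * ee x))) x)).
    apply: Int_ae; [exact: L1_measurable IX|exact: L1_measurable IPF|].
    apply: (ae_imp cube) => r Hr; have [rr|rO] := boolP (0 < r < rad).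
      rewrite -Hr// F' G2' G1' ee' /X /slice_w1 /slice_w2 /ee.
      by have /andP[r0 _] := rr; field; rewrite gt_eqF.
    have rcd : ~~ (c <= r <= d).
      by apply: contra rO => /andP[cr rd]; rewrite (lt_le_trans c0 cr) (le_lt_trans rd dr).
    by rewrite (derive1_eq0_outside z3 rcd) /X b'0// b0// !(mulr0, addr0, oppr0).
  rewrite E; congr (- _); apply: eq_Int => t; have [/andP[t0 _]|rO] := boolP (0 < t < rad).
    by rewrite /ee; field; rewrite gt_eqF.
  by have [_ h0 _] := Lh; rewrite h0// mulr0 !mul0r.
move: EX; rewrite /X IntB//; last exact: L1N.
rewrite IntN// IntD// => /eqP; rewrite -subr_eq0 opprK addrNK oppr_eq0 addr_eq0 => /eqP ->//.
Qed.

Let bnd (B : R) : 0 <= B -> L1 leb (fun r : R => B * (1 * (0 <= r <= rad)%R%:R)) /\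
  \int[leb]_r (B * (1 * (0 <= r <= rad)%R%:R)) = B * rad.
Proof.
by move=> B0; rewrite IntZl ?(Int_itv (ltW rad0)); [split => //; apply: L1Zl|]; exact: L1_seg.
Qed.

(** With [D rad = C^2 A rad^4], the terms of order 0 and 1 cost [D rad] each and that of order 2
    costs [32 D rad + 2 C^2 rad^4 A]: together 36. *)
Lemma slice_norm : (H20norm2 rad w slice_w1 slice_w2 <= (36 * C ^+ 2 * rad ^+ 4 * A)%:E)%E.
Proof.
have [mh h0 Ih] := Lh.
have mi : measurable_fun setT (fun r : R => r^-1) := measurable_inv.
have mw1 := L1_measurable slice_w1_L1; have mw2 := L1_measurable slice_w2_L1.
pose D := C ^+ 2 * A * rad ^+ 3.
have D0 : 0 <= D.
  by apply: mulr_ge0; [apply: mulr_ge0 => //; exact: sqr_ge0|rewrite exprn_ge0// ltW].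
have D1 (n : R) : 0 <= n -> 0 <= n * D by move=> n0; rewrite mulr_ge0.
have r3 r : 0 < r < rad -> r ^+ 3 <= rad ^+ 3.
  by move=> /andP[/ltW r0 /ltW r1]; apply: lerXn2r; rewrite ?nnegrE// ltW.
have rD r : 0 < r < rad -> C ^+ 2 * A * r ^+ 3 <= D * (1 * (0 <= r <= rad)%R%:R).
  move=> rr; have /andP[/ltW -> /ltW ->] := rr; rewrite !mulr1.
  by apply: ler_wpM2l; [rewrite mulr_ge0 ?sqr_ge0|exact: r3].
have zD r : 0 <= D * (1 * (0 <= r <= rad)%R%:R) by rewrite mulr_ge0// mul1r ler0n.
have ge (x : R -> R) (n : nat) r : (forall r, ~~ (0 < r < rad) -> x r = 0) ->
    0 <= x r ^+ 2 * (r^-1) ^+ n * r.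
  move=> x0; have [/andP[/ltW r0 _]|/x0 ->] := boolP (0 < r < rad); last by rewrite expr0n !mul0r.
  apply: mulr_ge0 => //; apply: mulr_ge0; [exact: sqr_ge0|by rewrite exprn_ge0// invr_ge0].
have z (x : R -> R) (n : nat) : (forall r, ~~ (0 < r < rad) -> x r = 0) ->
    forall r, ~~ (0 < r < rad) -> x r ^+ 2 * (r^-1) ^+ n * r = 0.
  by move=> x0 r /x0 ->; rewrite expr0n !mul0r.
have m (x : R -> R) (n : nat) : measurable_fun setT x ->
    measurable_fun setT (fun r => x r ^+ 2 * (r^-1) ^+ n * r).
  by move=> mx; apply: measurable_funM => //; apply: measurable_funM; exact: measurable_funX.
have w10 r : ~~ (0 < r < rad) -> slice_w1 r = 0 by move=> /p0; rewrite /slice_w1 => ->; rewrite mulr0 oppr0.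
have w20 r : ~~ (0 < r < rad) -> slice_w2 r = 0.
  by move=> rO; rewrite /slice_w2 p0// h0// !(mulr0, oppr0, addr0).
have [IB EB] := bnd D0.
have N0 : (\int[leb]_(r in `]0%R, rad[) (`|w r| ^+ 2 * r ^ (2 * (0%:Z - 2)) * r)%R%:E <= (D * rad)%:E)%E.
  rewrite -EB; apply: (Int_oo_le (G := fun r => vw r ^+ 2 * (r^-1) ^+ 4 * r)) => //.
  - by move=> r rr; rewrite vwE// real_normK ?num_real// exprVn.
  - exact: m.
  - by move=> r; exact: ge.
  - exact: z.
  - apply: (ae_imp vw_ae) => r Hr; have [rr|/vw0 ->] := boolP (0 < r < rad); last by rewrite expr0n !mul0r.
    apply: le_trans (rD _ rr); have /andP[r0 _] := rr.
    rewrite (_ : C ^+ 2 * A * r ^+ 3 = (C * S * r ^+ 3) ^+ 2 * (r^-1) ^+ 4 * r); last first.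
      by rewrite -S2; field; rewrite gt_eqF.
    apply: ler_wpM2r; first exact: ltW.
    apply: ler_wpM2r; first by rewrite exprn_ge0// invr_ge0 ltW.
    rewrite Hr// sqrrN -real_normK ?num_real//; apply: lerXn2r; rewrite ?nnegrE//; last exact: Prim_k_le.
    by rewrite !mulr_ge0 ?exprn_ge0// ltW.
have N1 : (\int[leb]_(r in `]0%R, rad[) (`|slice_w1 r| ^+ 2 * r ^ (2 * (1%:Z - 2)) * r)%R%:E <= (D * rad)%:E)%E.
  rewrite -EB; apply: (Int_oo_le (G := fun r => slice_w1 r ^+ 2 * (r^-1) ^+ 2 * r)) => //.
  - by move=> r rr; rewrite real_normK ?num_real// exprVn.
  - exact: m.
  - by move=> r; exact: ge.
  - exact: z.
  - apply: (ae_imp pS) => r Hr; have [rr|/w10 ->] := boolP (0 < r < rad); last by rewrite expr0n !mul0r.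
    apply: le_trans (rD _ rr); have /andP[r0 _] := rr.
    rewrite (_ : C ^+ 2 * A * r ^+ 3 = (C * r ^+ 2 * S) ^+ 2 * (r^-1) ^+ 2 * r); last first.
      by rewrite -S2; field; rewrite gt_eqF.
    apply: ler_wpM2r; first exact: ltW.
    apply: ler_wpM2r; first by rewrite exprn_ge0// invr_ge0 ltW.
    rewrite /slice_w1 sqrrN -real_normK ?num_real//; apply: lerXn2r; rewrite ?nnegrE//.
      by rewrite !mulr_ge0 ?exprn_ge0// ltW.
    by rewrite normrM; apply: ler_pM => //; have [] := KB rr.
have N2 : (\int[leb]_(r in `]0%R, rad[) (`|slice_w2 r| ^+ 2 * r ^ (2 * (2%:Z - 2)) * r)%R%:E <=
    (32 * (D * rad) + 2 * C ^+ 2 * rad ^+ 4 * A)%:E)%E.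
  have IC : L1 leb (fun r => 32 * (D * (1 * (0 <= r <= rad)%R%:R)) + 2 * C ^+ 2 * rad ^+ 4 * (h r ^+ 2 * r)).
    by apply: L1D; exact: L1Zl.
  rewrite -EB -IntZl// -[in X in (_ <= X)%E]IntZl// -[in X in (_ <= X)%E]IntD; [|exact: L1Zl|exact: L1Zl].
  apply: (Int_oo_le (G := fun r => slice_w2 r ^+ 2 * (r^-1) ^+ 0 * r)) => //.
  - by move=> r rr; rewrite real_normK ?num_real// expr0.
  - exact: m.
  - by move=> r; exact: ge.
  - exact: z.
  - apply: (ae_imp pS) => r Hr; have [rr|rO] := boolP (0 < r < rad); last first.
      by rewrite w20// h0// expr0n !mul0r mulr0 addr0 mulr_ge0.
    have /andP[r0 r1] := rr; rewrite expr0 mulr1; have [k1 k2] := KB rr.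
    (* The coefficient 4 is [1 + 3], from [K' p] and [3 K p / r]; squaring the sum then gives
       [2 * 4^2 = 32]. *)
    have b2 : `|slice_w2 r| <= C * r * (4 * S + r * `|h r|).
      rewrite (_ : C * r * _ = C * r * S + C * r ^+ 2 * (`|h r| + 3 * (r^-1 * S))); last first.
        by field; rewrite gt_eqF.
      rewrite /slice_w2; apply: (le_trans (ler_normB _ _)); rewrite normrN !normrM.
      apply: lerD; apply: ler_pM => //.
      apply: (le_trans (ler_normB _ _)); rewrite lerD2l normrM ger0_norm// ler_wpM2l// normrM.
      have i0 : 0 <= r^-1 by rewrite invr_ge0 ltW.
      by rewrite (ger0_norm i0) ler_wpM2l.
    have b3 : slice_w2 r ^+ 2 <= (C * r) ^+ 2 * (32 * A + 2 * (r ^+ 2 * h r ^+ 2)).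
      apply: (@le_trans _ _ ((C * r * (4 * S + r * `|h r|)) ^+ 2)).
        rewrite -real_normK ?num_real//; apply: lerXn2r; rewrite ?nnegrE//.
        by rewrite mulr_ge0 ?addr_ge0 ?mulr_ge0// ltW.
      rewrite exprMn; apply: ler_wpM2l; first exact: sqr_ge0.
      have <- : `|h r| ^+ 2 = h r ^+ 2 by rewrite real_normK ?num_real.
      by rewrite -S2; have := sqr_ge0 (4 * S - r * `|h r|); nra.
    apply: (@le_trans _ _ (32 * (C ^+ 2 * A * r ^+ 3) + 2 * C ^+ 2 * r ^+ 4 * (h r ^+ 2 * r))).
      rewrite (_ : 32 * _ + _ = (C * r) ^+ 2 * (32 * A + 2 * (r ^+ 2 * h r ^+ 2)) * r); last by ring.
      by apply: ler_wpM2r => //; exact: ltW.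
    apply: lerD; first by apply: ler_wpM2l => //; exact: rD.
    apply: ler_wpM2r; first by rewrite mulr_ge0 ?sqr_ge0// ltW.
    apply: ler_wpM2l; first by rewrite mulr_ge0 ?sqr_ge0.
    by apply: lerXn2r; rewrite ?nnegrE// ltW.
rewrite /H20norm2 !big_ord_recl big_ord0 /= adde0.
apply: (le_trans (leeD N0 (leeD N1 N2))).
by rewrite -!EFinD lee_fin /D le_eqVlt; apply/orP; left; apply/eqP; ring.
Qed.

End slice.

(** * Restriction to the domain *)

Section restriction.
Context {R : realType} (rad a : R) (rad0 : 0 < rad) (a0 : 0 < a).
Local Notation leb := (@lebesgue_measure R).
Local Notation leb2 := (leb \x leb)%E.

Definition restr (u : R * R -> R) (q : R * R) : R := u q * (inO rad a q)%:R.

Lemma restr_in u q : inO rad a q -> restr u q = u q.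
Proof. by move=> h; rewrite /restr h mulr1. Qed.

Lemma restr_out u q : ~~ inO rad a q -> restr u q = 0.
Proof. by move=> h; rewrite /restr (negbTE h) mulr0. Qed.

Lemma Int_restr (u th : R * R -> R) :
  \int[leb2]_(q in Omega rad a) (u q * th q) = \int[leb2]_q (restr u q * th q).
Proof.
rewrite [LHS]Rintegral_mkcond; apply: eq_Int => q; rewrite patchE mem_Omega.
by have [/restr_in ->|/restr_out ->] := boolP (inO rad a q); rewrite ?mul0r.
Qed.

Lemma L2w_restr u : in_L2 rad a u -> L2w rad a (restr u).
Proof. exact: L2w_of_in_L2. Qed.

Lemma L2norm2_restr u : in_L2 rad a u -> L2norm2 rad a u = (N2 (restr u))%:E.
Proof. by move=> Lu; apply: L2norm2E; [exact: L2w_restr|move=> q qO; rewrite restr_in]. Qed.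

Lemma cvg_N2_restr (u : nat -> R * R -> R) psi : (forall n, continuous (u n)) -> in_L2 rad a psi ->
  L2norm2 rad a (fun q => u n q - psi q) @[n --> \oo] --> 0%E ->
  (forall n, L2w rad a (fun q => u n q * (inO rad a q)%:R - restr psi q)) /\
  N2 (fun q => u n q * (inO rad a q)%:R - restr psi q) @[n --> \oo] --> 0.
Proof.
move=> cu Lp cv.
have L n : L2w rad a (fun q => u n q * (inO rad a q)%:R - restr psi q).
  by apply: L2wB; [exact: L2w_continuous|exact: L2w_restr].
split => //; move: cv.
have E n : L2norm2 rad a (fun q => u n q - psi q) = (N2 (fun q => u n q * (inO rad a q)%:R - restr psi q))%:E.
  by apply: L2norm2E => // q qO; rewrite restr_in// qO mulr1.
by under eq_fun do rewrite E; move/fine_cvg.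
Qed.

Lemma Int_oo_cont (c d : R) (F : R -> R) : continuous F -> 
  (\int[leb]_(z in `]c, d[) (F z)%:E = (\int[leb]_z (F z * (c < z < d)%R%:R))%:E)%E /\
  L1 leb (fun z => F z * (c < z < d)%R%:R).
Proof.
move=> cF.
have IF : L1 leb (fun z => F z * (c < z < d)%R%:R).
  rewrite (_ : (fun z => _) = (fun z => (F z * (c <= z <= d)%R%:R) * (c < z < d)%R%:R)).
    apply: L1_mul_bool; last exact: L1_continuous_segment.
    rewrite (_ : (fun z => _) = (fun z : R => (c < z)%R%:R * (z < d)%R%:R)).
      by apply: measurable_funM; exact: measurable_lt_nat.
    by apply/funext => z; case: (c < z); rewrite ?mul0r ?mul1r.
  apply/funext => z; have [/andP[/ltW -> /ltW ->]|_] := boolP (c < z < d); rewrite ?mulr1 ?mulr0//.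
split => //; rewrite -Int_EFin// [LHS]integral_mkcond; apply: eq_integral => z _.
rewrite patchE mem_setE in_itv/=.
by case: (c < z < d); rewrite ?mulr1 ?mulr0.
Qed.

(** The boundary norm is a sum of three nonnegative terms, so its convergence to 0 forces that of
    each; the lateral one carries the factor [rad]. *)
Lemma trace0_restr psi psir psiz : in_L2 rad a psi -> in_L2 rad a psir -> in_L2 rad a psiz ->
  zero_trace rad a psi psir psiz -> trace0 rad a (restr psi) (restr psir) (restr psiz).
Proof.
move=> Lp Lr Lz [u [su c1 c2 c3 cS]]; exists u.
have cu n : continuous (u n) by exact: smooth2_continuous.
have cr n : continuous (fun q => 'D_er (u n) q) by apply: smooth2_continuous; exact: smooth2_D_er.
have cz n : continuous (fun q => 'D_ez (u n) q) by apply: smooth2_continuous; exact: smooth2_D_ez.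
split.
- exact: su.
- exact: (cvg_N2_restr cu Lp c1).
- exact: (cvg_N2_restr cr Lr c2).
- exact: (cvg_N2_restr cz Lz c3).
have sq (F : R -> R) : continuous F -> continuous (fun x => F x ^+ 2).
  by move=> cF x; rewrite (_ : (fun x => F x ^+ 2) = (fun x => F x * F x)); [apply: cvgM; exact: cF|apply/funext => y; rewrite expr2].
pose X n := \int[leb]_z (u n (rad, z) ^+ 2 * itvJ a z).
pose Y n := \int[leb]_r (u n (r, a) ^+ 2 * r * (0 < r < rad)%R%:R).
pose Z n := \int[leb]_r (u n (r, - a) ^+ 2 * r * (0 < r < rad)%R%:R).
have w0 (F : R -> R) : 0 <= \int[leb]_r (F r ^+ 2 * r * (0 < r < rad)%R%:R).
  apply: Int_ge0 => r; have [/andP[/ltW r0 _]|_] := boolP (0 < r < rad); last by rewrite mulr0.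
  by rewrite mulr1 mulr_ge0 ?sqr_ge0.
have X0 n : 0 <= X n by apply: Int_ge0 => z; rewrite mulr_ge0 ?sqr_ge0// ler0n.
have Y0 n : 0 <= Y n by exact: w0.
have Z0 n : 0 <= Z n by exact: w0.
have SE n : L2norm2_S rad a (u n) = (rad * X n + Y n + Z n)%:E.
  have c1' : continuous (fun z => u n (rad, z) ^+ 2).
    by apply: (sq (fun z => u n (rad, z))); exact: continuous_slice2.
  have cc1 : continuous (fun z => u n (rad, z) ^+ 2 * rad).
    by move=> z; apply: cvgM; [exact: c1'|exact: cvg_cst].
  have cy s : continuous (fun r => u n (r, s) ^+ 2 * r).
    move=> z; apply: cvgM; last exact: cvg_id.
    by apply: (sq (fun r => u n (r, s))); exact: continuous_slice1.
  have [e1 _] := Int_oo_cont (- a) a cc1.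
  have [e2 _] := Int_oo_cont 0 rad (cy a); have [e3 _] := Int_oo_cont 0 rad (cy (- a)).
  have [_ I1] := Int_oo_cont (- a) a c1'.
  rewrite /L2norm2_S e1 e2 e3 -!EFinD /X -IntZl//; congr (_ + _ + _)%:E.
  by apply: eq_Int => z; rewrite /itvJ; ring.
have cS' : rad * X n + Y n + Z n @[n --> \oo] --> 0.
  by move: cS; under eq_fun do rewrite SE; move/fine_cvg.
have sqz (W : nat -> R) (k : R) : 0 < k -> (forall n, 0 <= W n) ->
    (forall n, k * W n <= rad * X n + Y n + Z n) -> W n @[n --> \oo] --> 0.
  move=> k0 W0 WS; have h : k^-1 * (rad * X n + Y n + Z n) @[n --> \oo] --> 0.
    by rewrite -[X in _ --> X](mulr0 k^-1); apply: cvgM; [exact: cvg_cst|exact: cS'].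
  apply: (squeeze_cvgr _ (cvg_cst 0) h); apply: nearW => n.
  by apply/andP; split; [exact: W0|rewrite ler_pdivlMl//; exact: WS].
split.
- apply: (sqz X rad) => // n; have := Y0 n; have := Z0 n; lra.
- apply: (sqz Y 1) => // n; have := Z0 n; have := mulr_ge0 (ltW rad0) (X0 n); lra.
- apply: (sqz Z 1) => // n; have := Y0 n; have := mulr_ge0 (ltW rad0) (X0 n); lra.
Qed.

(** Splitting the integral needs each term integrable. This follows from [pairing]: a test function
    is bounded by a multiple of [r], also after differentiation or division by [r]. *)
Lemma equation_restr om psi psir : in_L2 rad a om -> in_L2 rad a psi -> in_L2 rad a psir ->
  distr_equation rad a om psi psir -> forall ph, test2 (Omega rad a) ph ->
  \int[leb2]_q (restr psi q * 'D_er (fun s => 'D_er ph s) q) +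
  \int[leb2]_q (3 * (restr psir q * (q.1^-1 * ph q))) +
  \int[leb2]_q (restr psi q * 'D_ez (fun s => 'D_ez ph s) q) = - \int[leb2]_q (restr om q * ph q).
Proof.
move=> Lo Lp Lr eqn ph tp.
have wb th : test2 (Omega rad a) th -> exists M, forall q, inO rad a q -> `|th q| <= M * q.1.
  move=> tth; have [M M0 h] := test2_le_weight rad0 a0 tth; exists M => q /andP[/andP[q0 _] _].
  by have := h q; rewrite max_l// ltW.
have trr := test2_D_er (test2_D_er tp); have tzz := test2_D_ez (test2_D_ez tp).
have [Mr hr] := wb _ trr; have [Mz hz] := wb _ tzz.
have mi : measurable_fun setT (fun q : R * R => q.1^-1 * ph q).
  apply: measurable_funM; last exact: test2_measurable tp.
  exact: (measurableT_comp measurable_inv measurable_fst).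
have [Mi hi] : exists M, forall q, inO rad a q -> `|q.1^-1 * ph q| <= M * q.1.
  have [M M0 hM] := test2_bounded tp.
  have [c [d [c' [d' [/andP[c0 cd] _ _ _ p0]]]]] := test2_box rad0 a0 tp.
  exists (M / c ^+ 2) => q /andP[/andP[q0 _] _].
  have [cq|qc] := leP c q.1; last first.
    rewrite p0; last by rewrite negb_and negb_and -ltNge qc.
    rewrite mulr0 normr0; apply: mulr_ge0; last exact: ltW.
    by apply: divr_ge0 => //; exact: sqr_ge0.
  rewrite normrM normfV (gtr0_norm q0) ler_pdivrMl// (_ : q.1 * _ = M * (q.1 ^+ 2 / c ^+ 2)); last by ring.
  apply: (le_trans (hM q)); rewrite ler_peMr// ler_pdivlMr ?exprn_gt0// mul1r.
  by apply: lerXn2r; rewrite ?nnegrE// ltW.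
have [I1 _] := pairing rad0 a0 (L2w_restr Lp) (test2_measurable trr) hr.
have [I2 _] := pairing rad0 a0 (L2w_restr Lr) mi hi.
have [I3 _] := pairing rad0 a0 (L2w_restr Lp) (test2_measurable tzz) hz.
have I23 := L1D I1 (L1Zl 3 I2).
(* The pointwise identity of the integrands, [b] telling whether the point lies in the rectangle;
   only there can the inverse of [r] be simplified. *)
have alg (b : bool) (t s P x y w : R) : (b -> t != 0) ->
    (if b then - (s * x + 1 / t * P * w + s * y) - 2 / t * P * w else 0) =
    - (s * b%:R * x + 3 * (P * b%:R * (t^-1 * w)) + s * b%:R * y).
  case: b => [/(_ isT) t0|_]; first by rewrite !mulr1; field.
  by rewrite !mulr0 !mul0r mulr0 !addr0 oppr0.
have EQ : \int[leb2]_(q in Omega rad a) (om q * ph q) =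
    \int[leb2]_q (- (restr psi q * 'D_er (fun s => 'D_er ph s) q +
     3 * (restr psir q * (q.1^-1 * ph q)) + restr psi q * 'D_ez (fun s => 'D_ez ph s) q)).
  rewrite -(eqn _ tp) [LHS]Rintegral_mkcond; apply: eq_Int => q; rewrite patchE mem_Omega.
  by apply: alg => /andP[/andP[q0 _] _]; rewrite gt_eqF.
rewrite -(Int_restr om ph) EQ; symmetry; etransitivity.
  by apply: (congr1 (fun x => - x)); exact: (IntN (L1D I23 I3)).
rewrite opprK; etransitivity; first exact: (IntD I23 I3).
by congr (_ + _); exact: (IntD I1 (L1Zl 3 I2)).
Qed.

Lemma weak_deriv2_restr e u w : loc_integrable2 (Omega rad a) u ->
  weak_deriv2 (Omega rad a) e (restr u) w -> weak_deriv2 (Omega rad a) e u w.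
Proof.
move=> lu [_ lw H]; split => // ph tp; rewrite -H// !Int_restr; apply: eq_Int => q.
by congr (_ * _); have [qO|qO] := boolP (inO rad a q); rewrite ?(restr_in _ qO) ?(restr_out _ qO)//.
Qed.

End restriction.

Section slice_measurability.
Context {R : realType} (rad a : R).
Local Notation leb := (@lebesgue_measure R).

(** [W] and [rho] are versions of [w] and of the integer power that are measurable on the whole
    space, so that Tonelli applies to the integrand extended by zero. *)
Lemma measurable_slice_norm (w W : R * R -> R) (rho : R -> R) (i : int) :
  measurable_fun setT W -> (forall q, inO rad a q -> w q = W q) ->
  measurable_fun setT rho -> (forall r, 0 < r < rad -> r ^ i = rho r) ->
  measurable_fun `]- a, a[%classic
    (fun z => \int[leb]_(r in `]0%R, rad[) (`|w (r, z)| ^+ 2 * r ^ i * r)%R%:E)%E.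
Proof.
move=> mW wW mrho rhoE.
pose G (q : R * R) := `|W q| ^+ 2 * rho q.1 * q.1 * (inO rad a q)%:R.
have mG : measurable_fun setT G.
  apply: measurable_funM; last exact: measurable_inO.
  apply: measurable_funM; last exact: measurable_fst.
  apply: measurable_funM; last exact: (measurableT_comp mrho measurable_fst).
  by apply: measurable_funX; apply: measurableT_comp => //; exact: normr_measurable.
have G0 q : 0 <= G q.
  rewrite /G; have [/andP[q1 _]|_] := boolP (inO rad a q); last by rewrite mulr0.
  rewrite -rhoE// mulr1; have /andP[/ltW q0 _] := q1.
  by apply: mulr_ge0 => //; apply: mulr_ge0; [exact: sqr_ge0|exact: exprz_ge0].
apply: (@eq_measurable_fun _ _ _ _ _ (fun z => \int[leb]_r (G (r, z))%:E)%E).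
  move=> z; rewrite inE /= in_itv/= => zJ; rewrite [RHS]integral_mkcond; apply: eq_integral => r _.
  rewrite patchE mem_setE in_itv/= /G.
  have [rr|rO] := boolP (0 < r < rad); last by rewrite /inO /= (negbTE rO) mulr0.
  have qO : inO rad a (r, z) by rewrite /inO /= rr zJ.
  by rewrite qO mulr1 wW// -rhoE.
apply: measurable_funTS.
by apply: (@measurable_fun_fubini_tonelli_G _ _ _ _ R leb (fun q => (G q)%:E)) => //; exact/measurable_EFinP.
Qed.

End slice_measurability.

Theorem theorem3 (R : realType) (a rad : R) (K : R -> R) (c0 : R)
    (a_gt0 : 0 < a) (rad_gt0 : 0 < rad)
    (K_smooth : smooth_halfline K)
    (K_supp : compact_support_halfline K)
    (K_lim : K r / r ^+ 2 @[r --> 0^'+] --> c0) :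
  exists c : R, forall om psi psir psiz : R * R -> R,
    in_L2 rad a om ->
    weak_solution rad a om psi psir psiz ->
    chi_integrable rad a K psir /\
    exists (psi0 : R -> R) (psizr psizz v1 v2 : R * R -> R),
      [/\ axis_trace rad a psi psi0,
          weak_deriv2 (Omega rad a) er psiz psizr,
          weak_deriv2 (Omega rad a) ez psiz psizz,
          slice_derivs rad a
            (fun p => psi p - psi0 p.2 - chi K psir p) v1 v2 &
          (L2H20norm2 rad a (fun p => psi p - psi0 p.2 - chi K psir p)%R v1 v2
           + L2norm2 rad a psizr + L2norm2 rad a psizz
           <= c%:E * L2norm2 rad a om)%E].
Proof.
pose leb := @lebesgue_measure R.
have [Kt [C [sK C0 KE KB]]] := halfline_quadratic rad_gt0 K_smooth K_lim.
pose c1 := 36 * C ^+ 2 * rad ^+ 4.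
have c1_ge0 : 0 <= c1.
  by apply: mulr_ge0; [rewrite mulr_ge0 ?sqr_ge0|rewrite exprn_ge0// ltW].
(* [h = - (om + g)] costs [2 + 2 * 2 = 6] in [N2], multiplied by the slice constant [c1]; the
   derivatives [psi_zz] and [psi_zr] contribute 2 each. *)
exists (c1 * 6 + 4) => om psi psir psiz Lo [[Lp Lr Lz wr wz] tr eqn].
have Lo' := L2w_restr Lo; have Lp' := L2w_restr Lp.
have Lr' := L2w_restr Lr; have Lz' := L2w_restr Lz.
have tr' := trace0_restr rad_gt0 a_gt0 Lp Lr Lz tr.
have eq' := equation_restr rad_gt0 a_gt0 Lo Lp Lr eqn.
have [_ lz wz3] := wz.
have wz' ph : test2 (Omega rad a) ph ->
    \int[(leb \x leb)%E]_q (restr rad a psi q * 'D_ez ph q) =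
    - \int[(leb \x leb)%E]_q (restr rad a psiz q * ph q).
  by move=> tp; rewrite -(Int_restr rad a psi) -(Int_restr rad a psiz); exact: wz3.
have [g [Lg Ng cg wzz]] := ex_weak_deriv_zz rad_gt0 a_gt0 Lo' Lp' Lr' Lz' tr' wz' eq'.
have [gr [Lgr Ngr wzr]] := ex_weak_deriv_zr rad_gt0 a_gt0 Lo' Lp' Lr' Lz' tr' wz' eq'.
have cube := slice_cube rad_gt0 a_gt0 Lo' Lp' Lr' Lz' tr' wz' eq' Lg cg.
have prim := slice_primitive rad_gt0 a_gt0 Lo' Lp' Lr' Lz' tr' wz' eq' Lg cg.
pose h q := - (restr rad a om q + g q).
have [Log Nog] := N2_add_le Lo' Lg.
have Lh : L2w rad a h by exact: L2wN.
have Nh : N2 h <= 6 * N2 (restr rad a om).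
  rewrite (_ : N2 h = N2 (fun q => restr rad a om q + g q)); first by lra.
  by apply: eq_Int => q; rewrite /h sqrrN.
have [aLh [IA EA]] := slice_L2r Lh; have [aLr _] := slice_L2r Lr'; have [aLp _] := slice_L2r Lp'.
pose f z r := restr rad a psi (r, z); pose p z r := restr rad a psir (r, z).
pose hz z r := h (r, z).
pose good z := [/\ L2r rad (hz z), L2r rad (p z), L2r rad (f z),
  {ae leb, forall r, 0 < r < rad -> r ^+ 3 * p z r = Prim (fun t => t ^+ 3 * hz z t) r} &
  {ae leb, forall r, 0 < r < rad -> f z r = Prim (p z) r - \int[leb]_t p z t}].
have ag : {ae leb, forall z, - a < z < a -> good z}.
  apply: (ae_imp2 (ae_imp2 aLh aLr (fun z x y => conj x y)) (ae_imp2 aLp (ae_imp2 cube prim (fun z x y => conj x y)) (fun z x y => conj x y))).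
  by move=> z [Lhz Lrz] [Lpz [cz pz]] zJ; split => //; [exact: cz|exact: pz].
have inO_in z r : - a < z < a -> 0 < r < rad -> inO rad a (r, z) by move=> zJ rr; rewrite /inO /= rr zJ.
have mI : measurable `]0, rad[%classic by exact: measurable_itv.
have weight z : good z -> L1 leb (fun t => p z t * (1 + Kt t)).
  move=> [Lhz [mpz p0z _] _ cz _]; exact: (slice_weight_L1 rad_gt0 sK C0 KB Lhz mpz p0z cz).
split.
  apply: (ae_imp ag) => z Hz zJ; rewrite in_itv/= in zJ.
  apply: (@eq_integrable _ _ _ leb `]0, rad[%classic mI (fun t => (p z t * (1 + Kt t))%:E)).
    move=> t; rewrite inE /= in_itv/= => tI; rewrite /p restr_in ?inO_in// KE//.
    by have /andP[/ltW] := tI.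
  by apply: integrableS (weight _ (Hz zJ)).
pose P z := \int[leb]_t p z t.
(* A version of the corrected function made of restricted functions: it is measurable on the whole
   plane and agrees with [w] on the rectangle. *)
pose W q := restr rad a psi q + P q.2 - Prim (fun t => p q.2 t * (1 + Kt t)) q.1.
have [mpsi psi_out _] := Lp'; have [mpsir psir_out _] := Lr'; have [mh h_out _] := Lh.
have mK := continuous_measurable_fun (smooth1_continuous sK).
have mK' := continuous_measurable_fun (smooth1_continuous (smooth1_derive1 sK)).
have msw : measurable_fun setT (fun q : R * R => (q.2, q.1)).
  by apply: measurable_fun_pair; [exact: measurable_snd|exact: measurable_fst].
have mP : measurable_fun setT P.
  apply: (measurable_Int_slice (F := fun q : R * R => restr rad a psir (q.2, q.1))).
  exact: (measurableT_comp mpsir msw).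
have mKq : measurable_fun setT (fun q : R * R => Kt q.1) by exact: (measurableT_comp mK measurable_fst).
have mK'q : measurable_fun setT (fun q : R * R => derive1 Kt q.1) by exact: (measurableT_comp mK' measurable_fst).
have mu : measurable_fun setT (fun q : R * R => restr rad a psir q * (1 + Kt q.1)).
  by apply: measurable_funM => //; exact: measurable_funD.
have mW : measurable_fun setT W.
  apply: measurable_funB; last exact: (measurable_Prim_plane mu (measurable_id (D := setT))).
  by apply: measurable_funD => //; exact: (measurableT_comp mP measurable_snd).
pose w q := psi q - - P q.2 - chi K psir q.
have wW q : inO rad a q -> w q = W q.
  move=> qO; have /andP[/andP[q0 q1] q2] := qO; rewrite /w /W opprK restr_in//; congr (_ - _).
  have mpz : measurable_fun setT (fun t : R => p q.2 t * (1 + Kt t)).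
    apply: measurable_funM; last exact: measurable_funD.
    have mE : measurable_fun setT (fun r : R => (r, q.2)) by exact: measurable_fun_pair.
    exact: (measurableT_comp mpsir mE).
  rewrite -(Int_oo_Prim _ mpz); last first.
    by move=> t t0; rewrite /p restr_out ?mul0r// /inO /= negb_and negb_and -leNgt t0.
  apply: eq_Rintegral => t; rewrite inE /= in_itv/= => /andP[t0 tq].
  by rewrite /p restr_in ?KE ?(ltW t0)// /inO /= t0 (lt_trans tq q1) q2.
pose v1 q := - (Kt q.1 * restr rad a psir q).
pose v2 q := - (derive1 Kt q.1 * restr rad a psir q) - Kt q.1 * (h q - 3 * (q.1^-1 * restr rad a psir q)).
have mv1 : measurable_fun setT v1 by apply: measurableT_comp => //; exact: measurable_funM.
have mi : measurable_fun setT (fun q : R * R => q.1^-1).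
  exact: (measurableT_comp measurable_inv measurable_fst).
have mv2 : measurable_fun setT v2.
  apply: measurable_funB; first by apply: measurableT_comp => //; exact: measurable_funM.
  apply: measurable_funM => //; apply: measurable_funB => //; apply: measurable_funM => //.
  exact: measurable_funM.
have wE z : - a < z < a -> forall r, 0 < r < rad ->
    w (r, z) = f z r + \int[leb]_t p z t - Prim (fun t => p z t * (1 + Kt t)) r.
  by move=> zJ r rr; rewrite wW ?inO_in.
(* On almost every slice [psi = Prim p - P], and [Prim p] vanishes at 0. *)
exists (fun z => - P z), gr, g, v1, v2; split.
- apply: (ae_imp ag) => z Hz; rewrite in_itv/= => zJ; have [Lhz [mpz p0z _] _ cz pz] := Hz zJ.
  have cf := slice_primitive_continuous rad_gt0 Lhz mpz p0z cz.
  exists (fun r => Prim (p z) r - P z); split.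
  + by apply: continuous_subspaceT; exact: cf.
  + apply: (ae_imp pz) => r Hr; rewrite in_itv/= => rr.
    by rewrite -Hr// /f restr_in ?inO_in.
  + have := cvg_at_right_filter (cf 0); rewrite (Prim_out_le p0z (lexx 0)) sub0r; exact.
- exact: (weak_deriv2_restr lz wzr).
- exact: (weak_deriv2_restr lz wzz).
- split.
  + apply: (@eq_measurable_fun _ _ _ _ _ W); last exact: measurable_funTS.
    by move=> q qO; rewrite mem_Omega in qO; rewrite -wW.
  + exact: measurable_funTS.
  + exact: measurable_funTS.
  + apply: (ae_imp ag) => z Hz; rewrite in_itv/= => zJ; have [Lhz [mpz p0z _] [mfz _ _] cz pz] := Hz zJ.
    split; first exact: (slice_weak1 rad_gt0 sK C0 KB mfz Lhz mpz p0z cz pz (wE z zJ)).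
    exact: (slice_weak2 rad_gt0 sK C0 KB Lhz mpz p0z cz).
have mi1 : measurable_fun setT (fun r : R => r^-1) := measurable_inv.
(* [slice_norm] bounds almost every slice by [c1] times the integral of [r h^2], and by [EA] these
   integrals add up to [N2 h]. *)
have key : (L2H20norm2 rad a w v1 v2 <= (c1 * N2 h)%:E)%E.
  rewrite -EA -IntZl// -Int_EFin; last exact: L1Zl.
  have A0 z : 0 <= c1 * \int[leb]_r (h (r, z) ^+ 2 * r).
    by apply: mulr_ge0 => //; apply: Int_ge0 => r; exact: (supp_wge0 (r, z) h_out).
  have mA : measurable_fun setT (fun z => c1 * \int[leb]_r (h (r, z) ^+ 2 * r)).
    exact: L1_measurable (L1Zl c1 IA).
  apply: (@le_trans _ _ (\int[leb]_(z in `](- a)%R, a[) (c1 * \int[leb]_r (h (r, z) ^+ 2 * r))%:E)%E); last first.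
    by apply: ge0_subset_integral => //; [exact/measurable_EFinP|move=> z _; rewrite lee_fin].
  apply: ae_ge0_le_integral => //.
  + by move=> z _; apply: sume_ge0 => i _; apply: integral_ge0 => r; rewrite /= in_itv/= => /andP[/ltW r0 _];
      rewrite lee_fin mulr_ge0// mulr_ge0 ?exprz_ge0 ?exprn_ge0.
  + rewrite (_ : (fun z => _) = (fun z =>
      \int[leb]_(r in `]0%R, rad[) (`|w (r, z)| ^+ 2 * r ^ (2 * (0%:Z - 2)) * r)%R%:E +
      (\int[leb]_(r in `]0%R, rad[) (`|v1 (r, z)| ^+ 2 * r ^ (2 * (1%:Z - 2)) * r)%R%:E +
      \int[leb]_(r in `]0%R, rad[) (`|v2 (r, z)| ^+ 2 * r ^ (2 * (2%:Z - 2)) * r)%R%:E))%E); last first.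
      by apply/funext => z; rewrite /H20norm2 !big_ord_recl big_ord0 /= adde0.
    apply: emeasurable_funD; last apply: emeasurable_funD.
    * apply: (@measurable_slice_norm _ rad a w W (fun r => r^-1 ^+ 4)) => //; first exact: measurable_funX.
      by move=> r _; rewrite exprVn.
    * apply: (@measurable_slice_norm _ rad a v1 v1 (fun r => r^-1 ^+ 2)) => //; first exact: measurable_funX.
      by move=> r _; rewrite exprVn.
    * by apply: (@measurable_slice_norm _ rad a v2 v2 (fun=> 1)).
  + by move=> z _; rewrite lee_fin.
  + by apply: measurable_funTS; exact/measurable_EFinP.
  + apply: (ae_imp ag) => z Hz zJ; rewrite /= in_itv/= in zJ.
    have [Lhz [mpz p0z _] [mfz _ _] cz pz] := Hz zJ.
    exact: (slice_norm rad_gt0 sK C0 KB mfz Lhz mpz p0z cz pz (wE z zJ)).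
rewrite (L2norm2E Lgr)// (L2norm2E Lg)// (L2norm2_restr Lo) -EFinM.
apply: (le_trans (leeD (leeD key (lexx _)) (lexx _))); rewrite -!EFinD lee_fin.
have := ler_wpM2l c1_ge0 Nh; lra.
Qed.
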